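(* Let $n\ge 2$, $p>1$, $r>0$ and let $\alpha,\beta,\gamma\in\mathbb R$ satisfy $$\frac1r-\frac{\gamma}{n}>0,\qquad \frac1p-\frac{\alpha}{n}>0,\qquad 1-\frac{\beta}{n}>0,\qquad \gamma=\frac{1+\alpha}{r}+\frac{p-1}{pr}\beta .$$ Let $(M,g)$ be an $n$-dimensional Cartan--Hadamard manifold whose sectional curvature satisfies $K_M\le -b$ for some $b\ge0$, and let $P\in M$. Put $p'=\frac{p}{p-1}$. Then for every $f\in C_0^\infty(M)$, $$\int_{M}\frac{|f|^r}{d_P(x)^{\gamma r}}\left(1+\frac{n-1}{n-\gamma r}\mathbf D_b(d_P(x))\right)dV_g\le\frac{r}{n-\gamma r}\left\|\frac{\partial_\rho f}{d_P^{\alpha}}\right\|_{p}\left\|\frac{|f|^{r-1}}{d_P^{\beta/p'}}\right\|_{p',\operatorname{supp} f}$$ and $$\int_{M}\frac{|f|^r}{d_P(x)^{\gamma r}}\left(1+\frac{n-1}{n-\gamma r}\mathbf D_b(d_P(x))\right)dV_g\le\frac{r}{n-\gamma r}\left\|\frac{\nabla_g f}{d_P^{\alpha}}\right\|_{p}\left\|\frac{|f|^{r-1}}{d_P^{\beta/p'}}\right\|_{p',\operatorname{supp} f}.$$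
   Context: A Cartan--Hadamard manifold is a complete simply connected Riemannian manifold with non-positive sectional curvature; $d_P(x)=d(x,P)$ is the geodesic distance to $P$, $dV_g$ the Riemannian volume element, $\nabla_g$ the Riemannian gradient. For $x=\mathrm{Exp}_P(tu)$ with $t>0$ and $u\in T_PM$ a unit vector, $\partial_\rho f(x)=\frac{d}{dt}f(\mathrm{Exp}_P(tu))$. Notation: $\|h\|_q=(\int_M|h|^q\,dV_g)^{1/q}$ and $\|h\|_{q,\Omega}=(\int_\Omega|h|^q\,dV_g)^{1/q}$ for $\Omega\subset M$. The function $\mathbf D_b:[0,\infty)\to\mathbb R$ is $\mathbf D_b(0)=0$ and, for $t>0$, $\mathbf D_b(t)=t\,\mathbf{ct}_b(t)-1$, where $\mathbf{ct}_0(t)=\frac1t$ and $\mathbf{ct}_b(t)=\sqrt b\coth(\sqrt b\,t)$ for $b>0$. Norms take values in $[0,\infty]$; when $r\in(0,1)$, $|f|^{r-1}$ is read as $+\infty$ at points of $\operatorname{supp} f$ where $f=0$ (the right-hand sides are $0$ for $f\equiv0$); for $r=1$, $|f|^{r-1}=1$. *)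

(* Defs.v *)
From HB Require Import structures.
From mathcomp Require Import all_boot all_order all_algebra.
From mathcomp Require Import all_classical all_reals all_analysis.

Set Implicit Arguments.
Unset Strict Implicit.
Unset Printing Implicit Defensive.

Import Order.TTheory GRing.Theory Num.Theory.
Import numFieldNormedType.Exports.

Local Open Scope classical_set_scope.
Local Open Scope ring_scope.

Section euclidean_calculus.
Context {R : realType} {n : nat}.

Definition partial {W : normedModType R} (a : 'I_n) (f : 'rV[R]_n -> W) :
    'rV[R]_n -> W :=
  fun y => 'D_(delta_mx 0 a : 'rV[R]_n) f y.

(* C^infty on an open set U: all iterated partial derivatives exist and are
   continuous at every point of U. *)
Definition smooth_on {W : normedModType R} (U : set 'rV[R]_n)
    (f : 'rV[R]_n -> W) : Prop :=
  forall (s : seq 'I_n) (y : 'rV[R]_n), U y ->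
    {for y, continuous (foldr partial f s)} /\
    forall a : 'I_n,
      derivable (foldr partial f s) y (delta_mx 0 a : 'rV[R]_n).

End euclidean_calculus.

(* Integral over R^n of a nonnegative Borel function with respect to
   n-dimensional Lebesgue measure, as an iterated integral (Tonelli). *)
Fixpoint lebesgue_int {R : realType} (n : nat) :
    ('rV[R]_n -> \bar R) -> \bar R :=
  match n with
  | 0 => fun F => F 0
  | m.+1 => fun F =>
      (\int[@lebesgue_measure R]_x
         lebesgue_int (fun y : 'rV[R]_m =>
           F (row_mx (x%:M : 'M[R]_1) y : 'rV[R]_m.+1)))%E
  end.

Section simply_connected.
Context (R : realType) (T : topologicalType).

Definition path_connected : Prop :=
  forall x y : T, exists c : R -> T,
    [/\ {within (`[0, 1] : set R), continuous c}, c 0 = x & c 1 = y].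

Definition simply_connected : Prop :=
  path_connected /\
  forall c : R -> T, {within (`[0, 1] : set R), continuous c} -> c 0 = c 1 ->
    exists H : R * R -> T,
      [/\ {within (`[0, 1] : set R) `*` (`[0, 1] : set R), continuous H},
          forall t, 0 <= t <= 1 -> H (0, t) = c t,
          forall t, 0 <= t <= 1 -> H (1, t) = c 0 &
          forall s, 0 <= s <= 1 -> H (s, 0) = c 0 /\ H (s, 1) = c 0].

End simply_connected.

Notation borel M := (g_sigma_algebraType (@open M)).

(* A smooth n-manifold with a Riemannian metric.  [param i] inverts [coord i]
   on [chart_dom i]; only its values on [coord i @` chart_dom i] matter, and
   likewise for [metric i y], the Gram matrix of the metric in the coordinate
   frame of chart i at the point of coordinates y.  Row-vector convention: a
   tangent vector with components u in chart i has components
   u *m jacobian (coord j \o param i) in chart j. *)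
Record riemannian (R : realType) (n : nat) (M : ptopologicalType) := Riemannian {
  chart : Type ;
  chart_dom : chart -> set M ;
  coord : chart -> M -> 'rV[R]_n ;
  param : chart -> 'rV[R]_n -> M ;
  metric : chart -> 'rV[R]_n -> 'M[R]_n ;
  manifold_hausdorff : hausdorff_space M ;
  manifold_second_countable : @second_countable M ;
  chart_cover : forall x, exists i, chart_dom i x ;
  chart_dom_open : forall i, open (chart_dom i) ;
  chart_cod_open : forall i, open (coord i @` chart_dom i) ;
  coordK : forall i x, chart_dom i x -> param i (coord i x) = x ;
  coord_continuous : forall i x, chart_dom i x ->
    {for x, continuous (coord i)} ;
  param_continuous : forall i y, (coord i @` chart_dom i) y ->
    {for y, continuous (param i)} ;
  transition_smooth : forall i j,
    smooth_on (coord i @` (chart_dom i `&` chart_dom j)) (coord j \o param i) ;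
  metric_smooth : forall i, smooth_on (coord i @` chart_dom i) (metric i) ;
  metric_sym : forall i y, (coord i @` chart_dom i) y ->
    (metric i y)^T = metric i y ;
  metric_pos : forall i y, (coord i @` chart_dom i) y ->
    forall u : 'rV[R]_n, u != 0 -> 0 < (u *m metric i y *m u^T) 0 0 ;
  metric_transition : forall i j x, chart_dom i x -> chart_dom j x ->
    let J := jacobian (coord j \o param i) (coord i x) in
    metric i (coord i x) = J *m metric j (coord j x) *m J^T
}.

Section riemannian_geometry.
Context {R : realType} {n : nat} {M : ptopologicalType}.
Variable g : riemannian R n M.

(* The tangent space at x is represented by 'rV[R]_n, through a chart at x
   chosen once and for all. *)
Definition chart_at (x : M) : chart g := sval (cid (chart_cover g x)).

Definition gram (x : M) : 'M[R]_n :=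
  metric (chart_at x) (coord (chart_at x) x).

Definition inner (x : M) (u v : 'rV[R]_n) : R := (u *m gram x *m v^T) 0 0.

Definition tnorm (x : M) (u : 'rV[R]_n) : R := Num.sqrt (inner x u u).

(* Christoffel symbol Gamma^k_{ab} in chart i. *)
Definition christoffel (i : chart g) (k a b : 'I_n) (y : 'rV[R]_n) : R^o :=
  2^-1 * \sum_(l < n) invmx (metric i y) k l *
    (partial a (fun z => metric i z b l : R^o) y
     + partial b (fun z => metric i z a l : R^o) y
     - partial l (fun z => metric i z a b : R^o) y).

(* R(d_a, d_b) d_c = \sum_l (riemann_coef i l a b c) d_l, with the sign
   convention R(X, Y) Z = D_X D_Y Z - D_Y D_X Z - D_[X, Y] Z. *)
Definition riemann_coef (i : chart g) (l a b c : 'I_n) (y : 'rV[R]_n) : R :=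
  partial a (christoffel i l b c) y - partial b (christoffel i l a c) y
  + \sum_(m < n) (christoffel i m b c y * christoffel i l a m y
                  - christoffel i m a c y * christoffel i l b m y).

Definition curvature_op (x : M) (u v w : 'rV[R]_n) : 'rV[R]_n :=
  \row_l \sum_(a < n) \sum_(b < n) \sum_(c < n)
     riemann_coef (chart_at x) l a b c (coord (chart_at x) x)
       * u 0 a * v 0 b * w 0 c.

Definition sectional_curvature (x : M) (u v : 'rV[R]_n) : R :=
  inner x (curvature_op x u v v) u
    / (inner x u u * inner x v v - inner x u v ^+ 2).

Definition sectional_curvature_le (k : R) : Prop :=
  forall (x : M) (u v : 'rV[R]_n), row_free (col_mx u v) ->
    sectional_curvature x u v <= k.

Definition velocity (c : R -> M) (t : R) : 'rV[R]_n :=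
  derive1 (coord (chart_at (c t)) \o c) t.

Definition C1_curve (c : R -> M) : Prop :=
  continuous c /\
  forall (i : chart g) t, chart_dom i (c t) ->
    derivable (coord i \o c) t 1 /\
    {for t, continuous (derive1 (coord i \o c))}.

Definition geodesic (c : R -> M) : Prop :=
  C1_curve c /\
  forall (i : chart g) t, chart_dom i (c t) ->
    let x := coord i \o c in
    derivable (derive1 x) t 1 /\
    forall k : 'I_n,
      derive1 (derive1 x) t 0 k
      + \sum_(a < n) \sum_(b < n)
          christoffel i k a b (x t) * derive1 x t 0 a * derive1 x t 0 b = 0.

Definition geodesically_complete : Prop :=
  forall (x : M) (v : 'rV[R]_n),
    exists c : R -> M, [/\ geodesic c, c 0 = x & velocity c 0 = v].

Definition Exp (P : M) (v : 'rV[R]_n) : M :=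
  xget P [set y | exists c : R -> M,
    [/\ geodesic c, c 0 = P, velocity c 0 = v & c 1 = y]].

Definition cartan_hadamard : Prop :=
  [/\ geodesically_complete, simply_connected R M & sectional_curvature_le 0].

Definition piecewise_C1 (c : R -> M) : Prop :=
  exists (m : nat) (s : nat -> R),
    [/\ s 0%N = 0, s m = 1 &
        forall k, (k < m)%N -> s k < s k.+1 /\
          exists2 e : R -> M, C1_curve e & {in `[s k, s k.+1], c =1 e}].

(* The velocity is only meaningful off the finitely many break points, which
   do not contribute to the integral. *)
Definition curve_length (c : R -> M) : R :=
  (\int[@lebesgue_measure R]_(t in `[0, 1]) tnorm (c t) (velocity c t))%R.

Definition geodesic_dist (x y : M) : R :=
  inf [set curve_length c | c in
        [set c : R -> M | [/\ piecewise_C1 c, c 0 = x & c 1 = y]]].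

(* mu is the Riemannian volume measure: dV_g = sqrt (det g) dy in each chart.
   As M is second countable this determines mu on the Borel sets. *)
Definition riemannian_volume (mu : {measure set (borel M) -> \bar R}) : Prop :=
  forall (i : chart g) (A : set (borel M)), measurable A -> A `<=` chart_dom i ->
    mu A = lebesgue_int (fun y =>
      (\1_(coord i @` A) y * Num.sqrt (\det (metric i y)))%:E).

Definition supp (f : M -> R) : set M := closure [set x | f x != 0].

Definition test_function (f : M -> R) : Prop :=
  (forall i : chart g,
     smooth_on (coord i @` chart_dom i) (f \o param i : _ -> R^o)) /\
  compact (supp f).

Definition gradient (f : M -> R) (x : M) : 'rV[R]_n :=
  (\row_a partial a (f \o param (chart_at x) : _ -> R^o)
            (coord (chart_at x) x)) *m invmx (gram x).

(* The derivative at s = t of s |-> f (Exp_P (s u)), where x = Exp_P (t u),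
   t > 0 and u is a unit vector (t and u are unique on a Cartan-Hadamard
   manifold, for x <> P). *)
Definition radial_derivative (P : M) (f : M -> R) (x : M) : R :=
  xget 0 [set l | exists (t : R) (u : 'rV[R]_n),
    [/\ 0 < t, tnorm P u = 1, x = Exp P (t *: u) &
        l = derive1 (fun s : R => f (Exp P (s *: u)) : R^o) t]].

End riemannian_geometry.

Section comparison_function.
Context {R : realType}.

Definition coth (x : R) : R :=
  (expR x + expR (- x)) / (expR x - expR (- x)).

Definition ct (b t : R) : R :=
  if b == 0 then t^-1 else Num.sqrt b * coth (Num.sqrt b * t).

Definition DD (b t : R) : R := if t == 0 then 0 else t * ct b t - 1.

(* x ^ s for x >= 0, with 0 ^ s = +oo for s < 0 (the library's powR has
   0 `^ s = 0 in that case). *)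
Definition rpow (x s : R) : \bar R :=
  if (x == 0) && (s < 0) then +oo%E else (x `^ s)%:E.

End comparison_function.

(* Main.v *)
From HB Require Import structures.
Require Import Defs.
From mathcomp Require Import all_boot all_order all_algebra.
From mathcomp Require Import all_classical all_reals all_analysis.
From mathcomp Require Import perm measurable_realfun.
From mathcomp Require Import ring lra.
(* Repeated, since vector.v also defines [coord]. *)
Require Import Defs.
Set Implicit Arguments.
Unset Strict Implicit.
Unset Printing Implicit Defensive.
Import Order.TTheory GRing.Theory Num.Theory.
Import numFieldNormedType.Exports.
Local Open Scope classical_set_scope.
Local Open Scope ring_scope.

(* Since K <= -b <= 0, Exp_P is a diffeomorphism, rho = d_P satisfies
   rho(Exp_P v) = |v|, and comparing the Jacobi fields along the radial geodesics
   with the model of constant curvature -b bounds the Hessian of rho^2 / 2 from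
   below by 1 in the radial direction and by rho ct_b(rho) = 1 + D_b(rho) in the
   others.  Its trace is the divergence of Y = rho d/drho, so that
     div Y >= n + (n - 1) D_b(rho),
   and integrating div (q Y) = 0 for compactly supported q >= 0 yields
     int q (n + (n - 1) D_b(rho)) dV <= - int Y q dV.
   For q = rho^(-gamma r) |f|^r one has Y q = - gamma r q + rho^(-gamma r) Y |f|^r,
   which together with |Y |f|^r| <= r |f|^(r - 1) rho |d_rho f| and Hoelder's
   inequality gives the first inequality; the second one follows from
   |d_rho f| <= |grad f|.  The weights rho^(-gamma r) and |f|^r are first replaced
   by C^1 approximations, which are removed by Fatou's lemma. *)

(** * Functions of class C^{1,1} *)

(** Smoothness is used through the class [C^{1,1}], given by one inequality with explicit constants,
    so that the geodesic flow, changes of charts and local inverses become norm estimates. That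
    [Exp_P] is a diffeomorphism has a local and a global half. It has no critical point, since for a
    Jacobi field J the function <J, J'> is nondecreasing. Globally, coordinate segments are lifted
    through it: by the Gauss lemma a lift moves away from 0 no faster than the length of the path,
    hence stays in a compact set. This gives sections over coordinate balls, then lifts of paths and
    of homotopies, and injectivity follows from simple connectedness. The same growth estimate,
    applied to curves issuing from [P], identifies [d_P]. The volume measure is known in charts
    only, so the divergence theorem is integration by parts in coordinates after cutting [q] with
    bump functions. The difficult places are [P] and the zeros of [f], where the weights may blow up
    or fail to be differentiable; the approximations are chosen so that every error there vanishes
    or has the favourable sign. *)

Section matrix_norm.
Context {R : realType}.

Lemma mx_entry_le m n (A : 'M[R]_(m, n)) i j : `|A i j| <= `|A|.
Proof.
rewrite [leRHS]/Num.Def.normr/= mx_normrE.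
exact: (le_bigmax _ (fun ij : 'I_m * 'I_n => `|A ij.1 ij.2|) (i, j)).
Qed.

Lemma mx_norm_le m n (A : 'M[R]_(m, n)) c :
  0 <= c -> (forall i j, `|A i j| <= c) -> `|A| <= c.
Proof.
move=> c0 Ac; rewrite [leLHS]/Num.Def.normr/= mx_normrE.
by apply: bigmax_le => // ij _; exact: Ac.
Qed.

Lemma mulmx_norm_le m n p (A : 'M[R]_(m, n)) (B : 'M[R]_(n, p)) :
  `|A *m B| <= n%:R * `|A| * `|B|.
Proof.
apply: mx_norm_le => [|i j]; first by rewrite !mulr_ge0.
rewrite mxE (le_trans (ler_norm_sum _ _ _))//.
apply: (@le_trans _ _ (\sum_(k < n) `|A| * `|B|)).
  by apply: ler_sum => k _; rewrite normrM ler_pM// mx_entry_le.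
by rewrite sumr_const card_ord -[X in X <= _]mulr_natl mulrA.
Qed.

Lemma mul_row_col_le n (u : 'rV[R]_n) (B : 'cV[R]_n) :
  `|(u *m B) 0 0| <= n%:R * `|u| * `|B|.
Proof. exact: le_trans (mx_entry_le _ _ _) (mulmx_norm_le _ _). Qed.

Lemma ler_normM (x y a b : R) : `|x| <= a -> `|y| <= b -> `|x * y| <= a * b.
Proof. by move=> xa yb; rewrite normrM ler_pM. Qed.

End matrix_norm.

Section c11.
Context {R : realType}.

(* [f] is of class C^{1,1} near [y], with gradient [A]. *)
Definition c11at n (C d : R) (f : 'rV[R]_n -> R) (A : 'rV[R]_n -> 'cV[R]_n) y :=
  [/\ 0 < d, 0 <= C & forall p p' q,
     `|p - y| < d -> `|p' - y| < d -> `|q - y| < d ->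
     [/\ `|f p| <= C, `|f p - f p'| <= C * `|p - p'|, `|A q| <= C &
      `|f p - f p' - ((p - p') *m A q) 0 0| <=
        C * `|p - p'| * (`|p - q| + `|p' - q|)]].

(** The expansion between [p] and [p'] uses the gradient at a third point [q]. Taking [p' = q] gives
    Taylor's estimate at [q], and comparing two choices of [q] shows that [A] is Lipschitz, so that
    one inequality encodes the whole class. *)
Definition c11 n (f : 'rV[R]_n -> R) A y := exists C d, c11at C d f A y.

Definition c11v m n (f : 'rV[R]_n -> 'rV[R]_m) (A : 'rV[R]_n -> 'M[R]_(n, m)) y :=
  forall k, c11 (fun p => f p 0 k) (fun q => col k (A q)) y.

Lemma c11at_mono n C d C' d' (f : 'rV[R]_n -> R) A y : c11at C d f A y ->
  C <= C' -> 0 < d' -> d' <= d -> c11at C' d' f A y.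
Proof.
move=> [d0 C0 H] CC' d'0 d'd; split=> //; first exact: le_trans CC'.
move=> p p' q py p'y qy.
have [||| a b c e] := H p p' q; try exact: lt_le_trans d'd.
split; [exact: le_trans CC' | | exact: le_trans CC' |].
- by apply: le_trans b _; rewrite ler_wpM2r.
- by apply: le_trans e _; rewrite ler_wpM2r ?addr_ge0// ler_wpM2r.
Qed.

Lemma c11_pair n (f f' : 'rV[R]_n -> R) A A' y : c11 f A y -> c11 f' A' y ->
  exists C d, c11at C d f A y /\ c11at C d f' A' y.
Proof.
move=> [C [d h]] [C' [d' h']]; exists (Num.max C C'), (Num.min d d').
have [d0 _ _] := h; have [d0' _ _] := h'.
by split; [apply: (c11at_mono h)|apply: (c11at_mono h')];
  rewrite ?lt_min ?d0 ?d0'// ?le_max ?lexx ?orbT// ge_min lexx ?orbT.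
Qed.

Lemma c11v_unif m n (f : 'rV[R]_n -> 'rV[R]_m) A y : c11v f A y ->
  exists C d, [/\ 0 < d, 0 <= C & forall k, c11at C d (fun p => f p 0 k) (fun q => col k (A q)) y].
Proof.
move=> h; pose C k := sval (cid (h k)); pose d k := sval (cid (svalP (cid (h k)))).
have H k : c11at (C k) (d k) (fun p => f p 0 k) (fun q => col k (A q)) y.
  exact: (svalP (cid (svalP (cid (h k))))).
exists (\big[Num.max/0]_k C k), (\big[Num.min/1]_k d k).
have d0 : 0 < \big[Num.min/1]_k d k.
  by apply/bigmin_gtP; split=> // k _; have [] := H k.
split=> //; first exact: bigmax_ge_id.
move=> k; apply: (c11at_mono (H k)) => //; first exact: le_bigmax.
exact: bigmin_le_cond.
Qed.

Lemma c11_ext n (f f' : 'rV[R]_n -> R) A A' y :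
  (\forall q \near y, f q = f' q /\ A q = A' q) -> c11 f A y -> c11 f' A' y.
Proof.
move=> /nbhs_ballP[e /= e0 He] [C [d h]]; exists C, (Num.min d e).
have [d0 C0 _] := h.
have m0 : 0 < Num.min d e by rewrite lt_min d0.
have [_ _ H] : c11at C (Num.min d e) f A y.
  by apply: (c11at_mono h) => //; rewrite ge_min lexx.
split=> // p p' q hp hp' hq.
have ball_y z : `|z - y| < Num.min d e -> f z = f' z /\ A z = A' z.
  move=> zy; apply: He; rewrite -ball_normE /= distrC.
  by apply: lt_le_trans zy _; rewrite ge_min lexx orbT.
have [<- _] := ball_y _ hp; have [<- _] := ball_y _ hp'; have [_ <-] := ball_y _ hq.
exact: H.
Qed.

Lemma c11_near n (f : 'rV[R]_n -> R) A y : c11 f A y -> \forall z \near y, c11 f A z.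
Proof.
move=> [C [d [d0 C0 H]]]; apply/nbhs_ballP; exists (d / 2) => /=; first by rewrite divr_gt0.
move=> z; rewrite -ball_normE /= distrC => zy; exists C, (d / 2).
split=> //; first by rewrite divr_gt0.
by move=> p p' q hp hp' hq; apply: H; rewrite -(subrKA z) [d]splitr;
  apply: le_lt_trans (ler_normD _ _) _; rewrite ltrD.
Qed.

Lemma c11_cst n (c : R) (y : 'rV[R]_n) : c11 (fun=> c) (fun=> 0) y.
Proof.
exists `|c|, 1; split=> // p p' q _ _ _; split=> //.
- by rewrite subrr normr0 mulr_ge0.
- by rewrite normr0.
- by rewrite mulmx0 mxE subr0 subrr normr0 !mulr_ge0// addr_ge0.
Qed.

Lemma c11_lin n (B : 'cV[R]_n) (y : 'rV[R]_n) : c11 (fun p => (p *m B) 0 0) (fun=> B) y.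
Proof.
pose K := n%:R * (`|y| + 1) * `|B| + n%:R * `|B| + `|B|.
exists K, 1; split=> //; first by rewrite /K !addr_ge0 ?mulr_ge0 ?addr_ge0.
move=> p p' q hp hp' hq.
have E : (p *m B) 0 0 - (p' *m B) 0 0 = ((p - p') *m B) 0 0 by rewrite mulmxBl !mxE.
split.
- apply: le_trans (mul_row_col_le _ _) _.
  rewrite /K -addrA ler_wpDr ?addr_ge0 ?mulr_ge0//.
  rewrite ler_wpM2r// ler_wpM2l//.
  by rewrite -lerBlDl (le_trans (lerB_dist _ _))// ltW.
- rewrite E; apply: le_trans (mul_row_col_le _ _) _.
  rewrite mulrAC ler_wpM2r// /K addrAC ler_wpDl//.
- by rewrite /K ler_wpDl// !addr_ge0 ?mulr_ge0 ?addr_ge0.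
- rewrite E subrr normr0 !mulr_ge0 ?addr_ge0//.
Qed.

Lemma c11_coord n k (y : 'rV[R]_n) : c11 (fun p => p 0 k) (fun=> delta_mx k 0) y.
Proof.
apply: c11_ext (c11_lin (delta_mx k 0) y); near=> q; split=> //.
rewrite mxE (bigD1 k)//= big1 ?addr0 => [|j jk]; rewrite mxE ?eqxx ?mulr1//.
by rewrite (negbTE jk) mulr0.
Unshelve. all: by end_near. Qed.

Lemma c11D n (f g : 'rV[R]_n -> R) A B y : c11 f A y -> c11 g B y ->
  c11 (fun p => f p + g p) (fun q => A q + B q) y.
Proof.
move=> hf hg; have [C [d [[d0 C0 Hf] [_ _ Hg]]]] := c11_pair hf hg.
exists (C + C), d; split=> //; first by rewrite addr_ge0.
move=> p p' q hp hp' hq.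
have [f1 f2 f3 f4] := Hf _ _ _ hp hp' hq; have [g1 g2 g3 g4] := Hg _ _ _ hp hp' hq.
split.
- exact: le_trans (ler_normD _ _) (lerD f1 g1).
- by rewrite opprD addrACA mulrDl; exact: le_trans (ler_normD _ _) (lerD f2 g2).
- exact: le_trans (ler_normD _ _) (lerD f3 g3).
- rewrite mulmxDr mxE !mulrDl; apply: le_trans (lerD f4 g4).
  by rewrite -[leRHS]mulr1 mulr1; apply: le_trans (ler_normD _ _); rewrite le_eqVlt; apply/orP; left; apply/eqP; congr `|_|; ring.
Qed.

Lemma c11M n (f g : 'rV[R]_n -> R) A B y : c11 f A y -> c11 g B y ->
  c11 (fun p => f p * g p) (fun q => f q *: B q + g q *: A q) y.
Proof.
move=> hf hg; have [C [d [[d0 C0 Hf] [_ _ Hg]]]] := c11_pair hf hg.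
have n0 : 0 <= n%:R :> R by [].
have E : 2 * C * C <= C * C * (2 + 2 * n%:R) by nra.
exists (C * C * (2 + 2 * n%:R)), d; split=> //; first by nra.
move=> p p' q hp hp' hq.
have [f1 f2 f3 f4] := Hf _ _ _ hp hp' hq; have [g1 g2 g3 g4] := Hg _ _ _ hp hp' hq.
have [fq1 _ _ _] := Hf _ _ _ hq hp' hq; have [gq1 _ _ _] := Hg _ _ _ hq hp' hq.
have [f1' _ _ _] := Hf _ _ _ hp' hp' hq; have [g1' _ _ _] := Hg _ _ _ hp' hp' hq.
have [_ f2' _ _] := Hf _ _ _ hp hq hq; have [_ g2' _ _] := Hg _ _ _ hp' hq hq.
set a := `|p - p'| in f2 f4 g2 g4 *; set s := (`|p - q| + _) in f4 g4 *.
have a0 : 0 <= a by exact: normr_ge0.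
have sp : `|p - q| <= s by rewrite lerDl.
have sp' : `|p' - q| <= s by rewrite lerDr.
have s0 : 0 <= s by rewrite addr_ge0.
have dA : `|((p - p') *m A q) 0 0| <= n%:R * a * C.
  by apply: le_trans (mul_row_col_le _ _) _; rewrite ler_wpM2l// mulr_ge0.
have dB : `|((p - p') *m B q) 0 0| <= n%:R * a * C.
  by apply: le_trans (mul_row_col_le _ _) _; rewrite ler_wpM2l// mulr_ge0.
split.
- by apply: le_trans (ler_normM f1 g1) _; nra.
- have -> : f p * g p - f p' * g p' = f p * (g p - g p') + (f p - f p') * g p' by ring.
  apply: le_trans (ler_normD _ _) _.
  apply: le_trans (lerD (ler_normM f1 g2) (ler_normM f2 g1')) _.
  apply: (@le_trans _ _ (2 * C * C * a)); first by rewrite le_eqVlt; apply/orP; left; apply/eqP; ring.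
  by rewrite ler_wpM2r.
- apply: le_trans (ler_normD _ _) _; rewrite !mx_normZ.
  by apply: le_trans (lerD (ler_pM _ _ fq1 g3) (ler_pM _ _ gq1 f3)) _ => //; nra.
- rewrite mulmxDr -!scalemxAr !mxE.
  set dfB := \sum_j _ * _; set dfA := \sum_j _ * _.
  rewrite !mxE -/dfA in f4 dA; rewrite !mxE -/dfB in g4 dB.
  (* Two first-order remainders, and two increments relative to [q] multiplied by a differential;
     each is of the size of the allowed error. *)
  have -> : f p * g p - f p' * g p' - (f q * dfB + g q * dfA) =
     f p * (g p - g p' - dfB) + (f p - f q) * dfB +
     (g p' * (f p - f p' - dfA) + (g p' - g q) * dfA) by ring.
  apply: le_trans (ler_normD _ _) _.
  apply: le_trans (lerD (ler_normD _ _) (ler_normD _ _)) _.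
  have X1 := ler_normM f1 g4; have X2 := ler_normM f2' dB.
  have X3 := ler_normM g1' f4; have X4 := ler_normM g2' dA.
  apply: le_trans (lerD (lerD X1 X2) (lerD X3 X4)) _.
  have Y : 0 <= C * (n%:R * a * C) by rewrite !mulr_ge0.
  have Y1 : C * `|p - q| * (n%:R * a * C) <= C * s * (n%:R * a * C).
    by rewrite ler_wpM2r ?mulr_ge0// ler_wpM2l.
  have Y2 : C * `|p' - q| * (n%:R * a * C) <= C * s * (n%:R * a * C).
    by rewrite ler_wpM2r ?mulr_ge0// ler_wpM2l.
  apply: le_trans (lerD (lerD (lexx _) Y1) (lerD (lexx _) Y2)) _.
  by rewrite le_eqVlt; apply/orP; left; apply/eqP; ring.
Qed.

Lemma c11Z n (f : 'rV[R]_n -> R) A y c : c11 f A y ->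
  c11 (fun p => c * f p) (fun q => c *: A q) y.
Proof.
move=> /(c11M (c11_cst c y)); apply: c11_ext; near=> q.
by rewrite scaler0 addr0.
Unshelve. all: by end_near. Qed.

Lemma c11N n (f : 'rV[R]_n -> R) A y : c11 f A y ->
  c11 (fun p => - f p) (fun q => - A q) y.
Proof.
move=> /(c11Z (-1)); apply: c11_ext; near=> q.
by rewrite scaleN1r mulN1r.
Unshelve. all: by end_near. Qed.

Lemma c11_sum n (I : Type) (r : seq I) (P : pred I) (f : I -> 'rV[R]_n -> R) A y :
  (forall i, P i -> c11 (f i) (A i) y) ->
  c11 (fun p => \sum_(i <- r | P i) f i p) (fun q => \sum_(i <- r | P i) A i q) y.
Proof.
move=> h; elim: r => [|i r ih].
  apply: c11_ext (c11_cst 0 y); near=> q; by rewrite !big_nil.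
case: (boolP (P i)) => Pi.
  by apply: c11_ext (c11D (h _ Pi) ih); near=> q; rewrite !big_cons Pi.
by apply: c11_ext ih; near=> q; rewrite !big_cons (negbTE Pi).
Unshelve. all: by end_near. Qed.

Lemma c11_prod n (I : Type) (r : seq I) (f : I -> 'rV[R]_n -> R) A y :
  (forall i, c11 (f i) (A i) y) ->
  exists B, c11 (fun p => \prod_(i <- r) f i p) B y.
Proof.
move=> h; elim: r => [|i r [B ih]].
  exists (fun=> 0); apply: c11_ext (c11_cst 1 y); near=> q; by rewrite !big_nil.
exists (fun q => f i q *: B q + (\prod_(i <- r) f i q) *: A i q).
by apply: c11_ext (c11M (h _) ih); near=> q; rewrite !big_cons.
Unshelve. all: by end_near. Qed.

Lemma c11_comp m n (f : 'rV[R]_m -> R) A (F : 'rV[R]_n -> 'rV[R]_m) B y :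
  c11v F B y -> c11 f A (F y) -> c11 (fun p => f (F p)) (fun q => B q *m A (F q)) y.
Proof.
move=> /c11v_unif[C1 [d1 [d10 C10 HF]]] [C2 [d2 hf]].
pose C := Num.max C1 C2; have C1C : C1 <= C by rewrite le_max lexx.
have C0 : 0 <= C by exact: le_trans C1C.
pose d := Num.min d1 (d2 / (C + 1)).
have [d20 _ _] := hf.
have d0 : 0 < d by rewrite lt_min d10 divr_gt0// ltr_wpDl.
have {}HF k : c11at C d (fun p => F p 0 k) (fun q => col k (B q)) y.
  by apply: (c11at_mono (HF k)) => //; rewrite ge_min lexx.
have {}hf : c11at C d2 f A (F y) by apply: (c11at_mono hf) => //; rewrite le_max lexx orbT.
have [_ _ {}hf] := hf.
have yd : `|y - y| < d by rewrite subrr normr0.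
have FL p p' : `|p - y| < d -> `|p' - y| < d -> `|F p - F p'| <= C * `|p - p'|.
  move=> hp hp'; apply: mx_norm_le => [|i k]; first by rewrite mulr_ge0.
  by rewrite ord1 !mxE; have [_ _ /(_ _ _ _ hp hp' hp)[]] := HF k.
have Fball p : `|p - y| < d -> `|F p - F y| < d2.
  move=> hp; apply: le_lt_trans (FL _ _ hp yd) _.
  have : `|p - y| < d2 / (C + 1) by apply: lt_le_trans hp _; rewrite ge_min lexx orbT.
  rewrite ltr_pdivlMr ?ltr_wpDl// => h; apply: le_lt_trans h.
  by rewrite mulrC ler_wpM2l// lerDl.
have Bn q : `|q - y| < d -> `|B q| <= C.
  move=> hq; apply: mx_norm_le => // i k.
  have [_ _ /(_ _ _ _ hq hq hq)[_ _ h _]] := HF k.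
  by apply: le_trans h; have := mx_entry_le (col k (B q)) i 0; rewrite mxE.
have n0 : 0 <= n%:R :> R by [].
have m0 : 0 <= m%:R :> R by [].
pose K := C + C * C + m%:R * C * C + (C * C * C + m%:R * C * C).
have t1 : 0 <= C * C by rewrite mulr_ge0.
have t3 : 0 <= C * C * C by rewrite !mulr_ge0.
have t4 : 0 <= m%:R * C * C by rewrite !mulr_ge0.
exists K, d; split=> //; first by rewrite /K !addr_ge0.
move=> p p' q hp hp' hq.
have [f1 f2 f3 f4] := hf _ _ _ (Fball _ hp) (Fball _ hp') (Fball _ hq).
split.
- by apply: le_trans f1 _; rewrite /K; lra.
- apply: le_trans f2 _; apply: (@le_trans _ _ (C * (C * `|p - p'|))).
    by rewrite ler_wpM2l// FL.
  by rewrite mulrA ler_wpM2r// /K; lra.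
- apply: le_trans (mulmx_norm_le _ _) _.
  apply: (@le_trans _ _ (m%:R * C * C)); last by rewrite /K; lra.
  by rewrite ler_pM ?mulr_ge0// ler_wpM2l// Bn.
- set a := `|p - p'|; set s := (`|p - q| + _).
  have a0 : 0 <= a by exact: normr_ge0.
  have s0 : 0 <= s by rewrite addr_ge0.
  have -> : f (F p) - f (F p') - ((p - p') *m (B q *m A (F q))) 0 0 =
     (f (F p) - f (F p') - ((F p - F p') *m A (F q)) 0 0)
     + ((F p - F p' - (p - p') *m B q) *m A (F q)) 0 0.
    rewrite mulmxA -[LHS](subrKA (((F p - F p') *m A (F q)) 0 0)).
    by congr (_ + _); rewrite (mulmxBl (F p - F p')) !mxE.
  apply: le_trans (ler_normD _ _) _.
  have E1 : `|f (F p) - f (F p') - ((F p - F p') *m A (F q)) 0 0| <= C * C * C * a * s.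
    apply: le_trans f4 _.
    have -> : C * C * C * a * s = C * (C * a) * (C * s) by ring.
    rewrite ler_pM// ?mulr_ge0 ?addr_ge0 ?ler_wpM2l ?FL//.
    by rewrite mulrDr lerD// FL.
  have E2 : `|F p - F p' - (p - p') *m B q| <= C * a * s.
    apply: mx_norm_le => [|i k]; first by rewrite !mulr_ge0.
    have [_ _ /(_ _ _ _ hp hp' hq)[_ _ _]] := HF k.
    rewrite ord1; congr (_ <= _); congr `|_|; rewrite !mxE; congr (_ - _).
    by apply: eq_bigr => j _; rewrite !mxE.
  have E3 : `|((F p - F p' - (p - p') *m B q) *m A (F q)) 0 0| <= m%:R * C * C * a * s.
    apply: le_trans (mul_row_col_le _ _) _.
    have -> : m%:R * C * C * a * s = m%:R * (C * a * s) * C by ring.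
    by rewrite ler_pM// ?mulr_ge0// ler_wpM2l.
  apply: le_trans (lerD E1 E3) _; rewrite -2!mulrDl ler_wpM2r// ler_wpM2r// /K; lra.
Qed.

End c11.

(** * Differentials of functions of class C^{1,1}, and bounds by partial derivatives *)

Section differentiability.
Context {R : realType}.

Lemma diff_quad (V W : normedModType R) (f : V -> W) (df : {linear V -> W}) y C d :
  continuous df -> 0 < d ->
  (forall p, `|p - y| < d -> `|f p - f y - df (p - y)| <= C * `|p - y| ^+ 2) ->
  is_diff y f df.
Proof.
move=> dfc d0 H.
have E : f \o shift y = cst (f y) + df +o_ 0 id.
  apply/eqaddoP => _/posnumP[e]; rewrite -nbhs_nearE.
  apply/nbhs_ballP; exists (Num.min d (e%:num / (`|C| + 1))) => /=.
    by rewrite lt_min d0 divr_gt0// ltr_wpDl.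
  move=> h; rewrite -ball_normE /= sub0r normrN lt_min => /andP[hd he].
  have := H (h + y); rewrite addrK => /(_ hd) H1.
  rewrite /= !fctE /= opprD addrA; apply: le_trans H1 _.
  rewrite expr2 mulrA ler_wpM2r//; apply: le_trans (ltW _); last first.
    by move: he; rewrite ltr_pdivlMr ?ltr_wpDl//; apply.
  by rewrite mulrC ler_wpM2l// (le_trans (ler_norm _))// lerDl.
split; last exact: diff_unique.
by apply/diff_locallyP; rewrite (diff_unique dfc E).
Qed.

Lemma mulmxr_continuous m n (B : 'M[R]_(m, n)) :
  continuous (mulmxr B : 'rV[R]_m -> 'rV[R]_n).
Proof.
move=> x; apply/(@cvgrPdist_le _ _ _ (nbhs x)) => /= e e0.
near=> t; rewrite -mulmxBl (le_trans (mulmx_norm_le _ _))//.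
have K0 : 0 < m%:R * `|B| + 1 by rewrite ltr_wpDl ?mulr_ge0.
have : `|x - t| <= e / (m%:R * `|B| + 1).
  by near: t; apply: cvgr_dist_le; [exact: cvg_id|rewrite divr_gt0].
rewrite ler_pdivlMr// => h; apply: le_trans h.
by rewrite mulrAC mulrC ler_wpM2l// lerDl.
Unshelve. all: by end_near. Qed.

(** The linear form with gradient [B], bundled below as a linear map so that it can serve as a
    differential. *)
Definition gradmap n (B : 'cV[R]_n) (u : 'rV[R]_n) : R := (u *m B) 0 0.

Lemma gradmap_is_linear n (B : 'cV[R]_n) : linear (gradmap B).
Proof. by move=> a u v; rewrite /gradmap mulmxDl -scalemxAl !mxE. Qed.
HB.instance Definition _ n (B : 'cV[R]_n) :=
  GRing.isLinear.Build R _ _ _ (gradmap B) (gradmap_is_linear B).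

Lemma gradmap_continuous n (B : 'cV[R]_n) : continuous (gradmap B).
Proof.
move=> x; apply: (@cvg_comp _ _ _ (mulmxr B) (fun M : 'M[R]_1 => M 0 0)).
  exact: mulmxr_continuous.
exact: matrix_normedtype.coord_continuous.
Qed.

Lemma c11_is_diff n (f : 'rV[R]_n -> R) A y : c11 f A y -> is_diff y f (gradmap (A y)).
Proof.
move=> [C [d [d0 C0 H]]]; apply: (@diff_quad _ _ _ _ _ C d) => //.
  exact: gradmap_continuous.
move=> p py; have yy : `|y - y| < d by rewrite subrr normr0.
have [_ _ _] := H _ _ _ py yy yy; rewrite subrr normr0 addr0 expr2 mulrA.
by [].
Qed.

Lemma c11v_is_diff m n (F : 'rV[R]_n -> 'rV[R]_m) A y :
  c11v F A y -> is_diff y F (mulmxr (A y)).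
Proof.
move=> /c11v_unif[C [d [d0 C0 H]]]; apply: (@diff_quad _ _ _ _ _ C d) => //.
  exact: mulmxr_continuous.
move=> p py; have yy : `|y - y| < d by rewrite subrr normr0.
apply: mx_norm_le => [|i k]; first by rewrite mulr_ge0// exprn_ge0.
have [_ _ /(_ _ _ _ py yy yy)[_ _ _]] := H k.
rewrite subrr normr0 addr0 -mulrA -expr2 ord1; congr (_ <= _); congr `|_|.
by rewrite !mxE; congr (_ - _); apply: eq_bigr => j _; rewrite !mxE.
Qed.

Lemma c11v_jacobian m n (F : 'rV[R]_n -> 'rV[R]_m) A y :
  c11v F A y -> jacobian F y = A y.
Proof.
move=> h; have [_ e] := c11v_is_diff h.
by rewrite /jacobian; apply/row_matrixP => i; rewrite !rowE mul_rV_lin1 /= e.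
Qed.

Lemma c11_derive n (f : 'rV[R]_n -> R) A y v :
  c11 f A y -> is_derive y v f ((v *m A y) 0 0).
Proof.
move=> h; have [d1 d2] := c11_is_diff h; split; first exact: diff_derivable.
by rewrite deriveE// d2.
Qed.

Lemma c11v_derive m n (f : 'rV[R]_n -> 'rV[R]_m) A y v :
  c11v f A y -> is_derive y v f (v *m A y).
Proof.
move=> h; have [d1 d2] := c11v_is_diff h; split; first exact: diff_derivable.
by rewrite deriveE// d2.
Qed.

Lemma diff_curve (V W : normedModType R) (f : V -> W) df (x : R -> V) t x' :
  is_diff (x t) f df -> is_derive t 1 x x' -> is_derive t 1 (fun s => f (x s)) (df x').
Proof.
move=> [f1 <-] [x1 <-].
have dx : differentiable x t by apply/derivable1_diffP.
have dfx : differentiable (f \o x) t by exact: differentiable_comp.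
split; first by apply/derivable1_diffP.
by rewrite (deriveE _ dfx) diff_comp //= (deriveE _ dx).
Qed.

Lemma c11_curve n (f : 'rV[R]_n -> R) A (x : R -> 'rV[R]_n) t x' :
  c11 f A (x t) -> is_derive t 1 x x' ->
  is_derive t 1 (fun s => f (x s)) ((x' *m A (x t)) 0 0).
Proof. by move=> /c11_is_diff h; exact: diff_curve. Qed.

Lemma c11v_curve m n (f : 'rV[R]_n -> 'rV[R]_m) A (x : R -> 'rV[R]_n) t x' :
  c11v f A (x t) -> is_derive t 1 x x' ->
  is_derive t 1 (fun s => f (x s)) (x' *m A (x t)).
Proof. by move=> /c11v_is_diff h; exact: diff_curve. Qed.

Lemma c11_continuous n (f : 'rV[R]_n -> R) A y : c11 f A y -> {for y, continuous f}.
Proof. by move=> /c11_is_diff[h _]; exact: differentiable_continuous. Qed.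

Lemma c11v_continuous m n (f : 'rV[R]_n -> 'rV[R]_m) A y : c11v f A y -> {for y, continuous f}.
Proof. by move=> /c11v_is_diff[h _]; exact: differentiable_continuous. Qed.

Lemma is_derive_mxP m n (V : normedModType R) (F : V -> 'M[R]_(m, n)) t v F' :
  is_derive t v F F' <-> forall i j, is_derive t v (fun s => F s i j) (F' i j).
Proof.
split=> [[h1 h2] i j|h].
  split; first by move/derivable_mxP: h1; apply.
  by rewrite -h2 derive_mx// mxE.
have h1 : derivable F t v by apply/derivable_mxP => i j; have [] := h i j.
split=> //; rewrite derive_mx//; apply/matrixP => i j; rewrite mxE.
by have [_ <-] := h i j.
Qed.

Lemma line_is_derive (V W : normedModType R) (f : V -> W) (z e : V) (s : R) :
  derivable f (z + s *: e) e ->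
  is_derive s 1 (fun t => f (z + t *: e)) ('D_e f (z + s *: e)).
Proof.
move=> h.
have E : (fun k => k^-1 *: (((fun t => f (z + t *: e)) \o shift s) (k *: 1) - f (z + s *: e)))
   = (fun k => k^-1 *: ((f \o shift (z + s *: e)) (k *: e) - f (z + s *: e))).
  apply/funext => k /=; congr (_ *: (f _ - _)).
  by rewrite [_%:A]mulr1 scalerDl addrCA.
by split; rewrite /derivable /derive E.
Qed.

Lemma mvt_bound (f df : R -> R) (u v a eta : R) :
  (forall s, Num.min u v <= s <= Num.max u v -> is_derive s 1 f (df s)) ->
  (forall s, Num.min u v <= s <= Num.max u v -> `|df s - a| <= eta) ->
  `|f v - f u - (v - u) * a| <= eta * `|v - u|.
Proof.
wlog uv : u v / u <= v.
  move=> H fd fb; have [uv|/ltW vu] := leP u v; first exact: H.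
  have := H v u vu; rewrite minC maxC => /(_ fd fb).
  rewrite distrC; congr (_ <= _ * _); last by rewrite distrC.
  by congr `|_|; ring.
rewrite min_l// max_r// => fd fb.
have [||c cI ->] := @MVT_segment R f df u v uv.
- by move=> x xI; apply: fd; rewrite ?(itvP xI).
- apply: derivable_within_continuous => x xI.
  by have [] // := fd x; rewrite (itvP xI).
- have -> : df c * (v - u) - (v - u) * a = (df c - a) * (v - u) by ring.
  by rewrite normrM ler_wpM2r// fb// !(itvP cI).
Qed.

(* Joins [p'] to [p] by changing one coordinate at a time, which stays in any
   sup-norm ball containing both points. *)
Lemma partial_bound n (f : 'rV[R]_n -> R) (A : 'cV[R]_n) y d eta :
  0 <= eta ->
  (forall z a, `|z - y| < d -> derivable f z (delta_mx 0 a : 'rV[R]_n) /\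
     `|'D_(delta_mx 0 a : 'rV[R]_n) f z - A a 0| <= eta) ->
  forall p p', `|p - y| < d -> `|p' - y| < d ->
  `|f p - f p' - ((p - p') *m A) 0 0| <= n%:R * eta * `|p - p'|.
Proof.
move=> eta0 H p p' hp hp'.
have d0 : 0 < d by apply: le_lt_trans hp.
pose z k : 'rV[R]_n := \row_a (if (a < k)%N then p 0 a else p' 0 a).
have step (k : 'I_n) : `|f (z k.+1) - f (z k) - (p 0 k - p' 0 k) * A k 0| <= eta * `|p - p'|.
  pose phi s := f (z k + s *: (delta_mx 0 k : 'rV[R]_n)).
  have -> : f (z k.+1) = phi (p 0 k - p' 0 k).
    congr f; apply/rowP => a; rewrite !mxE eqxx /= ltnS leq_eqVlt.
    have [->|ak] := eqVneq a k.
      by rewrite eqxx /= ltnn mulr1 addrC subrK.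
    by rewrite val_eqE (negbTE ak) /= mulr0 addr0.
  have -> : f (z k) = phi 0 by rewrite /phi scale0r addr0.
  have yball s : Num.min 0 (p 0 k - p' 0 k) <= s <= Num.max 0 (p 0 k - p' 0 k) ->
      `|z k + s *: (delta_mx 0 k : 'rV[R]_n) - y| < d.
    move=> hs; pose m := Num.max `|p - y| `|p' - y|.
    have md : m < d by rewrite gt_max hp.
    apply: le_lt_trans md; apply: mx_norm_le => [|i a]; first by rewrite le_max normr_ge0.
    have pa b : `|p 0 b - y 0 b| <= m.
      by rewrite le_max; have := mx_entry_le (p - y) 0 b; rewrite !mxE => ->.
    have pa' b : `|p' 0 b - y 0 b| <= m.
      by rewrite le_max; have := mx_entry_le (p' - y) 0 b; rewrite !mxE => ->; rewrite orbT.
    rewrite ord1 !mxE eqxx /=.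
    have [->|ak] := eqVneq a k.
      rewrite ltnn mulr1; move: (pa k) (pa' k); rewrite !ler_norml.
      move: hs; rewrite ge_min le_max; lra.
    by rewrite mulr0 addr0; case: ifP.
  have := @mvt_bound phi (fun s => 'D_(delta_mx 0 k : 'rV[R]_n) f (z k + s *: delta_mx 0 k))
    0 (p 0 k - p' 0 k) (A k 0) eta.
  rewrite subr0 => M; apply: le_trans (M _ _) _.
  - by move=> s /yball/H => /(_ k)[h _]; exact: line_is_derive.
  - by move=> s /yball/H => /(_ k)[_ h].
  - by rewrite ler_wpM2l//; have := mx_entry_le (p - p') 0 k; rewrite !mxE.
have zn : z n = p by apply/rowP => a; rewrite mxE ltn_ord.
have z0 : z 0%N = p' by apply/rowP => a; rewrite mxE.
have -> : f p - f p' - ((p - p') *m A) 0 0 =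
    \sum_(k < n) (f (z k.+1) - f (z k) - (p 0 k - p' 0 k) * A k 0).
  rewrite sumrB -(big_mkord xpredT (fun k => f (z k.+1) - f (z k))).
  rewrite telescope_sumr// zn z0 mxE; congr (_ - _).
  by apply: eq_bigr => k _; rewrite !mxE.
apply: le_trans (ler_norm_sum _ _ _) _.
apply: le_trans (ler_sum _ (fun k _ => step k)) _.
by rewrite sumr_const card_ord -[X in X <= _]mulr_natl mulrA.
Qed.

Definition grad n (f : 'rV[R]_n -> R) (q : 'rV[R]_n) : 'cV[R]_n :=
  \col_a 'D_(delta_mx 0 a : 'rV[R]_n) f q.

(** Bounded second partial derivatives make the first ones Lipschitz. The first-order remainder is
    then [partial_bound] on a ball around [q] just large enough to contain [p] and [p']. *)
Lemma c11_of_partials n (f : 'rV[R]_n -> R) y K d : 0 < d -> 0 <= K ->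
  (forall z, `|z - y| < d -> [/\ `|f z| <= K,
    forall a, derivable f z (delta_mx 0 a : 'rV[R]_n) /\
              `|'D_(delta_mx 0 a : 'rV[R]_n) f z| <= K &
    forall a b, derivable ('D_(delta_mx 0 a : 'rV[R]_n) f) z (delta_mx 0 b : 'rV[R]_n) /\
      `|'D_(delta_mx 0 b : 'rV[R]_n) ('D_(delta_mx 0 a : 'rV[R]_n) f) z| <= K]) ->
  c11 f (grad f) y.
Proof.
move=> d0 K0 H.
have n0 : 0 <= n%:R :> R by [].
have nK : 0 <= n%:R * K by rewrite mulr_ge0.
have nnK : 0 <= n%:R * (n%:R * K) by rewrite mulr_ge0.
have L1 p p' : `|p - y| < d -> `|p' - y| < d -> `|f p - f p'| <= n%:R * K * `|p - p'|.
  move=> hp hp'; have := @partial_bound n f 0 y d K K0 _ p p' hp hp'.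
  rewrite mulmx0 mxE subr0; apply=> z a /H[_ /(_ a)[h1 h2] _]; split=> //.
  by rewrite mxE subr0.
have L2 a p p' : `|p - y| < d -> `|p' - y| < d ->
    `|'D_(delta_mx 0 a : 'rV[R]_n) f p - 'D_(delta_mx 0 a : 'rV[R]_n) f p'| <= n%:R * K * `|p - p'|.
  move=> hp hp'.
  have := @partial_bound n ('D_(delta_mx 0 a : 'rV[R]_n) f) 0 y d K K0 _ p p' hp hp'.
  rewrite mulmx0 mxE subr0; apply=> z b /H[_ _ /(_ a b)[h1 h2]]; split=> //.
  by rewrite mxE subr0.
exists (K + n%:R * K + n%:R * (n%:R * K) * 2), (d / 3); split; first by rewrite divr_gt0.
  by rewrite !addr_ge0// mulr_ge0.
move=> p p' q hp hp' hq.
have dd : d / 3 < d by rewrite ltr_pdivrMr// ltr_pMr// ltr1n.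
have hpd := lt_trans hp dd; have hpd' := lt_trans hp' dd; have hqd := lt_trans hq dd.
have [f1 f2 f3] := H _ hpd; have [_ f2q _] := H _ hqd.
split.
- by apply: le_trans f1 _; lra.
- apply: le_trans (L1 _ _ hpd hpd') _; rewrite ler_wpM2r//; lra.
- apply: mx_norm_le => [|a j]; first by rewrite !addr_ge0// mulr_ge0.
  by rewrite mxE; have [_ h] := f2q a; apply: le_trans h _; lra.
- pose r := `|p - q| + `|p' - q|.
  have r0 : 0 <= r by rewrite addr_ge0.
  have [pp|pp] := eqVneq (p - p') 0.
    by rewrite pp mul0mx mxE subr0 normr0 mulr0 mul0r (subr0_eq pp) subrr normr0.
  have Nn z1 z2 : `|z1 - y| < d / 3 -> `|z2 - y| < d / 3 -> `|z1 - z2| < 2 * (d / 3).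
    move=> h1 h2; rewrite -(subrKA y) (le_lt_trans (ler_normD _ _))// -(distrC z2).
    by rewrite (_ : _ * (d/3) = d/3 + d/3) ?ltrD//; ring.
  (* The ball around [q] must contain [p] and [p'], and its points must stay within [d] of [y]; this
     is why [p], [p'] and [q] were taken within [d / 3] of [y]. *)
  pose rr := Num.min (2 * (d / 3)) (2 * r).
  have rp : 0 < r.
    rewrite lt_neqAle r0 andbT eq_sym; apply: contra_neq pp => r00.
    have : `|p - q| = 0 by move: (normr_ge0 (p - q)) (normr_ge0 (p' - q)) r00; rewrite /r; lra.
    have : `|p' - q| = 0 by move: (normr_ge0 (p - q)) (normr_ge0 (p' - q)) r00; rewrite /r; lra.
    by move=> /normr0_eq0/subr0_eq -> /normr0_eq0/subr0_eq ->; rewrite subrr.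
  have := @partial_bound n f (grad f q) q rr (n%:R * K * (2 * r)) _ _ p p'.
  move=> M; apply: le_trans (M _ _ _ _) _.
  + by rewrite !mulr_ge0.
  + move=> z a; rewrite lt_min => /andP[z1 z2].
    have zd : `|z - y| < d.
      rewrite -(subrKA q) (le_lt_trans (ler_normD _ _))//.
      by rewrite (_ : d = 2 * (d/3) + d/3) ?ltrD//; field.
    have [_ /(_ a)[h _] _] := H _ zd; split=> //.
    rewrite mxE; apply: le_trans (L2 _ _ _ zd hqd) _.
    by rewrite ler_wpM2l// ltW.
  + rewrite lt_min Nn//=; rewrite /r; move: (normr_ge0 (p' - q)) rp; rewrite /r; lra.
  + rewrite lt_min Nn//=; rewrite /r; move: (normr_ge0 (p - q)) rp; rewrite /r; lra.
  + rewrite -/r; have -> : n%:R * (n%:R * K * (2 * r)) * `|p - p'| =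
      n%:R * (n%:R * K) * 2 * `|p - p'| * r by ring.
    by rewrite ler_wpM2r// ler_wpM2r//; lra.
Qed.

End differentiability.

(** * Smooth functions are of class C^{1,1}; closure under algebraic operations *)

Section smooth_functions.
Context {R : realType}.

Lemma near_all (n : nat) (P : 'rV[R]_n -> Prop) (y : 'rV[R]_n) : (\forall z \near y, P z) ->
  exists2 d : R, 0 < d & forall z, `|z - y| < d -> P z.
Proof.
move=> /nbhs_ballP[d /= d0 H]; exists d => // z zy; apply: H.
by rewrite -ball_normE /= distrC.
Qed.

Lemma near_norm n (y : 'rV[R]_n) d : 0 < d -> \forall z \near y, `|z - y| < d.
Proof.
move=> d0; apply/nbhs_ballP; exists d => // z; by rewrite -ball_normE /= distrC.
Qed.

Lemma open_near n (U : set 'rV[R]_n) y : open U -> U y -> \forall z \near y, U z.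
Proof. by move=> Uo Uy; apply: open_nbhs_nbhs. Qed.

Lemma continuous_bounded_near (T : topologicalType) (f : T -> R) y :
  {for y, continuous f} -> \forall z \near y, `|f z| <= `|f y| + 1.
Proof.
move=> /cvgrPdist_lt /(_ 1 ltr01); apply: filterS => z /ltW.
by rewrite distrC => h; rewrite -(subrK (f y) (f z)) addrC (le_trans (ler_normD _ _))// lerD2l.
Qed.

Lemma smooth_entry n a b (U : set 'rV[R]_n) (f : 'rV[R]_n -> 'M[R]_(a, b)) i j :
  open U -> smooth_on U f -> smooth_on U (fun z => f z i j : R^o).
Proof.
move=> Uo sf.
have E s y : U y -> foldr partial (fun z => f z i j : R^o) s y = foldr partial f s y i j.
  elim: s y => //= k s ih y Uy; rewrite /partial.
  have [_ /(_ k) df] := sf s y Uy.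
  rewrite derive_mx// mxE; apply: near_eq_derive.
  by apply: filterS (open_near Uo Uy) => z; exact: ih.
move=> s y Uy; have [cf df] := sf s y Uy.
have near_E : \forall z \near y, foldr partial f s z i j = foldr partial (fun z => f z i j : R^o) s z.
  by apply: filterS (open_near Uo Uy) => z Uz; rewrite E.
split=> [|k].
  rewrite /prop_for /continuous_at E//.
  apply: cvg_trans (near_eq_cvg near_E) _.
  exact: (cvg_comp _ _ cf (@matrix_normedtype.coord_continuous _ _ _ i j _)).
apply: (near_eq_derivable near_E).
by have /derivable_mxP := df k; apply.
Qed.

Lemma smooth_partial n (W : normedModType R) (U : set 'rV[R]_n) (f : 'rV[R]_n -> W) a :
  smooth_on U f -> smooth_on U (partial a f).
Proof. by move=> sf s y /(sf (rcons s a)); rewrite foldr_rcons. Qed.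

Lemma le_sum1 n (F : 'I_n -> R) a : (forall b, 0 <= F b) -> F a <= \sum_b F b.
Proof. by move=> F0; rewrite (bigD1 a)//= lerDl sumr_ge0. Qed.

(** Derivatives up to order two are continuous, hence bounded near [y], which is what
    [c11_of_partials] requires. *)
Lemma smooth_c11 n (U : set 'rV[R]_n) (f : 'rV[R]_n -> R^o) y :
  open U -> smooth_on U f -> U y -> c11 f (grad f) y.
Proof.
move=> Uo sf Uy.
have c0 := continuous_bounded_near (sf [::] y Uy).1.
have c1 a := continuous_bounded_near (sf [:: a] y Uy).1.
have c2 a b := continuous_bounded_near (sf [:: b; a] y Uy).1.
have {}c1 : \forall z \near y, forall a, `|foldr partial f [:: a] z| <= `|foldr partial f [:: a] y| + 1.
  exact: (@filter_forall _ _ _ (nbhs y)).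
have {c2} : \forall z \near y, forall a b, `|foldr partial f [:: b; a] z| <= `|foldr partial f [:: b; a] y| + 1.
  by apply: (@filter_forall _ _ _ (nbhs y)) => a; apply: (@filter_forall _ _ _ (nbhs y)) => b; exact: c2.
move=> /(filterI c1)/(filterI c0)/(filterI (open_near Uo Uy))/near_all[d d0 H].
pose K0 := `|f y| + 1.
pose K1 := \sum_(a < n) (`|partial a f y| + 1).
pose K2 := \sum_(a < n) \sum_(b < n) (`|partial b (partial a f) y| + 1).
have K00 : 0 <= K0 by rewrite addr_ge0.
have K10 : 0 <= K1 by apply: sumr_ge0 => a _; rewrite addr_ge0.
have K20 : 0 <= K2 by apply: sumr_ge0 => a _; apply: sumr_ge0 => b _; rewrite addr_ge0.
apply: (@c11_of_partials _ _ _ _ (K0 + K1 + K2) d) => //; first by rewrite !addr_ge0.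
move=> z /H[Uz [h0 [h1 h2]]]; split.
- by apply: le_trans h0 _; rewrite -addrA lerDl addr_ge0.
- move=> a; split; first by have [_] := sf [::] z Uz; apply.
  apply: le_trans (h1 a) _.
  apply: (@le_trans _ _ K1); last by rewrite addrAC lerDr addr_ge0.
  by apply: (le_sum1 (F := fun a => `|partial a f y| + 1)) => b; rewrite addr_ge0.
- move=> a b; split; first by have [_] := sf [:: a] z Uz; apply.
  apply: le_trans (h2 a b) _.
  apply: (@le_trans _ _ K2); last by rewrite lerDr addr_ge0.
  apply: le_trans (le_sum1 (F := fun b => `|partial b (partial a f) y| + 1) b _) _.
    by move=> c; rewrite addr_ge0.
  apply: (le_sum1 (F := fun a => \sum_(b < n) (`|partial b (partial a f) y| + 1))).
  by move=> c; apply: sumr_ge0 => d' _; rewrite addr_ge0.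
Qed.

Definition c11e n (f : 'rV[R]_n -> R) y := exists A, c11 f A y.

Lemma c11e_grad n (f : 'rV[R]_n -> R) y : c11e f y -> c11 f (grad f) y.
Proof.
move=> [A hy]; apply: c11_ext (hy); near=> q; split=> //.
have h : c11 f A q by near: q; exact: c11_near hy.
apply/colP => a; rewrite mxE; have [_ ->] := c11_derive (delta_mx 0 a) h.
rewrite mxE (bigD1 a)//= big1 ?addr0 => [|b ba]; rewrite mxE eqxx/= ?eqxx ?mul1r//.
by rewrite (negbTE ba) mul0r.
Unshelve. all: by end_near. Qed.

Lemma c11_scalar n (f : 'rV[R]_n -> R) A y (phi phi1 : R -> R) K d :
  c11 f A y -> 0 < d -> 0 <= K ->
  (forall x, `|x - f y| < d -> [/\ is_derive x 1 phi (phi1 x), `|phi x| <= K,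
      `|phi1 x| <= K & forall x', `|x' - f y| < d -> `|phi1 x - phi1 x'| <= K * `|x - x'|]) ->
  c11 (fun p => phi (f p)) (fun q => phi1 (f q) *: A q) y.
Proof.
move=> [C [d1 [d10 C0 H]]] d0 K0 P.
have n0 : 0 <= n%:R :> R by [].
have t1 : 0 <= K * C by rewrite mulr_ge0.
have t2 : 0 <= 2 * K * C * C by rewrite !mulr_ge0.
pose d2 := Num.min d1 (d / (C + 1)).
exists (K + K * C + (2 * K * C * C + K * C)), d2; split.
- by rewrite lt_min d10 divr_gt0// ltr_wpDl.
- by rewrite !addr_ge0.
move=> p p' q; rewrite !lt_min => /andP[hp kp] /andP[hp' kp'] /andP[hq kq].
have yy : `|y - y| < d1 by rewrite subrr normr0.
have fb z : `|z - y| < d1 -> `|z - y| < d / (C + 1) -> `|f z - f y| < d.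
  move=> h; rewrite ltr_pdivlMr ?ltr_wpDl// => h2.
  have [_ h3 _ _] := H _ _ _ h yy yy; apply: le_lt_trans h3 _.
  by apply: le_lt_trans h2; rewrite mulrC ler_wpM2l// lerDl.
have fp := fb _ hp kp; have fp' := fb _ hp' kp'; have fq := fb _ hq kq.
have [_ phip _ _] := P _ fp; have [_ _ phiq phiL] := P _ fq.
have [f1 f2 f3 f4] := H _ _ _ hp hp' hq.
have [_ f2' _ _] := H _ _ _ hp hq hq; have [_ f2'' _ _] := H _ _ _ hp' hq hq.
have btw s : Num.min (f p') (f p) <= s <= Num.max (f p') (f p) ->
    `|s - f y| < d /\ `|s - f q| <= `|f p - f q| + `|f p' - f q|.
  move=> hs; split.
    move: fp fp'; rewrite !ltr_norml; move: hs; rewrite ge_min le_max; lra.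
  have [h|h] := lerP 0 (s - f q); rewrite ?(ger0_norm h) ?(ltr0_norm h); move: hs; rewrite ge_min le_max.
    by move: (ler_norm (f p - f q)) (ler_norm (f p' - f q)) (normr_ge0 (f p - f q)) (normr_ge0 (f p' - f q)); lra.
  rewrite [`|f p - _|]distrC [`|f p' - _|]distrC.
  by move: (ler_norm (f q - f p)) (ler_norm (f q - f p')) (normr_ge0 (f q - f p)) (normr_ge0 (f q - f p')); lra.
have L0 : `|phi (f p) - phi (f p')| <= K * `|f p - f p'|.
  have := @mvt_bound R phi phi1 (f p') (f p) 0 K; rewrite mulr0 subr0; apply.
    by move=> s /btw[/P[]].
  by move=> s /btw[/P[]]; rewrite subr0.
split.
- by apply: le_trans phip _; lra.
- apply: le_trans L0 _; apply: (@le_trans _ _ (K * (C * `|p - p'|))); first by rewrite ler_wpM2l.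
  by rewrite mulrA ler_wpM2r//; lra.
- rewrite mx_normZ; apply: (@le_trans _ _ (K * C)); first exact: ler_pM.
  by lra.
- have -> : phi (f p) - phi (f p') - ((p - p') *m (phi1 (f q) *: A q)) 0 0 =
     (phi (f p) - phi (f p') - (f p - f p') * phi1 (f q)) +
     phi1 (f q) * (f p - f p' - ((p - p') *m A q) 0 0).
    by rewrite -scalemxAr [in LHS]mxE; ring.
  have E1 := @mvt_bound R phi phi1 (f p') (f p) (phi1 (f q)) (K * (C * (`|p - q| + `|p' - q|))).
  apply: le_trans (ler_normD _ _) _.
  apply: (@le_trans _ _ (K * (C * (`|p - q| + `|p' - q|)) * (C * `|p - p'|) + K * (C * `|p - p'| * (`|p - q| + `|p' - q|)))).
    apply: lerD; last exact: ler_normM.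
    apply: le_trans (E1 _ _) _; last by rewrite ler_wpM2l// !mulr_ge0 ?addr_ge0.
      by move=> s /btw[/P[]].
    move=> s /btw[sy sq]; have [_ _ _ /(_ _ fq) h] := P _ sy; apply: le_trans h _.
    rewrite ler_wpM2l//; apply: le_trans sq _; rewrite mulrDr lerD//.
  have a0 := normr_ge0 (p - p'); set a := `|p - p'| in a0 *.
  have s0 : 0 <= `|p - q| + `|p' - q| by rewrite addr_ge0.
  set s := (`|p - q| + _) in s0 *.
  have -> : K * (C * s) * (C * a) + K * (C * a * s) = (K * C * C + K * C) * a * s by ring.
  have t3 : 0 <= K * C * C by rewrite !mulr_ge0.
  rewrite ler_wpM2r// ler_wpM2r//; clear - t1 t2 t3 K0; lra.
Qed.

Lemma c11V n (f : 'rV[R]_n -> R) y : c11e f y -> f y != 0 -> c11e (fun p => (f p)^-1) y.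
Proof.
move=> [A h] fy0; exists (fun q => - (f q) ^- 2 *: A q).
have d0 : 0 < `|f y| / 2 by rewrite divr_gt0// normr_gt0.
set d := `|f y| / 2 in d0.
have low x : `|x - f y| < d -> d <= `|x|.
  move=> hx; have : `|f y| <= `|x| + `|x - f y|.
    by rewrite [`|x - _|]distrC -{1}(subrKC x (f y)) ler_normD.
  by rewrite /d in hx *; lra.
have lowV x : `|x - f y| < d -> `|x^-1| <= d^-1.
  by move=> hx; have lx := low _ hx; rewrite normfV lef_pV2// posrE// (lt_le_trans d0).
have dV0 : 0 <= d^-1 by rewrite invr_ge0 ltW.
pose K := d^-1 + d^-1 ^+ 2 + 2 * d^-1 ^+ 3.
have t2 : 0 <= d^-1 ^+ 2 by rewrite exprn_ge0.
have t3 : 0 <= d^-1 ^+ 3 by rewrite exprn_ge0.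
apply: (@c11_scalar _ f A y (fun x => x^-1) (fun x => - x ^- 2) K d) => //.
  by rewrite /K !addr_ge0// mulr_ge0.
move=> x hx.
have x0 : x != 0 by rewrite -normr_gt0 (lt_le_trans d0)// low.
have b1 := lowV _ hx.
have Dinv (z : R) : z != 0 -> is_derive z (1 : R) (fun x : R => x^-1) (- z ^- 2).
  move=> z0; apply: is_derive_eq (is_deriveV _ _) _ => //=.
  by rewrite /GRing.scale /= mulr1.
split.
- exact: Dinv.
- by apply: le_trans b1 _; rewrite /K; lra.
- rewrite normrN -exprVn normrX.
  by apply: le_trans (lerXn2r 2 _ _ b1) _; rewrite ?nnegrE//; rewrite /K; lra.
- move=> x' hx'; have b1' := lowV _ hx'.
  have x'0 : x' != 0 by rewrite -normr_gt0 (lt_le_trans d0)// low.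
  have -> : - x ^- 2 - - x' ^- 2 = (x - x') * (x^-1 * x'^-1 * x^-1 + x^-1 * x'^-1 * x'^-1).
    by field; rewrite x0 x'0.
  rewrite normrM mulrC ler_wpM2r//; apply: le_trans (ler_normD _ _) _.
  apply: le_trans (lerD (ler_normM (ler_normM b1 b1') b1) (ler_normM (ler_normM b1 b1') b1')) _.
  by rewrite -!expr2 -!exprSr /K; lra.
Qed.

Lemma c11_sqrt n (f : 'rV[R]_n -> R) y : c11e f y -> 0 < f y -> c11e (fun p => Num.sqrt (f p)) y.
Proof.
move=> [A h] fy0; exists (fun q => (2 * Num.sqrt (f q))^-1 *: A q).
have d0 : 0 < f y / 2 by rewrite divr_gt0.
set d := f y / 2 in d0.
pose m := Num.sqrt d.
have m0 : 0 < m by rewrite sqrtr_gt0.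
have low x : `|x - f y| < d -> 0 < x /\ m <= Num.sqrt x.
  rewrite ltr_norml => hx; have dx : d < x by rewrite /d in hx *; lra.
  split; [exact: lt_trans dx|rewrite ler_wsqrtr// ltW//].
have mV0 : 0 <= (2 * m)^-1 by rewrite invr_ge0 mulr_ge0// ltW.
pose K := Num.sqrt (f y + d) + (2 * m)^-1 + (2 * m)^-1 * (2 * m)^-1 * m^-1.
have q1 : 0 <= Num.sqrt (f y + d) by exact: sqrtr_ge0.
have q2 : 0 <= (2 * m)^-1 * (2 * m)^-1 * m^-1 by rewrite !mulr_ge0// invr_ge0 ltW.
apply: (@c11_scalar _ f A y Num.sqrt (fun x => (2 * Num.sqrt x)^-1) K d) => //.
  by rewrite /K !addr_ge0.
move=> x hx; have [x0 mx] := low _ hx.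
have Vx z : m <= Num.sqrt z -> `|(2 * Num.sqrt z)^-1| <= (2 * m)^-1.
  move=> mz; have z0 := lt_le_trans m0 mz.
  rewrite ger0_norm ?invr_ge0 ?mulr_ge0// lef_pV2 ?posrE ?mulr_gt0//.
  by rewrite ler_wpM2l.
split.
- exact: is_derive1_sqrt.
- rewrite ger0_norm// (@le_trans _ _ (Num.sqrt (f y + d)))//; last by rewrite /K; lra.
  rewrite ler_wsqrtr//; move: hx; rewrite ltr_norml; lra.
- by apply: le_trans (Vx _ mx) _; rewrite /K; lra.
- move=> x' /low[x'0 mx'].
  set s := Num.sqrt x; set s' := Num.sqrt x'; rewrite -/s -/s' in mx mx'.
  have s0 := lt_le_trans m0 mx; have s'0 := lt_le_trans m0 mx'.
  have -> : (2 * s)^-1 - (2 * s')^-1 = (x' - x) * ((2 * s)^-1 * (2 * s')^-1 * (2 * (s + s')^-1)).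
    rewrite -{1}(sqr_sqrtr (ltW x0)) -(sqr_sqrtr (ltW x'0)) -/s -/s'; field.
    by rewrite (gt_eqF s0) (gt_eqF s'0) gt_eqF// addr_gt0.
  rewrite normrM distrC mulrC ler_wpM2r//.
  apply: (@le_trans _ _ ((2 * m)^-1 * (2 * m)^-1 * m^-1)); last by rewrite /K; lra.
  apply: ler_normM; first by apply: ler_normM; exact: Vx.
  rewrite ger0_norm; last by rewrite mulr_ge0// invr_ge0 addr_ge0// ltW.
  rewrite -ler_pdivlMl// mulrC -invfM lef_pV2 ?posrE ?addr_gt0 ?mulr_gt0//.
  by lra.
Qed.

Lemma c11e_ext n (f g : 'rV[R]_n -> R) y : (\forall q \near y, f q = g q) -> c11e f y -> c11e g y.
Proof.
by move=> fg [A h]; exists A; apply: c11_ext h; apply: filterS fg.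
Qed.

Lemma c11eD n (f g : 'rV[R]_n -> R) y : c11e f y -> c11e g y -> c11e (fun p => f p + g p) y.
Proof. by move=> [A h] [B k]; exists (fun q => A q + B q); exact: c11D. Qed.

Lemma c11eN n (f : 'rV[R]_n -> R) y : c11e f y -> c11e (fun p => - f p) y.
Proof. by move=> [A h]; exists (fun q => - A q); exact: c11N. Qed.

Lemma c11eM n (f g : 'rV[R]_n -> R) y : c11e f y -> c11e g y -> c11e (fun p => f p * g p) y.
Proof. by move=> [A h] [B k]; exists (fun q => f q *: B q + g q *: A q); exact: c11M. Qed.

Lemma c11eC n (c : R) (y : 'rV[R]_n) : c11e (fun=> c) y.
Proof. by exists (fun=> 0); exact: c11_cst. Qed.

Lemma c11e_sum n (I : Type) (r : seq I) (P : pred I) (f : I -> 'rV[R]_n -> R) y :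
  (forall i, c11e (f i) y) -> c11e (fun p => \sum_(i <- r | P i) f i p) y.
Proof.
move=> h; exists (fun q => \sum_(i <- r | P i) grad (f i) q).
by apply: c11_sum => i _; exact: c11e_grad.
Qed.

Lemma c11e_det n m (F : 'rV[R]_n -> 'M[R]_m) y :
  (forall i j, c11e (fun p => F p i j) y) -> c11e (fun p => \det (F p)) y.
Proof.
move=> h; apply: c11e_sum => s; apply: c11eM; first exact: c11eC.
by apply: c11_prod => i; exact: c11e_grad.
Qed.

(** Cramer's rule: the entries are cofactors divided by the determinant, which stays nonzero near
    [y]. *)
Lemma c11e_invmx n m (F : 'rV[R]_n -> 'M[R]_m) y :
  (forall i j, c11e (fun p => F p i j) y) -> F y \in unitmx ->
  forall i j, c11e (fun p => invmx (F p) i j) y.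
Proof.
move=> h Fy i j; have hd := c11e_det h.
have dn0 : \forall q \near y, \det (F q) != 0.
  have /cvgr_neq0 := c11_continuous (c11e_grad hd); apply.
  by move: Fy; rewrite unitmxE unitfE.
apply: (@c11e_ext _ (fun q => (\det (F q))^-1 * \adj (F q) i j)).
  apply: filterS dn0 => q dq.
  by rewrite /invmx unitmxE unitfE dq !mxE.
apply: c11eM; first by apply: c11V => //; move: Fy; rewrite unitmxE unitfE.
apply: (@c11e_ext _ (fun q => (-1) ^+ (j + i) * \det (row' j (col' i (F q))))).
  by near=> q; rewrite !mxE.
apply: c11eM; first exact: c11eC.
apply: c11e_det => k l; apply: c11e_ext (h (lift j k) (lift i l)).
by near=> q; rewrite !mxE.
Unshelve. all: by end_near. Qed.

End smooth_functions.

(** * Induction on intervals and Gronwall's inequality *)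

Section one_variable.
Context {R : realType}.

(** The infimum of the counterexamples would itself have a neighbourhood to its right free of them.
    At [t = a] the assumption on earlier points is void, so the base case is part of the hypothesis.
    All continuation arguments in time below take this form. *)
Lemma real_induction (a b : R) (P : R -> Prop) :
  (forall t, a <= t <= b -> (forall s, a <= s < t -> P s) ->
    exists2 e, 0 < e & forall s, t <= s < t + e -> s <= b -> P s) ->
  forall t, a <= t <= b -> P t.
Proof.
move=> H; apply: contrapT => /existsNP[t /not_implyP[/andP[at_ tb] nPt]].
pose S := [set s | a <= s <= b /\ ~ P s].
have S0 : S !=set0 by exists t; rewrite /S /= at_ tb.
have Sl : lbound S a by move=> s [/andP[]].
have hS : has_inf S by split=> //; exists a.
pose m := inf S.
have am : a <= m by exact: lb_le_inf.
have mt : m <= t by apply: ge_inf; [exists a|split; rewrite // at_].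
have Pm s : a <= s < m -> P s.
  move=> /andP[as_ sm]; apply: contrapT => nP.
  have : m <= s by apply: ge_inf; [exists a|split=> //; rewrite as_ (ltW (lt_le_trans sm _))// (le_trans mt)].
  by rewrite leNgt sm.
have [|e e0 He] := H m _ Pm; first by rewrite am (le_trans mt).
have [s [/andP[as_ sb] nP] sm] := inf_adherent e0 hS.
apply: (nP); apply: He => //; rewrite sm andbT.
have Ss : S s by split=> //; rewrite as_ sb.
by apply: ge_inf => //; exists a.
Qed.

Lemma mvt_bound_vec m (z dz : R -> 'rV[R]_m) (u v eta : R) w : 0 <= eta ->
  (forall s, Num.min u v <= s <= Num.max u v -> is_derive s 1 z (dz s)) ->
  (forall s, Num.min u v <= s <= Num.max u v -> `|dz s - w| <= eta) ->
  `|z v - z u - (v - u) *: w| <= eta * `|v - u|.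
Proof.
move=> eta0 zd zb; apply: mx_norm_le => [|i k]; first by rewrite mulr_ge0.
rewrite ord1 !mxE; apply: (@mvt_bound R (fun s => z s 0 k) (fun s => dz s 0 k)).
  by move=> s /zd /is_derive_mxP/(_ 0 k).
by move=> s /zb; apply: le_trans; have := mx_entry_le (dz s - w) 0 k; rewrite !mxE.
Qed.

Lemma is_derive_continuous (V : normedModType R) (z : R -> V) (t : R) dz :
  is_derive t 1 z dz -> {for t, continuous z}.
Proof. by move=> [h _]; apply: differentiable_continuous; apply/derivable1_diffP. Qed.

(* Gronwall's inequality for times so short that the factor exp(L delta) is at
   most 2. *)
Lemma short_gronwall m (z dz : R -> 'rV[R]_m) (t0 delta L eps : R) :
  0 <= delta -> 0 <= L -> 0 <= eps -> delta * L <= 2^-1 ->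
  (forall t, `|t - t0| <= delta -> is_derive t 1 z (dz t)) ->
  (forall t, `|t - t0| <= delta -> `|dz t| <= L * `|z t| + eps) ->
  forall t, `|t - t0| <= delta -> `|z t| <= 2 * `|z t0| + 2 * delta * eps.
Proof.
move=> d0 L0 e0 dL zd zb.
have I t : (t \in `[t0 - delta, t0 + delta]) = (`|t - t0| <= delta).
  by rewrite in_itv /= ler_distl.
(* At a maximum point [c] of the norm, the mean value bound reads [|z c| <= |z t0| + |z c| / 2 +
   delta * eps], and the middle term is absorbed. *)
have [||c cI cmax] := @EVT_max R (fun t => `|z t|) (t0 - delta) (t0 + delta).
- by lra.
- apply: continuous_in_subspaceT => t; rewrite inE /= => tI.
  apply: (@cvg_comp _ _ _ z (fun x => `|x|)); last exact: norm_continuous.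
  by apply: is_derive_continuous (zd t _); rewrite -I.
rewrite I in cI.
have seg s : Num.min t0 c <= s <= Num.max t0 c -> `|s - t0| <= delta.
  by move: cI; rewrite !ler_distl ge_min le_max; lra.
have := @mvt_bound_vec m z dz t0 c (L * `|z c| + eps) 0.
rewrite scaler0 subr0 => /(_ _ _ _) B.
have {}B : `|z c - z t0| <= (L * `|z c| + eps) * delta.
  apply: le_trans (B _ _ _) _; first by rewrite addr_ge0// mulr_ge0.
  - by move=> s /seg/zd.
  - move=> s /seg hs; rewrite subr0; apply: le_trans (zb _ hs) _.
    by rewrite lerD2r ler_wpM2l// cmax// I.
  - by rewrite ler_wpM2l// addr_ge0// mulr_ge0.
have Bc : `|z c| <= `|z t0| + `|z c - z t0|.
  by rewrite -{1}(subrKC (z t0) (z c)) ler_normD.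
move=> t; rewrite -I => /cmax tc; apply: le_trans tc _.
have : L * `|z c| * delta <= 2^-1 * `|z c| by rewrite mulrAC (mulrC L) ler_wpM2r.
by move: B Bc (normr_ge0 (z c)); lra.
Qed.

End one_variable.

(** * Geodesics *)

Section geodesics.
Context {R : realType} {n : nat} {M : ptopologicalType}.
Variable g : riemannian R n M.
Implicit Types (i j : chart g) (c : R -> M).

Definition cod i : set 'rV[R]_n := coord i @` chart_dom i.

Lemma cod_open i : open (cod i). Proof. exact: chart_cod_open. Qed.

Lemma cod_coord i x : chart_dom i x -> cod i (coord i x).
Proof. by move=> ix; exists x. Qed.

Lemma metric_unit i y : cod i y -> metric i y \in unitmx.
Proof.
move=> iy; rewrite -row_free_unit -kermx_eq0; apply: contraT => k0.
have u0 : nz_row (kermx (metric i y)) != 0 by rewrite nz_row_eq0.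
have := metric_pos iy u0.
have /sub_kermxP -> := nz_row_sub (kermx (metric i y)).
by rewrite mul0mx mxE ltxx.
Qed.

Lemma smooth_c11e (U : set 'rV[R]_n) (f : 'rV[R]_n -> R^o) y :
  open U -> smooth_on U f -> U y -> c11e f y.
Proof. by move=> Uo sf Uy; exists (grad f); exact: smooth_c11 sf Uy. Qed.

Lemma metric_c11 i y a b : cod i y -> c11e (fun z => metric i z a b) y.
Proof.
move=> iy; apply: (smooth_c11e (@cod_open i) _ iy).
by apply: (@smooth_entry _ _ _ _ _ (metric i)); [exact: cod_open|exact: metric_smooth].
Qed.

Lemma metric_partial_c11 i y a b l : cod i y ->
  c11e (partial l (fun z => metric i z a b : R^o)) y.
Proof.
move=> iy; apply: (smooth_c11e (@cod_open i) _ iy).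
apply: smooth_partial; by apply: (@smooth_entry _ _ _ _ _ (metric i)); [exact: cod_open|exact: metric_smooth].
Qed.

Lemma christoffel_c11 i k a b y : cod i y -> c11e (christoffel i k a b) y.
Proof.
move=> iy; apply: c11eM; first exact: c11eC.
apply: c11e_sum => l; apply: c11eM.
  by apply: c11e_invmx; [move=> *; exact: metric_c11|exact: metric_unit].
by apply: c11eD; [apply: c11eD|apply: c11eN]; exact: metric_partial_c11.
Qed.

(* [Gam], [field] and [state] are sealed, since comparing their bodies by
   conversion is prohibitively slow. *)
Lemma Gam_sealed : {G : chart g -> 'rV[R]_n -> 'rV[R]_n -> 'rV[R]_n -> 'rV[R]_n |
  forall i y u v, G i y u v =
    \row_k \sum_(a < n) \sum_(b < n) christoffel i k a b y * u 0 a * v 0 b}.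
Proof. by eexists. Qed.

Definition Gam := sval Gam_sealed.

Lemma GamE i y u v : Gam i y u v =
  \row_k \sum_(a < n) \sum_(b < n) christoffel i k a b y * u 0 a * v 0 b.
Proof. exact: (svalP Gam_sealed). Qed.

(** The geodesic spray of a chart: the second-order geodesic equation as a first-order system for a
    row holding position and velocity. *)
Lemma field_sealed : {F : chart g -> 'rV[R]_(n + n) -> 'rV[R]_(n + n) |
  forall i z, F i z = row_mx (rsubmx z) (- Gam i (lsubmx z) (rsubmx z) (rsubmx z))}.
Proof. by eexists. Qed.

Definition field := sval field_sealed.

Lemma fieldE i z : field i z = row_mx (rsubmx z) (- Gam i (lsubmx z) (rsubmx z) (rsubmx z)).
Proof. exact: (svalP field_sealed). Qed.

Definition jac p q (F : 'rV[R]_p -> 'rV[R]_q) (y : 'rV[R]_p) : 'M[R]_(p, q) :=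
  \matrix_(a, k) grad (fun z => F z 0 k) y a 0.

Lemma c11v_jac p q (F : 'rV[R]_p -> 'rV[R]_q) y :
  (forall k, c11e (fun z => F z 0 k) y) -> c11v F (jac F) y.
Proof.
move=> h k; apply: c11_ext (c11e_grad (h k)); near=> z; split=> //.
by apply/colP => a; rewrite !mxE.
Unshelve. all: by end_near. Qed.

Lemma c11e_compv p q (f : 'rV[R]_q -> R) (F : 'rV[R]_p -> 'rV[R]_q) y :
  (forall k, c11e (fun z => F z 0 k) y) -> c11e f (F y) -> c11e (fun z => f (F z)) y.
Proof.
by move=> /c11v_jac h [A hA]; exists (fun q => jac F q *m A (F q)); exact: c11_comp.
Qed.

Lemma c11e_coord p k (y : 'rV[R]_p) : c11e (fun z : 'rV[R]_p => z 0 k) y.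
Proof. by exists (fun=> delta_mx k 0); exact: c11_coord. Qed.

Lemma field_c11e i z k : cod i (lsubmx z) -> c11e (fun z => field i z 0 k) z.
Proof.
move=> iz; rewrite -(splitK k); case: (fintype.split k) => a /=.
  apply: c11e_ext (c11e_coord (rshift n a) z); near=> q.
  by rewrite fieldE row_mxEl mxE.
apply: (@c11e_ext _ _ (fun q => - \sum_(b < n) \sum_(d < n)
   christoffel i a b d (lsubmx q) * q 0 (rshift n b) * q 0 (rshift n d))).
  near=> q; rewrite fieldE row_mxEr mxE GamE mxE; congr (- _).
  by apply: eq_bigr => b _; apply: eq_bigr => d _; rewrite !mxE.
apply: c11eN; apply: c11e_sum => b; apply: c11e_sum => d.
apply: c11eM; last exact: c11e_coord.
apply: c11eM; last exact: c11e_coord.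
apply: (@c11e_compv _ _ (christoffel i a b d) lsubmx); last exact: christoffel_c11.
move=> l; apply: c11e_ext (c11e_coord (lshift n l) z).
by near=> q; rewrite mxE.
Unshelve. all: by end_near. Qed.

Lemma field_c11 i z : cod i (lsubmx z) -> c11v (field i) (jac (field i)) z.
Proof. by move=> iz; apply: c11v_jac => k; exact: field_c11e. Qed.

(** The vector form with one constant for all components. The operator bound on [A z] is added
    because it is what Gronwall's inequality uses for the linearised equation. *)
Definition c11vat p q C d (F : 'rV[R]_p -> 'rV[R]_q) A (y : 'rV[R]_p) :=
  forall x x' z : 'rV[R]_p, `|x - y| < d -> `|x' - y| < d -> `|z - y| < d ->
     [/\ `|F x| <= C, `|F x - F x'| <= C * `|x - x'|, `|A z| <= C,
      (forall u : 'rV[R]_p, `|u *m A z| <= C * `|u|) &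
      `|F x - F x' - (x - x') *m A z| <= C * `|x - x'| * (`|x - z| + `|x' - z|)].

Lemma c11v_vec p q (F : 'rV[R]_p -> 'rV[R]_q) A y : c11v F A y ->
  exists C d, [/\ 0 < d, 0 <= C & c11vat C d F A y].
Proof.
move=> /c11v_unif[C [d [d0 C0 H]]].
have p0 : 0 <= p%:R :> R by [].
have CC : C <= (p%:R + 1) * C by rewrite mulrDl mul1r lerDr mulr_ge0.
exists ((p%:R + 1) * C), d; split=> //; first by rewrite mulr_ge0// addr_ge0.
move=> u u' v hu hu' hv.
have {}H k := let: And3 _ _ h := H k in h _ _ _ hu hu' hv.
have Av : `|A v| <= C.
  apply: mx_norm_le => // a k; have [_ _ h _] := H k; apply: le_trans h.
  by have := mx_entry_le (col k (A v)) a 0; rewrite mxE.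
split.
- apply: le_trans CC; apply: mx_norm_le => // a k; rewrite ord1; by have [] := H k.
- apply: (@le_trans _ _ (C * `|u - u'|)); last by rewrite ler_wpM2r.
  apply: mx_norm_le => [|a k]; first by rewrite mulr_ge0.
  by rewrite ord1 !mxE; have [] := H k.
- exact: le_trans CC.
- move=> w; apply: le_trans (mulmx_norm_le _ _) _; rewrite mulrAC ler_wpM2r//.
  by rewrite mulrDl mul1r ler_wpDr// ler_wpM2l.
- apply: (@le_trans _ _ (C * `|u - u'| * (`|u - v| + `|u' - v|))); last first.
    by rewrite ler_wpM2r ?addr_ge0// ler_wpM2r.
  apply: mx_norm_le => [|a k]; first by rewrite !mulr_ge0// addr_ge0.
  have [_ _ _ ] := H k; rewrite ord1 !mxE.
  rewrite (_ : \sum_j _ = \sum_j (u - u') 0 j * A v j k)//.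
  by apply: eq_bigr => l _; rewrite !mxE.
Qed.

Lemma state_sealed : {st : chart g -> (R -> M) -> R -> 'rV[R]_(n + n) |
  forall i c t, st i c t = row_mx (coord i (c t)) (derive1 (coord i \o c) t)}.
Proof. by eexists. Qed.

Definition state := sval state_sealed.

Lemma stateE i c t : state i c t = row_mx (coord i (c t)) (derive1 (coord i \o c) t).
Proof. exact: (svalP state_sealed). Qed.

Lemma lsub_state i c t : lsubmx (state i c t) = coord i (c t).
Proof. by rewrite stateE row_mxKl. Qed.

Lemma rsub_state i c t : rsubmx (state i c t) = derive1 (coord i \o c) t.
Proof. by rewrite stateE row_mxKr. Qed.

Lemma curve_near_dom i c t : continuous c -> chart_dom i (c t) ->
  \forall s \near t, chart_dom i (c s).
Proof. by move=> cc it; apply: cc; apply: open_nbhs_nbhs; split=> //; exact: chart_dom_open. Qed.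

Lemma is_derive_row_mx p q (x dx : R -> 'rV[R]_p) (y dy : R -> 'rV[R]_q) (t : R) :
  is_derive t 1 x (dx t) -> is_derive t 1 y (dy t) ->
  is_derive t 1 (fun s => row_mx (x s) (y s)) (row_mx (dx t) (dy t)).
Proof.
move=> /is_derive_mxP hx /is_derive_mxP hy; apply/is_derive_mxP => a k.
rewrite -(splitK k); case: (fintype.split k) => b /=.
  rewrite row_mxEl; apply: near_eq_is_derive (hx a b).
  by near=> s; rewrite row_mxEl.
rewrite row_mxEr; apply: near_eq_is_derive (hy a b).
by near=> s; rewrite row_mxEr.
Unshelve. all: by end_near. Qed.

Lemma geodesic_coord i c t : geodesic g c -> chart_dom i (c t) ->
  is_derive t 1 (coord i \o c) (rsubmx (state i c t)).
Proof.
move=> [[cc c1] _] it; have [h _] := c1 i t it.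
by rewrite rsub_state derive1E; exact: derivableP.
Qed.

Lemma geodesic_ode i c t : geodesic g c -> chart_dom i (c t) ->
  is_derive t 1 (state i c) (field i (state i c t)).
Proof.
move=> gc it; have [[cc c1] c2] := gc; have [h2 eq2] := c2 i t it.
have d1 := geodesic_coord gc it.
have d2 : is_derive t 1 (derive1 (coord i \o c)) (- Gam i (coord i (c t)) (derive1 (coord i \o c) t) (derive1 (coord i \o c) t)).
  apply: DeriveDef => //; rewrite -derive1E; apply/rowP => k.
  rewrite !(mxE, GamE); apply/eqP; rewrite -addr_eq0; apply/eqP; exact: (eq2 k).
have := @is_derive_row_mx _ _ (coord i \o c) (fun t => rsubmx (state i c t)) _
   (fun t => - Gam i (coord i (c t)) (derive1 (coord i \o c) t) (derive1 (coord i \o c) t)) _ d1 d2.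
rewrite fieldE lsub_state rsub_state; apply: near_eq_is_derive.
  by near=> s; rewrite stateE.
Unshelve. all: by end_near. Qed.

Lemma lsub_norm p q (z : 'rV[R]_(p + q)) : `|lsubmx z| <= `|z|.
Proof. by apply: mx_norm_le => // a b; rewrite mxE mx_entry_le. Qed.

(** The image is compact in a Hausdorff space. Hence a curve whose coordinates remain in a compact
    part of the chart cannot run out of the chart in the limit. *)
Lemma param_compact_closed i (K : set 'rV[R]_n) : compact K -> K `<=` cod i -> closed (param i @` K).
Proof.
move=> Kc KU; apply: compact_closed; first exact: manifold_hausdorff g.
apply: continuous_compact => //.
apply: continuous_in_subspaceT => y /set_mem/KU; exact: param_continuous.
Qed.

Lemma closed_ball_compact p (y : 'rV[R]_p) (r : R) : compact [set z : 'rV[R]_p | `|z - y| <= r].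
Proof.
apply: bounded_closed_compact.
  exists (`|y| + r); split; first exact: num_real.
  move=> x xr z /= zr; apply: le_trans (ltW xr).
  by rewrite -(subrKC y z) (le_trans (ler_normD _ _))// lerD2l.
have -> : [set z : 'rV[R]_p | `|z - y| <= r] = closed_ball_ (fun x => `|x|) y r.
  by apply/seteqP; split=> z /=; rewrite distrC.
exact: closed_closed_ball_.
Qed.

Lemma near_all1 (P : R -> Prop) (t : R) : (\forall s \near t, P s) ->
  exists2 e : R, 0 < e & forall s, `|s - t| < e -> P s.
Proof.
by move=> /nbhs_ballP[e /= e0 H]; exists e => // s st; apply: H; rewrite /ball /= distrC.
Qed.

Lemma near_left (P : R -> Prop) (t a : R) : a < t -> (\forall s \near t, P s) ->
  exists2 s, a <= s < t & P s.
Proof.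
move=> at_ /nbhs_ballP[e /= e0 H].
exists (Num.max a (t - e / 2)).
  by rewrite le_max lexx gt_max at_ /= ltrBlDr ltrDl divr_gt0.
apply: H; rewrite /ball /= ger0_norm; last by rewrite subr_ge0 ge_max ltW// lerBlDr lerDl ltW// divr_gt0.
rewrite ltrBlDr (@lt_le_trans _ _ (e + (t - e / 2)))//; first by move: e0; lra.
by rewrite lerD2l le_max lexx orbT.
Qed.

(** The spray is bounded by [C] near [zs], so in time [delta] a state moves by at most [rho / 2].
    The point is that [delta] is the same for all geodesics starting near [zs]: they can be compared
    with each other and continued from a time slightly before the one of interest. *)
Lemma flow_box i (zs : 'rV[R]_(n + n)) : cod i (lsubmx zs) ->
  exists C rho delta, [/\ 0 <= C, 0 < rho, 0 < delta <= 2^-1, delta * C <= 2^-1 &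
   [/\ c11vat C (2 * rho) (field i) (jac (field i)) zs,
    (forall z, `|z - zs| < 2 * rho -> cod i (lsubmx z)) &
    forall c t0, geodesic g c -> chart_dom i (c t0) -> `|state i c t0 - zs| < rho ->
      forall t, `|t - t0| <= delta ->
        chart_dom i (c t) /\ `|state i c t - zs| < 2 * rho]].
Proof.
move=> izs; have [C [d [d0 C0 H]]] := c11v_vec (field_c11 izs).
have /near_all[d' d'0 Hd'] := open_near (@cod_open i) izs.
pose m := Num.min d d'; have m0 : 0 < m by rewrite lt_min d0.
pose rho := m / 2; have rho0 : 0 < rho by rewrite divr_gt0.
(* The bound [1 / 2] absorbs the factor [2 * delta] of Gronwall's inequality, the second one
   confines states to [3 / 2 * rho], and the third is the smallness condition of
   [short_gronwall]. *)
pose delta := Num.min (2^-1) (Num.min (rho / (2 * (C + 1))) (2^-1 / (C + 1))).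
have C10 : 0 < C + 1 by rewrite ltr_wpDl.
have de0 : 0 < delta by rewrite !lt_min invr_gt0 ltr0n !divr_gt0 ?mulr_gt0 ?invr_gt0.
have deC : delta * C <= rho / 2.
  apply: (@le_trans _ _ (delta * (C + 1))); first by rewrite ler_wpM2l ?(ltW de0)// lerDl.
  have : delta <= rho / (2 * (C + 1)) by rewrite !ge_min lexx !orbT.
  rewrite ler_pdivlMr ?mulr_gt0// => h; rewrite ler_pdivlMr//.
  by apply: le_trans h; rewrite -mulrA (mulrC _ 2).
have m2 : 2 * rho = m by rewrite /rho mulrC divfK.
exists C, rho, delta; split => //.
- by rewrite de0 ge_min lexx.
- apply: (@le_trans _ _ (delta * (C + 1))); first by rewrite ler_wpM2l ?(ltW de0)// lerDl.
  have : delta <= 2^-1 / (C + 1) by rewrite !ge_min lexx !orbT.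
  by rewrite ler_pdivlMr.
have U2 z : `|z - zs| < 2 * rho -> cod i (lsubmx z).
  rewrite m2 lt_min => /andP[_ h]; apply: Hd'; rewrite -linearB /=.
  exact: le_lt_trans (lsub_norm _) h.
have F2 : c11vat C (2 * rho) (field i) (jac (field i)) zs.
  by rewrite m2 => p p' q; rewrite !lt_min => /andP[hp _] /andP[hp' _] /andP[hq _]; exact: H.
split=> // c t0 gc it0 st0.
have cc : continuous c by case: gc => [[]].
pose Good t := chart_dom i (c t) /\ `|state i c t - zs| < 2 * rho.
have Gnear t : Good t -> exists2 e, 0 < e & forall s, `|s - t| < e -> Good s.
  move=> [it h].
  have h1 := curve_near_dom cc it.
  have h2 : \forall s \near t, `|state i c s - zs| < 2 * rho.
    have sc := is_derive_continuous (geodesic_ode gc it).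
    have : (fun s => `|state i c s - zs|) @ t --> `|state i c t - zs|.
      apply: (@cvg_comp _ _ _ (fun s => state i c s - zs) (fun z => `|z|)); last exact: norm_continuous.
      by apply: cvgB; [exact: sc|exact: cvg_cst].
    by move=> /cvgr_lt; apply.
  apply: near_all1; near=> s; split; by near: s.
(* Bootstrap: a state that has stayed within [2 * rho] is in fact within [3 / 2 * rho], which leaves
   room to continue. *)
have Gbd t : (forall s, `|s - t0| <= `|t - t0| -> Good s) -> `|t - t0| <= delta ->
    `|state i c t - zs| < 3 / 2 * rho.
  move=> Gs td.
  have seg s : Num.min t0 t <= s <= Num.max t0 t -> `|s - t0| <= `|t - t0|.
    have [h|h] := lerP 0 (t - t0); rewrite ?(ger0_norm h) ?(ltr0_norm h) ler_distl ge_min le_max;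
    by move: h; lra.
  have := @mvt_bound_vec _ _ (state i c) (fun s => field i (state i c s)) t0 t C 0 C0.
  rewrite scaler0 subr0 => B.
  have {}B : `|state i c t - state i c t0| <= C * `|t - t0|.
    apply: B => s /seg/Gs[is_ hs]; first exact: geodesic_ode.
    by rewrite subr0; have [] := F2 _ _ _ hs hs hs.
  rewrite -(subrKA (state i c t0)); apply: le_lt_trans (ler_normD _ _) _.
  have : C * `|t - t0| <= rho / 2.
    by apply: le_trans deC; rewrite mulrC ler_wpM2r.
  by move: st0 B; lra.
have G0 : Good t0 by split=> //; move: st0 rho0; lra.
pose K := [set y : 'rV[R]_n | `|y - lsubmx zs| <= 3 / 2 * rho].
have KU : K `<=` cod i.
  move=> y /= yK; rewrite -(row_mxKl y (rsubmx zs)); apply: U2.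
  apply: (@le_lt_trans _ _ (3 / 2 * rho)); last by move: rho0; lra.
  apply: mx_norm_le => [|a b]; first by move: rho0; lra.
  rewrite ord1 -{2}(hsubmxK zs) opp_row_mx add_row_mx.
  rewrite -(splitK b); case: (fintype.split b) => k /=.
    by rewrite row_mxEl; apply: le_trans yK; exact: mx_entry_le.
  by rewrite row_mxEr subrr mxE normr0; move: rho0; lra.
have Kcl : closed (param i @` K) by apply: param_compact_closed => //; exact: closed_ball_compact.
(* Closedness. At the limit time it is not yet known that [c t] lies in the chart; it does because
   earlier points lie in the image of the compact set [K], which is closed. *)
have Lim t : 0 < `|t - t0| <= delta -> (forall s, `|s - t0| < `|t - t0| -> Good s) -> Good t.
  move=> /andP[t0t td] Gs.
  have near_t e : 0 < e -> exists2 s, `|s - t| < e & `|s - t0| < `|t - t0|.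
    move=> e0; pose l := Num.min (2^-1) (e / (2 * `|t - t0|)).
    have l0 : 0 < l by rewrite lt_min invr_gt0 ltr0n divr_gt0 ?mulr_gt0.
    have l1 : l <= 2^-1 by rewrite ge_min lexx.
    exists (t - l * (t - t0)).
      rewrite addrAC subrr sub0r normrN normrM gtr0_norm//.
      have : l <= e / (2 * `|t - t0|) by rewrite ge_min lexx orbT.
      rewrite ler_pdivlMr ?mulr_gt0// mulrCA => h.
      have : 0 < l * `|t - t0| by rewrite mulr_gt0.
      by move: h; lra.
    rewrite (_ : t - l * (t - t0) - t0 = (1 - l) * (t - t0)); last by ring.
    rewrite normrM gtr_pMl// ger0_norm; last by move: l1; lra.
    by move: l0; lra.
  have Gs' s : `|s - t0| < `|t - t0| -> `|state i c s - zs| < 3 / 2 * rho.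
    move=> st; apply: Gbd; last by apply: le_trans td; exact: ltW.
    by move=> r rs; apply: Gs; apply: le_lt_trans st.
  have : (param i @` K) (c t).
    apply: Kcl => B /cc /near_all1[e e0 He].
    have [s st s0] := near_t e e0.
    have [is_ _] := Gs _ s0.
    exists (c s); split; last exact: He.
    exists (coord i (c s)); last exact: coordK.
    rewrite /K /= -(lsub_state i c) -linearB /=.
    by apply: le_trans (lsub_norm _) (ltW _); exact: Gs'.
  move=> [y yK yc]; have [x ix xy] := KU y yK.
  have xc : x = c t by rewrite -yc -xy coordK.
  have it : chart_dom i (c t) by rewrite -xc.
  split=> //; rewrite ltNge; apply/negP => big.
  have sc := is_derive_continuous (geodesic_ode gc it).
  have : (fun s => `|state i c s - zs|) @ t --> `|state i c t - zs|.
    apply: (@cvg_comp _ _ _ (fun s => state i c s - zs) (fun z => `|z|)); last exact: norm_continuous.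
    by apply: cvgB; [exact: sc|exact: cvg_cst].
  move=> /cvgr_gt /(_ (3 / 2 * rho)) /(_ _)/near_all1[|e e0 He].
    by apply: lt_le_trans big; move: rho0; lra.
  have [s st s0] := near_t e e0.
  have : 3 / 2 * rho < `|state i c s - zs| by exact: He.
  by rewrite ltNge (ltW (Gs' _ s0)).
(* Continuation in the half-length [tau] of a window around [t0]: [Lim] reaches its two ends and
   [Gnear] goes beyond them. *)
have P tau : 0 <= tau <= delta -> forall t, `|t - t0| <= tau -> Good t.
  move: tau; apply: real_induction => tau /andP[tau0 taud] IH.
  have Gt t : `|t - t0| <= tau -> Good t.
    rewrite le_eqVlt => /orP[/eqP tt|tt]; last first.
      by apply: (IH `|t - t0|); rewrite ?normr_ge0.
    have [t0t|] := ltP 0 `|t - t0|.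
      apply: Lim; first by rewrite t0t tt.
      by move=> s st; apply: (IH `|s - t0|); rewrite ?normr_ge0// -tt.
    by rewrite normr_le0 subr_eq0 => /eqP ->.
  have [e1 e10 He1] : exists2 e, 0 < e & forall s, `|s - (t0 + tau)| < e -> Good s.
    by apply/Gnear/Gt; rewrite addrAC subrr add0r ger0_norm.
  have [e2 e20 He2] : exists2 e, 0 < e & forall s, `|s - (t0 - tau)| < e -> Good s.
    by apply/Gnear/Gt; rewrite addrAC subrr add0r normrN ger0_norm.
  exists (Num.min e1 e2); first by rewrite lt_min e10.
  move=> s /andP[ts se] sd t tt.
  have [h|h] := leP `|t - t0| tau; first exact: Gt.
  have : `|t - t0| < tau + Num.min e1 e2 by apply: le_lt_trans se.
  move: h; have [h0|h0] := lerP 0 (t - t0); rewrite ?(ger0_norm h0) ?(ltr0_norm h0) => h h1.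
    apply: He1; have : Num.min e1 e2 <= e1 by rewrite ge_min lexx.
    by rewrite ltr_norml; move: h h1 e10; lra.
  apply: He2; have : Num.min e1 e2 <= e2 by rewrite ge_min lexx orbT.
  by rewrite ltr_norml; move: h h1 e20; lra.
by apply: P; rewrite lexx ltW.
Unshelve. all: by end_near. Qed.

Lemma near_dist (T : topologicalType) (V : normedModType R) (z : T -> V) t (e : R) :
  {for t, continuous z} -> 0 < e -> \forall s \near t, `|z s - z t| < e.
Proof.
by move=> /cvgrPdist_lt h e0; have := h e e0; apply: filterS => s; rewrite distrC.
Qed.

End geodesics.

(** * Uniqueness of geodesics and the exponential map *)

Section geodesic_uniqueness.
Context {R : realType} {n : nat} {M : ptopologicalType}.
Variable g : riemannian R n M.
Implicit Types (i j : chart g) (c : R -> M).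

Lemma near_eq_derive1 (V : normedModType R) (f h : R -> V) t :
  (\forall s \near t, f s = h s) -> derive1 f t = derive1 h t.
Proof. by move=> fh; rewrite !derive1E; exact: near_eq_derive. Qed.

Lemma state_near_eq i c c' t : (\forall s \near t, c s = c' s) -> state i c t = state i c' t.
Proof.
move=> cc'; rewrite !stateE (nbhs_singleton cc'); congr row_mx.
by apply: near_eq_derive1; apply: filterS cc' => s /= ->.
Qed.

Definition lip_box i zs rho delta := forall c c' t0, geodesic g c -> geodesic g c' ->
  chart_dom i (c t0) -> chart_dom i (c' t0) ->
  `|state i c t0 - zs| < rho -> `|state i c' t0 - zs| < rho ->
  forall t, `|t - t0| <= delta ->
    `|state i c t - state i c' t| <= 2 * `|state i c t0 - state i c' t0|.

Definition stay_box i zs rho delta := forall c t0, geodesic g c ->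
  chart_dom i (c t0) -> `|state i c t0 - zs| < rho ->
  forall t, `|t - t0| <= delta -> chart_dom i (c t) /\ `|state i c t - zs| < 2 * rho.

Lemma flow_box_lip i zs C rho delta :
  0 <= C -> 0 < delta <= 2^-1 -> delta * C <= 2^-1 ->
  c11vat C (2 * rho) (field i) (jac (field i)) zs ->
  stay_box i zs rho delta -> lip_box i zs rho delta.
Proof.
move=> C0 /andP[de0 de1] dC F2 box c c' t0 gc gc' ic ic' sc sc' t td.
have B := box _ _ gc ic sc; have B' := box _ _ gc' ic' sc'.
have := @short_gronwall R _ (fun t => state i c t - state i c' t)
  (fun t => field i (state i c t) - field i (state i c' t)) t0 delta C 0 (ltW de0) C0 (lexx _) dC.
rewrite mulr0 => G; rewrite -[leRHS]addr0; apply: G td => s /[dup] /B[is1 h1] /B'[is2 h2].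
  by apply: is_deriveB; exact: geodesic_ode.
by rewrite addr0; have [] := F2 _ _ _ h1 h2 h2.
Qed.

Lemma flow_box_agree i zs rho delta c c' t0 :
  stay_box i zs rho delta -> lip_box i zs rho delta ->
  geodesic g c -> geodesic g c' -> chart_dom i (c t0) -> chart_dom i (c' t0) ->
  `|state i c t0 - zs| < rho -> state i c t0 = state i c' t0 ->
  forall t, `|t - t0| <= delta -> [/\ chart_dom i (c t), chart_dom i (c' t) &
    state i c t = state i c' t].
Proof.
move=> box lip gc gc' ic ic' sc scc' t td.
have sc' : `|state i c' t0 - zs| < rho by rewrite -scc'.
have [h1 _] := box _ _ gc ic sc _ td; have [h2 _] := box _ _ gc' ic' sc' _ td.
split=> //; have := lip _ _ _ gc gc' ic ic' sc sc' _ td.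
by rewrite scc' subrr normr0 mulr0 normr_le0 subr_eq0 => /eqP.
Qed.

Lemma state_eq_pt i c c' t : chart_dom i (c t) -> chart_dom i (c' t) ->
  state i c t = state i c' t -> c t = c' t.
Proof.
move=> h1 h2 h; rewrite -(coordK h1) -(coordK h2); congr (param i _).
by rewrite -!lsub_state h.
Qed.

Lemma agree_near i c c' t : geodesic g c -> geodesic g c' ->
  chart_dom i (c t) -> chart_dom i (c' t) -> state i c t = state i c' t ->
  \forall s \near t, c s = c' s.
Proof.
move=> gc gc' ic ic' e.
have ict : cod i (lsubmx (state i c t)) by rewrite lsub_state; exact: cod_coord.
have [C [rho [delta [C0 rho0 de dC [F2 _ box]]]]] := flow_box ict.
have lip := flow_box_lip C0 de dC F2 box.
have [de0 _] := andP de.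
apply/nbhs_ballP; exists delta => //= s; rewrite /ball /= distrC => /ltW st.
have [|h1 h2 h3] := flow_box_agree box lip gc gc' ic ic' _ e st; first by rewrite subrr normr0.
exact: state_eq_pt h1 h2 h3.
Qed.

Definition agree c c' t := exists i, [/\ chart_dom i (c t), chart_dom i (c' t) &
    state i c t = state i c' t].

Lemma geodesic_near_state i c t e : geodesic g c -> chart_dom i (c t) -> 0 < e ->
  \forall s \near t, chart_dom i (c s) /\ `|state i c s - state i c t| < e.
Proof.
move=> gc it e0; have [[cc _] _] := gc; near=> s; split; near: s; first exact: curve_near_dom.
exact: near_dist (is_derive_continuous (geodesic_ode gc it)) e0.
Unshelve. all: by end_near. Qed.

(** Agreement is continued by flow boxes. The box around the state of [c] at time [t] is entered at
    a slightly earlier time, where agreement is already known; its duration [delta] carries the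
    agreement past [t]. *)
Lemma geodesic_agree c c' t0 T : geodesic g c -> geodesic g c' -> agree c c' t0 ->
  t0 <= T -> agree c c' T.
Proof.
move=> gc gc' a0 t0T.
suff : forall t, t0 <= t <= T -> agree c c' t by apply; rewrite t0T lexx.
apply: real_induction => t /andP[t0t tT] IH.
have [i it] := chart_cover g (c t).
have ict : cod i (lsubmx (state i c t)) by rewrite lsub_state; exact: cod_coord.
have [C [rho [delta [C0 rho0 de dC [F2 _ box]]]]] := flow_box ict.
have lip := flow_box_lip C0 de dC F2 box; have [de0 _] := andP de.
have agree_state s : agree c c' s -> chart_dom i (c s) ->
    chart_dom i (c' s) /\ state i c s = state i c' s.
  move=> [j [h1 h2 h3]] h4; have cc' := agree_near gc gc' h1 h2 h3.
  by split; [rewrite -(nbhs_singleton cc')|exact: state_near_eq].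
have Near := geodesic_near_state gc it rho0.
have [s [ts st as_ [is_ ss]]] : exists s, [/\ t - delta < s, s <= t, agree c c' s &
    chart_dom i (c s) /\ `|state i c s - state i c t| < rho].
  move: t0t; rewrite le_eqVlt => /orP[/eqP t0t|t0t].
    exists t; split; rewrite ?gtrBl//; first by rewrite -t0t.
    by have := nbhs_singleton Near.
  have [|s /andP[s1 s2] h] := @near_left R _ t (Num.max t0 (t - delta / 2)) _ Near.
    by rewrite gt_max t0t /= gtrBl divr_gt0.
  move: s1; rewrite ge_max => /andP[s1 s3].
  exists s; split => //; first by apply: lt_le_trans s3; move: de0; lra.
    exact: ltW.
  by apply: IH; rewrite s1.
have [is' ss'] := agree_state _ as_ is_.
exists (s + delta - t); first by move: ts; lra.
move=> r /andP[tr re] rT; exists i.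
apply: (flow_box_agree box lip gc gc' is_ is' ss ss').
rewrite ler_norml; move: st ts tr re; lra.
Qed.

Lemma chart_atP x : chart_dom (chart_at g x) x.
Proof. exact: (svalP (cid (chart_cover g x))). Qed.

Lemma geodesic_unique c c' : geodesic g c -> geodesic g c' -> c 0 = c' 0 ->
  velocity g c 0 = velocity g c' 0 -> forall t, 0 <= t -> c t = c' t.
Proof.
move=> gc gc' c0 v0 t t0.
have [i [h1 h2 h3]] : agree c c' t; last exact: state_eq_pt h1 h2 h3.
apply: geodesic_agree t0 => //; exists (chart_at g (c 0)).
have it := chart_atP (c 0).
split=> //; first by rewrite -c0.
by move: v0; rewrite /velocity -c0 stateE => ->; rewrite c0 stateE.
Qed.

Lemma is_derive_scale (V : normedModType R) (x : R -> V) (l t : R) x' :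
  is_derive (l * t) 1 x x' -> is_derive t 1 (fun s => x (l * s)) (l *: x').
Proof.
move=> [h1 h2].
have dx : is_diff (l * t) x (fun h => h *: x').
  split; first by apply/derivable1_diffP.
  by rewrite deriv1E// derive1E h2.
have dl : is_derive t 1 (fun s : R => l * s) l.
  have := @is_deriveZ R R R id l t 1 1 (is_derive_id t 1).
  by rewrite [l *: 1]mulr1.
exact: (diff_curve dx dl).
Qed.

Lemma geodesic_scale c l : geodesic g c -> geodesic g (fun t => c (l * t)).
Proof.
move=> gc; have [[cc c1] c2] := gc.
have D i t : chart_dom i (c (l * t)) ->
    is_derive t 1 (coord i \o (fun t => c (l * t))) (l *: derive1 (coord i \o c) (l * t)).
  move=> it; have := geodesic_coord gc it; rewrite rsub_state.
  exact: (@is_derive_scale _ (coord i \o c)).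
have cl : continuous (fun t => c (l * t)).
  by move=> t; apply: (@cvg_comp _ _ _ (fun t => l * t) c); [exact: mulrl_continuous|exact: cc].
have E i t : chart_dom i (c (l * t)) ->
   \forall s \near t, l *: derive1 (coord i \o c) (l * s) = derive1 (coord i \o (fun t => c (l * t))) s.
  move=> it; have := @curve_near_dom _ _ _ _ i _ t cl it.
  by apply: filterS => s /D[_ <-]; rewrite derive1E.
have D2 i t : chart_dom i (c (l * t)) ->
    is_derive t 1 (derive1 (coord i \o (fun t => c (l * t)))) (l *: (l *: derive1 (derive1 (coord i \o c)) (l * t))).
  move=> it; apply: near_eq_is_derive (E _ _ it) _.
  apply: is_deriveZ; apply: (@is_derive_scale _ (derive1 (coord i \o c))).
  have [h _] := c2 i _ it; rewrite derive1E; exact: derivableP.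
split; first split=> //.
  move=> i t it; split; first by have [] := D i t it.
  exact: (is_derive_continuous (D2 i t it)).
move=> i t it; split; first by have [] := D2 i t it.
move=> k; have [_ /(_ k) eq2] := c2 i _ it.
rewrite derive1E; have [_ ->] := D2 i t it.
have [_] := D i t it; rewrite -derive1E => ->.
rewrite !mxE -[RHS](mulr0 (l * l)) -[in RHS]eq2 mulrDr mulrA; congr (_ + _).
rewrite mulr_sumr; apply: eq_bigr => a _; rewrite mulr_sumr; apply: eq_bigr => b _.
by rewrite !mxE /=; ring.
Qed.

Lemma velocity_scale c l : geodesic g c -> velocity g (fun t => c (l * t)) 0 = l *: velocity g c 0.
Proof.
move=> gc; rewrite /velocity mulr0.
have it : chart_dom (chart_at g (c 0)) (c (l * 0)) by rewrite mulr0; exact: chart_atP.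
have := geodesic_coord gc it; rewrite rsub_state.
move=> /(@is_derive_scale _ (coord (chart_at g (c 0)) \o c))[_ e].
rewrite derive1E e mulr0; reflexivity.
Qed.

Hypothesis complete : geodesically_complete g.
Variable P : M.

Definition gd (v : 'rV[R]_n) : R -> M := sval (cid (complete P v)).

Lemma gdP v : [/\ geodesic g (gd v), gd v 0 = P & velocity g (gd v) 0 = v].
Proof. exact: (svalP (cid (complete P v))). Qed.

Lemma gd_geodesic v : geodesic g (gd v). Proof. by have [] := gdP v. Qed.

(** The restriction [0 <= t] comes from [geodesic_unique], which runs forward in time; the factor
    [l] may have any sign. *)
Lemma gd_scale l v t : 0 <= t -> gd (l *: v) t = gd v (l * t).
Proof.
move=> t0; have [h1 h2 h3] := gdP (l *: v); have [k1 k2 k3] := gdP v.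
apply: (@geodesic_unique _ (fun t => gd v (l * t))) t0.
- exact: h1.
- exact: geodesic_scale k1.
- rewrite h2 mulr0 k2; reflexivity.
- rewrite h3 (velocity_scale _ k1) k3; reflexivity.
Qed.

(** By uniqueness the set from which [Exp] chooses contains exactly one point. *)
Lemma Exp_gd v : Exp g P v = gd v 1.
Proof.
have [h1 h2 h3] := gdP v; rewrite /Exp; case: xgetP => [y _ [c [gc c0 cv <-]]|].
  apply: (geodesic_unique gc h1); [rewrite c0 h2|rewrite cv h3|exact: ler01]; reflexivity.
by move=> /(_ (gd v 1)) []; exists (gd v).
Qed.

End geodesic_uniqueness.

(** * Smooth dependence on the initial velocity *)

Section flow_derivative.
Context {R : realType}.

Lemma vec_c11v p q C d (F : 'rV[R]_p -> 'rV[R]_q) A y : 0 < d -> 0 <= C ->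
  (forall x x' z, `|x - y| < d -> `|x' - y| < d -> `|z - y| < d ->
     [/\ `|F x| <= C, `|F x - F x'| <= C * `|x - x'|, `|A z| <= C &
      `|F x - F x' - (x - x') *m A z| <= C * `|x - x'| * (`|x - z| + `|x' - z|)]) ->
  c11v F A y.
Proof.
move=> d0 C0 H k; exists C, d; split=> // u u' v hu hu' hv.
have [h1 h2 h3 h4] := H _ _ _ hu hu' hv; split.
- by apply: le_trans h1; exact: mx_entry_le.
- by apply: le_trans h2; have := mx_entry_le (F u - F u') 0 k; rewrite !mxE.
- by apply: mx_norm_le => // a j; rewrite mxE; apply: le_trans h3; exact: mx_entry_le.
- apply: le_trans h4; have := mx_entry_le (F u - F u' - (u - u') *m A v) 0 k.
  rewrite !mxE; congr (_ <= _); congr `|_ - _|.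
  by apply: eq_bigr => l _; rewrite !mxE.
Qed.

(** The expansion is applied to the short displacement from [v] to [v + r *: u], once with the
    gradient at [v] and once with that at [v']; the difference is divided by [r]. *)
Lemma c11vat_lip p q C d (F : 'rV[R]_p -> 'rV[R]_q) A y v v' (u : 'rV[R]_p) : 0 <= C ->
  c11vat C d F A y -> `|v - y| < d -> `|v' - y| < d ->
  `|u *m A v - u *m A v'| <= 2 * C * `|u| * `|v - v'|.
Proof.
move=> C0 H hv hv'; have [->|u0] := eqVneq u 0.
  by rewrite !mul0mx subrr !normr0 mulr0 mul0r.
have u1 : 0 < `|u| by rewrite normr_gt0.
apply/ler_addgt0Pr => e e0.
(* Small enough to keep [v + r *: u] in the ball, and to make the quadratic error at most [e] after
   division by [r]. *)
pose r := Num.min ((d - `|v - y|) / (2 * `|u|)) (e / (2 * C * `|u| * `|u| + 1)).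
have dv : 0 < d - `|v - y| by rewrite subr_gt0.
have K0 : 0 <= 2 * C * `|u| * `|u| by rewrite !mulr_ge0.
have r0 : 0 < r by rewrite lt_min !divr_gt0 ?mulr_gt0// ltr_wpDl.
have ru : `|(v + r *: u) - y| < d.
  rewrite addrAC; apply: le_lt_trans (ler_normD _ _) _.
  rewrite mx_normZ gtr0_norm// -ltrBrDl.
  have : r <= (d - `|v - y|) / (2 * `|u|) by rewrite ge_min lexx.
  rewrite ler_pdivlMr ?mulr_gt0// mulrCA => h.
  have : 0 < r * `|u| by rewrite mulr_gt0.
  by clear - h dv; lra.
have [_ _ _ _ h1] := H _ _ _ ru hv hv; have [_ _ _ _ h2] := H _ _ _ ru hv hv'.
have w1 : v + r *: u - v = r *: u by rewrite addrAC subrr add0r.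
have w2 : v + r *: u - v' = v - v' + r *: u by rewrite addrAC.
rewrite w1 subrr normr0 addr0 in h1; rewrite w1 w2 in h2.
have : r * `|u *m A v - u *m A v'| <= r * (2 * C * `|u| * `|v - v'| + e).
  rewrite -{1}(gtr0_norm r0) -mx_normZ scalerBr !scalemxAl.
  rewrite -(subrKA (F (v + r *: u) - F v)) (le_trans (ler_normD _ _))//.
  rewrite [X in X + _ <= _]distrC; apply: le_trans (lerD h1 h2) _.
  have n1 : `|v - v' + r *: u| <= `|v - v'| + r * `|u|.
    by rewrite (le_trans (ler_normD _ _))// mx_normZ (gtr0_norm r0).
  rewrite !mx_normZ !(gtr0_norm r0).
  have re : r * (2 * C * `|u| * `|u|) <= e.
    have : r <= e / (2 * C * `|u| * `|u| + 1) by rewrite ge_min lexx orbT.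
    rewrite ler_pdivlMr ?ltr_wpDl// => h; apply: le_trans h.
    by rewrite ler_wpM2l ?(ltW r0)// lerDl.
  have X : C * (r * `|u|) * (`|v - v' + r *: u| + `|v - v'|) <=
     C * (r * `|u|) * (`|v - v'| + r * `|u| + `|v - v'|).
    by rewrite ler_wpM2l ?mulr_ge0 ?(ltW r0)// lerD2r.
  apply: le_trans (lerD (lexx _) X) _.
  have -> : C * (r * `|u|) * (r * `|u|) + C * (r * `|u|) * (`|v - v'| + r * `|u| + `|v - v'|)
     = r * (2 * C * `|u| * `|v - v'| + r * (2 * C * `|u| * `|u|)) by ring.
  by rewrite ler_wpM2l ?(ltW r0)// lerD2l.
by rewrite ler_pM2l.
Qed.

(** Approximate solutions [xh h] of the linear equation [x' = x A] that converge uniformly at rate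
    [K * h] have a solution as limit. The increment of [x] between [s] and [t] is compared with that
    of [xh h], where [h] is chosen after [t], so that no integral equation is needed. *)
Lemma limit_ode N (x : R -> 'rV[R]_N) (xh dxh : R -> R -> 'rV[R]_N) (A : R -> 'M[R]_N)
    (t0 delta C K X e0 : R) : 0 <= C -> 0 <= K -> 0 <= X -> 0 < e0 ->
  (forall t (u : 'rV[R]_N), `|t - t0| <= delta -> `|u *m A t| <= C * `|u|) ->
  (forall t, `|t - t0| < delta -> forall (u : 'rV[R]_N) e, 0 < e -> \forall s \near t, `|u *m A s - u *m A t| <= e) ->
  (forall h t, 0 < h < e0 -> `|t - t0| <= delta -> [/\ is_derive t 1 (xh h) (dxh h t),
     `|dxh h t - xh h t *m A t| <= K * h, `|xh h t| <= X & `|xh h t - x t| <= K * h]) ->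
  forall t, `|t - t0| < delta -> is_derive t 1 x (x t *m A t).
Proof.
move=> C0 K0 X0 e00 Ab Ac H s sd.
set w := x s *m A s.
pose M := C * X + K * e0.
have M0 : 0 <= M by rewrite addr_ge0 ?mulr_ge0// ltW.
suff lim : forall e, 0 < e -> \forall t \near s, `|x t - x s - (t - s) *: w| <= e * `|t - s|.
  apply: DeriveDef.
    apply/cvg_ex; exists w; apply/cvgrPdist_le => e e1.
    have /near_all1[r r0 Hr] := lim e e1.
    apply/nbhs_ballP; exists r => //= h; rewrite /ball /= sub0r normrN => hr h0.
    have := Hr (h *: 1 + s); rewrite addrK [h *: 1]mulr1 => /(_ hr) L.
    rewrite -(scalerK h0 w) -scalerBr mx_normZ normfV ler_pdivrMl ?normr_gt0//.
    by rewrite distrC mulrC.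
  apply: cvg_lim => //; apply/cvgrPdist_le => e e1.
  have /near_all1[r r0 Hr] := lim e e1.
  apply/nbhs_ballP; exists r => //= h; rewrite /ball /= sub0r normrN => hr h0.
  have := Hr (h *: 1 + s); rewrite addrK [h *: 1]mulr1 => /(_ hr) L.
  rewrite -(scalerK h0 w) -scalerBr mx_normZ normfV ler_pdivrMl ?normr_gt0//.
  by rewrite distrC mulrC.
move=> e e1.
have e2 : 0 < e / 3 by rewrite divr_gt0.
have /near_all1[r r0 Hr] := Ac s sd (x s) _ e2.
pose r' := Num.min r (Num.min (delta - `|s - t0|) (e / 3 / (C * M + 1))).
have CM : 0 <= C * M by rewrite mulr_ge0.
have r'0 : 0 < r' by rewrite !lt_min r0 subr_gt0 sd !divr_gt0// ltr_wpDl.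
apply/nbhs_ballP; exists r' => //= t; rewrite /ball /= distrC => ts.
apply/ler_addgt0Pr => eps eps0.
pose h := Num.min (e0 / 2) (Num.min (e / 3 / (C * K + K + 1)) (eps / (2 * K + 1))).
have CK : 0 <= C * K by rewrite mulr_ge0.
have h0 : 0 < h by rewrite !lt_min !divr_gt0// ltr_wpDl ?addr_ge0// mulr_ge0.
have he : 0 < h < e0 by rewrite h0 /= gt_min ltr_pdivrMr// ltr_pMr// ltr1n.
have h1 : (C * K + K) * h <= e / 3.
  have : h <= e / 3 / (C * K + K + 1) by rewrite !ge_min lexx !orbT.
  rewrite ler_pdivlMr ?ltr_wpDl ?addr_ge0// mulrC => hh; apply: le_trans hh.
  by rewrite ler_wpM2r ?(ltW h0)// lerDl.
have h2 : 2 * (K * h) <= eps.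
  have : h <= eps / (2 * K + 1) by rewrite !ge_min lexx !orbT.
  rewrite ler_pdivlMr ?ltr_wpDl ?mulr_ge0// mulrC => hh; apply: le_trans hh.
  by rewrite mulrA ler_wpM2r ?(ltW h0)// lerDl.
have seg z : Num.min s t <= z <= Num.max s t -> `|z - s| < r' /\ `|z - t0| <= delta.
  move=> hz; have zs : `|z - s| <= `|t - s|.
    have [k|k] := lerP 0 (t - s); rewrite ?(ger0_norm k) ?(ltr0_norm k) ler_distl;
    move: hz; rewrite ge_min le_max; clear - k; lra.
  have zr := le_lt_trans zs ts; split=> //.
  rewrite -(subrKA s); apply: le_trans (ler_normD _ _) _.
  have : r' <= delta - `|s - t0| by rewrite !ge_min lexx !orbT.
  by clear - zr; lra.
have ss : Num.min s t <= s <= Num.max s t by rewrite ge_min le_max lexx.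
have tt : Num.min s t <= t <= Num.max s t by rewrite ge_min le_max lexx !orbT.
have [_ sdl] := seg _ ss; have [_ tdl] := seg _ tt.
have dM z : `|z - t0| <= delta -> `|dxh h z| <= M.
  move=> /[dup] zd /(H _ _ he)[_ k1 k2 _].
  rewrite -(subrK (xh h z *m A z) (dxh h z)) (le_trans (ler_normD _ _))// addrC.
  apply: lerD; first by apply: le_trans (Ab _ _ zd) _; rewrite ler_wpM2l.
  by apply: le_trans k1 _; rewrite ler_wpM2l//; case/andP: he => _ /ltW.
have lipx z : Num.min s t <= z <= Num.max s t -> `|xh h z - xh h s| <= M * `|z - s|.
  move=> hz; have := @mvt_bound_vec _ _ (xh h) (dxh h) s z M 0 M0.
  rewrite scaler0 subr0; apply=> y hy.
    have [_ yd] : `|y - s| < r' /\ `|y - t0| <= delta.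
      by apply: seg; move: hy hz; rewrite !ge_min !le_max; clear; lra.
    by have [] := H _ _ he yd.
  rewrite subr0; apply: dM.
  have [_ yd //] : `|y - s| < r' /\ `|y - t0| <= delta.
  by apply: seg; move: hy hz; rewrite !ge_min !le_max; clear; lra.
have main : `|xh h t - xh h s - (t - s) *: w| <= e * `|t - s|.
  apply: (@mvt_bound_vec _ _ (xh h) (dxh h)); first exact: ltW.
    by move=> z /seg[_ /(H _ _ he)[]].
  move=> z /[dup] hz /seg[zr zd]; have [_ k1 k2 k3] := H _ _ he zd.
  have [_ _ _ k3s] := H _ _ he sdl.
  rewrite -(subrKA (xh h z *m A z)) (le_trans (ler_normD _ _))//.
  have -> : xh h z *m A z - w = (xh h z - x s) *m A z + (x s *m A z - x s *m A s).
    by rewrite mulmxBl addrA subrK.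
  have k4 : `|(xh h z - x s) *m A z| <= C * (M * r' + K * h).
    apply: le_trans (Ab _ _ zd) _; rewrite ler_wpM2l//.
    rewrite -(subrKA (xh h s)) (le_trans (ler_normD _ _))// lerD//.
    by apply: le_trans (lipx _ hz) _; rewrite ler_wpM2l// ltW.
  have k5 : `|x s *m A z - x s *m A s| <= e / 3.
    by apply: Hr; apply: lt_le_trans zr _; rewrite ge_min lexx.
  have k6 : C * (M * r') <= e / 3.
    have : r' <= e / 3 / (C * M + 1) by rewrite !ge_min lexx !orbT.
    rewrite ler_pdivlMr ?ltr_wpDl// mulrC => hh; apply: le_trans hh.
    by rewrite mulrA ler_wpM2r ?(ltW r'0)// lerDl.
  have k7 := ler_normD ((xh h z - x s) *m A z) (x s *m A z - x s *m A s).
  clear - k1 k4 k5 k6 k7 h1; rewrite mulrDl in h1; rewrite mulrDr in k4.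
  rewrite -mulrA in h1; lra.
have [_ _ _ k3s] := H _ _ he sdl; have [_ _ _ k3t] := H _ _ he tdl.
have -> : x t - x s - (t - s) *: w = (xh h t - xh h s - (t - s) *: w) -
   (xh h t - x t) + (xh h s - x s).
  by rewrite !opprB !addrA; apply/rowP => k; rewrite !mxE; ring.
rewrite (le_trans (ler_normD _ _))// (le_trans (lerD (ler_normB _ _) (lexx _)))//.
by clear - main k3s k3t h2; lra.
Qed.

Lemma normed_ball (V : normedModType R) (x y : V) e : `|x - y| < e -> ball x e y.
Proof. by rewrite -ball_normE. Qed.

Lemma is_derive_mulmxl p l (u : 'rV[R]_p) (X : R -> 'M[R]_(p, l)) (t : R) X' :
  is_derive t 1 X X' -> is_derive t 1 (fun s => u *m X s) (u *m X').
Proof.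
move=> /is_derive_mxP h; apply/is_derive_mxP => a k.
have -> : (fun s => (u *m X s) a k) = \sum_(j < p) (fun s => u a j * X s j k).
  by apply/funext => s; rewrite mxE fct_sumE.
rewrite mxE; apply: is_derive_sum => j; exact: is_deriveZ.
Qed.

(** * Dependence of a flow on parameters in the class C^{1,1} *)

Section flow.
Context {m N : nat} (S : 'rV[R]_m -> R -> 'rV[R]_N) (F : 'rV[R]_N -> 'rV[R]_N)
  (DF : 'rV[R]_N -> 'M[R]_N) (A0 : 'rV[R]_m -> 'M[R]_(m, N))
  (v0 : 'rV[R]_m) (zs : 'rV[R]_N) (t0 delta C r C1 d : R).
Hypotheses (C0 : 0 <= C) (C10 : 0 <= C1) (d0 : 0 < d)
  (de : 0 < delta <= 2^-1) (dC : delta * C <= 2^-1)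
  (HF : c11vat C r F DF zs)
  (HS : forall v, `|v - v0| < d -> forall t, `|t - t0| <= delta ->
      `|S v t - zs| < r /\ is_derive t 1 (S v) (F (S v t)))
  (H0 : c11vat C1 d (fun v => S v t0) A0 v0).

Let de0 : 0 <= delta. Proof. by case/andP: de => /ltW. Qed.

Let de1 : 2 * delta <= 1.
Proof. by case/andP: de => _; lra. Qed.

Lemma flow_lip v v' t : `|v - v0| < d -> `|v' - v0| < d -> `|t - t0| <= delta ->
  `|S v t - S v' t| <= 2 * C1 * `|v - v'|.
Proof.
move=> hv hv' td.
have := @short_gronwall R _ (fun t => S v t - S v' t)
  (fun t => F (S v t) - F (S v' t)) t0 delta C 0 de0 C0 (lexx _) dC.
rewrite mulr0 => G; apply: le_trans (G _ _ t td) _.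
- by move=> s sd; apply: is_deriveB; [have [] := HS hv sd|have [] := HS hv' sd].
- move=> s sd; have [h1 _] := HS hv sd; have [h2 _] := HS hv' sd.
  by rewrite addr0; have [] := HF h1 h2 h2.
- rewrite addr0 -mulrA ler_wpM2l//; by have [] := H0 hv hv' hv'.
Qed.

(** Gronwall's inequality doubles the initial defect, of constant [C1]. The second term is the
    quadratic error [C] of [F] on flow lines that separate at rate [2 * C1], with
    [2 * delta <= 1]. *)
Let K := 2 * C1 + 4 * C * C1 * C1.

Let K0 : 0 <= K. Proof. by rewrite /K addr_ge0 ?mulr_ge0. Qed.

(** The remainder of the linearisation satisfies the linearised equation up to a quadratic error, so
    Gronwall's inequality carries the [C^{1,1}] estimate from time [t0] to time [t]. Here [x] is the
    candidate for the derivative applied to [v - v']. *)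
Lemma flow_linear q (x : R -> 'rV[R]_N) u v v' t : `|q - v0| < d -> `|v - v0| < d -> `|v' - v0| < d ->
  (forall t, `|t - t0| < delta -> is_derive t 1 x (x t *m DF (S q t))) ->
  x t0 = u *m A0 q -> v - v' = u -> `|t - t0| < delta ->
  `|S v t - S v' t - x t| <= K * `|v - v'| * (`|v - q| + `|v' - q|).
Proof.
move=> hq hv hv' hx x0 vv' td.
set a := `|v - v'|; set s := (`|v - q| + _).
have a0 : 0 <= a by exact: normr_ge0.
have s0 : 0 <= s by rewrite addr_ge0.
have eps0 : 0 <= 4 * C * C1 * C1 * a * s by rewrite !mulr_ge0.
have := @short_gronwall R _ (fun t => S v t - S v' t - x t)
  (fun t => F (S v t) - F (S v' t) - x t *m DF (S q t)) t0 `|t - t0| C _ (normr_ge0 _) C0 eps0 _.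
have tC : `|t - t0| * C <= 2^-1 by apply: le_trans dC; rewrite ler_wpM2r// ltW.
have t1 : 2 * `|t - t0| <= 1 by apply: le_trans de1; rewrite ler_wpM2l// ltW.
move=> /(_ tC) G; apply: le_trans (G _ _ t (lexx _)) _.
- move=> z /le_lt_trans/(_ td)/[dup] zd' /ltW zd; apply: is_deriveB; last exact: hx.
  by apply: is_deriveB; [have [] := HS hv zd|have [] := HS hv' zd].
- move=> z /le_lt_trans/(_ td)/ltW zd; have [h1 _] := HS hv zd; have [h2 _] := HS hv' zd; have [h3 _] := HS hq zd.
  have [_ _ _ f4 f5] := HF h1 h2 h3.
  have -> : F (S v z) - F (S v' z) - x z *m DF (S q z) =
    (S v z - S v' z - x z) *m DF (S q z) +
    (F (S v z) - F (S v' z) - (S v z - S v' z) *m DF (S q z)).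
    by rewrite (mulmxBl _ (x z)); apply/rowP => k; rewrite !mxE; ring.
  rewrite (le_trans (ler_normD _ _))// lerD//; apply: le_trans f5 _.
  have -> : 4 * C * C1 * C1 * a * s = C * (2 * C1 * a) * (2 * C1 * s) by ring.
  apply: ler_pM; rewrite ?mulr_ge0 ?addr_ge0//.
    by rewrite ler_wpM2l// flow_lip.
  by rewrite mulrDr lerD// flow_lip.
- rewrite x0 -vv'; have [_ _ _ _ h] := H0 hv hv' hq.
  apply: (@le_trans _ _ (2 * (C1 * a * s) + 1 * (4 * C * C1 * C1 * a * s))).
    by apply: lerD; [rewrite ler_wpM2l|rewrite ler_wpM2r].
  by rewrite /K le_eqVlt; apply/orP; left; apply/eqP; ring.
Qed.

Let quot q u (h t : R) := h^-1 *: (S (q + h *: u) t - S q t).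

Let dquot q u (h t : R) := h^-1 *: (F (S (q + h *: u) t) - F (S q t)).

Lemma quot_bounds q u h t : h != 0 -> `|q - v0| < d -> `|q + h *: u - v0| < d -> `|t - t0| <= delta ->
  [/\ is_derive t 1 (quot q u h) (dquot q u h t),
   `|dquot q u h t - quot q u h t *m DF (S q t)| <= 4 * C * C1 * C1 * `|u| * `|u| * `|h| &
   `|quot q u h t| <= 2 * C1 * `|u|].
Proof.
move=> h0 hq hqh td; have [s1 d1] := HS hq td; have [s2 d2] := HS hqh td.
have n0 : 0 < `|h| by rewrite normr_gt0.
have L := flow_lip hqh hq td.
have E : q + h *: u - q = h *: u by rewrite addrAC subrr add0r.
rewrite E mx_normZ in L.
split.
- by apply: is_deriveZ; exact: is_deriveB.
- rewrite /dquot /quot -scalemxAl -scalerBr mx_normZ normfV ler_pdivrMl//.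
  have [_ _ _ _ h1] := HF s2 s1 s1; apply: le_trans h1 _.
  rewrite subrr normr0 addr0.
  apply: (@le_trans _ _ (C * (2 * C1 * (`|h| * `|u|)) * (2 * C1 * (`|h| * `|u|)))).
    by apply: ler_pM => //; rewrite ?mulr_ge0// ler_wpM2l.
  by rewrite le_eqVlt; apply/orP; left; apply/eqP; ring.
- rewrite /quot mx_normZ normfV ler_pdivrMl//; apply: le_trans L _.
  by rewrite mulrCA mulrA.
Qed.

(** Difference quotients form a Cauchy family as the step tends to 0, uniformly in [t]. This
    constructs the derivative of the flow without solving the linearised equation beforehand. *)
Lemma quot_cauchy q u h h' t : h != 0 -> h' != 0 -> `|q - v0| < d -> `|q + h *: u - v0| < d ->
  `|q + h' *: u - v0| < d -> `|t - t0| <= delta ->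
  `|quot q u h t - quot q u h' t| <= K * `|u| * `|u| * (`|h| + `|h'|).
Proof.
move=> h0 h'0 hq hqh hqh' td.
have eps0 : 0 <= 4 * C * C1 * C1 * `|u| * `|u| * (`|h| + `|h'|) by rewrite !mulr_ge0 ?addr_ge0.
have := @short_gronwall R _ (fun t => quot q u h t - quot q u h' t)
  (fun t => dquot q u h t - dquot q u h' t) t0 delta C _ de0 C0 eps0 dC.
move=> G; apply: le_trans (G _ _ t td) _.
- move=> z zd; have [d1 _ _] := quot_bounds h0 hq hqh zd.
  by have [d2 _ _] := quot_bounds h'0 hq hqh' zd; exact: is_deriveB.
- move=> z zd; have [_ e1 _] := quot_bounds h0 hq hqh zd.
  have [_ e2 _] := quot_bounds h'0 hq hqh' zd.
  have [s1 _] := HS hq zd; have [_ _ _ f4 _] := HF s1 s1 s1.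
  have -> : dquot q u h z - dquot q u h' z = (quot q u h z - quot q u h' z) *m DF (S q z)
    + (dquot q u h z - quot q u h z *m DF (S q z) - (dquot q u h' z - quot q u h' z *m DF (S q z))).
    by rewrite mulmxBl; apply/rowP => k; rewrite !mxE; ring.
  rewrite (le_trans (ler_normD _ _))// lerD// (le_trans (ler_normB _ _))//.
  by rewrite mulrDr lerD.
- have init k : k != 0 -> `|q + k *: u - v0| < d -> `|quot q u k t0 - u *m A0 q| <= C1 * `|u| * `|u| * `|k|.
    move=> k0 hk; have [_ _ _ _] := H0 hk hq hq.
    have E : q + k *: u - q = k *: u by rewrite addrAC subrr add0r.
    rewrite E subrr normr0 addr0 mx_normZ => B.
    rewrite -(scalerK k0 (u *m A0 q)) -scalerBr mx_normZ normfV ler_pdivrMl ?normr_gt0//.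
    rewrite scalemxAl; apply: le_trans B _.
    by rewrite le_eqVlt; apply/orP; left; apply/eqP; ring.
  have := init h h0 hqh; have := init h' h'0 hqh' => i1 i2.
  have i3 : `|quot q u h t0 - quot q u h' t0| <= C1 * `|u| * `|u| * (`|h| + `|h'|).
    rewrite -(subrKA (u *m A0 q)) (le_trans (ler_normD _ _))// mulrDr.
    by rewrite [X in _ + X]distrC lerD.
  apply: (@le_trans _ _ (2 * (C1 * `|u| * `|u| * (`|h| + `|h'|)) +
     1 * (4 * C * C1 * C1 * `|u| * `|u| * (`|h| + `|h'|)))).
    by apply: lerD; [rewrite ler_wpM2l|rewrite ler_wpM2r].
  by rewrite /K le_eqVlt; apply/orP; left; apply/eqP; ring.
Qed.

Lemma quot_near q u : `|q - v0| < d -> exists2 e, 0 < e & forall h, `|h| < e -> `|q + h *: u - v0| < d.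
Proof.
move=> hq; have d1 : 0 < d - `|q - v0| by rewrite subr_gt0.
have u1 : 0 < `|u| + 1 by rewrite ltr_wpDl.
exists ((d - `|q - v0|) / (`|u| + 1)); first by rewrite divr_gt0.
move=> h; rewrite ltr_pdivlMr// => hh; rewrite addrAC.
rewrite (le_lt_trans (ler_normD _ _))// -ltrBrDl mx_normZ; apply: le_lt_trans hh.
by rewrite ler_wpM2l// lerDl.
Qed.

Lemma flow_derivable q u t : `|q - v0| < d -> `|t - t0| <= delta ->
  derivable (fun v => S v t) q u.
Proof.
move=> hq td; have [e e0 He] := quot_near u hq.
apply: cauchy_cvg; apply: cauchy_exP => eps eps0.
pose K' := K * `|u| * `|u|; have K'0 : 0 <= K' by rewrite !mulr_ge0.
pose e1 := Num.min e (eps / (2 * K' + 1)).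
have e10 : 0 < e1 by rewrite lt_min e0 divr_gt0// ltr_wpDl// mulr_ge0.
have e1e : e1 <= e by rewrite ge_min lexx.
have e12 : 0 < e1 / 2 by rewrite divr_gt0.
have e11 : `|e1 / 2| < e1 by rewrite gtr0_norm// ltr_pdivrMr// ltr_pMr// ltr1n.
exists (quot q u (e1 / 2) t); apply/nbhs_ballP; exists e1 => //= h.
rewrite {1}/ball /= sub0r normrN => hh h0.
apply: (@normed_ball 'rV[R]_N); rewrite [h *: u + q]addrC.
have := @quot_cauchy q u (e1 / 2) h t (lt0r_neq0 e12) h0 hq (He _ (lt_le_trans e11 e1e)) (He _ (lt_le_trans hh e1e)) td.
move=> /le_lt_trans; apply.
apply: (@le_lt_trans _ _ (K' * (2 * e1))).
  by rewrite ler_wpM2l// mulrDl mul1r lerD// ltW.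
have : e1 <= eps / (2 * K' + 1) by rewrite ge_min lexx orbT.
rewrite ler_pdivlMr ?ltr_wpDl ?mulr_ge0// => h1.
apply: lt_le_trans h1; have -> : e1 * (2 * K' + 1) = K' * (2 * e1) + e1 by ring.
by rewrite ltrDl.
Qed.

Lemma flow_D_near q u t : `|q - v0| < d -> `|t - t0| <= delta ->
  exists2 e, 0 < e & forall h, h != 0 -> `|h| < e ->
   `|quot q u h t - 'D_u (fun v => S v t) q| <= K * `|u| * `|u| * `|h|.
Proof.
move=> hq td; have [e e0 He] := quot_near u hq.
exists e => // h h0 hh; apply/ler_addgt0Pr => eps eps0.
pose K' := K * `|u| * `|u|; have K'0 : 0 <= K' by rewrite !mulr_ge0.
have /cvgrPdist_lt/(_ (eps / 2)) := @flow_derivable q u t hq td.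
rewrite divr_gt0// => /(_ isT)/nbhs_ballP[rr /= rr0 Hr].
pose k := Num.min (rr / 2) (Num.min (e / 2) (eps / 2 / (K' + 1))).
have k0 : 0 < k by rewrite !lt_min !divr_gt0// ltr_wpDl.
have kr : `|k| < rr by rewrite gtr0_norm// !gt_min ltr_pdivrMr// ltr_pMr// ltr1n.
have ke : `|k| < e.
  by rewrite gtr0_norm// !gt_min [e / 2 < e]ltr_pdivrMr// ltr_pMr// ltr1n orbT.
have kK : K' * `|k| <= eps / 2.
  have : k <= eps / 2 / (K' + 1) by rewrite !ge_min lexx !orbT.
  rewrite ler_pdivlMr ?ltr_wpDl// gtr0_norm// mulrC => hk; apply: le_trans hk.
  by rewrite ler_wpM2r ?(ltW k0)// lerDl.
have := Hr k; rewrite /ball /= sub0r normrN => /(_ kr (lt0r_neq0 k0)).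
rewrite [k *: u + q]addrC -/(quot q u k t) distrC => B1.
have B2 := @quot_cauchy q u h k t h0 (lt0r_neq0 k0) hq (He _ hh) (He _ ke) td.
rewrite -(subrKA (quot q u k t)) (le_trans (ler_normD _ _))//.
rewrite -/K' mulrDr in B2.
rewrite [eps]splitr addrA; apply: lerD; last exact: ltW.
by apply: le_trans B2 _; rewrite lerD2l.
Qed.

Lemma flow_D_ode q u t : `|q - v0| < d -> `|t - t0| < delta ->
  is_derive t 1 (fun s => 'D_u (fun v => S v s) q) ('D_u (fun v => S v t) q *m DF (S q t)).
Proof.
move=> hq td; have [e e0 He] := quot_near u hq.
(* In [flow_D_near] the range of the step depends on the time [s]; going through a smaller quotient
   makes it uniform in [s], as [limit_ode] requires. *)
have dd s : `|s - t0| <= delta -> forall h, 0 < h < e ->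
    `|quot q u h s - 'D_u (fun v => S v s) q| <= K * `|u| * `|u| * h.
  move=> sd h /andP[h0 he]; have [e' e'0 He'] := flow_D_near u hq sd.
  apply/ler_addgt0Pr => eps eps0.
  pose K' := K * `|u| * `|u|; have K'0 : 0 <= K' by rewrite !mulr_ge0.
  pose k := Num.min (e' / 2) (Num.min (e / 2) (eps / 2 / (K' + 1))).
  have k0 : 0 < k by rewrite !lt_min !divr_gt0// ltr_wpDl.
  have kr : `|k| < e' by rewrite gtr0_norm// !gt_min ltr_pdivrMr// ltr_pMr// ltr1n.
  have ke : `|k| < e.
    by rewrite gtr0_norm// !gt_min [e / 2 < e]ltr_pdivrMr// ltr_pMr// ltr1n orbT.
  have kK : K' * `|k| <= eps / 2.
    have : k <= eps / 2 / (K' + 1) by rewrite !ge_min lexx !orbT.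
    rewrite ler_pdivlMr ?ltr_wpDl// gtr0_norm// mulrC => hk; apply: le_trans hk.
    by rewrite ler_wpM2r ?(ltW k0)// lerDl.
  have B1 := He' k (lt0r_neq0 k0) kr.
  have hh : `|h| < e by rewrite gtr0_norm.
  have B2 := @quot_cauchy q u h k s (lt0r_neq0 h0) (lt0r_neq0 k0) hq (He _ hh) (He _ ke) sd.
  rewrite -(subrKA (quot q u k s)) (le_trans (ler_normD _ _))//.
  rewrite -/K' mulrDr (gtr0_norm h0) in B2; rewrite -/K' in B1 *.
  lra.
pose K2 := 4 * C * C1 * C1 * `|u| * `|u| + K * `|u| * `|u|.
have K20 : 0 <= K2 by rewrite /K2 addr_ge0// !mulr_ge0.
apply: (@limit_ode N _ (quot q u) (dquot q u) (fun s => DF (S q s)) t0 delta C K2 (2 * C1 * `|u|) e) => //.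
- by rewrite !mulr_ge0.
- by move=> s w sd; have [h1 _] := HS hq sd; have [_ _ _ h _] := HF h1 h1 h1.
- move=> s sd w eps eps0; have [h1 d1] := HS hq (ltW sd).
  have K3 : 0 <= 2 * C * `|w| by rewrite !mulr_ge0.
  have e2 : 0 < eps / (2 * C * `|w| + 1) by rewrite divr_gt0// ltr_wpDl.
  have N1 := near_dist (is_derive_continuous d1) e2.
  have N2 : \forall z \near s, `|z - t0| < delta.
    apply/nbhs_ballP; exists (delta - `|s - t0|) => /=; first by rewrite subr_gt0.
    move=> z; rewrite /ball /= distrC ltrBrDr => zt.
    by rewrite -(subrKA s) (le_lt_trans (ler_normD _ _)).
  near=> z.
  have zd : `|z - t0| < delta by near: z.
  have [h2 _] := HS hq (ltW zd).
  apply: le_trans (c11vat_lip w C0 HF h2 h1) _.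
  have : `|S q z - S q s| < eps / (2 * C * `|w| + 1) by near: z.
  rewrite ltr_pdivlMr ?ltr_wpDl// => /ltW h; apply: le_trans h.
  by rewrite mulrC ler_wpM2l// lerDl.
- move=> h s he sd; have [h0 h1] := andP he.
  have hh : `|h| < e by rewrite gtr0_norm.
  have [b1 b2 b3] := quot_bounds (lt0r_neq0 h0) hq (He _ hh) sd.
  rewrite (gtr0_norm h0) in b2; split=> //.
    by apply: le_trans b2 _; rewrite ler_wpM2r ?(ltW h0)// /K2 lerDl !mulr_ge0.
  by apply: le_trans (dd _ sd _ he) _; rewrite ler_wpM2r ?(ltW h0)// /K2 lerDr !mulr_ge0.
Unshelve. all: by end_near. Qed.

Lemma jac_row p l (G : 'rV[R]_p -> 'rV[R]_l) q a : derivable G q (delta_mx 0 a : 'rV[R]_p) ->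
  row a (jac G q) = 'D_(delta_mx 0 a : 'rV[R]_p) G q.
Proof. by move=> h; rewrite derive_mx//; apply/rowP => k; rewrite !mxE. Qed.

Lemma flow_jac_ode q t : `|q - v0| < d -> `|t - t0| < delta ->
  is_derive t 1 (fun s => jac (fun v => S v s) q) (jac (fun v => S v t) q *m DF (S q t)).
Proof.
move=> hq td; apply/is_derive_mxP => a k.
have N2 : \forall z \near t, `|z - t0| < delta.
  apply/nbhs_ballP; exists (delta - `|t - t0|) => /=; first by rewrite subr_gt0.
  move=> z; rewrite /ball /= distrC ltrBrDr => zt.
  by rewrite -(subrKA t) (le_lt_trans (ler_normD _ _)).
have E s l : `|s - t0| < delta -> jac (fun v => S v s) q a l = ('D_(delta_mx 0 a : 'rV[R]_m) (fun v => S v s) q) 0 l.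
  move=> sd; have /jac_row <- := @flow_derivable q (delta_mx 0 a : 'rV[R]_m) s hq (ltW sd).
  by rewrite [RHS]mxE.
have := flow_D_ode (delta_mx 0 a : 'rV[R]_m) hq td => /is_derive_mxP/(_ 0 k) D.
rewrite (_ : (jac _ q *m _) a k = ('D_(delta_mx 0 a : 'rV[R]_m) (fun v => S v t) q *m DF (S q t)) 0 k); last first.
  by rewrite [LHS]mxE [RHS]mxE; apply: eq_bigr => l _; rewrite E.
by apply: near_eq_is_derive D; apply: filterS N2 => s sd; rewrite E.
Qed.

(** The Jacobian solves the linearised equation with initial value [A0], so [flow_linear] gives the
    expansion, and the difference quotients bound the Jacobian. *)
Lemma flow_c11 t : `|t - t0| < delta -> c11v (fun v => S v t) (jac (fun v => S v t)) v0.
Proof.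
move=> td.
have A0E q : `|q - v0| < d -> jac (fun v => S v t0) q = A0 q.
  move=> hq; apply/row_matrixP => a.
  have cq : c11v (fun v => S v t0) A0 q.
    have d1 : 0 < d - `|q - v0| by rewrite subr_gt0.
    apply: (vec_c11v d1 C10) => x x' z.
    have B y : `|y - q| < d - `|q - v0| -> `|y - v0| < d.
      by rewrite ltrBrDr => h; rewrite -(subrKA q) (le_lt_trans (ler_normD _ _)).
    by move=> /B hx /B hx' /B hz; have [] := H0 hx hx' hz.
  by have [h1 h2] := c11v_derive (delta_mx 0 a) cq; rewrite jac_row// h2 -rowE.
pose n0 : R := m%:R; have n00 : 0 <= n0 by [].
pose B := `|S v0 t| + 2 * C1 * d + 2 * C1 + K.
have B0 : 0 <= B by rewrite !addr_ge0// ?mulr_ge0// ltW.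
apply: (vec_c11v d0 B0) => x x' z hx hx' hz.
have td' := ltW td.
have v0d : `|v0 - v0| < d by rewrite subrr normr0.
have t1 : 0 <= 2 * C1 * d by rewrite !mulr_ge0// ltW.
have t2 : 0 <= 2 * C1 by rewrite !mulr_ge0.
split.
- have := flow_lip hx v0d td' => L.
  rewrite -(subrKC (S v0 t) (S x t)) (le_trans (ler_normD _ _))// /B -!addrA lerD2l.
  apply: le_trans L _; apply: (@le_trans _ _ (2 * C1 * d)); first by rewrite ler_wpM2l// ltW.
  by rewrite lerDl addr_ge0.
- apply: le_trans (flow_lip hx hx' td') _; rewrite ler_wpM2r// /B.
  by rewrite -[_ + 2 * C1 + K]addrA addrC -addrA lerDl addr_ge0// addr_ge0.
- apply: mx_norm_le => // a k.
  have -> : jac (fun v => S v t) z a k = ('D_(delta_mx 0 a : 'rV[R]_m) (fun v => S v t) z) 0 k.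
    by have /jac_row <- := @flow_derivable z (delta_mx 0 a : 'rV[R]_m) t hz td'; rewrite [RHS]mxE.
  have n1 : `|delta_mx 0 a : 'rV[R]_m| <= 1.
    by apply: mx_norm_le => // i j; rewrite mxE; case: (_ && _); rewrite ?normr1 ?normr0.
  have [e e0 He] := flow_D_near (delta_mx 0 a : 'rV[R]_m) hz td'.
  have [e' e'0 He'] := quot_near (delta_mx 0 a : 'rV[R]_m) hz.
  pose h := Num.min 1 (Num.min (e / 2) (e' / 2)).
  have h0 : 0 < h by rewrite !lt_min ltr01 !divr_gt0.
  have he : `|h| < e by rewrite gtr0_norm// !gt_min [e / 2 < e]ltr_pdivrMr// ltr_pMr// ltr1n !orbT.
  have he' : `|h| < e' by rewrite gtr0_norm// !gt_min [e' / 2 < e']ltr_pdivrMr// ltr_pMr// ltr1n !orbT.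
  have h1 : `|h| <= 1 by rewrite gtr0_norm// ge_min lexx.
  have [_ _ b3] := quot_bounds (lt0r_neq0 h0) hz (He' _ he') td'.
  have b4 := He h (lt0r_neq0 h0) he.
  apply: le_trans (mx_entry_le _ _ _) _.
  rewrite -(subrKC (quot z (delta_mx 0 a) h t) ('D_(delta_mx 0 a : 'rV[R]_m) (fun v => S v t) z)).
  rewrite (le_trans (ler_normD _ _))// distrC.
  have b5 : 2 * C1 * `|delta_mx 0 a : 'rV[R]_m| <= 2 * C1 by rewrite ler_piMr.
  have b6 : K * `|delta_mx 0 a : 'rV[R]_m| * `|delta_mx 0 a : 'rV[R]_m| * `|h| <= K.
    by rewrite -[leRHS]mulr1 -[in leRHS](mulr1 K) -[in leRHS](mulr1 (K * 1)) !ler_pM ?mulr_ge0.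
  have b7 : 0 <= `|S v0 t| by [].
  rewrite /B; lra.
- have := @flow_linear z (fun s => (x - x') *m jac (fun v => S v s) z) (x - x') x x' t hz hx hx' _ _ erefl td.
  move=> L; apply: le_trans (L _ _) _.
  + by move=> s sd; rewrite -mulmxA; apply: is_derive_mulmxl; exact: flow_jac_ode.
  + by rewrite A0E.
  + rewrite ler_wpM2r ?addr_ge0// ler_wpM2r// /B lerDr addr_ge0// addr_ge0//.
Qed.

End flow.

End flow_derivative.

(** * Dependence of geodesics on their initial velocity *)

Section dependence.
Context {R : realType} {n : nat} {M : ptopologicalType}.
Variable g : riemannian R n M.
Implicit Types (i j : chart g) (c : R -> M).

Definition overlap i j : set 'rV[R]_n := coord i @` (chart_dom i `&` chart_dom j).

Definition trans i j : 'rV[R]_n -> 'rV[R]_n := coord j \o param i.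

Lemma cod_near i y (B : set M) : cod i y -> open B -> B (param i y) ->
  \forall z \near y, cod i z /\ B (param i z).
Proof.
move=> iy Bo By; near=> z; split; near: z; first exact: open_near (@cod_open _ _ _ g i) iy.
by apply: (param_continuous iy); apply: open_nbhs_nbhs.
Unshelve. all: by end_near. Qed.

Lemma cod_param i y : cod i y -> chart_dom i (param i y) /\ coord i (param i y) = y.
Proof. by move=> [x ix <-]; rewrite coordK. Qed.

Lemma overlap_open i j : open (overlap i j).
Proof.
rewrite openE => y [x [ix jx] <-].
have iy : cod i (coord i x) by exact: cod_coord.
have : \forall z \near coord i x, cod i z /\ chart_dom j (param i z).
  by apply: cod_near => //; [exact: chart_dom_open|rewrite coordK].
apply: filterS => z [iz jz]; have [iz' zE] := cod_param iz.
by exists (param i z).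
Qed.

Lemma overlap_coord i j x : chart_dom i x -> chart_dom j x -> overlap i j (coord i x).
Proof. by move=> ix jx; exists x. Qed.

Lemma trans_c11e i j y k : overlap i j y -> c11e (fun z => trans i j z 0 k) y.
Proof.
move=> ijy; apply: (smooth_c11e (@overlap_open i j) _ ijy).
apply: (@smooth_entry _ _ _ _ _ (coord j \o param i)); first exact: overlap_open.
exact: transition_smooth.
Qed.

Lemma trans_c11 i j y : overlap i j y -> c11v (trans i j) (jac (trans i j)) y.
Proof. by move=> ijy; apply: c11v_jac => k; exact: trans_c11e. Qed.

Lemma trans_jac_c11e i j y a k : overlap i j y -> c11e (fun z => jac (trans i j) z a k) y.
Proof.
move=> ijy; apply: (@c11e_ext _ _ (partial a (fun z => trans i j z 0 k : R^o))).
  by near=> z; rewrite !mxE.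
apply: (smooth_c11e (@overlap_open i j) _ ijy); apply: smooth_partial.
apply: (@smooth_entry _ _ _ _ _ (coord j \o param i)); first exact: overlap_open.
exact: transition_smooth.
Unshelve. all: by end_near. Qed.

(** The change of charts on the tangent bundle; it transports the states of a geodesic, velocity
    included. *)
Definition strans i j (z : 'rV[R]_(n + n)) : 'rV[R]_(n + n) :=
  row_mx (trans i j (lsubmx z)) (rsubmx z *m jac (trans i j) (lsubmx z)).

Lemma strans_c11e i j z k : overlap i j (lsubmx z) -> c11e (fun z => strans i j z 0 k) z.
Proof.
move=> ijz.
have lz l : c11e (fun z : 'rV[R]_(n + n) => lsubmx z 0 l) z.
  by apply: c11e_ext (c11e_coord (lshift n l) z); near=> q; rewrite mxE.
rewrite -(splitK k); case: (fintype.split k) => a /=.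
  apply: (@c11e_ext _ _ (fun z => trans i j (lsubmx z) 0 a)).
    by near=> q; rewrite row_mxEl.
  by apply: (@c11e_compv _ _ _ (fun y => trans i j y 0 a) lsubmx) => //; exact: trans_c11e.
apply: (@c11e_ext _ _ (fun z => \sum_b z 0 (rshift n b) * jac (trans i j) (lsubmx z) b a)).
  by near=> q; rewrite row_mxEr mxE; apply: eq_bigr => b _; rewrite [rsubmx _ _ _]mxE.
apply: c11e_sum => b; apply: c11eM; first exact: c11e_coord.
by apply: (@c11e_compv _ _ _ (fun y => jac (trans i j) y b a) lsubmx) => //; exact: trans_jac_c11e.
Unshelve. all: by end_near. Qed.

Lemma curve_trans i j c t x' : continuous c -> chart_dom i (c t) -> chart_dom j (c t) ->
  is_derive t 1 (coord i \o c) x' ->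
  is_derive t 1 (coord j \o c) (x' *m jac (trans i j) (coord i (c t))).
Proof.
move=> cc it jt dx.
have := c11v_curve (trans_c11 (overlap_coord it jt)) dx.
apply: near_eq_is_derive; have := curve_near_dom cc it.
by apply: filterS => s is_; rewrite /trans /= coordK.
Qed.

Lemma state_trans i j c t : geodesic g c -> chart_dom i (c t) -> chart_dom j (c t) ->
  state j c t = strans i j (state i c t).
Proof.
move=> gc it jt; have [[cc _] _] := gc.
have [_ d] := curve_trans cc it jt (geodesic_coord gc it).
rewrite /strans lsub_state [LHS]stateE derive1E d; congr row_mx.
by rewrite /trans /= coordK.
Qed.

Hypothesis complete : geodesically_complete g.
Variable P : M.
Local Notation gd := (gd complete P).

(** The chart has to contain the point at time [t] for all velocities near [v0], since coordinates
    outside the chart domain are arbitrary. *)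
Definition dep_in i v0 t := [/\ chart_dom i (gd v0 t),
  \forall v \near v0, chart_dom i (gd v t) &
  forall k, c11e (fun v => state i (gd v) t 0 k) v0].

Lemma dep_chart i j v0 t : dep_in i v0 t -> chart_dom j (gd v0 t) -> dep_in j v0 t.
Proof.
move=> [it ni di] jt.
have nj : \forall v \near v0, chart_dom j (gd v t).
  have cs : {for v0, continuous (fun v => state i (gd v) t)}.
    exact: c11v_continuous (c11v_jac di).
  have [ix Bx] : cod i (lsubmx (state i (gd v0) t)) /\ chart_dom j (param i (lsubmx (state i (gd v0) t))).
    by rewrite lsub_state coordK//; split=> //; exact: cod_coord.
  have /near_all[e e0 He] := cod_near ix (@chart_dom_open _ _ _ g j) Bx.
  have N := near_dist cs e0.
  near=> v; have iv : chart_dom i (gd v t) by near: v.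
  rewrite -(coordK iv) -lsub_state; apply: (He _ _).2.
  rewrite -linearB; apply: le_lt_trans (lsub_norm _) _; by near: v.
split=> // k; apply: (@c11e_ext _ _ (fun v => strans i j (state i (gd v) t) 0 k)).
  near=> v; have iv : chart_dom i (gd v t) by near: v.
  have jv : chart_dom j (gd v t) by near: v.
  by rewrite -(state_trans (gd_geodesic complete P v) iv jv).
apply: (@c11e_compv _ _ _ (fun z => strans i j z 0 k) (fun v => state i (gd v) t)) => //.
by apply: strans_c11e; rewrite lsub_state; exact: overlap_coord.
Unshelve. all: by end_near. Qed.

Lemma dep_init v0 : dep_in (chart_at g P) v0 0.
Proof.
have g0 v : gd v 0 = P by have [_ h _] := gdP complete P v.
split; first by rewrite g0; exact: chart_atP.
  by near=> v; rewrite g0; exact: chart_atP.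
move=> k; apply: (@c11e_ext _ _ (fun v => row_mx (coord (chart_at g P) P) v 0 k)).
  near=> v; rewrite stateE; have [_ h1 h2] := gdP complete P v.
  by move: h2; rewrite /velocity h1 => ->.
rewrite -(splitK k); case: (fintype.split k) => a /=.
  by apply: c11e_ext (c11eC (coord (chart_at g P) P 0 a) v0); near=> v; rewrite row_mxEl.
by apply: c11e_ext (c11e_coord a v0); near=> v; rewrite row_mxEr.
Unshelve. all: by end_near. Qed.

(** The linearised geodesic equation, satisfied by the derivative of the state in the initial
    velocity. *)
Definition dep_ode i v0 (t : R) := is_derive t 1
  (fun s => jac (fun v => state i (gd v) s) v0)
  (jac (fun v => state i (gd v) t) v0 *m jac (field i) (state i (gd v0) t)).

Lemma dep_window i zs C rho delta v0 t0 :
  0 <= C -> 0 < delta <= 2^-1 -> delta * C <= 2^-1 ->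
  c11vat C (2 * rho) (field i) (jac (field i)) zs -> stay_box i zs rho delta ->
  `|state i (gd v0) t0 - zs| < rho -> dep_in i v0 t0 ->
  forall t, `|t - t0| < delta -> dep_in i v0 t /\ dep_ode i v0 t.
Proof.
move=> C0 de dC HF stay near0 [it ni di] t td.
have [C1 [d1 [d10 C10 H0]]] := c11v_vec (c11v_jac di).
have cs : {for v0, continuous (fun v => state i (gd v) t0)}.
  exact: c11v_continuous (c11v_jac di).
have /near_all[d2 d20 Hd2] := ni.
have rr : 0 < rho - `|state i (gd v0) t0 - zs| by rewrite subr_gt0.
have /near_all[d3 d30 Hd3] := near_dist cs rr.
pose d := Num.min d1 (Num.min d2 d3).
have d0 : 0 < d by rewrite !lt_min d10 d20.
have HS v : `|v - v0| < d -> forall s, `|s - t0| <= delta ->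
   `|state i (gd v) s - zs| < 2 * rho /\ is_derive s 1 (state i (gd v)) (field i (state i (gd v) s)).
  rewrite !lt_min => /and3P[_ /Hd2 iv /Hd3 sv] s sd.
  have sv' : `|state i (gd v) t0 - zs| < rho.
    rewrite -(subrKA (state i (gd v0) t0)) (le_lt_trans (ler_normD _ _))//.
    by rewrite -ltrBrDr.
  have [h1 h2] := stay _ _ (gd_geodesic complete P v) iv sv' s sd.
  by split=> //; exact: geodesic_ode (gd_geodesic complete P v) h1.
have dom v : `|v - v0| < d -> chart_dom i (gd v t).
  rewrite !lt_min => /and3P[_ /Hd2 iv /Hd3 sv].
  have sv' : `|state i (gd v) t0 - zs| < rho.
    rewrite -(subrKA (state i (gd v0) t0)) (le_lt_trans (ler_normD _ _))//.
    by rewrite -ltrBrDr.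
  by have [] := stay _ _ (gd_geodesic complete P v) iv sv' t (ltW td).
have H0d : c11vat C1 d (fun v => state i (gd v) t0) (jac (fun v => state i (gd v) t0)) v0.
  by move=> x x' z; rewrite !lt_min => /and3P[hx _ _] /and3P[hx' _ _] /and3P[hz _ _]; exact: H0.
have v0d : `|v0 - v0| < d by rewrite subrr normr0.
split; last by rewrite /dep_ode; exact: (@flow_jac_ode R n (n + n) (fun v => state i (gd v)) (field i) (jac (field i)) _ v0 zs t0 delta C (2 * rho) C1 d C0 C10 de dC HF HS H0d).
split; first exact: dom.
  by near=> v; apply: dom; near: v; exact: near_norm.
move=> k; exists (fun q => col k (jac (fun v => state i (gd v) t) q)).
exact: (@flow_c11 R n (n + n) (fun v => state i (gd v)) (field i) (jac (field i)) _ v0 zs t0 delta C (2 * rho) C1 d C0 C10 d0 de dC HF HS H0d).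
Unshelve. all: by end_near. Qed.

(** Continuation along the geodesic by flow boxes and changes of charts, starting at time 0, where
    the state is affine in the velocity. *)
Lemma dep_all v0 t : 0 <= t -> forall i, chart_dom i (gd v0 t) -> dep_in i v0 t.
Proof.
move=> t0.
suff : forall s, 0 <= s <= t -> exists i, dep_in i v0 s.
  move=> /(_ t); rewrite t0 lexx => /(_ isT)[j dj] i it; exact: dep_chart dj it.
apply: real_induction => s /andP[s0 st] IH.
have gc := gd_geodesic complete P v0.
have [i is_] := chart_cover g (gd v0 s).
have ict : cod i (lsubmx (state i (gd v0) s)) by rewrite lsub_state; exact: cod_coord.
have [C [rho [delta [C0 rho0 de dC [F2 _ box]]]]] := flow_box ict; have [de0 _] := andP de.
have Near := geodesic_near_state gc is_ rho0.
have [r [sr rs dr rho_r]] : exists r, [/\ s - delta < r, r <= s, dep_in i v0 r &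
     `|state i (gd v0) r - state i (gd v0) s| < rho].
  move: s0; rewrite le_eqVlt => /orP[/eqP s0|s0].
    have [h1 h2] := nbhs_singleton Near.
    exists s; split; rewrite ?gtrBl//; apply: (@dep_chart (chart_at g P)) => //.
    by rewrite -s0; exact: dep_init.
  have [|r /andP[r1 r2] [h1 h2]] := @near_left R _ s (Num.max 0 (s - delta / 2)) _ Near.
    by rewrite gt_max s0 /= gtrBl divr_gt0.
  move: r1; rewrite ge_max => /andP[r1 r3].
  exists r; split => //; first by apply: lt_le_trans r3; move: de0; lra.
    exact: ltW.
  have [|j dj] := IH r; first by rewrite r1.
  exact: dep_chart dj h1.
exists (r + delta - s); first by move: sr; lra.
move=> z /andP[sz ze] zt; exists i.
have zr : `|z - r| < delta.
  by rewrite ltr_norml; move: rs sr sz ze de0; lra.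
by have [] := dep_window C0 de dC F2 box rho_r dr zr.
Qed.

End dependence.

(** * Covariant derivatives and curvature *)

Section tensor_calculus.
Context {R : realType} {n : nat}.
Implicit Types (q : 'I_n -> 'I_n -> 'rV[R]_n -> R) (y u v w : 'rV[R]_n).

Definition bil q y u v : R := \sum_(a < n) \sum_(b < n) q a b y * u 0 a * v 0 b.

Definition dbil q y w u v : R :=
  \sum_(a < n) \sum_(b < n) (w *m grad (q a b) y) 0 0 * u 0 a * v 0 b.

Lemma bil_is_linear_l q y v : linear (fun u => bil q y u v : R^o).
Proof.
move=> c u u'; rewrite /bil scaler_sumr -big_split; apply: eq_bigr => a _ /=.
rewrite scaler_sumr -big_split; apply: eq_bigr => b _ /=.
by rewrite !mxE /GRing.scale /=; ring.
Qed.

Lemma bil_is_linear_r q y u : linear (fun v => bil q y u v : R^o).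
Proof.
move=> c v v'; rewrite /bil scaler_sumr -big_split; apply: eq_bigr => a _ /=.
rewrite scaler_sumr -big_split; apply: eq_bigr => b _ /=.
by rewrite !mxE /GRing.scale /=; ring.
Qed.

Lemma bilDl q y u u' v : bil q y (u + u') v = bil q y u v + bil q y u' v.
Proof. by have := bil_is_linear_l q y v 1 u u'; rewrite !scale1r. Qed.

Lemma bilDr q y u v v' : bil q y u (v + v') = bil q y u v + bil q y u v'.
Proof. by have := bil_is_linear_r q y u 1 v v'; rewrite !scale1r. Qed.

Lemma bil0l q y v : bil q y 0 v = 0.
Proof. by rewrite /bil big1// => a _; rewrite big1// => b _; rewrite mxE mulr0 mul0r. Qed.

Lemma bil0r q y u : bil q y u 0 = 0.
Proof. by rewrite /bil big1// => a _; rewrite big1// => b _; rewrite mxE mulr0. Qed.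

Lemma bilZl q y c u v : bil q y (c *: u) v = c * bil q y u v.
Proof. by have := bil_is_linear_l q y v c u 0; rewrite !addr0 bil0l addr0. Qed.

Lemma bilZr q y c u v : bil q y u (c *: v) = c * bil q y u v.
Proof. by have := bil_is_linear_r q y u c v 0; rewrite !addr0 bil0r addr0. Qed.

Lemma bil_sym q y u v : (forall a b, q a b y = q b a y) -> bil q y u v = bil q y v u.
Proof.
move=> qs; rewrite /bil exchange_big /=; apply: eq_bigr => a _; apply: eq_bigr => b _.
by rewrite qs mulrAC.
Qed.

Lemma dbil_sym q y w u v : (forall a b, \forall z \near y, q a b z = q b a z) ->
  dbil q y w u v = dbil q y w v u.
Proof.
move=> qs; rewrite /dbil exchange_big /=; apply: eq_bigr => a _; apply: eq_bigr => b _.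
rewrite mulrAC; suff -> : grad (q a b) y = grad (q b a) y by [].
by apply/colP => l; rewrite !mxE; exact: near_eq_derive.
Qed.

Lemma is_derive_sumf m (h : 'I_m -> R -> R) (t : R) dh :
  (forall k, is_derive t 1 (h k) (dh k)) ->
  is_derive t 1 (fun s => \sum_(k < m) h k s) (\sum_(k < m) dh k).
Proof.
move=> H; have -> : (fun s => \sum_(k < m) h k s) = \sum_(k < m) h k.
  by apply/funext => s; rewrite fct_sumE.
exact: is_derive_sum.
Qed.

Lemma is_derive_mul (f h : R -> R) (t : R) df dh : is_derive t 1 f df -> is_derive t 1 h dh ->
  is_derive t 1 (fun s => f s * h s) (df * h t + f t * dh).
Proof.
move=> hf hh; have := @is_deriveM R R f h t 1 df dh hf hh.
by rewrite /GRing.scale /= [h t * _]mulrC addrC.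
Qed.

Lemma bil_derive q (x A B : R -> 'rV[R]_n) (t : R) x' A' B' :
  (forall a b, c11e (q a b) (x t)) ->
  is_derive t 1 x x' -> is_derive t 1 A A' -> is_derive t 1 B B' ->
  is_derive t 1 (fun s => bil q (x s) (A s) (B s))
    (dbil q (x t) x' (A t) (B t) + bil q (x t) A' (B t) + bil q (x t) (A t) B').
Proof.
move=> hq hx /is_derive_mxP hA /is_derive_mxP hB.
rewrite /bil /dbil -!big_split /=; apply: is_derive_sumf => a.
rewrite -!big_split /=; apply: is_derive_sumf => b.
have hqx := c11_curve (c11e_grad (hq a b)) hx.
have := is_derive_mul (is_derive_mul hqx (hA 0 a)) (hB 0 b).
by rewrite mulrDl.
Qed.

End tensor_calculus.

(** * The metric, the Christoffel symbols and the curvature in a chart *)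

Section riemannian_algebra.
Context {R : realType} {n : nat} {M : ptopologicalType}.
Variable g : riemannian R n M.
Implicit Types (i j : chart g) (y u v w : 'rV[R]_n).

Definition gcoef i a b := fun z : 'rV[R]_n => metric i z a b : R^o.

Definition ip i y u v := bil (gcoef i) y u v.

Lemma ipE i y u v : ip i y u v = (u *m metric i y *m v^T) 0 0.
Proof.
rewrite /ip /bil mxE exchange_big /=; apply: eq_bigr => b _.
rewrite !mxE mulr_suml; apply: eq_bigr => a _; rewrite /gcoef; ring.
Qed.

Lemma inner_ip (x : M) u v : inner g x u v = ip (chart_at g x) (coord (chart_at g x) x) u v.
Proof. by rewrite ipE. Qed.

Lemma gcoef_sym i y a b : cod i y -> gcoef i a b y = gcoef i b a y.
Proof. by move=> iy; rewrite /gcoef -[in LHS](metric_sym iy) mxE. Qed.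

Lemma gcoef_sym_near i y a b : cod i y -> \forall z \near y, gcoef i a b z = gcoef i b a z.
Proof. by move=> iy; apply: filterS (open_near (@cod_open _ _ _ g i) iy) => z; exact: gcoef_sym. Qed.

Lemma gcoef_c11 i y a b : cod i y -> c11e (gcoef i a b) y.
Proof. exact: metric_c11. Qed.

Lemma ip_sym i y u v : cod i y -> ip i y u v = ip i y v u.
Proof. by move=> iy; apply: bil_sym => a b; exact: gcoef_sym. Qed.

Lemma ip_ge0 i y u : cod i y -> 0 <= ip i y u u.
Proof.
move=> iy; have [->|u0] := eqVneq u 0; first by rewrite /ip bil0l.
by rewrite ipE ltW// metric_pos.
Qed.

Lemma ip_eq0 i y u : cod i y -> ip i y u u = 0 -> u = 0.
Proof.
move=> iy u0; apply/eqP; apply: contraT => un0.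
by have := metric_pos iy un0; rewrite -ipE u0 ltxx.
Qed.

Lemma ip_sub_scale i y u v c : cod i y ->
  ip i y (u - c *: v) (u - c *: v) = ip i y u u - 2 * c * ip i y u v + c ^+ 2 * ip i y v v.
Proof.
move=> iy; rewrite -scaleNr /ip !bilDl !bilDr !bilZl !bilZr.
rewrite -/(ip i y v u) -/(ip i y u v) (ip_sym v u iy); ring.
Qed.

Lemma ip_CS i y u v : cod i y -> ip i y u v ^+ 2 <= ip i y u u * ip i y v v.
Proof.
move=> iy; have [v0|v0] := eqVneq (ip i y v v) 0.
  by rewrite (ip_eq0 iy v0) /ip !bil0r expr2 mul0r mulr0.
have vp : 0 < ip i y v v by rewrite lt_neqAle eq_sym v0 ip_ge0.
have := ip_ge0 (u - (ip i y u v / ip i y v v) *: v) iy.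
rewrite ip_sub_scale//.
have -> : ip i y u u - 2 * (ip i y u v / ip i y v v) * ip i y u v +
   (ip i y u v / ip i y v v) ^+ 2 * ip i y v v = ip i y u u - ip i y u v ^+ 2 / ip i y v v.
  by field.
by rewrite subr_ge0 ler_pdivrMr.
Qed.

(* Cauchy-Schwarz for the components orthogonal to [w]; for [w = 0] the
   divisions give [0]. *)
Lemma ip_CS_perp i y u v w W : cod i y -> W = ip i y w w ->
  (ip i y u v - ip i y u w * ip i y v w / W) ^+ 2 <=
  (ip i y u u - ip i y u w ^+ 2 / W) * (ip i y v v - ip i y v w ^+ 2 / W).
Proof.
move=> iy WE; have [W0|W0] := eqVneq W 0.
  by rewrite W0 invr0 !mulr0 !subr0; exact: ip_CS.
have P z z' : ip i y (z - (ip i y z w / W) *: w) (z' - (ip i y z' w / W) *: w) =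
   ip i y z z' - ip i y z w * ip i y z' w / W.
  have h1 : bil (gcoef i) y w z' = bil (gcoef i) y z' w by exact: (ip_sym w z' iy).
  have h2 : bil (gcoef i) y w w = W by rewrite WE.
  rewrite -![- (_ *: w)]scaleNr /ip !bilDl !bilDr !bilZl !bilZr h1 h2; field.
  exact: W0.
have := ip_CS (u - (ip i y u w / W) *: w) (v - (ip i y v w / W) *: w) iy.
by rewrite !P !expr2.
Qed.

Lemma christoffel_sym i k a b y : cod i y -> christoffel i k a b y = christoffel i k b a y.
Proof.
move=> iy; rewrite /christoffel; congr (_ * _); apply: eq_bigr => l _; congr (_ * _).
rewrite [partial a _ _ + _]addrC; congr (_ - _).
exact: near_eq_derive (gcoef_sym_near a b iy).
Qed.

Lemma GamE' i y u v k : Gam i y u v 0 k = bil (christoffel i k) y u v.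
Proof. by rewrite GamE mxE. Qed.

Lemma Gam_sym i y u v : cod i y -> Gam i y u v = Gam i y v u.
Proof.
move=> iy; apply/rowP => k; rewrite !GamE'; apply: bil_sym => a b.
exact: christoffel_sym.
Qed.

Lemma GamDl i y u u' v : Gam i y (u + u') v = Gam i y u v + Gam i y u' v.
Proof. by apply/rowP => k; rewrite !(GamE', mxE) bilDl. Qed.

Lemma GamDr i y u v v' : Gam i y u (v + v') = Gam i y u v + Gam i y u v'.
Proof. by apply/rowP => k; rewrite !(GamE', mxE) bilDr. Qed.

Lemma GamZl i y c u v : Gam i y (c *: u) v = c *: Gam i y u v.
Proof. by apply/rowP => k; rewrite !(GamE', mxE) bilZl. Qed.

Lemma GamZr i y c u v : Gam i y u (c *: v) = c *: Gam i y u v.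
Proof. by apply/rowP => k; rewrite !(GamE', mxE) bilZr. Qed.

Lemma GamNl i y u v : Gam i y (- u) v = - Gam i y u v.
Proof. by rewrite -scaleN1r GamZl scaleN1r. Qed.

Lemma mul_grad (f : 'rV[R]_n -> R^o) y w : (w *m grad f y) 0 0 = \sum_l w 0 l * partial l f y.
Proof. by rewrite mxE; apply: eq_bigr => l _; rewrite mxE. Qed.

Lemma koszul i y u v w : cod i y -> 2 * ip i y (Gam i y u v) w =
  dbil (gcoef i) y u v w + dbil (gcoef i) y v u w - dbil (gcoef i) y w u v.
Proof.
move=> iy.
(* Twice the Christoffel symbols of the first kind, contracted with [u] and [v]; raising the index
   gives [Gam]. *)
pose L : 'rV[R]_n := \row_l \sum_a \sum_b (partial a (gcoef i b l) y + partial b (gcoef i a l) y - partial l (gcoef i a b) y) * u 0 a * v 0 b.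
have GL : Gam i y u v = 2^-1 *: (L *m invmx (metric i y)).
  apply/rowP => k; rewrite GamE' /bil !mxE.
  under eq_bigr do under eq_bigr do rewrite /christoffel -!mulrA.
  under eq_bigr do rewrite -mulr_sumr.
  rewrite -mulr_sumr; congr (_ * _).
  under eq_bigr do under eq_bigr do rewrite mulr_suml.
  under eq_bigr do rewrite exchange_big /=.
  rewrite exchange_big /=; apply: eq_bigr => l _.
  rewrite mxE mulr_suml; apply: eq_bigr => a _; rewrite mulr_suml; apply: eq_bigr => b _.
  have -> : invmx (metric i y) l k = invmx (metric i y) k l.
    by rewrite -[in LHS](metric_sym iy) -trmx_inv mxE.
  by rewrite /gcoef; ring.
have -> : 2 * ip i y (Gam i y u v) w = (L *m w^T) 0 0.
  rewrite ipE GL -scalemxAl -mulmxA mulVmx ?metric_unit// mulmx1 -scalemxAl mxE.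
  by rewrite mulrA divff ?mul1r.
rewrite mxE.
have -> : dbil (gcoef i) y u v w = \sum_l \sum_a \sum_b partial a (gcoef i b l) y * u 0 a * v 0 b * w 0 l.
  rewrite /dbil exchange_big /=; apply: eq_bigr => l _.
  rewrite exchange_big /=; apply: eq_bigr => b _.
  by rewrite mul_grad !mulr_suml; apply: eq_bigr => a _; ring.
have -> : dbil (gcoef i) y v u w = \sum_l \sum_a \sum_b partial b (gcoef i a l) y * u 0 a * v 0 b * w 0 l.
  rewrite /dbil exchange_big /=; apply: eq_bigr => l _; apply: eq_bigr => a _.
  by rewrite mul_grad !mulr_suml; apply: eq_bigr => b _; ring.
have -> : dbil (gcoef i) y w u v = \sum_l \sum_a \sum_b partial l (gcoef i a b) y * u 0 a * v 0 b * w 0 l.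
  rewrite /dbil [RHS]exchange_big /=; apply: eq_bigr => a _.
  rewrite exchange_big /=; apply: eq_bigr => b _.
  by rewrite mul_grad !mulr_suml; apply: eq_bigr => l _; ring.
rewrite -sumrN -!big_split /=; apply: eq_bigr => l _.
rewrite !mxE mulr_suml -sumrN -!big_split /=; apply: eq_bigr => a _.
rewrite mulr_suml -sumrN -!big_split /=; apply: eq_bigr => b _; ring.
Qed.

Lemma metric_compat i y u v w : cod i y ->
  ip i y (Gam i y w u) v + ip i y u (Gam i y w v) = dbil (gcoef i) y w u v.
Proof.
move=> iy; rewrite (ip_sym u _ iy).
have k1 := koszul w u v iy; have k2 := koszul w v u iy.
have s1 := @dbil_sym R n (gcoef i) y w v u (fun a b => gcoef_sym_near a b iy).
have s2 := @dbil_sym R n (gcoef i) y u v w (fun a b => gcoef_sym_near a b iy).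
have s3 := @dbil_sym R n (gcoef i) y v u w (fun a b => gcoef_sym_near a b iy).
by move: k1 k2 s1 s2 s3; lra.
Qed.

(* [A'] is the derivative of the components [A] of a field along a curve through
   [y] with velocity [x']. *)
Definition cov i y x' A A' := A' + Gam i y x' A.

Lemma ip_derive i (x A B : R -> 'rV[R]_n) (t : R) x' A' B' : cod i (x t) ->
  is_derive t 1 x x' -> is_derive t 1 A A' -> is_derive t 1 B B' ->
  is_derive t 1 (fun s => ip i (x s) (A s) (B s))
    (ip i (x t) (cov i (x t) x' (A t) A') (B t) + ip i (x t) (A t) (cov i (x t) x' (B t) B')).
Proof.
move=> it hx hA hB.
have := @bil_derive R n (gcoef i) x A B t x' A' B' (fun a b => gcoef_c11 a b it) hx hA hB.
rewrite -(metric_compat _ _ _ it) => D.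
rewrite (_ : _ + _ = ip i (x t) (Gam i (x t) x' (A t)) (B t) + ip i (x t) (A t) (Gam i (x t) x' (B t)) +
   bil (gcoef i) (x t) A' (B t) + bil (gcoef i) (x t) (A t) B')//.
by rewrite /cov /ip !bilDl !bilDr; ring.
Qed.

Definition dGam i y w u v : 'rV[R]_n := \row_k dbil (christoffel i k) y w u v.

Lemma dGam_sym i y w u v : cod i y -> dGam i y w u v = dGam i y w v u.
Proof.
move=> iy; apply/rowP => k; rewrite !mxE; apply: dbil_sym => a b.
by apply: filterS (open_near (@cod_open _ _ _ g i) iy) => z; exact: christoffel_sym.
Qed.

Lemma Gam_derive i (x A B : R -> 'rV[R]_n) (t : R) x' A' B' : cod i (x t) ->
  is_derive t 1 x x' -> is_derive t 1 A A' -> is_derive t 1 B B' ->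
  is_derive t 1 (fun s => Gam i (x s) (A s) (B s))
    (dGam i (x t) x' (A t) (B t) + Gam i (x t) A' (B t) + Gam i (x t) (A t) B').
Proof.
move=> it hx hA hB; apply/is_derive_mxP => a k; rewrite ord1 !mxE !GamE'.
have := @bil_derive R n (christoffel i k) x A B t x' A' B' (fun a b => christoffel_c11 k a b it) hx hA hB.
by apply: near_eq_is_derive; near=> s; rewrite GamE'.
Unshelve. all: by end_near. Qed.

Definition Rm i y u v w : 'rV[R]_n :=
  \row_l \sum_(a < n) \sum_(b < n) \sum_(c < n) riemann_coef i l a b c y * u 0 a * v 0 b * w 0 c.

Lemma curvature_Rm (x : M) u v w :
  curvature_op g x u v w = Rm (chart_at g x) (coord (chart_at g x) x) u v w.
Proof. by []. Qed.

(** The form in which the curvature shows up when the geodesic equation is linearised: derivatives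
    of the Christoffel symbols, antisymmetrised, plus the commutator of their contractions. *)
Lemma Rm_expand i y u v w : Rm i y u v w =
  dGam i y u v w - dGam i y v u w + (Gam i y u (Gam i y v w) - Gam i y v (Gam i y u w)).
Proof.
apply/rowP => l; rewrite !mxE !GamE' /dbil /bil.
under [X in _ = _ + (X - _)]eq_bigr do under eq_bigr do rewrite GamE' /bil.
under [X in _ = _ + (_ - X)]eq_bigr do under eq_bigr do rewrite GamE' /bil.
have E1 : \sum_a \sum_b (u *m grad (christoffel i l a b) y) 0 0 * v 0 a * w 0 b =
   \sum_a \sum_b \sum_c partial a (christoffel i l b c) y * u 0 a * v 0 b * w 0 c.
  rewrite [RHS]exchange_big /=; apply: eq_bigr => b _; rewrite exchange_big /=.
  by apply: eq_bigr => c _; rewrite mul_grad !mulr_suml; apply: eq_bigr => a _; ring.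
have E2 : \sum_a \sum_b (v *m grad (christoffel i l a b) y) 0 0 * u 0 a * w 0 b =
   \sum_a \sum_b \sum_c partial b (christoffel i l a c) y * u 0 a * v 0 b * w 0 c.
  apply: eq_bigr => a _; rewrite exchange_big /=.
  by apply: eq_bigr => c _; rewrite mul_grad !mulr_suml; apply: eq_bigr => b _; ring.
have E3 : \sum_a \sum_m christoffel i l a m y * u 0 a * (\sum_b \sum_c christoffel i m b c y * v 0 b * w 0 c)
   = \sum_a \sum_b \sum_c (\sum_m christoffel i m b c y * christoffel i l a m y) * u 0 a * v 0 b * w 0 c.
  apply: eq_bigr => a _.
  under eq_bigr do rewrite mulr_sumr; rewrite exchange_big /=; apply: eq_bigr => b _.
  under eq_bigr do rewrite mulr_sumr; rewrite exchange_big /=; apply: eq_bigr => c _.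
  by rewrite !mulr_suml; apply: eq_bigr => m _; ring.
have E4 : \sum_b \sum_m christoffel i l b m y * v 0 b * (\sum_a \sum_c christoffel i m a c y * u 0 a * w 0 c)
   = \sum_a \sum_b \sum_c (\sum_m christoffel i m a c y * christoffel i l b m y) * u 0 a * v 0 b * w 0 c.
  rewrite [RHS]exchange_big /=; apply: eq_bigr => b _.
  under eq_bigr do rewrite mulr_sumr; rewrite exchange_big /=; apply: eq_bigr => a _.
  under eq_bigr do rewrite mulr_sumr; rewrite exchange_big /=; apply: eq_bigr => c _.
  by rewrite !mulr_suml; apply: eq_bigr => m _; ring.
rewrite E1 E2 E3 E4 -!sumrN -!big_split /=; apply: eq_bigr => a _.
rewrite -!sumrN -!big_split /=; apply: eq_bigr => b _.
rewrite -!sumrN -!big_split /=; apply: eq_bigr => c _.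
rewrite /riemann_coef sumrB.
move: (partial a _ y) (partial b _ y) (\sum_(m < n) _) (\sum_(m < n) _) (u 0 a) (v 0 b) (w 0 c).
by move=> *; ring.
Qed.

Lemma Rm_diag i y u v c : Rm i y (c *: u) u v = 0.
Proof.
have E w' w u' v' : dGam i y (c *: w') u' v' = c *: dGam i y w' u' v' /\
    dGam i y w (c *: u') v' = c *: dGam i y w u' v'.
  split; apply/rowP => k; rewrite !mxE /dbil mulr_sumr; apply: eq_bigr => a _;
  rewrite mulr_sumr; apply: eq_bigr => b _.
    have -> : (c *: w' *m grad (christoffel i k a b) y) 0 0 = c * (w' *m grad (christoffel i k a b) y) 0 0.
      by rewrite -scalemxAl mxE.
    by ring.
  by rewrite [(c *: u') 0 a]mxE; ring.
rewrite Rm_expand (E u 0 u v).1 (E 0 u u v).2 !GamZl GamZr.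
by rewrite !subrr addr0.
Qed.

End riemannian_algebra.

(** * Jacobi fields *)

Section jacobi_fields.
Context {R : realType} {n : nat} {M : ptopologicalType}.
Variable g : riemannian R n M.
Implicit Types (i j : chart g) (c : R -> M).

Lemma line_is_derive_id (V : normedModType R) (z u : V) (s : R) :
  is_derive s 1 (fun t => z + t *: u) u.
Proof.
have [h e] : is_diff s ( *:%R ^~ u) ( *:%R ^~ u) by exact: is_diff_scalel.
have d : is_derive s 1 (fun t => t *: u) u.
  by split; [apply/derivable1_diffP|rewrite deriveE// e scale1r].
have := is_deriveD (is_derive_cst z s 1) d; rewrite add0r.
by apply: near_eq_is_derive; near=> t.
Unshelve. all: by end_near. Qed.

Lemma lsub_line (p q : nat) (z u : 'rV[R]_(p + q)) t : lsubmx (z + t *: u) = lsubmx z + t *: lsubmx u.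
Proof. by rewrite linearD linearZ. Qed.

Lemma rsub_line (p q : nat) (z u : 'rV[R]_(p + q)) t : rsubmx (z + t *: u) = rsubmx z + t *: rsubmx u.
Proof. by rewrite linearD linearZ. Qed.

Lemma is_derive_unique (V : normedModType R) (f : R -> V) (t : R) d d' :
  is_derive t 1 f d -> is_derive t 1 f d' -> d = d'.
Proof. by move=> [_ <-] [_ <-]. Qed.

(** The differential of the spray, read off from its derivative along the line through [z]. The
    derivative of the Christoffel symbols in it is the source of the curvature in the Jacobi
    equation. *)
Lemma jac_field i z u : cod i (lsubmx z) ->
  u *m jac (field i) z = row_mx (rsubmx u)
   (- (dGam i (lsubmx z) (lsubmx u) (rsubmx z) (rsubmx z)
       + Gam i (lsubmx z) (rsubmx u) (rsubmx z) + Gam i (lsubmx z) (rsubmx z) (rsubmx u))).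
Proof.
move=> iz.
have z0 : z + (0 : R) *: u = z by rewrite scale0r addr0.
have dL : is_derive (0 : R) 1 (fun t => field i (z + t *: u)) (u *m jac (field i) z).
  have := @c11v_curve R _ _ (field i) _ (fun t => z + t *: u) 0 u _ (line_is_derive_id z u 0).
  by rewrite z0; apply; exact: field_c11.
apply: is_derive_unique dL _.
have lx : is_derive (0 : R) 1 (fun t : R => lsubmx z + t *: lsubmx u) (lsubmx u) by exact: line_is_derive_id.
have ly : is_derive (0 : R) 1 (fun t : R => rsubmx z + t *: rsubmx u) (rsubmx u) by exact: line_is_derive_id.
have l0 : lsubmx z + (0 : R) *: lsubmx u = lsubmx z by rewrite scale0r addr0.
have r0 : rsubmx z + (0 : R) *: rsubmx u = rsubmx z by rewrite scale0r addr0.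
have iz' : cod i (lsubmx z + (0 : R) *: lsubmx u) by rewrite l0.
have := Gam_derive iz' lx ly ly; rewrite l0 r0 => dG.
have := @is_derive_row_mx R _ _ _ (fun=> rsubmx u) _ (fun=> _) 0 ly (is_deriveN dG).
by apply: near_eq_is_derive; near=> t; rewrite fieldE lsub_line rsub_line.
Unshelve. all: by end_near. Qed.

Lemma ip_trans i j (x : M) u w : chart_dom i x -> chart_dom j x ->
  ip i (coord i x) u w = ip j (coord j x) (u *m jac (trans i j) (coord i x)) (w *m jac (trans i j) (coord i x)).
Proof.
move=> ix jx; rewrite !ipE (metric_transition ix jx).
rewrite (c11v_jacobian (trans_c11 (overlap_coord ix jx))) trmx_mul !mulmxA.
by [].
Qed.

Hypothesis complete : geodesically_complete g.
Variable P : M.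
Local Notation gd := (gd complete P).

(** Derivatives at time 0 are two-sided, while [dep_all] covers nonnegative times only. Around 0 the
    flow box at the base point reaches both sides. *)
Lemma dep_near v (t : R) : 0 <= t -> \forall s \near t, forall i, chart_dom i (gd v s) -> dep_in complete P i v s.
Proof.
rewrite le_eqVlt => /orP[/eqP <-|t0]; last first.
  have : \forall s \near t, 0 < s by apply: (@cvgr_gt _ _ (nbhs t) _ id t) => //; exact: cvg_id.
  by apply: filterS => s /ltW s0 i; exact: dep_all.
have [_ g0 _] := gdP complete P v.
pose i := chart_at g P; have it : chart_dom i (gd v 0) by rewrite g0; exact: chart_atP.
have ict : cod i (lsubmx (state i (gd v) 0)) by rewrite lsub_state; exact: cod_coord.
have [C [rho [delta [C0 rho0 de dC [F2 _ box]]]]] := flow_box ict; have [de0 _] := andP de.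
have z0 : `|state i (gd v) 0 - state i (gd v) 0| < rho by rewrite subrr normr0.
apply/nbhs_ballP; exists delta => //= s; rewrite /ball /= distrC => sd j js.
have [di _] := dep_window C0 de dC F2 box z0 (dep_init complete P v) sd.
exact: dep_chart di js.
Qed.

(* In the chart [i], [xx] and [yy] are the components of the geodesic [gd v] and of
   its velocity; [Jx] are those of the Jacobi field d/ds gd (v + s k) at [s = 0],
   and [Jy] their derivatives. *)
Definition Jst i v (k : 'rV[R]_n) t := k *m jac (fun w => state i (gd w) t) v.
Definition Jx i v k t := lsubmx (Jst i v k t).
Definition Jy i v k t := rsubmx (Jst i v k t).
Definition xx i v t := coord i (gd v t).
Definition yy i v t := rsubmx (state i (gd v) t).

Lemma Jst_curve i v k t : dep_in complete P i v t ->
  is_derive (0 : R) 1 (fun s => state i (gd (v + s *: k)) t) (Jst i v k t).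
Proof.
move=> [it ni di].
have := @c11v_curve R _ _ (fun w => state i (gd w) t) _ (fun s => v + s *: k) 0 k _ (line_is_derive_id v k 0).
by rewrite scale0r addr0; apply; exact: c11v_jac.
Qed.

Lemma is_derive_lsub (p q : nat) (z : R -> 'rV[R]_(p + q)) (t : R) z' : is_derive t 1 z z' ->
  is_derive t 1 (fun s => lsubmx (z s)) (lsubmx z').
Proof.
move=> /is_derive_mxP h; apply/is_derive_mxP => a b; rewrite mxE.
by apply: near_eq_is_derive (h a (lshift q b)); near=> s; rewrite mxE.
Unshelve. all: by end_near. Qed.

Lemma is_derive_rsub (p q : nat) (z : R -> 'rV[R]_(p + q)) (t : R) z' : is_derive t 1 z z' ->
  is_derive t 1 (fun s => rsubmx (z s)) (rsubmx z').
Proof.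
move=> /is_derive_mxP h; apply/is_derive_mxP => a b; rewrite mxE.
by apply: near_eq_is_derive (h a (rshift p b)); near=> s; rewrite mxE.
Unshelve. all: by end_near. Qed.

Lemma Jx_curve i v k t : dep_in complete P i v t ->
  is_derive (0 : R) 1 (fun s => coord i (gd (v + s *: k) t)) (Jx i v k t).
Proof.
move=> /(Jst_curve k)/is_derive_lsub; apply: near_eq_is_derive.
by near=> s; rewrite lsub_state.
Unshelve. all: by end_near. Qed.

Lemma Jy_curve i v k t : dep_in complete P i v t ->
  is_derive (0 : R) 1 (fun s => yy i (v + s *: k) t) (Jy i v k t).
Proof. by move=> /(Jst_curve k)/is_derive_rsub. Qed.

Lemma line_near (v k : 'rV[R]_n) (B : 'rV[R]_n -> Prop) : (\forall w \near v, B w) ->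
  \forall s \near (0 : R), B (v + s *: k).
Proof.
move=> h; have c : (fun s : R => v + s *: k) @ (0 : R) --> v.
  have := is_derive_continuous (line_is_derive_id v k (0 : R)).
  by rewrite /prop_for /continuous_at scale0r addr0.
exact: c h.
Qed.

Lemma Jx_trans i j v k t : dep_in complete P i v t -> dep_in complete P j v t ->
  Jx j v k t = Jx i v k t *m jac (trans i j) (xx i v t).
Proof.
move=> di dj; have [it ni _] := di; have [jt nj _] := dj.
apply: is_derive_unique (Jx_curve k dj) _.
have z0 : v + (0 : R) *: k = v by rewrite scale0r addr0.
have := @c11v_curve R _ _ (trans i j) (jac (trans i j)) (fun s => coord i (gd (v + s *: k) t)) 0 _ _ (Jx_curve k di).
rewrite z0 => /(_ (trans_c11 (overlap_coord it jt))).
apply: near_eq_is_derive.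
have : \forall w \near v, trans i j (coord i (gd w t)) = coord j (gd w t).
  by near=> w; rewrite /trans /= coordK//; near: w.
exact: line_near.
Unshelve. all: by end_near. Qed.

Lemma xx_derive i v t : chart_dom i (gd v t) -> is_derive t 1 (xx i v) (yy i v t).
Proof. by move=> it; exact: geodesic_coord (gd_geodesic complete P v) it. Qed.

Lemma state_split i v t : state i (gd v) t = row_mx (xx i v t) (yy i v t).
Proof. by rewrite /xx /yy -lsub_state hsubmxK. Qed.

Lemma yy_derive i v t : chart_dom i (gd v t) ->
  is_derive t 1 (yy i v) (- Gam i (xx i v t) (yy i v t) (yy i v t)).
Proof.
move=> it; have := is_derive_rsub (geodesic_ode (gd_geodesic complete P v) it).
by rewrite fieldE row_mxKr state_split row_mxKl row_mxKr.
Qed.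

Lemma Jst_derive i v k t : dep_ode complete P i v t ->
  is_derive t 1 (Jst i v k) (Jst i v k t *m jac (field i) (state i (gd v) t)).
Proof. by move=> h; have := is_derive_mulmxl k h; rewrite mulmxA. Qed.

Lemma Jx_derive i v k t : chart_dom i (gd v t) -> dep_ode complete P i v t ->
  is_derive t 1 (Jx i v k) (Jy i v k t).
Proof.
move=> it /(Jst_derive k)/is_derive_lsub; rewrite jac_field ?row_mxKl//.
by rewrite lsub_state; exact: cod_coord.
Qed.

Lemma Jy_derive i v k t : chart_dom i (gd v t) -> dep_ode complete P i v t ->
  is_derive t 1 (Jy i v k)
   (- (dGam i (xx i v t) (Jx i v k t) (yy i v t) (yy i v t)
       + Gam i (xx i v t) (Jy i v k t) (yy i v t) + Gam i (xx i v t) (yy i v t) (Jy i v k t))).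
Proof.
move=> it /(Jst_derive k)/is_derive_rsub; rewrite jac_field ?row_mxKr.
  by rewrite lsub_state.
by rewrite lsub_state; exact: cod_coord.
Qed.

Definition DJ i v k t := cov i (xx i v t) (yy i v t) (Jx i v k t) (Jy i v k t).

Lemma cod_xx i v t : chart_dom i (gd v t) -> cod i (xx i v t).
Proof. exact: cod_coord. Qed.

(** With two covariant derivatives in place of the coordinate ones, the linearised geodesic equation
    reads [J'' = - R(J, c') c']. The symmetry of the Christoffel symbols cancels all terms except
    those of [Rm_expand]. *)
Lemma jacobi_equation i v k t : chart_dom i (gd v t) -> dep_ode complete P i v t ->
  exists2 d, is_derive t 1 (DJ i v k) d &
   cov i (xx i v t) (yy i v t) (DJ i v k t) d = - Rm i (xx i v t) (Jx i v k t) (yy i v t) (yy i v t).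
Proof.
move=> it ode; have cx := cod_xx it.
have dG := Gam_derive cx (xx_derive it) (yy_derive it) (Jx_derive k it ode).
have dD := is_deriveD (Jy_derive k it ode) dG.
eexists; first exact: dD.
rewrite /cov Rm_expand GamDr GamNl (dGam_sym _ (Jx i v k t) _ cx).
rewrite (Gam_sym (Gam i _ _ _) (Jx i v k t) cx) (Gam_sym (Jy i v k t) (yy i v t) cx).
rewrite (Gam_sym (Jx i v k t) (yy i v t) cx).
rewrite (dGam_sym (yy i v t) (yy i v t) (Jx i v k t) cx).
by apply/rowP => l; rewrite !mxE; ring.
Qed.

Lemma cov_yy i v t : cov i (xx i v t) (yy i v t) (yy i v t) (- Gam i (xx i v t) (yy i v t) (yy i v t)) = 0.
Proof. by rewrite /cov addNr. Qed.

(** This and the next three are [|c'|^2], [|J|^2], [<J, J'>] and [<J, c'>], for the geodesic c, its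
    Jacobi field J and the covariant derivative [J']. *)
Definition EE i v t := ip i (xx i v t) (yy i v t) (yy i v t).
Definition NN i v k t := ip i (xx i v t) (Jx i v k t) (Jx i v k t).
Definition QQ i v k t := ip i (xx i v t) (Jx i v k t) (DJ i v k t).
Definition mm i v k t := ip i (xx i v t) (Jx i v k t) (yy i v t).

Lemma EE_derive i v t : chart_dom i (gd v t) -> is_derive t 1 (EE i v) 0.
Proof.
move=> it; have := ip_derive (cod_xx it) (xx_derive it) (yy_derive it) (yy_derive it).
by rewrite cov_yy /ip bil0l bil0r addr0.
Qed.

Lemma NN_derive i v k t : chart_dom i (gd v t) -> dep_ode complete P i v t ->
  is_derive t 1 (NN i v k) (2 * QQ i v k t).
Proof.
move=> it ode; have := ip_derive (cod_xx it) (xx_derive it) (Jx_derive k it ode) (Jx_derive k it ode).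
by rewrite (ip_sym (cov _ _ _ _ _) _ (cod_xx it)) -mulr2n mulr_natl.
Qed.

Lemma mm_derive i v k t : chart_dom i (gd v t) -> dep_ode complete P i v t ->
  is_derive t 1 (mm i v k) (ip i (xx i v t) (DJ i v k t) (yy i v t)).
Proof.
move=> it ode; have := ip_derive (cod_xx it) (xx_derive it) (Jx_derive k it ode) (yy_derive it).
by rewrite cov_yy /ip bil0r addr0.
Qed.

Lemma QQ_derive i v k t : chart_dom i (gd v t) -> dep_ode complete P i v t ->
  is_derive t 1 (QQ i v k) (ip i (xx i v t) (DJ i v k t) (DJ i v k t)
   - ip i (xx i v t) (Rm i (xx i v t) (Jx i v k t) (yy i v t) (yy i v t)) (Jx i v k t)).
Proof.
move=> it ode; have [d dd dE] := jacobi_equation k it ode.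
have := ip_derive (cod_xx it) (xx_derive it) (Jx_derive k it ode) dd.
by rewrite dE -scaleN1r /ip bilZr mulN1r -/(ip i _ (Jx _ _ _ _) _) (ip_sym (Jx _ _ _ _) _ (cod_xx it)).
Qed.

Lemma yy_trans i j v t : chart_dom i (gd v t) -> chart_dom j (gd v t) ->
  yy j v t = yy i v t *m jac (trans i j) (xx i v t).
Proof.
move=> it jt; rewrite /yy (state_trans (gd_geodesic complete P v) it jt).
by rewrite /strans row_mxKr lsub_state.
Qed.

Lemma EE_trans i j v t : chart_dom i (gd v t) -> chart_dom j (gd v t) -> EE j v t = EE i v t.
Proof. by move=> it jt; rewrite /EE [RHS](ip_trans _ _ it jt) -yy_trans. Qed.

Lemma NN_trans i j v k t : dep_in complete P i v t -> dep_in complete P j v t -> NN j v k t = NN i v k t.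
Proof.
move=> di dj; have [it _ _] := di; have [jt _ _] := dj.
by rewrite /NN [RHS](ip_trans _ _ it jt) -Jx_trans.
Qed.

Lemma mm_trans i j v k t : dep_in complete P i v t -> dep_in complete P j v t -> mm j v k t = mm i v k t.
Proof.
move=> di dj; have [it _ _] := di; have [jt _ _] := dj.
by rewrite /mm [RHS](ip_trans _ _ it jt) -Jx_trans// -yy_trans.
Qed.

Lemma gd_near v t i : chart_dom i (gd v t) -> \forall s \near t, chart_dom i (gd v s).
Proof. by move=> it; have [[cc _] _] := gd_geodesic complete P v; exact: curve_near_dom. Qed.

End jacobi_fields.

(** * Comparison *)

Section comparison.
Context {R : realType}.

(* With [Z = (q s - (N + e) s') / sqrt (N + e)], the hypotheses give
   [Z' >= - K sqrt e s]; let [e] tend to 0. *)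
Lemma sn_comparison (N q dq D s ds : R -> R) (K S : R) : 0 <= K -> 0 <= S ->
  (forall t : R, 0 <= t <= 1 -> is_derive t 1 N (2 * q t)) ->
  (forall t : R, 0 <= t <= 1 -> is_derive t 1 q (dq t)) ->
  (forall t : R, 0 <= t <= 1 -> D t + K * N t <= dq t) ->
  (forall t : R, 0 <= t <= 1 -> q t ^+ 2 <= N t * D t) ->
  (forall t : R, 0 <= t <= 1 -> 0 <= N t) ->
  (forall t : R, 0 <= t <= 1 -> 0 <= D t) ->
  (forall t : R, 0 <= t <= 1 -> is_derive t 1 s (ds t)) ->
  (forall t : R, 0 <= t <= 1 -> is_derive t 1 ds (K * s t)) ->
  (forall t : R, 0 <= t <= 1 -> 0 <= s t <= S) ->
  N 0 = 0 -> s 0 = 0 -> 0 <= ds 0 -> 0 <= ds 1 -> N 1 * ds 1 <= q 1 * s 1.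
Proof.
move=> K0 S0 dN dQ hD CS N0 D0 hs hds sS N00 s0 ds0 ds1.
have I0 : 0 <= (0 : R) <= 1 by rewrite lexx ler01.
have I1 : 0 <= (1 : R) <= 1 by rewrite lexx ler01.
have main e : 0 < e -> - (e * (ds 0 + K * S)) * Num.sqrt (N 1 + e ^+ 2) <= q 1 * s 1 - (N 1 + e ^+ 2) * ds 1.
  move=> e0; have e20 : 0 < e ^+ 2 by rewrite exprn_gt0.
  (* [N] vanishes at 0, where its square root need not be differentiable; the shift removes this and
     gives [e <= Num.sqrt (W t)]. *)
  pose W t := N t + e ^+ 2.
  have W0 t : 0 <= t <= 1 -> 0 < W t by move=> /N0 h; rewrite ltr_wpDl.
  pose Z t := (q t * s t - W t * ds t) * (Num.sqrt (W t))^-1.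
  pose dZ t := (dq t * s t - q t * ds t - W t * (K * s t)) * (Num.sqrt (W t))^-1
     - (q t * s t - W t * ds t) * ((Num.sqrt (W t))^-1 * (W t)^-1 * q t).
  have hW (t : R) : 0 <= t <= 1 -> is_derive t 1 W (2 * q t).
    move=> It; have := is_deriveD (dN t It) (is_derive_cst (e ^+ 2) t 1).
    by rewrite addr0; apply: near_eq_is_derive; near=> z.
  have hZ (t : R) : 0 <= t <= 1 -> is_derive t 1 Z (dZ t).
    move=> It; have Wt := W0 t It.
    have sq0 : Num.sqrt (W t) != 0 by rewrite gt_eqF// sqrtr_gt0.
    have hsq : is_derive t 1 (fun z => Num.sqrt (W z)) ((2 * Num.sqrt (W t))^-1 * (2 * q t)).
      exact: (@is_derive1_comp R Num.sqrt W t _ _ (is_derive1_sqrt Wt) (hW t It)).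
    have hinv : is_derive t 1 (fun z => (Num.sqrt (W z))^-1) (- (Num.sqrt (W t)) ^- 2 * ((2 * Num.sqrt (W t))^-1 * (2 * q t))).
      have [h1 h2] := hsq; split; first exact: derivableV.
      by rewrite deriveV// h2 /GRing.scale /=.
    have num := is_deriveB (is_derive_mul (dQ t It) (hs t It)) (is_derive_mul (hW t It) (hds t It)).
    have := is_derive_mul num hinv.
    rewrite (_ : _ + _ = dZ t); first by apply: near_eq_is_derive; near=> z.
    have W2 : Num.sqrt (W t) ^+ 2 = W t by rewrite sqr_sqrtr// ltW.
    rewrite /dZ; rewrite -[X in _ + X * _ = _]/(q t * s t - W t * ds t).
    move: sq0 W2; move: (Num.sqrt (W t)) => w w0 <-; field.
    by rewrite w0.
  have dZb t : 0 <= t <= 1 -> - (K * e * S) <= dZ t.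
    move=> It; have Wt := W0 t It; have st := sS t It.
    have r0 : 0 < Num.sqrt (W t) by rewrite sqrtr_gt0.
    have W2 : Num.sqrt (W t) ^+ 2 = W t by rewrite sqr_sqrtr// ltW.
    set r := Num.sqrt (W t) in r0 W2.
    have re : e <= r by rewrite -(gtr0_norm e0) -sqrtr_sqr ler_wsqrtr// /W lerDr N0.
    have h1 : dZ t = ((dq t * s t - q t * ds t - W t * (K * s t)) * W t
       - (q t * s t - W t * ds t) * q t) / (r * W t).
      rewrite /dZ -/r; field; rewrite !gt_eqF//.
    (* The terms with [ds] cancel, and the hypothesis [q ^ 2 <= N D] controls what remains; only the
       shift in [W] contributes an error. *)
    have h2 : - (K * e ^+ 2 * s t * W t) <= (dq t * s t - q t * ds t - W t * (K * s t)) * W t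
       - (q t * s t - W t * ds t) * q t.
      have -> : (dq t * s t - q t * ds t - W t * (K * s t)) * W t - (q t * s t - W t * ds t) * q t
        = (dq t - K * W t) * s t * W t - q t ^+ 2 * s t by ring.
      have d1 : D t - K * e ^+ 2 <= dq t - K * W t.
        by have := hD t It; rewrite /W mulrDr; lra.
      have d2 : (D t - K * e ^+ 2) * s t * W t <= (dq t - K * W t) * s t * W t.
        by rewrite ler_wpM2r ?(ltW Wt)// ler_wpM2r//; case/andP: st.
      have D00 : 0 <= e ^+ 2 * D t + (N t * D t - q t ^+ 2).
        by apply: addr_ge0; [rewrite mulr_ge0 ?(ltW e20)// D0|rewrite subr_ge0 CS].
      have d3 : 0 <= (e ^+ 2 * D t + (N t * D t - q t ^+ 2)) * s t.
        by rewrite mulr_ge0//; case/andP: st.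
      apply: le_trans (lerB d2 (lexx _)).
      rewrite -subr_ge0; apply: le_trans d3 _.
      by rewrite le_eqVlt; apply/orP; left; apply/eqP; rewrite /W; ring.
    rewrite h1 ler_pdivlMr ?mulr_gt0//; apply: le_trans h2.
    rewrite mulNr lerN2.
    have -> : K * e * S * (r * W t) = K * e * r * S * W t by ring.
    have -> : K * e ^+ 2 * s t * W t = K * e * e * s t * W t by ring.
    rewrite ler_wpM2r ?(ltW Wt)//; apply: ler_pM; rewrite ?mulr_ge0 ?(ltW e0)//; first by case/andP: st.
      by rewrite ler_wpM2l ?mulr_ge0// ltW.
    by case/andP: st.
  have [||c cI ZE] := @MVT_segment R Z dZ 0 1 ler01.
  - by move=> t tI; apply: hZ; rewrite !ltW ?(itvP tI).
  - apply: derivable_within_continuous => t tI.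
    by have [] // := hZ t _; rewrite !(itvP tI).
  have {ZE} ZE : Z 1 = Z 0 + dZ c by rewrite -[Z 1](subrK (Z 0)) ZE subr0 mulr1 addrC.
  have cI' : 0 <= c <= 1 by rewrite !(itvP cI).
  have Z0 : Z 0 = - (e * ds 0).
    rewrite /Z /W N00 s0 mulr0 !add0r sqrtr_sqr gtr0_norm//; field.
    by rewrite gt_eqF.
  have : - (e * (ds 0 + K * S)) <= Z 1.
    by rewrite ZE Z0; have := dZb c cI'; rewrite mulrDr; lra.
  by rewrite /Z ler_pdivlMr// sqrtr_gt0 W0.
rewrite -subr_ge0; apply/ler_addgt0Pr => eps eps0; rewrite addrC -lerBlDl sub0r.
pose C := (ds 0 + K * S) * Num.sqrt (N 1 + 1).
have C0 : 0 <= C by rewrite mulr_ge0 ?sqrtr_ge0// addr_ge0// mulr_ge0.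
pose e := Num.min 1 (eps / (C + 1)).
have e0 : 0 < e by rewrite lt_min ltr01 divr_gt0// ltr_wpDl.
have e1 : e <= 1 by rewrite ge_min lexx.
have eC : e * C <= eps.
  have : e <= eps / (C + 1) by rewrite ge_min lexx orbT.
  rewrite ler_pdivlMr ?ltr_wpDl// => h; apply: le_trans h.
  by rewrite ler_wpM2l ?(ltW e0)// lerDl.
have := main e e0.
have sq : Num.sqrt (N 1 + e ^+ 2) <= Num.sqrt (N 1 + 1).
  by rewrite ler_wsqrtr// lerD2l expr_le1// ltW.
have : e * (ds 0 + K * S) * Num.sqrt (N 1 + e ^+ 2) <= e * C.
  rewrite /C mulrA ler_wpM2l// mulr_ge0 ?(ltW e0)// addr_ge0// mulr_ge0//.
have : 0 <= e ^+ 2 * ds 1 by rewrite mulr_ge0// exprn_ge0// ltW.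
rewrite mulrDl; move: eC; lra.
Unshelve. all: by end_near. Qed.

End comparison.

(** * Jacobi fields along radial geodesics under a curvature bound *)

Section exponential_comparison.
Context {R : realType} {n : nat} {M : ptopologicalType}.
Variable g : riemannian R n M.
Implicit Types (i j : chart g).

Lemma inner_sub_scale (x : M) u v c :
  inner g x (u - c *: v) (u - c *: v) = inner g x u u - 2 * c * inner g x u v + c ^+ 2 * inner g x v v.
Proof. by rewrite !inner_ip ip_sub_scale//; exact: cod_coord (chart_atP g x). Qed.

Lemma inner_ge0 (x : M) u : 0 <= inner g x u u.
Proof. by rewrite inner_ip ip_ge0//; exact: cod_coord (chart_atP g x). Qed.

Lemma inner_eq0 (x : M) u : inner g x u u = 0 -> u = 0.
Proof. by rewrite inner_ip; apply: ip_eq0; exact: cod_coord (chart_atP g x). Qed.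

Lemma inner_sym (x : M) u v : inner g x u v = inner g x v u.
Proof. by rewrite !inner_ip ip_sym//; exact: cod_coord (chart_atP g x). Qed.

Lemma inner_CS (x : M) u v : inner g x u v ^+ 2 <= inner g x u u * inner g x v v.
Proof. by rewrite !inner_ip ip_CS//; exact: cod_coord (chart_atP g x). Qed.

(** For independent vectors this is the definition cleared of its denominator, which is positive by
    Cauchy-Schwarz. For dependent ones, of which the hypothesis says nothing, both sides vanish. *)
Lemma curvature_le b (x : M) u v : sectional_curvature_le g (- b) ->
  inner g x (curvature_op g x u v v) u <= - b * (inner g x u u * inner g x v v - inner g x u v ^+ 2).
Proof.
move=> sec; have [->|v0] := eqVneq v 0.
  have -> : curvature_op g x u 0 0 = 0.
    apply/rowP => l; rewrite !mxE big1// => a _; rewrite big1// => c _; rewrite big1// => d _.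
    by rewrite !mxE !mulr0.
  by rewrite !inner_ip /ip bil0l !bil0r mulr0 expr2 mulr0 subr0 mulr0.
have vv : 0 < inner g x v v.
  by rewrite lt_neqAle inner_ge0 andbT eq_sym; apply: contra_neq v0; exact: inner_eq0.
pose c := inner g x u v / inner g x v v.
have [ucv|ucv] := eqVneq u (c *: v).
  have -> : curvature_op g x u v v = 0 by rewrite curvature_Rm ucv Rm_diag.
  have -> : inner g x 0 u = 0 by rewrite inner_ip /ip bil0l.
  have -> : inner g x u u * inner g x v v - inner g x u v ^+ 2 = 0.
    have := inner_sub_scale x u v c; rewrite {1}ucv {1}ucv subrr.
    have -> : inner g x 0 0 = 0 by rewrite inner_ip /ip bil0l.
    move=> /esym h; apply: (mulIf (invr_neq0 (lt0r_neq0 vv))); rewrite mul0r -[RHS]h /c.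
    by field; rewrite lt0r_neq0.
  by rewrite mulr0.
have free : row_free (col_mx u v).
  rewrite -kermx_eq0; apply: contraT => k0.
  have w0 : nz_row (kermx (col_mx u v)) != 0 by rewrite nz_row_eq0.
  have /sub_kermxP := nz_row_sub (kermx (col_mx u v)).
  set w := nz_row _ in w0 *; rewrite -(hsubmxK w) mul_row_col.
  rewrite [lsubmx w]mx11_scalar [rsubmx w]mx11_scalar !mul_scalar_mx.
  set a := lsubmx w 0 0; set d := rsubmx w 0 0 => E.
  have [a0|a0] := eqVneq a 0.
    move: E; rewrite a0 scale0r add0r => /eqP; rewrite scaler_eq0 (negbTE v0) orbF => /eqP d0.
    move: w0; rewrite -(hsubmxK w) [lsubmx w]mx11_scalar [rsubmx w]mx11_scalar -/a -/d a0 d0.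
    by move/eqP; case; apply/rowP => l; rewrite mxE; case: (fintype.split l) => z; rewrite !mxE mul0rn.
  have ud : u = (- d / a) *: v.
    apply: (scalerI a0); rewrite scalerA mulrCA divff// mulr1 scaleNr.
    by apply/eqP; rewrite -addr_eq0 E.
  have cE : c = - d / a.
    rewrite /c {1}ud inner_ip /ip bilZl -/(ip _ _ _ _) -inner_ip mulfK//.
    by rewrite lt0r_neq0.
  by rewrite cE -ud eqxx in ucv.
have gram0 : 0 < inner g x u u * inner g x v v - inner g x u v ^+ 2.
  have h : 0 < inner g x (u - c *: v) (u - c *: v).
    rewrite lt_neqAle inner_ge0 andbT eq_sym; apply: contra_neq ucv => /inner_eq0/eqP.
    by rewrite subr_eq0 => /eqP.
  have -> : inner g x u u * inner g x v v - inner g x u v ^+ 2 = inner g x (u - c *: v) (u - c *: v) * inner g x v v.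
    by rewrite inner_sub_scale /c; field; rewrite lt0r_neq0.
  by rewrite mulr_gt0.
by have := sec x u v free; rewrite /sectional_curvature ler_pdivrMr.
Qed.

Hypothesis complete : geodesically_complete g.
Variable P : M.
Local Notation gd := (gd complete P).
Local Notation dep_in := (dep_in complete P).
Local Notation dep_ode := (dep_ode complete P).
Local Notation ca v t := (chart_at g (gd v t)).

Lemma dep_in_window i v t : dep_in i v t ->
  exists2 e, 0 < e & forall s, `|s - t| < e -> dep_in i v s /\ dep_ode i v s.
Proof.
move=> di; have [it _ _] := di.
have ict : cod i (lsubmx (state i (gd v) t)) by rewrite lsub_state; exact: cod_coord.
have [C [rho [delta [C0 rho0 de dC [F2 _ box]]]]] := flow_box ict; have [de0 _] := andP de.
have z0 : `|state i (gd v) t - state i (gd v) t| < rho by rewrite subrr normr0.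
by exists delta => // s; exact: dep_window C0 de dC F2 box z0 di s.
Qed.

Lemma dep_in_ode i v t : dep_in i v t -> dep_ode i v t.
Proof. by move=> /dep_in_window[e e0 /(_ t)]; rewrite subrr normr0 => /(_ e0)[]. Qed.

Lemma dep_in_near i v (t : R) : dep_in i v t -> \forall s \near t, dep_in i v s.
Proof.
move=> /dep_in_window[e e0 H]; apply/nbhs_ballP; exists e => //= s.
by rewrite /ball /= distrC => /H[].
Qed.

(** [2 * QQ] is the derivative of [NN], which is already known to be independent of the chart; this
    avoids a transformation rule for the covariant derivative [DJ]. *)
Lemma QQ_trans i j v k t : dep_in i v t -> dep_in j v t ->
  QQ complete P j v k t = QQ complete P i v k t.
Proof.
move=> di dj; have [it _ _] := di; have [jt _ _] := dj.
have h1 := NN_derive k it (dep_in_ode di); have h2 := NN_derive k jt (dep_in_ode dj).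
have h3 : is_derive t 1 (NN complete P i v k) (2 * QQ complete P j v k t).
  apply: near_eq_is_derive h2; near=> s.
  by apply: NN_trans; near: s; exact: dep_in_near.
have := is_derive_unique h1 h3 => /(mulfI (x := 2)) ->//.
Unshelve. all: by end_near. Qed.

(** The scalars of the Jacobi field as functions of time on the whole geodesic, each read in the
    chart chosen at the point. They can be differentiated because near [t] the value in any fixed
    chart is the same. *)
Definition gNN v k t := NN complete P (ca v t) v k t.
Definition gQQ v k t := QQ complete P (ca v t) v k t.
Definition gmm v k t := mm complete P (ca v t) v k t.
Definition gEE v t := EE complete P (ca v t) v t.
Definition gDD v k t := let i := ca v t in ip i (xx complete P i v t) (DJ complete P i v k t) (DJ complete P i v k t).

Lemma dep_ca v t : 0 <= t -> dep_in (ca v t) v t.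
Proof. by move=> t0; apply: dep_all => //; exact: chart_atP. Qed.

Lemma near_ca i v (t : R) : 0 <= t -> chart_dom i (gd v t) ->
  \forall s \near t, dep_in i v s /\ dep_in (ca v s) v s.
Proof.
move=> t0 it; near=> s.
have h : forall j, chart_dom j (gd v s) -> dep_in j v s.
  by near: s; exact: dep_near.
by split; apply: h; [near: s; exact: gd_near|exact: chart_atP].
Unshelve. all: by end_near. Qed.

Lemma gNN_derive v k (t : R) : 0 <= t -> is_derive t 1 (gNN v k) (2 * gQQ v k t).
Proof.
move=> t0; have d0 := dep_ca v t0; have [it _ _] := d0.
apply: near_eq_is_derive (NN_derive k it (dep_in_ode d0)).
apply: filterS (near_ca t0 it) => s [d1 d2]; exact: NN_trans.
Qed.

Lemma gQQ_derive v k (t : R) : 0 <= t -> let i := ca v t in is_derive t 1 (gQQ v k)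
  (gDD v k t - ip i (xx complete P i v t)
    (Rm i (xx complete P i v t) (Jx complete P i v k t) (yy complete P i v t) (yy complete P i v t)) (Jx complete P i v k t)).
Proof.
move=> t0 i; have d0 := dep_ca v t0; have [it _ _] := d0.
apply: near_eq_is_derive (QQ_derive k it (dep_in_ode d0)).
apply: filterS (near_ca t0 it) => s [d1 d2]; exact: QQ_trans.
Qed.

Lemma gmm_derive v k (t : R) : 0 <= t -> let i := ca v t in is_derive t 1 (gmm v k)
  (ip i (xx complete P i v t) (DJ complete P i v k t) (yy complete P i v t)).
Proof.
move=> t0 i; have d0 := dep_ca v t0; have [it _ _] := d0.
apply: near_eq_is_derive (mm_derive k it (dep_in_ode d0)).
apply: filterS (near_ca t0 it) => s [d1 d2]; exact: mm_trans.
Qed.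

Lemma gEE_derive v (t : R) : 0 <= t -> is_derive t 1 (gEE v) 0.
Proof.
move=> t0; have d0 := dep_ca v t0; have [it _ _] := d0.
apply: near_eq_is_derive (EE_derive it).
apply: filterS (near_ca t0 it) => s [[d1 _ _] [d2 _ _]]; exact: EE_trans.
Qed.

Lemma derive_const_affine (f : R -> R) (c t : R) : 0 <= t ->
  (forall s : R, 0 <= s -> is_derive s (1 : R) f c) -> f t = f 0 + t * c.
Proof.
move=> t0 df.
have : `|f t - f 0 - t * c| <= 0.
  have := @mvt_bound R f (fun=> c) 0 t c 0; rewrite mul0r subr0 min_l// max_r//.
  by apply=> s /andP[s0 _]; [exact: df|rewrite subrr normr0].
by rewrite normr_le0 subr_eq0 subr_eq addrC => /eqP.
Qed.

Lemma gd0 v : gd v 0 = P. Proof. by have [] := gdP complete P v. Qed.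

Lemma state0 v : state (chart_at g P) (gd v) 0 = row_mx (coord (chart_at g P) P) v.
Proof.
have [_ h1 h2] := gdP complete P v; rewrite stateE.
by move: h2; rewrite /velocity h1 => ->.
Qed.

Lemma gEE_inner v t : 0 <= t -> gEE v t = inner g P v v.
Proof.
move=> t0; rewrite (derive_const_affine t0 (gEE_derive v)) mulr0 addr0.
rewrite /gEE gd0 /EE /xx /yy state0 row_mxKr gd0 inner_ip.
by [].
Qed.

Lemma EE_inner i v t : 0 <= t -> chart_dom i (gd v t) -> EE complete P i v t = inner g P v v.
Proof. by move=> t0 it; rewrite -(gEE_inner v t0) /gEE; apply: EE_trans => //; exact: chart_atP. Qed.

(* The speed of the geodesics [gd (v + s *: k)] is constant in time, so the
   covariant derivative of [J] is controlled by the initial data. *)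
Lemma DJ_yy i v k t : 0 <= t -> chart_dom i (gd v t) ->
  ip i (xx complete P i v t) (DJ complete P i v k t) (yy complete P i v t) = inner g P v k.
Proof.
move=> t0 it; have di := dep_all t0 it; have [_ ni _] := di.
have z0 : v + (0 : R) *: k = v by rewrite scale0r addr0.
have cx := cod_xx it.
have cx0 : cod i (coord i (gd (v + (0 : R) *: k) t)) by rewrite z0.
have := ip_derive cx0 (Jx_curve k di) (Jy_curve k di) (Jy_curve k di).
rewrite z0 -/(xx complete P i v t) => d1.
have dv : is_derive (0 : R) 1 (fun s => v + s *: k) k by exact: line_is_derive_id.
have cP := cod_coord (chart_atP g P).
set y0 := coord (chart_at g P) P in cP.
have d2 := @ip_derive R n M g (chart_at g P) (fun=> y0) _ _ 0 0 _ _ cP (is_derive_cst y0 (0 : R) 1) dv dv.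
have cov0 : cov (chart_at g P) y0 0 v k = k.
  by rewrite /cov -(scale0r (0 : 'rV[R]_n)) GamZl scale0r addr0.
rewrite z0 cov0 -!inner_ip (inner_sym P k v) in d2.
have d3 : is_derive (0 : R) 1 (fun s => ip i (coord i (gd (v + s *: k) t)) (yy complete P i (v + s *: k) t) (yy complete P i (v + s *: k) t))
   (inner g P v k + inner g P v k).
  apply: near_eq_is_derive d2.
  have : \forall w \near v, inner g P w w = EE complete P i w t.
    by near=> w; rewrite EE_inner//; near: w.
  by move=> /(@line_near R n v k _); apply: filterS => s es; rewrite -[RHS]es inner_ip.
have := is_derive_unique d1 d3.
rewrite (ip_sym (yy _ _ _ _ _) _ cx) -!mulr2n.
have -> : cov i (xx complete P i v t) (Jx complete P i v k t) (yy complete P i v t) (Jy complete P i v k t)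
   = DJ complete P i v k t by rewrite /DJ /cov (Gam_sym _ (yy _ _ _ _ _) cx).
by move=> /eqP; rewrite -subr_eq0 -mulrnBl mulrn_eq0 /= subr_eq0 => /eqP.
Unshelve. all: by end_near. Qed.

Lemma Jst0 v k : Jst complete P (chart_at g P) v k 0 = row_mx 0 k.
Proof.
have d0 : dep_in (chart_at g P) v 0 by exact: dep_init.
apply: is_derive_unique (Jst_curve k d0) _.
have := @is_derive_row_mx R _ _ (fun=> coord (chart_at g P) P) (fun=> 0) (fun s => v + s *: k) (fun=> k) 0
   (is_derive_cst _ _ _) (line_is_derive_id v k 0).
by apply: near_eq_is_derive; near=> s; rewrite state0.
Unshelve. all: by end_near. Qed.

Lemma Jx0 v k : Jx complete P (chart_at g P) v k 0 = 0.
Proof. by rewrite /Jx Jst0 row_mxKl. Qed.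

Lemma gNN0 v k : gNN v k 0 = 0.
Proof. by rewrite /gNN gd0 /NN Jx0 /ip bil0l. Qed.

Lemma gQQ0 v k : gQQ v k 0 = 0.
Proof. by rewrite /gQQ gd0 /QQ Jx0 /ip bil0l. Qed.

(** The Gauss lemma: by [DJ_yy] the function [<J, c'>] has constant derivative, and it vanishes at
    time 0. *)
Lemma gmm_eq v k t : 0 <= t -> gmm v k t = t * inner g P v k.
Proof.
move=> t0; have h : forall s : R, 0 <= s -> is_derive s (1 : R) (gmm v k) (inner g P v k).
  move=> s s0; rewrite -(@DJ_yy (ca v s) v k s s0 (chart_atP g _)); exact: gmm_derive.
by rewrite (derive_const_affine t0 h) /gmm gd0 /mm Jx0 /ip bil0l add0r.
Qed.

Lemma mm_eq i v k t : 0 <= t -> chart_dom i (gd v t) -> mm complete P i v k t = t * inner g P v k.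
Proof.
move=> t0 it; rewrite -gmm_eq// /gmm; apply: mm_trans; first exact: dep_ca.
exact: dep_all.
Qed.

Lemma gDD0 v k : gDD v k 0 = inner g P k k.
Proof.
rewrite /gDD /= gd0 inner_ip /xx gd0; congr (ip _ _ _ _);
by rewrite /DJ /cov Jx0 /Jy Jst0 row_mxKr -(scale0r (0 : 'rV[R]_n)) GamZr scale0r addr0.
Qed.

Section with_curvature.
Variable b : R.
Hypothesis b0 : 0 <= b.
Hypothesis sec : sectional_curvature_le g (- b).
Variables (v k : 'rV[R]_n).

Let E := inner g P v v.
Let a := inner g P v k.
(* For the component of the Jacobi field orthogonal to the geodesic. *)
Definition perpN t := gNN v k t - t ^+ 2 * (a ^+ 2 / E).
Definition perpQ t := gQQ v k t - t * (a ^+ 2 / E).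
Definition perpD t := gDD v k t - a ^+ 2 / E.

Lemma perpN_derive (t : R) : 0 <= t -> is_derive t 1 perpN (2 * perpQ t).
Proof.
move=> t0.
have h : is_derive t 1 (fun s : R => s ^+ 2 * (a ^+ 2 / E)) (2 * t * (a ^+ 2 / E)).
  have := is_derive_mul (is_derive_mul (is_derive_id t 1) (is_derive_id t 1)) (is_derive_cst (a ^+ 2 / E) t 1).
  rewrite (_ : _ + _ = 2 * t * (a ^+ 2 / E)); last by rewrite /cst /=; ring.
  by apply: near_eq_is_derive; near=> s; rewrite expr2.
have := is_deriveB (gNN_derive v k t0) h.
rewrite [X in is_derive _ _ _ X -> _](_ : _ = 2 * perpQ t); last by rewrite /perpQ -/E -/a; ring.
by apply: near_eq_is_derive; near=> s.
Unshelve. all: by end_near. Qed.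

(** The Jacobi equation with the curvature bound for the pair [J], [c']: the Gram determinant of
    this pair is [E * perpN], since subtracting the radial component does not change it. *)
Lemma perpQ_derive (t : R) : 0 <= t -> exists2 d, is_derive t 1 perpQ d & perpD t + b * E * perpN t <= d.
Proof.
move=> t0.
have h : is_derive t 1 (fun s : R => s * (a ^+ 2 / E)) (a ^+ 2 / E).
  have := is_derive_mul (is_derive_id t 1) (is_derive_cst (a ^+ 2 / E) t 1).
  by rewrite mul1r mulr0 addr0.
have hd := is_deriveB (gQQ_derive v k t0) h.
eexists; first by apply: near_eq_is_derive hd; near=> s.
have it := chart_atP g (gd v t).
have cl := @curvature_le b (gd v t) (Jx complete P (ca v t) v k t) (yy complete P (ca v t) v t) sec.
rewrite curvature_Rm !inner_ip -/(xx complete P (ca v t) v t) in cl.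
rewrite -/(NN complete P (ca v t) v k t) -/(mm complete P (ca v t) v k t) in cl.
rewrite -/(EE complete P (ca v t) v t) -/(gNN v k t) -/(gmm v k t) -/(gEE v t) in cl.
rewrite gEE_inner// gmm_eq// -/E -/a in cl.
(* For [E = 0] the quotient is 0 by convention, and [a] vanishes by Cauchy-Schwarz. *)
have e1 : E * (t ^+ 2 * (a ^+ 2 / E)) = (t * a) ^+ 2.
  have [E0|E0] := eqVneq E 0; last by field.
  have : a ^+ 2 <= E * inner g P k k by exact: inner_CS.
  rewrite E0 mul0r => a2; have a20 : a ^+ 2 = 0 by apply/eqP; rewrite eq_le a2 sqr_ge0.
  by rewrite mul0r exprMn a20 mulr0.
rewrite /perpD -!addrA lerD2l.
rewrite [X in _ <= X]addrC [X in X <= _]addrC [X in X <= _]addrC lerD2l.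
rewrite -lerN2; rewrite opprK; apply: le_trans cl _.
have e2 : E * perpN t = gNN v k t * E - (t * a) ^+ 2 by rewrite /perpN mulrBr e1 mulrC.
by rewrite -mulrA e2 mulNr lexx.
Unshelve. all: by end_near. Qed.

Lemma perp_CS t : 0 <= t -> perpQ t ^+ 2 <= perpN t * perpD t.
Proof.
move=> t0; have it := chart_atP g (gd v t).
have := @ip_CS_perp R n M g (ca v t) (xx complete P (ca v t) v t) (Jx complete P (ca v t) v k t)
  (DJ complete P (ca v t) v k t) (yy complete P (ca v t) v t) E (cod_xx it).
rewrite -/(EE complete P (ca v t) v t) EE_inner// => /(_ erefl).
rewrite -/(mm complete P (ca v t) v k t) mm_eq// DJ_yy// -/a.
rewrite -/(NN complete P (ca v t) v k t) -/(gNN v k t) -/(QQ complete P (ca v t) v k t) -/(gQQ v k t) -/(gDD v k t).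
rewrite /perpQ /perpN /perpD; congr (_ ^+ 2 <= _ * _).
- by rewrite expr2 !mulrA.
- by rewrite exprMn mulrA.
Qed.

Lemma perpN_ge0 t : 0 <= t -> 0 <= perpN t.
Proof.
move=> t0; have it := chart_atP g (gd v t); have cx := cod_xx it.
have := ip_CS (Jx complete P (ca v t) v k t) (yy complete P (ca v t) v t) cx.
rewrite -/(mm complete P (ca v t) v k t) -/(NN complete P (ca v t) v k t) -/(EE complete P (ca v t) v t).
rewrite mm_eq// EE_inner// -/E -/a -/(gNN v k t) => cs.
rewrite subr_ge0 mulrA -exprMn.
have [E0|E0] := eqVneq E 0; first by rewrite E0 invr0 mulr0; exact: (ip_ge0 _ cx).
by rewrite ler_pdivrMr// lt_neqAle eq_sym E0 inner_ge0.
Qed.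

Lemma perpD_ge0 t : 0 <= t -> 0 <= perpD t.
Proof.
move=> t0; have it := chart_atP g (gd v t); have cx := cod_xx it.
have := ip_CS (DJ complete P (ca v t) v k t) (yy complete P (ca v t) v t) cx.
rewrite DJ_yy// -/(EE complete P (ca v t) v t) EE_inner// -/E -/a -/(gDD v k t) => cs.
rewrite subr_ge0; have [E0|E0] := eqVneq E 0; first by rewrite E0 invr0 mulr0; exact: (ip_ge0 _ cx).
by rewrite ler_pdivrMr// lt_neqAle eq_sym E0 inner_ge0.
Qed.

End with_curvature.

End exponential_comparison.

(** * Comparison with constant curvature, and absence of conjugate points *)

Section exponential_conclusions.
Context {R : realType} {n : nat} {M : ptopologicalType}.
Variable g : riemannian R n M.
Implicit Types (i j : chart g).
Hypothesis complete : geodesically_complete g.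
Variable P : M.
Local Notation gd := (gd complete P).
Local Notation perpN := (perpN complete P).
Local Notation perpQ := (perpQ complete P).
Local Notation perpD := (perpD complete P).

Lemma nondecreasing_of_derive (q dq : R -> R) (u v : R) : u <= v ->
  (forall t : R, u <= t <= v -> is_derive t 1 q (dq t)) -> (forall t : R, u <= t <= v -> 0 <= dq t) ->
  q u <= q v.
Proof.
rewrite le_eqVlt => /predU1P[->//|uv] dQ p.
have [||c cI ZE] := @MVT_segment R q dq u v (ltW uv).
- by move=> t tI; apply: dQ; rewrite !ltW ?(itvP tI).
- apply: derivable_within_continuous => t tI.
  by have [] // := dQ t _; rewrite !(itvP tI).
by rewrite -subr_ge0 ZE mulr_ge0 ?subr_ge0 ?(ltW uv)// p// !(itvP cI).
Qed.

Lemma derive_pos_right (q : R -> R) (d : R) : is_derive (0 : R) 1 q d -> 0 < d ->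
  exists2 t : R, 0 < t < 1 & q 0 < q t.
Proof.
move=> [dq dE] d0; have /cvgr_gt/(_ 0) : h^-1 *: ((q \o shift 0) (h *: 1) - q 0) @[h --> (0 : R)^'] --> d.
  by rewrite -dE; exact: dq.
move=> /(_ d0) /nbhs_ballP[e /= e0 H].
pose t := Num.min (e / 2) 2^-1.
have t0 : 0 < t by rewrite lt_min divr_gt0//= invr_gt0.
have t1 : t < 1 by rewrite gt_min; apply/orP; right; lra.
exists t; first by rewrite t0 t1.
have te : t < e by rewrite gt_min; apply/orP; left; lra.
have := H t; rewrite /ball /= sub0r normrN gtr0_norm// => /(_ te); rewrite gt_eqF// => /(_ isT).
by rewrite addr0 [t *: 1]mulr1 pmulr_rgt0 ?invr_gt0// subr_gt0.
Qed.

Section fixed_direction.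
Variable b : R.
Hypothesis b0 : 0 <= b.
Hypothesis sec : sectional_curvature_le g (- b).
Variables (v k : 'rV[R]_n).
Let E := inner g P v v.

Let E_ge0 : 0 <= E. Proof. exact: inner_ge0. Qed.

Lemma perpQ_derive1 (t : R) : 0 <= t -> is_derive t 1 (perpQ v k) ('D_1 (perpQ v k) t) /\
  perpD v k t + b * E * perpN v k t <= 'D_1 (perpQ v k) t.
Proof.
move=> t0; have [d dq ld] := perpQ_derive complete P sec v k t0.
by have -> : 'D_1 (perpQ v k) t = d by exact: derive_val.
Qed.

Lemma perpN0 : perpN v k 0 = 0.
Proof. by rewrite /perpN gNN0 expr2 !mul0r subrr. Qed.

Lemma perpQ0 : perpQ v k 0 = 0.
Proof. by rewrite /perpQ gQQ0 !mul0r subrr. Qed.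

(** The geodesic is run over [[0, 1]] with speed [sqrt E], so the constant of the model equation is
    [b * E] and not [b]. *)
Lemma perp_comparison s ds S : 0 <= S ->
  (forall t : R, 0 <= t <= 1 -> is_derive t 1 s (ds t)) ->
  (forall t : R, 0 <= t <= 1 -> is_derive t 1 ds (b * E * s t)) ->
  (forall t : R, 0 <= t <= 1 -> 0 <= s t <= S) ->
  s 0 = 0 -> 0 <= ds 0 -> 0 <= ds 1 -> perpN v k 1 * ds 1 <= perpQ v k 1 * s 1.
Proof.
move=> S0 hs hds sS s0 d0 d1.
have K0 : 0 <= b * E by exact: mulr_ge0.
have h1 (t : R) : 0 <= t <= 1 -> is_derive t 1 (perpN v k) (2 * perpQ v k t).
  by move=> /andP[t0 _]; exact: perpN_derive.
have h2 (t : R) : 0 <= t <= 1 -> is_derive t 1 (perpQ v k) ('D_1 (perpQ v k) t).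
  by move=> /andP[t0 _]; have [] := perpQ_derive1 t0.
have h3 (t : R) : 0 <= t <= 1 -> perpD v k t + b * E * perpN v k t <= 'D_1 (perpQ v k) t.
  by move=> /andP[t0 _]; have [] := perpQ_derive1 t0.
have h4 (t : R) : 0 <= t <= 1 -> perpQ v k t ^+ 2 <= perpN v k t * perpD v k t.
  by move=> /andP[t0 _]; exact: perp_CS.
have h5 (t : R) : 0 <= t <= 1 -> 0 <= perpN v k t.
  by move=> /andP[t0 _]; exact: perpN_ge0.
have h6 (t : R) : 0 <= t <= 1 -> 0 <= perpD v k t.
  by move=> /andP[t0 _]; exact: perpD_ge0.
exact: (sn_comparison K0 S0 h1 h2 h3 h4 h5 h6 hs hds sS perpN0 s0 d0 d1).
Qed.

(** The model solution is the identity for [b = 0], and otherwise twice the hyperbolic sine of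
    [k0 * t]; its logarithmic derivative at 1 is the factor on the left. *)
Lemma perp_hessian : v != 0 ->
  Num.sqrt E * ct b (Num.sqrt E) * perpN v k 1 <= perpQ v k 1.
Proof.
move=> v0; have Ep : 0 < E.
  by rewrite lt_neqAle E_ge0 andbT eq_sym; apply: contra_neq v0; exact: inner_eq0.
have rp : 0 < Num.sqrt E by rewrite sqrtr_gt0.
rewrite /ct; case: eqVneq => [bz|bn0].
  rewrite divff ?gt_eqF// mul1r.
  have := @perp_comparison id (fun=> 1) 1 ler01; rewrite !mulr1; apply=> //.
  by move=> t _; rewrite bz !mul0r; exact: is_derive_cst.
have bp : 0 < b by rewrite lt_neqAle eq_sym bn0.
pose k0 := Num.sqrt b * Num.sqrt E.
have kp : 0 < k0 by rewrite mulr_gt0 // sqrtr_gt0.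
have kk : k0 * k0 = b * E by rewrite /k0 mulrACA -!expr2 !sqr_sqrtr// ltW.
have de (c : R) (t : R) : is_derive t 1 (fun t => expR (c * t)) (c * expR (c * t)).
  have h : is_derive t 1 (fun s : R => c * s) c.
    by have := is_derive_mul (is_derive_cst c t 1) (is_derive_id t 1); rewrite mul0r add0r mulr1.
  have := @is_derive1_comp R expR ( *%R c) t (expR (c * t)) c (is_derive_expR _) h.
  by rewrite mulrC; exact.
pose s t := expR (k0 * t) - expR (- k0 * t).
pose ds t := k0 * expR (k0 * t) + k0 * expR (- k0 * t).
have hs (t : R) : 0 <= t <= 1 -> is_derive t 1 s (ds t).
  by move=> _; apply: is_derive_eq; rewrite /ds mulNr opprK.
have hds (t : R) : 0 <= t <= 1 -> is_derive t 1 ds (b * E * s t).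
  by move=> _; apply: is_derive_eq; rewrite /s -kk /GRing.scale /=; ring.
have := @perp_comparison s ds (expR k0) (ltW (expR_gt0 _)) hs hds.
have e0 c : expR (k0 * c) > 0 := expR_gt0 _.
have -> : s 0 = 0 by rewrite /s !mulr0 subrr.
have s1 : 0 < s 1 by rewrite subr_gt0 ltr_expR; lra.
have dp t : 0 <= ds t by rewrite addr_ge0// mulr_ge0 ?expR_ge0// ltW.
move=> /(_ _ erefl (dp 0) (dp 1)) => H.
have {H} : perpN v k 1 * ds 1 <= perpQ v k 1 * s 1.
  apply: H => t /andP[t0 t1]; apply/andP; split.
    by rewrite subr_ge0 ler_expR; nra.
  rewrite lerBlDr; apply: ler_wpDr; first exact: expR_ge0.
  by rewrite ler_expR; nra.
rewrite -ler_pdivrMr// => /(le_trans _); apply.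
rewrite /coth -/k0 mulrA [Num.sqrt E * _]mulrC -/k0 /s /ds mulr1 mulNr mulr1 le_eqVlt; apply/orP; left.
by apply/eqP; ring.
Qed.

(** If [J] vanishes at time 1, it is orthogonal to the geodesic and [perpQ] vanishes at both ends of
    [[0, 1]]. Being nondecreasing, [perpQ] has no positive value there, whereas its derivative at 0
    is at least the squared norm of [k]. *)
Lemma gd_injective_derivative i : chart_dom i (gd v 1) -> Jx complete P i v k 1 = 0 -> k = 0.
Proof.
move=> i1 J0; have z1 : (0 : R) <= 1 by exact: ler01.
have a0 : inner g P v k = 0.
  by rewrite -[LHS]mul1r -(mm_eq k z1 i1) /mm J0 /ip bil0l.
have q1 : perpQ v k 1 = 0.
  rewrite /perpQ a0 expr2 !mul0r mulr0 subr0 /gQQ.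
  rewrite (QQ_trans k (dep_all z1 i1) (dep_ca _ _ _ z1)).
  by rewrite /QQ J0 /ip bil0l.
have q_ge (s : R) : 0 <= s -> 0 <= 'D_1 (perpQ v k) s.
  move=> s0; have [_ ] := perpQ_derive1 s0; apply: le_trans.
  by rewrite addr_ge0 ?perpD_ge0// mulr_ge0 ?perpN_ge0// mulr_ge0.
have qz (t : R) : 0 <= t <= 1 -> perpQ v k t <= 0.
  move=> /andP[t0 t1]; rewrite -q1.
  apply: (@nondecreasing_of_derive _ (fun t => 'D_1 (perpQ v k) t)) => // s /andP[s0 _].
    by have [] := perpQ_derive1 (le_trans t0 s0).
  by apply: q_ge; exact: le_trans s0.
have [d0 l0] := perpQ_derive1 (lexx 0).
apply: (@inner_eq0 _ _ _ g P); apply/eqP; rewrite eq_le inner_ge0 andbT leNgt; apply/negP => kpos.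
have [|t /andP[t0 t1]] := derive_pos_right d0.
  apply: lt_le_trans l0; rewrite perpN0 mulr0 addr0 /perpD gDD0 a0 expr2 !mul0r subr0 //.
by rewrite perpQ0 ltNge qz// !ltW.
Qed.

End fixed_direction.

End exponential_conclusions.

(** * The exponential map is a diffeomorphism *)

Lemma near_all0 (R : realType) (n m : nat) (P : 'I_m -> 'rV[R]_n -> Prop) (y : 'rV[R]_n) :
  (forall k, \forall z \near y, P k z) -> \forall z \near y, forall k, P k z.
Proof. by move=> h; exact: (@filter_forall _ _ _ (nbhs y)). Qed.

Lemma inj_unitmx (R : realType) (n : nat) (B : 'M[R]_n) : (forall k : 'rV[R]_n, k *m B = 0 -> k = 0) -> B \in unitmx.
Proof.
move=> inj; rewrite -row_free_unit -kermx_eq0; apply/eqP/row_matrixP => i.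
by rewrite row0; apply: inj; rewrite -row_mul mulmx_ker row0.
Qed.

Lemma norm_bound_mx (R : realType) (n : nat) (B : 'M[R]_n) c : 0 <= c -> (forall u : 'rV[R]_n, `|u *m B| <= c * `|u|) -> `|B| <= c.
Proof.
move=> c0 h; apply: mx_norm_le => // a b.
have d1 : `|delta_mx 0 a : 'rV[R]_n| <= 1.
  by apply: mx_norm_le => // i j; rewrite mxE; case: (_ && _); rewrite ?normr1 ?normr0.
have := h (delta_mx 0 a); rewrite -rowE => hr.
have := mx_entry_le (row a B) 0 b; rewrite mxE => /le_trans; apply; apply: le_trans hr _.
by rewrite ler_piMr.
Qed.

(** With [B] the inverse of the derivative at [y], a preimage of [x] is found as a minimum of
    [|(F w - x) *m B|] over a closed ball: a step of the simplified Newton map [T x] would at least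
    halve this quantity, so the minimum is 0. The expansion of the inverse is that of [F],
    multiplied by the inverse derivative. *)
Lemma local_inverse (R : realType) (n : nat) (F : 'rV[R]_n -> 'rV[R]_n) (A : 'rV[R]_n -> 'M[R]_n) (y : 'rV[R]_n) : c11v F A y -> (forall k : 'rV[R]_n, k *m A y = 0 -> k = 0) ->
  exists r e S, [/\ 0 < r, 0 < e,
   (forall w w', `|w - y| < r -> `|w' - y| < r -> F w = F w' -> w = w'),
   (forall x, `|x - F y| < e -> `|S x - y| < r /\ F (S x) = x) &
   c11v S (fun x => invmx (A (S x))) (F y)].
Proof.
move=> cF inj; have Au := inj_unitmx inj.
have [C [d [d0 C0 H]]] := c11v_vec cF.
have Fc : \forall z \near y, {for z, continuous F}.
  have : \forall z \near y, c11v F A z by apply: near_all0 => k; exact: c11_near.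
  by apply: filterS => z; exact: c11v_continuous.
have [d1 d10 Fc1] := near_all Fc.
pose B := invmx (A y); pose kap := n%:R * `|B| + 1.
have kap0 : 0 < kap by rewrite ltr_wpDl// mulr_ge0.
have Bk (u : 'rV[R]_n) : `|u *m B| <= kap * `|u|.
  apply: le_trans (mulmx_norm_le _ _) _; rewrite mulrAC ler_wpM2r// lerDl//.
(* The bound [kap * C * r <= 1 / 4] makes [T x] contract by [1 / 2] on the ball. *)
pose r := Num.min (Num.min (d / 2) (d1 / 2)) (4^-1 / (kap * C + 1)).
have kC : 0 <= kap * C by rewrite mulr_ge0// ltW.
have r0 : 0 < r by rewrite !lt_min !divr_gt0// ltr_wpDl.
have rd : r < d by rewrite !gt_min; apply/orP; left; apply/orP; left; move: d0; clear; lra.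
have rd1 : r < d1 by rewrite !gt_min; apply/orP; left; apply/orP; right; move: d10; clear; lra.
have rC : kap * C * r <= 4^-1.
  have : r <= 4^-1 / (kap * C + 1) by rewrite ge_min lexx orbT.
  rewrite ler_pdivlMr ?ltr_wpDl// => h; apply: le_trans h.
  by rewrite mulrC ler_wpM2l ?(ltW r0)// lerDl.
pose T x w := w - (F w - x) *m B.
have Tc x w w' : `|w - y| <= r -> `|w' - y| <= r -> `|T x w - T x w'| <= 2^-1 * `|w - w'|.
  move=> wr wr'; have yd : `|y - y| < d by rewrite subrr normr0.
  have [_ _ _ _ h] := H w w' y (le_lt_trans wr rd) (le_lt_trans wr' rd) yd.
  have -> : T x w - T x w' = - ((F w - F w' - (w - w') *m A y) *m B).
    have aux (a b p q : 'rV[R]_n) : a - p - (b - q) = - (p - q - (a - b)).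
      by apply/rowP => l; rewrite !mxE; ring.
    rewrite mulmxBl -mulmxA mulmxV// mulmx1 /T aux -mulmxBl; congr (- (_ *m _ - _)).
    by rewrite opprB addrA subrK.
  rewrite normrN; apply: le_trans (Bk _) _; apply: le_trans (ler_wpM2l (ltW kap0) h) _.
  have wl := lerD wr wr'.
  have X : kap * (C * `|w - w'| * (`|w - y| + `|w' - y|)) <= kap * C * (r + r) * `|w - w'|.
    rewrite !mulrA [leRHS]mulrAC ler_wpM2l// mulr_ge0//.
  apply: le_trans X _; rewrite ler_wpM2r//.
  by move: rC; rewrite mulrDr; clear; lra.
have low w w' : `|w - y| <= r -> `|w' - y| <= r -> `|w - w'| <= 2 * kap * `|F w - F w'|.
  move=> wr wr'; have h := Tc 0 _ _ wr wr'.
  have e1 : w - w' = (T 0 w - T 0 w') + (F w - F w') *m B.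
    have aux (a b p q : 'rV[R]_n) : a - b = a - p - (b - q) + (p - q).
      by apply/rowP => l; rewrite !mxE; ring.
    by rewrite mulmxBl /T !subr0 -aux.
  have : `|w - w'| <= 2^-1 * `|w - w'| + kap * `|F w - F w'|.
    by rewrite {1}e1; apply: le_trans (ler_normD _ _) (lerD h (Bk _)).
  by rewrite -mulrA; clear; lra.
(* With [kap * e = r / 4] the map [T x] sends the ball of radius [r / 2] into itself. *)
pose e := r / (4 * kap).
have e0 : 0 < e by rewrite divr_gt0// mulr_gt0.
have ke : kap * e = r / 4 by rewrite /e; field; rewrite gt_eqF.
pose K := [set w : 'rV[R]_n | `|w - y| <= r / 2].
have Kr w : K w -> `|w - y| <= r by move=> /= h; apply: le_trans h _; move: r0; clear; lra.
have yK : K y by rewrite /K /= subrr normr0 divr_ge0// ltW.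
have ex x : `|x - F y| < e -> exists w, K w /\ F w = x.
  move=> xe; have TK w : K w -> K (T x w).
    move=> wK; rewrite /K /= -(subrKA (T x y)).
    have h1 := Tc x _ _ (Kr _ wK) (Kr _ yK).
    have h2 : `|T x y - y| <= kap * e.
      rewrite /T addrAC subrr add0r normrN; apply: le_trans (Bk _) _.
      by rewrite ler_wpM2l ?(ltW kap0)// distrC ltW.
    apply: le_trans (ler_normD _ _) _; apply: le_trans (lerD h1 h2) _.
    by move: wK; rewrite /K /= ke; clear; lra.
  have TE w : `|(F w - x) *m B| = `|T x w - w|.
    by rewrite /T addrAC subrr add0r normrN.
  have [|||c] := @compact_EVT_min _ R (fun w => `|(F w - x) *m B|) K.
  - by exists y.
  - exact: closed_ball_compact.
  - apply: continuous_in_subspaceT => w /set_mem wK.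
    have Fw : F @ w --> F w by apply: Fc1; exact: le_lt_trans (Kr _ wK) rd1.
    have Fx : (fun z => F z - x) @ w --> F w - x by apply: (@cvgB _ _ _ (nbhs w)) => //; exact: (@cvg_cst _ _ _ (nbhs w)).
    have hB := @mulmxr_continuous R n n B (F w - x).
    exact: cvg_norm (cvg_comp _ _ Fx hB).
  move=> /set_mem cK /(_ (T x c)) /(_ (mem_set (TK _ cK))) hmin.
  have h := Tc x _ _ (Kr _ (TK _ cK)) (Kr _ cK).
  have fB : (F c - x) *m B = 0.
    apply/eqP; rewrite -normr_le0; have := normr_ge0 ((F c - x) *m B).
    by move: hmin h; rewrite -!TE; clear; lra.
  exists c; split=> //; apply/eqP; rewrite -subr_eq0; apply/eqP.
  by rewrite -[LHS]mulmx1 -(mulVmx Au) mulmxA -/B fB mul0mx.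
pose S x := xget y [set w | K w /\ F w = x].
have SP x : `|x - F y| < e -> K (S x) /\ F (S x) = x.
  by move=> /ex[w hw]; rewrite /S; case: xgetP => [z -> //|/(_ w)/=].
have r2 : r / 2 < r by move: r0; clear; lra.
exists r, e, S; split=> //.
- by move=> w w' wr wr' E; apply/eqP; rewrite -subr_eq0 -normr_le0; have := low _ _ (ltW wr) (ltW wr'); rewrite E subrr normr0 mulr0.
- by move=> x /SP[SK ->]; split=> //; exact: le_lt_trans SK r2.
have lowA w (k : 'rV[R]_n) : `|w - y| <= r -> `|k| <= 2 * kap * `|k *m A w|.
  move=> wr; have yd : `|y - y| < d by rewrite subrr normr0.
  have h := c11vat_lip k C0 H (le_lt_trans wr rd) yd.
  have e1 : k = k *m A w *m B - (k *m A w - k *m A y) *m B.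
    by rewrite mulmxBl opprB addrC subrK -mulmxA mulmxV// mulmx1.
  have : `|k| <= kap * `|k *m A w| + kap * (2 * C * `|k| * `|w - y|).
    rewrite {1}e1; apply: le_trans (ler_normB _ _) _; apply: lerD; first exact: Bk.
    by apply: le_trans (Bk _) _; rewrite ler_wpM2l ?(ltW kap0).
  have : kap * (2 * C * `|k| * `|w - y|) <= 2 * (kap * C * r) * `|k|.
    have -> : kap * (2 * C * `|k| * `|w - y|) = kap * C * (2 * `|k| * `|w - y|) by ring.
    have -> : 2 * (kap * C * r) * `|k| = kap * C * (2 * `|k| * r) by ring.
    by rewrite ler_wpM2l// ler_wpM2l ?mulr_ge0.
  have : 2 * (kap * C * r) * `|k| <= 2 * 4^-1 * `|k| by rewrite ler_wpM2r// ler_wpM2l.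
  by rewrite -mulrA; clear; lra.
have Aun w : `|w - y| <= r -> A w \in unitmx.
  move=> wr; apply: inj_unitmx => k k0; apply/eqP; rewrite -normr_le0.
  by have := lowA w k wr; rewrite k0 normr0 mulr0.
have Ainv w (u : 'rV[R]_n) : `|w - y| <= r -> `|u *m invmx (A w)| <= 2 * kap * `|u|.
  by move=> wr; have := lowA w (u *m invmx (A w)) wr; rewrite -mulmxA mulVmx ?Aun// mulmx1.
have k2 : 0 <= 2 * kap by rewrite mulr_ge0// ltW.
have Slip x x' : `|x - F y| < e -> `|x' - F y| < e -> `|S x - S x'| <= 2 * kap * `|x - x'|.
  by move=> /SP[Sx Fx] /SP[Sx' Fx']; rewrite -{2}Fx -{2}Fx'; apply: low; exact: Kr.
pose C' := (`|y| + r) + 2 * kap + 2 * kap * C * (2 * kap) * (2 * kap).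
have t1 : 0 <= `|y| + r by rewrite addr_ge0// ltW.
have t2 : 0 <= 2 * kap * C * (2 * kap) * (2 * kap) by rewrite !mulr_ge0// ltW.
have C'0 : 0 <= C' by rewrite addr_ge0// addr_ge0.
apply: (@vec_c11v _ _ _ C' e) => // x x' z xe xe' ze.
have [Sx Fx] := SP _ xe; have [Sx' Fx'] := SP _ xe'; have [Sz Fz] := SP _ ze.
split.
- rewrite -(subrK y (S x)); apply: le_trans (ler_normD _ _) _.
  by have := Kr _ Sx; move: t2 k2; rewrite /C'; clear; lra.
- apply: le_trans (Slip _ _ xe xe') _; rewrite ler_wpM2r//.
  by move: t1 t2; rewrite /C'; clear; lra.
- apply: norm_bound_mx => // u; apply: le_trans (Ainv _ _ (Kr _ Sz)) _.
  by rewrite ler_wpM2r//; move: t1 t2; rewrite /C'; clear; lra.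
have [_ _ _ _ h] := H _ _ _ (le_lt_trans (Kr _ Sx) rd) (le_lt_trans (Kr _ Sx') rd) (le_lt_trans (Kr _ Sz) rd).
rewrite Fx Fx' in h.
have -> : S x - S x' - (x - x') *m invmx (A (S z)) =
   - ((x - x' - (S x - S x') *m A (S z)) *m invmx (A (S z))).
  rewrite [X in _ = - X]mulmxBl -(mulmxA (S x - S x')) mulmxV; last by apply: Aun; exact: Kr.
  by rewrite mulmx1 opprB.
rewrite normrN; apply: le_trans (Ainv _ _ (Kr _ Sz)) _.
apply: le_trans (ler_wpM2l k2 h) _.
have l1 := Slip _ _ xe xe'; have l2 := Slip _ _ xe ze; have l3 := Slip _ _ xe' ze.
apply: (@le_trans _ _ (2 * kap * (C * (2 * kap * `|x - x'|) * (2 * kap * (`|x - z| + `|x' - z|))))).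
  rewrite ler_wpM2l//; apply: ler_pM; rewrite ?mulr_ge0 ?addr_ge0//.
    by rewrite ler_wpM2l.
  by rewrite mulrDr lerD.
have -> : 2 * kap * (C * (2 * kap * `|x - x'|) * (2 * kap * (`|x - z| + `|x' - z|)))
   = 2 * kap * C * (2 * kap) * (2 * kap) * (`|x - x'| * (`|x - z| + `|x' - z|)) by ring.
rewrite -[leRHS]mulrA ler_wpM2r ?mulr_ge0 ?addr_ge0//.
by move: t1 k2; rewrite /C'; clear; lra.
Qed.

(** * Local sections of the exponential map and uniqueness of lifts *)

Section covering.
Context {R : realType} {n : nat} {M : ptopologicalType}.
Variable g : riemannian R n M.
Implicit Types (i j : chart g).
Hypothesis complete : geodesically_complete g.
Variable P : M.
Local Notation gd := (gd complete P).
Local Notation ex v := (gd v 1).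

(** The derivative of the exponential map at [v] in the chart [i]: the position block of the
    derivative of the state at time 1. *)
Definition JX i v : 'M[R]_n := lsubmx (jac (fun w => state i (gd w) 1) v).

Lemma JX_Jx i v k : Jx complete P i v k 1 = k *m JX i v.
Proof. by rewrite /Jx /Jst mulmx_lsub. Qed.

Lemma c11v_near p q (f : 'rV[R]_p -> 'rV[R]_q) A y : c11v f A y -> \forall z \near y, c11v f A z.
Proof. by move=> h; apply: near_all0 => k; apply: c11_near; exact: h. Qed.

Lemma dep1 i v : chart_dom i (ex v) -> dep_in complete P i v 1.
Proof. by move=> iv; exact: dep_all. Qed.

Lemma ex_near i v : chart_dom i (ex v) -> \forall w \near v, chart_dom i (ex w).
Proof. by move=> /dep1[]. Qed.

Lemma state1_c11 i v : chart_dom i (ex v) ->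
  c11v (fun w => state i (gd w) 1) (jac (fun w => state i (gd w) 1)) v.
Proof. by move=> /dep1[_ _ h]; exact: c11v_jac. Qed.

Lemma ex_c11 i v : chart_dom i (ex v) -> c11v (fun w => coord i (ex w)) (JX i) v.
Proof.
move=> iv k; have h := state1_c11 iv (lshift n k).
apply: c11_ext h; near=> w; split; last by apply/colP => a; rewrite !mxE.
by rewrite stateE row_mxEl.
Unshelve. all: by end_near. Qed.

Lemma exp_local (b : R) (b0 : 0 <= b) (sec : sectional_curvature_le g (- b)) i v : chart_dom i (ex v) ->
  exists r S A, [/\ 0 < r,
   (forall w w', `|w - v| < r -> `|w' - v| < r -> ex w = ex w' -> w = w'),
   S (coord i (ex v)) = v &
   \forall y \near coord i (ex v),
     [/\ `|S y - v| < r, chart_dom i (ex (S y)), coord i (ex (S y)) = y & c11v S A y]].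
Proof.
move=> iv; have [|r [e [S [r0 e0 inj SP cS]]]] := local_inverse (ex_c11 iv).
  by move=> k; rewrite -JX_Jx; exact: gd_injective_derivative b0 sec _ _ _ iv.
have SF : S (coord i (ex v)) = v.
  have [|h1 h2] := SP (coord i (ex v)); first by rewrite subrr normr0.
  by apply: inj => //; rewrite subrr normr0.
exists r, S, (fun x => invmx (JX i (S x))); split=> //.
  by move=> w w' wr wr' ww; apply: inj => //; rewrite ww.
have cont := c11v_continuous cS.
have h := ex_near iv; rewrite -SF in h.
near=> y; have ye : `|y - coord i (ex v)| < e by near: y; exact: near_norm.
have [h1 h2] := SP _ ye; split=> //; near: y.
  exact: cont h.
exact: c11v_near.
Unshelve. all: by end_near. Qed.

Lemma near_coord i x (B : 'rV[R]_n -> Prop) : chart_dom i x -> (\forall y \near coord i x, B y) ->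
  \forall z \near x, B (coord i z).
Proof. by move=> ix h; exact: (coord_continuous ix) h. Qed.

Lemma near_param i y (B : M -> Prop) : cod i y -> (\forall x \near param i y, B x) ->
  \forall z \near y, B (param i z).
Proof. by move=> iy h; exact: (param_continuous iy) h. Qed.

Lemma near_chart i x : chart_dom i x -> \forall z \near x, chart_dom i z.
Proof. by move=> ix; apply: open_nbhs_nbhs; split=> //; exact: chart_dom_open. Qed.

Lemma near_cod i y : cod i y -> \forall z \near y, cod i z.
Proof. by move=> iy; apply: open_near => //; exact: cod_open. Qed.

Lemma ex_continuous v : {for v, continuous (fun w => ex w)}.
Proof.
have iv := chart_atP g (ex v); set i := chart_at g (ex v) in iv.
move=> B /= hB; have cx := c11v_continuous (ex_c11 iv).
have h : \forall y \near coord i (ex v), B (param i y).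
  by apply: near_param; [exact: cod_coord|rewrite coordK].
have {}h : \forall w \near v, B (param i (coord i (ex w))) := cx _ h.
have h2 := ex_near iv.
change (nbhs v [set w | B (ex w)]).
by apply: filterS2 h h2 => w + iw; rewrite coordK.
Qed.

Lemma continuous_near_eq (T : topologicalType) (U : topologicalType) (f h : T -> U) (t : T) :
  {for t, continuous f} -> (\forall z \near t, h z = f z) -> {for t, continuous h}.
Proof.
move=> cf hf B; rewrite /= (nbhs_singleton hf) => hB; have h2 : \forall z \near t, B (f z) := cf _ hB.
change (nbhs t [set z | B (h z)]).
by apply: filterS2 h2 hf => z fz E; rewrite /= E.
Qed.

Section with_curvature.
Variable b : R.
Hypothesis b0 : 0 <= b.
Hypothesis sec : sectional_curvature_le g (- b).

(** The content of [exp_local] without charts. The ball of radius [r] is one on which the map is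
    injective, so a lift that is in this ball coincides with the section [S]. *)
Lemma exp_section v : exists r (S : M -> 'rV[R]_n), [/\ 0 < r,
   (forall w w', `|w - v| < r -> `|w' - v| < r -> ex w = ex w' -> w = w') &
   \forall x \near ex v, [/\ `|S x - v| < r, ex (S x) = x & {for x, continuous S}]].
Proof.
have iv := chart_atP g (ex v); set i := chart_at g (ex v) in iv.
have [r [S [A [r0 inj SF nS]]]] := exp_local b0 sec iv; have nS' := near_coord iv nS.
exists r, (S \o coord i); split=> //; near=> x.
have ix : chart_dom i x by near: x; exact: near_chart.
have [h1 h2 h3 h4] : [/\ `|S (coord i x) - v| < r, chart_dom i (ex (S (coord i x))),
   coord i (ex (S (coord i x))) = coord i x & c11v S A (coord i x)].
  by near: x; exact: nS'.
split; [exact: h1| |].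
  by rewrite -[RHS](coordK ix) -h3 coordK.
have c1 := coord_continuous ix; have c2 := c11v_continuous h4.
exact: continuous_comp c1 c2.
Unshelve. all: by end_near. Qed.

(** A lift of [c] over [[0, T]]. Continuity is two-sided even at the ends of the interval, which
    makes gluing immediate. *)
Definition lift (c : R -> M) (L : R -> 'rV[R]_n) (T : R) :=
  forall t : R, 0 <= t <= T -> {for t, continuous L} /\ ex (L t) = c t.

(** Agreement is closed by continuity, and open because the exponential map is locally injective. *)
Lemma lift_unique (L L' : R -> 'rV[R]_n) (a e : R) :
  (forall t, a <= t <= e -> [/\ {for t, continuous L}, {for t, continuous L'} & ex (L t) = ex (L' t)]) ->
  L a = L' a -> forall t, a <= t <= e -> L t = L' t.
Proof.
move=> h La; apply: real_induction => t tI IH.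
have [cL cL' exL] := h t tI; have /andP[at_ te] := tI.
have Lt : L t = L' t.
  move: at_; rewrite le_eqVlt => /predU1P[<-//|lt_at].
  apply/eqP; rewrite -subr_eq0 -normr_le0 leNgt; apply/negP => d0.
  have e3 : 0 < `|L t - L' t| / 2 by rewrite divr_gt0.
  have nn : \forall s \near t, `|L s - L t| < `|L t - L' t| / 2 /\ `|L' s - L' t| < `|L t - L' t| / 2.
    by apply: filterS2 (near_dist cL e3) (near_dist cL' e3) => s.
  have [s /andP[as_ st] [h1 h2]] := near_left lt_at nn.
  have E := IH s; rewrite as_ st in E; rewrite (E isT) in h1.
  have : `|L t - L' t| <= `|L' s - L t| + `|L' s - L' t|.
    by rewrite [X in _ <= X + _]distrC -(subrKA (L' s)) ler_normD.
  by apply/negP; rewrite -ltNge; lra.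
have [r [S [r0 inj _]]] := exp_section (L t).
have nn : \forall s \near t, `|L s - L t| < r /\ `|L' s - L t| < r.
  by have n2 := near_dist cL' r0; rewrite -Lt in n2; apply: filterS2 (near_dist cL r0) n2 => s.
have [d d0 hd] := near_all1 nn.
exists d => // s /andP[ts sd] se.
have st : `|s - t| < d by rewrite ger0_norm ?subr_ge0// ltrBlDl.
have [h1 h2] := hd s st; apply: inj => //.
by have [] := h s; first by rewrite (le_trans at_ ts) se.
Qed.

Lemma lift_glue c (L1 L2 : R -> 'rV[R]_n) (s T : R) : lift c L1 s ->
  (forall t, s <= t <= T -> {for t, continuous L2} /\ ex (L2 t) = c t) -> L1 s = L2 s -> 0 <= s ->
  lift c (fun t => if t <= s then L1 t else L2 t) T.
Proof.
move=> h1 h2 E s0 t /andP[t0 tT]; case: (ltgtP t s) => [ts|st|ts]; last 1 first.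
- have [|c1 e1] := h1 s; first by rewrite s0 lexx.
  split; last by rewrite ts.
  have [|c2 e2] := h2 s; first by rewrite lexx -ts.
  apply/cvgrPdist_lt => e e0; rewrite ts lexx.
  have n1 := near_dist c1 e0; have n2 := near_dist c2 e0.
  near=> z; rewrite distrC; case: ifP => _; first by near: z; exact: n1.
  by rewrite E; near: z; exact: n2.
- have [|c1 e1] := h1 t; first by rewrite t0 ltW.
  split=> //; apply: (@continuous_near_eq _ _ L1) => //.
  have : \forall z \near t, z < s by apply: (@cvgr_lt _ _ (nbhs t) _ id t) => //; exact: cvg_id.
  by apply: filterS => z /ltW ->.
- have [|c2 e2] := h2 t; first by rewrite tT ltW.
  split=> //; apply: (@continuous_near_eq _ _ L2) => //.
  have : \forall z \near t, s < z by apply: (@cvgr_gt _ _ (nbhs t) _ id t) => //; exact: cvg_id.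
  by apply: filterS => z zs; rewrite leNgt zs.
Unshelve. all: by end_near. Qed.

End with_curvature.

End covering.

(** * Lifting of segments, paths and homotopies; bijectivity of the exponential map *)

Section lifting.
Context {R : realType} {n : nat} {M : ptopologicalType}.
Variable g : riemannian R n M.
Implicit Types (i j : chart g).
Hypothesis complete : geodesically_complete g.
Variable P : M.
Local Notation gd := (gd complete P).
Local Notation ex v := (gd v 1).
Local Notation lift := (lift complete P).
Variable b : R.
Hypothesis b0 : 0 <= b.
Hypothesis sec : sectional_curvature_le g (- b).

Lemma inner_derive (L : R -> 'rV[R]_n) (t : R) k : is_derive t 1 L k ->
  is_derive t 1 (fun s => inner g P (L s) (L s)) (2 * inner g P (L t) k).
Proof.
move=> dL; have cP := cod_coord (chart_atP g P).
set y0 := coord (chart_at g P) P in cP.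
have d2 := @ip_derive R n M g (chart_at g P) (fun=> y0) _ _ t 0 _ _ cP (is_derive_cst y0 t 1) dL dL.
have cov0 A A' : cov (chart_at g P) y0 0 A A' = A'.
  by rewrite /cov -(scale0r (0 : 'rV[R]_n)) GamZl scale0r addr0.
rewrite !cov0 -!inner_ip (inner_sym g P k) in d2.
rewrite mulr_natl mulr2n; apply: near_eq_is_derive d2.
by near=> s; rewrite inner_ip.
Unshelve. all: by end_near. Qed.

Lemma inner_c11 x (w : 'rV[R]_n) : c11e (fun w => inner g x w w) w.
Proof.
have cx := cod_coord (chart_atP g x).
apply: (@c11e_ext _ _ (fun w => ip (chart_at g x) (coord (chart_at g x) x) w w)).
  by near=> z; rewrite inner_ip.
apply: c11e_sum => a; apply: c11e_sum => c.
apply: c11eM; last exact: c11e_coord.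
by apply: c11eM; [exact: c11eC|exact: c11e_coord].
Unshelve. all: by end_near. Qed.

Lemma inner_continuous (w : 'rV[R]_n) : {for w, continuous (fun w => inner g P w w)}.
Proof. by have [A hA] := inner_c11 P w; exact: c11_continuous hA. Qed.

(** The entries of [w] are its inner products with the rows of the inverse Gram matrix, so
    Cauchy-Schwarz bounds them by the Riemannian norm. *)
Lemma inner_coercive : exists2 C, 0 <= C & forall w, `|w| <= C * Num.sqrt (inner g P w w).
Proof.
have cP := cod_coord (chart_atP g P); set i := chart_at g P in cP; set y := coord i P in cP.
have Gu := metric_unit cP; set G := metric i y in Gu.
pose K a := (row a (invmx G)); pose C := \sum_a Num.sqrt (inner g P (K a) (K a)).
exists C => [|w]; first by apply: sumr_ge0 => a _; exact: sqrtr_ge0.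
have C0 : 0 <= C by apply: sumr_ge0 => a _; exact: sqrtr_ge0.
apply: mx_norm_le => [|a c]; first by rewrite mulr_ge0 ?sqrtr_ge0.
have E : w 0 c = inner g P w (K c).
  rewrite /inner /gram -/i -/y -/G /K -[in LHS](mulmx1 w) -(mulmxV Gu) mulmxA.
  have GT : (invmx G)^T = invmx G by rewrite trmx_inv (metric_sym cP).
  by rewrite tr_row GT [LHS]mxE [RHS]mxE; apply: eq_bigr => l _; congr (_ * _); rewrite [RHS]mxE.
rewrite ord1 E; apply: (@le_trans _ _ (Num.sqrt (inner g P w w) * Num.sqrt (inner g P (K c) (K c)))).
  rewrite -sqrtrM ?inner_ge0// -sqrtr_sqr ler_wsqrtr//; exact: inner_CS.
rewrite mulrC ler_wpM2r ?sqrtr_ge0// /C (bigD1 c)//= lerDl.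
by apply: sumr_ge0 => *; exact: sqrtr_ge0.
Qed.

(** Near an interior time the lift is a local inverse applied to the segment, hence differentiable.
    Its derivative [k] generates the Jacobi field whose value at time 1 is the direction [u] of the
    segment. *)
Lemma lift_coord_derive i z u L s t : lift (fun t => param i (z + t *: u)) L s -> 0 < t < s ->
  cod i (z + t *: u) ->
  exists2 k, is_derive t 1 L k & Jx complete P i (L t) k 1 = u.
Proof.
move=> hL /andP[t0 ts] ct; have [|cL eL] := hL t; first by rewrite !ltW.
have [pd pc] := cod_param ct.
have it : chart_dom i (ex (L t)) by rewrite eL.
have ce : coord i (ex (L t)) = z + t *: u by rewrite eL.
have [r [S [A [r0 inj SF nS]]]] := exp_local b0 sec it.
have dl := line_is_derive_id z u t.
have cl := is_derive_continuous dl.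
have nS' : \forall s \near t, [/\ `|S (z + s *: u) - L t| < r, chart_dom i (ex (S (z + s *: u))),
    coord i (ex (S (z + s *: u))) = z + s *: u & c11v S A (z + s *: u)].
  by rewrite ce in nS; exact: cl nS.
have nI : \forall s' \near t, 0 <= s' <= s.
  near=> s'; rewrite !ltW//.
    by near: s'; apply: (@cvgr_lt _ _ (nbhs t) _ id t) => //; exact: cvg_id.
  by near: s'; apply: (@cvgr_gt _ _ (nbhs t) _ id t) => //; exact: cvg_id.
have nr := near_dist cL r0.
have LS : \forall s' \near t, L s' = S (z + s' *: u).
  near=> s'; have [h1 h2 h3 h4] : [/\ `|S (z + s' *: u) - L t| < r, chart_dom i (ex (S (z + s' *: u))),
    coord i (ex (S (z + s' *: u))) = z + s' *: u & c11v S A (z + s' *: u)] by near: s'; exact: nS'.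
  apply: inj => //; first by near: s'; exact: nr.
  have [|_ ->] := hL s'; first by near: s'; exact: nI.
  by rewrite -[RHS](coordK h2) h3.
have [_ _ _ cS] := nbhs_singleton nS'.
have dS := c11v_curve cS dl.
have dL : is_derive t 1 L (u *m A (z + t *: u)).
  by apply: near_eq_is_derive dS; apply: filterS LS => s'.
exists (u *m A (z + t *: u)) => //.
rewrite JX_Jx; have d1 := c11v_curve (ex_c11 it) dL.
apply: is_derive_unique d1 _; apply: near_eq_is_derive dl.
have nc : \forall s' \near t, cod i (z + s' *: u) by apply: cl; exact: near_cod.
near=> s'; have [|_ ->] := hL s'; first by near: s'; exact: nI.
have [|_ -> //] := @cod_param _ _ _ g i (z + s' *: u).
by near: s'; exact: nc.
Unshelve. all: by end_near. Qed.

(** By the Gauss lemma [<L, L'>] at [P] equals the inner product of [u] with the velocity of the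
    geodesic at its end, which has norm [|L|]. So the norm of the lift grows at most at the speed of
    the path. The summand 1 keeps the square root differentiable at the zero vector. *)
Lemma lift_growth i z u L s K : 0 <= K -> 0 <= s <= 1 ->
  (forall t : R, 0 <= t <= 1 -> cod i (z + t *: u) /\ ip i (z + t *: u) u u <= K ^+ 2) ->
  lift (fun t => param i (z + t *: u)) L s ->
  Num.sqrt (1 + inner g P (L s) (L s)) <= Num.sqrt (1 + inner g P (L 0) (L 0)) + K.
Proof.
move=> K0 /andP[s0 s1] hK hL.
move: s0; rewrite le_eqVlt => /predU1P[<-|s0]; first by rewrite lerDl.
pose E t := inner g P (L t) (L t); have E0 t : 0 <= E t by exact: inner_ge0.
have W0 t : 0 < 1 + E t by rewrite ltr_pwDl.
have ex_d t : 0 < t < s -> exists2 d, is_derive t 1 (fun t => Num.sqrt (1 + E t)) d & d <= K.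
  move=> ts; have /andP[t0 ts'] := ts.
  have [|ct Kt] := hK t; first by rewrite !ltW// (lt_le_trans ts').
  have [k dL Jk] := lift_coord_derive hL ts ct.
  have dE := inner_derive dL.
  have d1 : is_derive t 1 (fun t => 1 + E t) (2 * inner g P (L t) k).
    by have := is_deriveD (is_derive_cst (1 : R) t 1) dE; rewrite add0r.
  have d2 := @is_derive1_comp R Num.sqrt (fun t => 1 + E t) t _ _ (is_derive1_sqrt (W0 t)) d1.
  eexists; first exact: d2.
  have w0 : 0 < Num.sqrt (1 + E t) by rewrite sqrtr_gt0.
  rewrite invfM -mulrA mulrCA mulKf ?pnatr_eq0// ler_pdivrMl//.
  have [|_ eL] := hL t; first by rewrite !ltW.
  have [pd pc] := cod_param ct.
  have it : chart_dom i (ex (L t)) by rewrite eL.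
  have ce : coord i (ex (L t)) = z + t *: u by rewrite eL.
  have mE := @mm_eq _ _ _ g complete P i (L t) k 1 ler01 it.
  have EE := @EE_inner _ _ _ g complete P i (L t) 1 ler01 it.
  rewrite mul1r /mm Jk /xx ce in mE; rewrite /EE /xx ce in EE.
  rewrite -mE; apply: le_trans (ler_norm _) _; rewrite -sqrtr_sqr.
  apply: le_trans (ler_wsqrtr (ip_CS u _ ct)) _; rewrite EE sqrtrM ?ip_ge0// mulrC.
  apply: ler_pM; rewrite ?sqrtr_ge0//; first by rewrite ler_wsqrtr// lerDr.
  by rewrite -(ger0_norm K0) -sqrtr_sqr ler_wsqrtr.
pose d t := 'D_1 (fun t => Num.sqrt (1 + E t)) t.
have dd t : 0 < t < s -> is_derive t 1 (fun t => Num.sqrt (1 + E t)) (d t) /\ d t <= K.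
  by move=> /ex_d[d' h1 h2]; rewrite /d; have -> : 'D_1 (fun t => Num.sqrt (1 + E t)) t = d' by exact: derive_val.
have [||c cI ZE] := @MVT R (fun t => Num.sqrt (1 + E t)) d 0 s s0.
- by move=> t; rewrite in_itv /= => /dd[].
- apply: continuous_in_subspaceT => t; rewrite inE /= in_itv /= => tI.
  have [cL _] := hL t tI; have cE := continuous_comp cL (@inner_continuous (L t)).
  exact: continuous_comp (cvgD (cvg_cst (1 : R)) cE) (@sqrt_continuous R (1 + E t)).
have {}ZE : Num.sqrt (1 + E s) = Num.sqrt (1 + E 0) + d c * s.
  by move: ZE; rewrite subr0; lra.
rewrite -/(E s) -/(E 0) ZE lerD2l.
have [_ dK] : is_derive c 1 (fun t => Num.sqrt (1 + E t)) (d c) /\ d c <= K by apply: dd; move: cI.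
apply: le_trans (ler_wpM2r (ltW s0) dK) _; exact: ler_piMr.
Unshelve. all: by end_near. Qed.

(** The extension step for [real_induction]: a lift up to some time [s <= t], glued at [s] to a
    local lift [L2] defined past [t]. *)
Lemma lift_step c v0 t : (forall s, 0 <= s < t -> exists2 L, lift c L s & L 0 = v0) ->
  (exists s L L2 e, [/\ 0 <= s <= t, lift c L s, L 0 = v0, L s = L2 s & 0 < e /\
    forall tau, s <= tau < t + e -> tau <= 1 -> {for tau, continuous L2} /\ ex (L2 tau) = c tau]) ->
  exists2 e, 0 < e & forall s, t <= s < t + e -> s <= 1 -> exists2 L, lift c L s & L 0 = v0.
Proof.
move=> _ [s [L [L2 [e [/andP[s0 st] hL L0 E [e0 h2]]]]]]; exists e => // s' /andP[ts' s'e] s'1.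
exists (fun t => if t <= s then L t else L2 t); last by rewrite s0.
apply: (@lift_glue _ _ _ _ complete P c L L2 s s') => // tau /andP[s1 s2].
by apply: h2; [rewrite s1 (le_lt_trans s2)|exact: le_trans s2 s'1].
Qed.

Lemma lift_cst c v0 : ex v0 = c 0 -> lift c (fun=> v0) 0.
Proof.
move=> E t /andP[t0 t1]; have -> : t = 0 by apply/eqP; rewrite eq_le t0 t1.
by split=> //; exact: cst_continuous.
Qed.

Lemma segment_bound i (z u : 'rV[R]_n) : (forall t : R, 0 <= t <= 1 -> cod i (z + t *: u)) ->
  exists2 K, 0 <= K & forall t : R, 0 <= t <= 1 -> ip i (z + t *: u) u u <= K ^+ 2.
Proof.
move=> hc.
have [|c cI h] := @EVT_max R (fun t => ip i (z + t *: u) u u) 0 1 ler01.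
  apply: continuous_in_subspaceT => t; rewrite inE /= in_itv /= => tI.
  have := ip_derive (hc t tI) (line_is_derive_id z u t) (is_derive_cst u t 1) (is_derive_cst u t 1).
  exact: is_derive_continuous.
set B := ip i (z + c *: u) u u in h.
have B0 : 0 <= B by apply: ip_ge0; apply: hc; move: cI; rewrite in_itv.
exists (1 + B); first by rewrite addr_ge0.
move=> t tI; have := h t; rewrite in_itv /= => /(_ tI) /le_trans; apply.
by rewrite expr2; nra.
Qed.

(** By [lift_growth] the ends of the lifts up to times before [t] stay in a fixed ball, and so
    cluster at some [v] as the time tends to [t]. By continuity [v] lies above [c t], and the
    section at [v] extends a lift whose end is close to [v]. *)
Lemma segment_lift i z u v0 : (forall t : R, 0 <= t <= 1 -> cod i (z + t *: u)) -> ex v0 = param i z ->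
  exists2 L, lift (fun t => param i (z + t *: u)) L 1 & L 0 = v0.
Proof.
move=> hc ez; set c := fun t : R => param i (z + t *: u).
have [K K0 hK] := segment_bound hc.
have [C C0 hC] := inner_coercive.
pose B := C * (Num.sqrt (1 + inner g P v0 v0) + K).
have cc (t : R) : 0 <= t <= 1 -> {for t, continuous c}.
  move=> tI; have cl := is_derive_continuous (line_is_derive_id z u t).
  by have cp := param_continuous (hc t tI); exact: continuous_comp cl cp.
have c0 : ex v0 = c 0 by rewrite /c scale0r addr0.
suff H : forall T, 0 <= T <= 1 -> exists2 L, lift c L T & L 0 = v0 by apply: H; rewrite ler01 lexx.
apply: real_induction => t tI IH; apply: lift_step => //.
have /andP[t0 t1] := tI; have ct := cc t tI.
have key v (s : R) L r S d : 0 <= s <= t -> lift c L s -> L 0 = v0 -> `|L s - v| < r ->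
  (forall w w', `|w - v| < r -> `|w' - v| < r -> ex w = ex w' -> w = w') ->
  0 < d -> t - d < s -> (forall tau, `|tau - t| < d -> [/\ `|S (c tau) - v| < r, ex (S (c tau)) = c tau & {for c tau, continuous S}]) ->
  exists s L L2 e, [/\ 0 <= s <= t, lift c L s, L 0 = v0, L s = L2 s & 0 < e /\
    forall tau, s <= tau < t + e -> tau <= 1 -> {for tau, continuous L2} /\ ex (L2 tau) = c tau].
  move=> /andP[s0 st] hL L0 Ls inj d0 sd hS.
  exists s, L, (S \o c), d; split; [by rewrite s0|exact: hL|exact: L0| |].
    have [|h1 h2 h3] := hS s; first by rewrite ltr_norml; apply/andP; split; lra.
    apply: inj; [exact: Ls|exact: h1|].
    by have [|_ ->] := hL s; [rewrite s0 lexx|rewrite /= h2].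
  split; [exact: d0|move=> tau /andP[stau taud] tau1].
  have [|h1 h2 h3] := hS tau; first by rewrite ltr_norml; apply/andP; split; lra.
  split; last exact: h2.
  have ctau : {for tau, continuous c} by apply: cc; rewrite tau1 (le_trans s0).
  exact: continuous_comp ctau h3.
move: t0; rewrite le_eqVlt => /predU1P[t0|t0].
  have [r [S [r0 inj nS]]] := exp_section complete P b0 sec v0.
  have nc : \forall tau \near t, [/\ `|S (c tau) - v0| < r, ex (S (c tau)) = c tau & {for c tau, continuous S}].
    by rewrite c0 t0 in nS; exact: ct nS.
  have [d d0 hd] := near_all1 nc.
  apply: (key v0 0 (fun=> v0) r S d) => //; rewrite ?lexx -?t0 ?subrr ?normr0//.
  - by rewrite lexx.
  - exact: lift_cst.
  - lra.
(* The lifts for different times [s] are chosen independently of each other; only their end points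
   [p s] matter. *)
pose p s := if pselect (0 <= s < t) is left h then s2val (cid2 (IH s h)) s else v0.
have pP s : 0 <= s < t -> exists L, [/\ lift c L s, L 0 = v0 & L s = p s].
  move=> h; rewrite /p; case: pselect => [h'|/(_ h)//].
  by case: (cid2 (IH s h')) => L h1 h2; exists L.
have pK s : 0 <= s < t -> `|p s - 0| <= B.
  move=> sI; have [L [hL L0 <-]] := pP s sI; rewrite subr0.
  have /andP[s0 st] := sI.
  have hK' (t' : R) : 0 <= t' <= 1 -> cod i (z + t' *: u) /\ ip i (z + t' *: u) u u <= K ^+ 2.
    by move=> h; split; [exact: hc|exact: hK].
  have := @lift_growth i z u L s K K0 _ hK' hL; rewrite s0 (le_trans (ltW st) t1) L0 => /(_ isT) h.
  apply: le_trans (hC _) _; rewrite ler_wpM2l//; apply: le_trans h.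
  by rewrite ler_wsqrtr// lerDr.
have nleft : \forall s \near at_left t, 0 <= s < t.
  near=> s; apply/andP; split; last by near: s; exact: nbhs_left_lt.
  by near: s; exact: nbhs_left_ge.
have [v [_ clv]] : [set w : 'rV[R]_n | `|w - 0| <= B] `&` cluster (p @ at_left t) !=set0.
  have pf : ProperFilter (p @ at_left t) by exact: fmap_proper_filter (at_left_proper_filter t).
  apply: (closed_ball_compact pf).
  by apply: filterS nleft => s; exact: pK.
(* Otherwise disjoint neighbourhoods would separate the two points, although some [c s = ex (p s)]
   lies in both. *)
have evt : ex v = c t.
  apply: (manifold_hausdorff g) => A1 B1 hA hB.
  have hA' : \forall w \near v, A1 (ex w) by exact: (@ex_continuous _ _ _ g complete P v) hA.
  have hB'' : \forall s \near t, B1 (c s) := ct _ hB.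
  have hB' : \forall s \near at_left t, B1 (c s) /\ 0 <= s < t.
    near=> s; split; last by near: s; exact: nleft.
    by near: s; exact: filterS (fun s hs _ => hs) hB''.
  have [w [[s [Bs sI] <-] Aw]] := clv (p @` [set s | B1 (c s) /\ 0 <= s < t]) [set w | A1 (ex w)]
    (filterS (fun s h => ex_intro2 _ _ s h erefl) hB') hA'.
  exists (c s); split=> //; have [L [hL _ ep]] := pP s sI.
  have /andP[s0 _] := sI; have [|_ <-] := hL s; first by rewrite s0 lexx.
  by rewrite ep.
have [r [S [r0 inj nS]]] := exp_section complete P b0 sec v.
have nc : \forall tau \near t, [/\ `|S (c tau) - v| < r, ex (S (c tau)) = c tau & {for c tau, continuous S}].
  by rewrite evt in nS; exact: ct nS.
have [d d0 hd] := near_all1 nc.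
have hB' : \forall s \near at_left t, t - d < s /\ 0 <= s < t.
  near=> s; split; last by near: s; exact: nleft.
  by near: s; apply: nbhs_left_gt; rewrite ltrBlDr ltrDl.
have [w [[s [sd sI] <-] ws]] := clv (p @` [set s | t - d < s /\ 0 <= s < t]) [set w | `|w - v| < r]
    (filterS (fun s h => ex_intro2 _ _ s h erefl) hB') (near_norm v r0).
have [L [hL L0 ep]] := pP s sI; have /andP[s0 st] := sI.
by apply: (key v s L r S d) => //; [rewrite s0 ltW|rewrite ep].
Unshelve. all: by end_near. Qed.

(** Homotopy lifting: continuity in the parameter at time 0 propagates to all times. For parameters
    near [y0] and times near [t], uniqueness of lifts identifies [L y] with the section at [L y0 t]
    composed with [H y]. *)
Lemma lift_family (Y : topologicalType) (y0 : Y) (H : Y -> R -> M) (L : Y -> R -> 'rV[R]_n) :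
  (forall t : R, 0 <= t <= 1 -> {for (y0, t), continuous (fun p : Y * R => H p.1 p.2)}) ->
  (\forall y \near y0, (forall t : R, 0 <= t <= 1 -> {for t, continuous (H y)}) /\ lift (H y) (L y) 1) ->
  {for y0, continuous (fun y => L y 0)} ->
  forall t, 0 <= t <= 1 -> {for y0, continuous (fun y => L y t)}.
Proof.
move=> h1 hL c0; apply: real_induction => t tI IH; have /andP[t0 t1] := tI.
have [_ hL0] := nbhs_singleton hL.
have [cL eL] := hL0 t tI.
have [r [S [r0 inj nS]]] := exp_section complete P b0 sec (L y0 t).
rewrite eL in nS.
have [[A B] [/= hA hB] AB] := h1 t tI _ nS.
have hAB y tau : A y -> B tau -> [/\ `|S (H y tau) - L y0 t| < r, ex (S (H y tau)) = H y tau & {for H y tau, continuous S}].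
  by move=> Ay Bt; exact: (AB (y, tau)).
have [d d0 hd] := near_all1 (filterI hB (near_dist cL r0)).
have [s [s0 st sd cs]] : exists s, [/\ 0 <= s, s <= t, t - d < s & {for y0, continuous (fun y => L y s)}].
  move: t0; rewrite le_eqVlt => /predU1P[tz|tp].
    by exists 0; split; [exact: lexx|rewrite tz lexx|rewrite -tz; lra|exact: c0].
  exists (Num.max 0 (t - d / 2)).
  have m1 : Num.max 0 (t - d / 2) < t by rewrite gt_max tp /=; lra.
  have m0 : 0 <= Num.max 0 (t - d / 2) by rewrite le_max lexx.
  have m2 : t - d < Num.max 0 (t - d / 2) by rewrite lt_max; apply/orP; right; lra.
  by split; [exact: m0|exact: ltW|exact: m2|apply: IH; rewrite m0 m1].
have Lsr : `|L y0 s - L y0 t| < r.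
  by have [|_ //] := hd s; rewrite ltr_norml; apply/andP; split; lra.
have gap : 0 < r - `|L y0 s - L y0 t| by rewrite subr_gt0.
have n1 := near_dist cs gap.
exists d; first exact: d0.
move=> s' /andP[ts' s'd] s'1.
have main y : A y -> `|L y s - L y0 s| < r - `|L y0 s - L y0 t| ->
    ((forall t : R, 0 <= t <= 1 -> {for t, continuous (H y)}) /\ lift (H y) (L y) 1) -> L y s' = S (H y s').
  move=> Ay Ls [cH Ly].
  have hB' tau : s <= tau <= s' -> B tau.
    by move=> /andP[h2 h3]; have [|//] := hd tau; rewrite ltr_norml; apply/andP; split; lra.
  have ss' : s <= s' := le_trans st ts'.
  apply: (@lift_unique _ _ _ _ complete P b b0 sec (L y) (S \o H y) s s'); last by rewrite ss' lexx.
  - move=> tau tauI; have /andP[h2 h3] := tauI.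
    have tau1 : 0 <= tau <= 1 by rewrite (le_trans s0 h2) (le_trans h3).
    have [c1 e1] := Ly tau tau1; have [g1 g2 g3] := hAB y tau Ay (hB' _ tauI).
    split; [exact: c1| |by rewrite e1 /= g2].
    by have c2 := cH tau tau1; exact: continuous_comp c2 g3.
  - have sI : s <= s <= s' by rewrite lexx ss'.
    have [g1 g2 g3] := hAB y s Ay (hB' _ sI).
    apply: inj; [|exact: g1|].
      rewrite -(subrKA (L y0 s)); apply: le_lt_trans (ler_normD _ _) _.
      by rewrite -ltrBrDr.
    by have [|_ ->] := Ly s; [rewrite s0 (le_trans st)|rewrite /= g2].
have Ay0 : A y0 := nbhs_singleton hA.
have bs' : B s' by have [|//] := hd s'; rewrite ltr_norml; apply/andP; split; lra.
have [_ _ cS] := hAB y0 s' Ay0 bs'.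
have cH : {for y0, continuous (fun y => H y s')}.
  have s'I : 0 <= s' <= 1 by rewrite s'1 (le_trans t0 ts').
  have cp : {for y0, continuous (fun y : Y => (y, s'))}.
    by move=> X /= [[X1 X2] [/= hX1 hX2] HX]; apply: filterS hX1 => y Xy; apply: HX; split=> //=; exact: nbhs_singleton.
  by have c2 := h1 s' s'I; exact: continuous_comp cp c2.
apply: continuous_near_eq (continuous_comp cH cS) _.
near=> y; apply: main; near: y; [exact: hA|exact: n1|exact: hL].
Unshelve. all: by end_near. Qed.

Lemma convex_ball (x0 z y : 'rV[R]_n) (rho t : R) : `|z - x0| < rho -> `|y - x0| < rho -> 0 <= t <= 1 ->
  `|z + t *: (y - z) - x0| < rho.
Proof.
move=> hz hy /andP[t0 t1].
have -> : z + t *: (y - z) - x0 = (1 - t) *: (z - x0) + t *: (y - x0).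
  by apply/rowP => l; rewrite !mxE; ring.
apply: le_lt_trans (ler_normD _ _) _; rewrite !mx_normZ (ger0_norm t0) ger0_norm ?subr_ge0//.
move: t0; rewrite le_eqVlt => /predU1P[<-|t0]; first by rewrite subr0 mul1r mul0r addr0.
have h1 : (1 - t) * `|z - x0| <= (1 - t) * rho by rewrite ler_wpM2l ?subr_ge0// ltW.
have h2 : t * `|y - x0| < t * rho by rewrite ltr_pM2l.
lra.
Qed.

(** Segments issuing from [z] are lifted from [v0]. The resulting section covers the whole
    coordinate ball, whatever the vector [v0] above [z]; this uniformity is the covering
    property. *)
Lemma ball_section i (x0 z : 'rV[R]_n) rho v0 : (forall y, `|y - x0| < rho -> cod i y) -> `|z - x0| < rho ->
  ex v0 = param i z ->
  exists S : 'rV[R]_n -> 'rV[R]_n, S z = v0 /\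
   forall y, `|y - x0| < rho -> ex (S y) = param i y /\ {for y, continuous S}.
Proof.
move=> hc hz ez.
pose H (y : 'rV[R]_n) t := param i (z + t *: (y - z)).
have exL y : `|y - x0| < rho -> exists2 L, lift (H y) L 1 & L 0 = v0.
  by move=> hy; apply: segment_lift => // t tI; apply: hc; exact: convex_ball.
pose L y := if pselect (`|y - x0| < rho) is left h then s2val (cid2 (exL y h)) else fun=> v0.
have LP y : `|y - x0| < rho -> lift (H y) (L y) 1 /\ L y 0 = v0.
  by move=> hy; rewrite /L; case: pselect => [h|/(_ hy)//]; case: (cid2 _).
have I1 : 0 <= (1 : R) <= 1 by rewrite ler01 lexx.
have I0 : 0 <= (0 : R) <= 1 by rewrite ler01 lexx.
have nb y : `|y - x0| < rho -> \forall w \near y, `|w - x0| < rho.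
  move=> hy; have gap : 0 < rho - `|y - x0| by rewrite subr_gt0.
  near=> w; rewrite -(subrKA y); apply: le_lt_trans (ler_normD _ _) _; rewrite -ltrBrDr.
  by near: w; exact: near_norm.
exists (fun y => L y 1); split.
  have [hL L0] := LP z hz.
  apply: (@lift_unique _ _ _ _ complete P b b0 sec (L z) (fun=> v0) 0 1 _ L0 1 I1) => t tI.
  have [c1 e1] := hL t tI; split; [exact: c1|exact: cst_continuous|].
  by rewrite e1 /H subrr scaler0 addr0.
move=> y hy; have [hL L0] := LP y hy; split.
  by have [_ ->] := hL 1 I1; rewrite /H scale1r addrC subrK.
have cline (w : 'rV[R]_n) (t : R) : {for (w, t), continuous (fun p : 'rV[R]_n * R => z + p.2 *: (p.1 - z))}.
  apply: cvgD; first exact: cvg_cst.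
  by apply: cvgZ; [exact: cvg_snd|apply: cvgB; [exact: cvg_fst|exact: cvg_cst]].
apply: (@lift_family _ y H L) => //.
- move=> t tI; have ct : cod i (z + t *: (y - z)) by apply: hc; exact: convex_ball.
  by have cp := param_continuous ct; exact: continuous_comp (cline y t) cp.
- apply: filterS (nb y hy) => w hw; have [hLw _] := LP w hw; split; last exact: hLw.
  move=> t tI; have ct : cod i (z + t *: (w - z)) by apply: hc; exact: convex_ball.
  have cp := param_continuous ct.
  have cl := is_derive_continuous (line_is_derive_id z (w - z) t).
  exact: continuous_comp cl cp.
- apply: (@continuous_near_eq _ _ (fun=> v0)); first exact: cst_continuous.
  by apply: filterS (nb y hy) => w /LP[].
Unshelve. all: by end_near. Qed.

(** A merely continuous path has no length to control its lift. It is followed through coordinate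
    balls instead, each of which has a section through any prescribed vector above one of its
    points. *)
Lemma path_lift c v0 : (forall t : R, 0 <= t <= 1 -> {for t, continuous c}) -> ex v0 = c 0 ->
  exists2 L, lift c L 1 & L 0 = v0.
Proof.
move=> cc ez.
suff H : forall T, 0 <= T <= 1 -> exists2 L, lift c L T & L 0 = v0 by apply: H; rewrite ler01 lexx.
apply: real_induction => t tI IH; apply: lift_step => //.
have /andP[t0 t1] := tI; have ct := cc t tI.
have it := chart_atP g (c t); set i := chart_at g (c t) in it.
have [rho rho0 hrho] := near_all (near_cod (cod_coord it)).
have ccoord : {for t, continuous (coord i \o c)} by exact: continuous_comp ct (coord_continuous it).
have nc : \forall tau \near t, chart_dom i (c tau) by exact: ct (near_chart it).
have nd := near_dist ccoord rho0.
have [d d0 hd] := near_all1 (filterI nc nd).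
have [s [L [s0 st sd hL L0]]] : exists s L, [/\ 0 <= s, s <= t, t - d < s, lift c L s & L 0 = v0].
  move: t0; rewrite le_eqVlt => /predU1P[tz|tp].
    exists 0, (fun=> v0); split; [exact: lexx|by rewrite tz|by rewrite -tz; lra|exact: lift_cst|by []].
  have m1 : Num.max 0 (t - d / 2) < t by rewrite gt_max tp /=; lra.
  have m0 : 0 <= Num.max 0 (t - d / 2) by rewrite le_max lexx.
  have m2 : t - d < Num.max 0 (t - d / 2) by rewrite lt_max; apply/orP; right; lra.
  have [|L hL L0] := IH (Num.max 0 (t - d / 2)); first by rewrite m0 m1.
  by exists (Num.max 0 (t - d / 2)), L; split; [exact: m0|exact: ltW|exact: m2|exact: hL|exact: L0].
have hd' tau : s <= tau < t + d -> chart_dom i (c tau) /\ `|coord i (c tau) - coord i (c t)| < rho.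
  by move=> /andP[h1 h2]; apply: hd; rewrite ltr_norml; apply/andP; split; lra.
have [|is_ sr] := hd' s; first by rewrite lexx; lra.
have [|S [Sz hS]] := @ball_section i (coord i (c t)) (coord i (c s)) rho (L s) hrho sr.
  by have [|_ ->] := hL s; [rewrite s0 lexx|rewrite coordK].
exists s, L, (S \o (coord i \o c)), d; split; [by rewrite s0|exact: hL|exact: L0|by rewrite /= Sz|].
split; first exact: d0.
move=> tau tauI tau1; have [itau taur] := hd' tau tauI; have [e1 c1] := hS _ taur.
have ctau : {for tau, continuous c} by apply: cc; case/andP: tauI => h _; rewrite tau1 (le_trans s0 h).
split; last by rewrite /= e1 coordK.
have c2 : {for tau, continuous (coord i \o c)} by exact: continuous_comp ctau (coord_continuous itau).
exact: continuous_comp c2 c1.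
Qed.

(** The retraction of the line onto [[0, 1]]; composition with it turns continuity within the
    interval into continuity everywhere. *)
Definition clamp (t : R) : R := Num.max 0 (Num.min 1 t).

Lemma clamp_in t : 0 <= clamp t <= 1.
Proof. by rewrite /clamp le_max lexx /= ge_max ler01 ge_min lexx. Qed.

Lemma clamp_id t : 0 <= t <= 1 -> clamp t = t.
Proof. by move=> /andP[t0 t1]; rewrite /clamp min_r// max_r. Qed.

Lemma clamp_continuous : continuous clamp.
Proof.
move=> t; apply: continuous_max; first exact: cvg_cst.
by apply: continuous_min; [exact: cvg_cst|exact: cvg_id].
Qed.

Lemma ex0 : ex 0 = P.
Proof. by rewrite -(scale0r (0 : 'rV[R]_n)) gd_scale// mul0r gd0. Qed.

Lemma within_clamp (T : topologicalType) (c : R -> T) :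
  {within (`[0, 1] : set R), continuous c} -> continuous (c \o clamp).
Proof.
move=> /subspace_continuousP cc t.
have h : `[0, 1]%classic (clamp t) by rewrite /= in_itv /= clamp_in.
apply: cvg_comp (cc _ h) => B /= hB.
have hB2 : \forall s \near t, `[0, 1]%classic (clamp s) -> B (clamp s) := @clamp_continuous t _ hB.
by apply: filterS hB2 => s; apply; rewrite /= in_itv /= clamp_in.
Qed.

Lemma exp_surjective : path_connected R M -> forall x, exists v, ex v = x.
Proof.
move=> pc x; have [c [cc c0 c1]] := pc P x.
have cc' := within_clamp cc.
have [|L hL _] := @path_lift (c \o clamp) 0 (fun t _ => cc' t).
  by rewrite ex0 /= clamp_id ?lexx ?ler01.
exists (L 1); have [|_ ->] := hL 1; first by rewrite ler01 lexx.
by rewrite /= clamp_id ?lexx ?ler01.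
Qed.

(** The segment from [v] to [w] is mapped to a loop. A contraction of this loop lifts, and the ends
    of the lifted paths move continuously in one fibre, hence not at all; they start at [w], for the
    loop, and finish at [v], for the constant path. *)
Lemma exp_injective : simply_connected R M -> forall v w, ex v = ex w -> v = w.
Proof.
move=> [_ sc] v w vw.
have I1 : 0 <= (1 : R) <= 1 by rewrite ler01 lexx.
have I0 : 0 <= (0 : R) <= 1 by rewrite ler01 lexx.
pose l (t : R) := v + t *: (w - v); pose c t := ex (l t).
have cl (t : R) : {for t, continuous l} by exact: is_derive_continuous (line_is_derive_id v (w - v) t).
have cc (t : R) : {for t, continuous c} by exact: continuous_comp (cl t) (@ex_continuous _ _ _ g complete P (l t)).
have l0 : l 0 = v by rewrite /l scale0r addr0.
have l1 : l 1 = w by rewrite /l scale1r addrC subrK.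
have [||H [cH H0 H1 Hs]] := sc c.
- by apply: continuous_subspaceT => t; exact: cc.
- by rewrite /c l0 l1.
pose H' (s t : R) := H (clamp s, clamp t).
have cH' p : {for p, continuous (fun p : R * R => H' p.1 p.2)}.
  move/subspace_continuousP: cH => cH.
  have hp : ((`[0, 1] : set R) `*` (`[0, 1] : set R)) (clamp p.1, clamp p.2).
    by split; rewrite /= in_itv /= clamp_in.
  apply: cvg_comp (cH _ hp) => B /= hB.
  have cp : {for p, continuous (fun p : R * R => (clamp p.1, clamp p.2))}.
    move=> X [[X1 X2] [/= h1 h2] HX]; exists (clamp @^-1` X1, clamp @^-1` X2).
      by split; [exact: (@clamp_continuous p.1) h1|exact: (@clamp_continuous p.2) h2].
    by move=> [s t] [/= hs ht]; exact: (HX (clamp s, clamp t)).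
  have hB2 : \forall q \near p, ((`[0, 1] : set R) `*` (`[0, 1] : set R)) (clamp q.1, clamp q.2) ->
    B (clamp q.1, clamp q.2) := cp _ hB.
  by apply: filterS hB2 => q; apply; split; rewrite /= in_itv /= clamp_in.
have H'0 s : H' s 0 = c 0 by rewrite /H' (clamp_id I0); have [] := Hs (clamp s) (clamp_in s).
have H'1 s : H' s 1 = c 0 by rewrite /H' (clamp_id I1); have [] := Hs (clamp s) (clamp_in s).
have cs s (t : R) : {for t, continuous (H' s)}.
  have cp : {for t, continuous (fun t : R => (s, t))}.
    by apply: (@cvg_pair _ _ _ _ (nbhs s) (nbhs t)); [exact: cvg_cst|exact: cvg_id].
  exact: continuous_comp cp (cH' (s, t)).
have exL s : exists2 L, lift (H' s) L 1 & L 0 = v.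
  by apply: path_lift => [t _|]; [exact: cs|rewrite H'0 /c l0].
pose L s := s2val (cid2 (exL s)).
have LP s : lift (H' s) (L s) 1 /\ L s 0 = v by rewrite /L; case: (cid2 _).
have cL1 (s : R) : {for s, continuous (fun s => L s 1)}.
  apply: (@lift_family _ s H' L) => //.
  - by apply: filterE => y; have [h _] := LP y; split.
  - apply: (@continuous_near_eq _ _ (fun=> v)); first exact: cst_continuous.
    by apply: filterE => y; have [] := LP y.
have L01 : L 0 1 = w.
  have [h h0] := LP 0; rewrite -l1.
  apply: (@lift_unique _ _ _ _ complete P b b0 sec (L 0) l 0 1 _ _ 1 I1); last by rewrite h0 l0.
  move=> t tI; have [c1 e1] := h t tI; split; [exact: c1|exact: cl|].
  by rewrite e1 /H' (clamp_id I0) (clamp_id tI) H0.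
have L11 : L 1 1 = v.
  have [h h0] := LP 1.
  apply: (@lift_unique _ _ _ _ complete P b b0 sec (L 1) (fun=> v) 0 1 _ h0 1 I1).
  move=> t tI; have [c1 e1] := h t tI; split; [exact: c1|exact: cst_continuous|].
  by rewrite e1 /H' (clamp_id I1) (clamp_id tI) H1// /c l0.
rewrite -L11.
apply: (@lift_unique _ _ _ _ complete P b b0 sec (fun s => L s 1) (fun=> w) 0 1 _ L01 1 I1) => s sI.
split; [exact: cL1|exact: cst_continuous|].
by have [h _] := LP s; have [_ ->] := h 1 I1; rewrite H'1 /c l0.
Qed.

End lifting.

(** * Distance to the base point *)

Section inverse_exponential.
Context {R : realType} {n : nat} {M : ptopologicalType}.
Variable g : riemannian R n M.
Implicit Types (i j : chart g).
Hypothesis complete : geodesically_complete g.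
Variable P : M.
Local Notation gd := (gd complete P).
Local Notation ex v := (gd v 1).

(* [sg] will be the inverse of [Exp P], and [en] the square of the distance to [P]. *)
Definition sg (x : M) : 'rV[R]_n := xget 0 [set v | ex v = x].

Definition en (x : M) : R := inner g P (sg x) (sg x).

Definition rho (x : M) : R := Num.sqrt (en x).

Lemma enE x : en x = inner g P (sg x) (sg x). Proof. by []. Qed.

Lemma rhoE x : rho x = Num.sqrt (en x). Proof. by []. Qed.

Lemma en_ge0 x : 0 <= en x. Proof. exact: inner_ge0. Qed.

Lemma rho_ge0 x : 0 <= rho x. Proof. exact: sqrtr_ge0. Qed.

Lemma rho_sqr x : rho x ^+ 2 = en x. Proof. by rewrite sqr_sqrtr// en_ge0. Qed.

Section with_curvature.
Variable b : R.
Hypothesis b0 : 0 <= b.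
Hypothesis sec : sectional_curvature_le g (- b).

(** Extends [perp_hessian] to [v = 0], where [DD] is 0 and the comparison function is the
    identity. *)
Lemma perp_hessian_DD v k :
  (1 + DD b (Num.sqrt (inner g P v v))) * perpN complete P v k 1 <= perpQ complete P v k 1.
Proof.
set E := inner g P v v; have E_ge0 : 0 <= E by exact: inner_ge0.
have [v0|v0] := eqVneq v 0; last first.
  have rp : 0 < Num.sqrt E.
    by rewrite sqrtr_gt0 lt_neqAle E_ge0 andbT eq_sym; apply: contra_neq v0; exact: inner_eq0.
  by rewrite /DD gt_eqF// addrC subrK; exact: perp_hessian.
have E0 : E = 0 by rewrite /E v0 inner_ip /ip bil0l.
rewrite E0 sqrtr0 /DD eqxx addr0 mul1r.
have := @perp_comparison _ _ _ g complete P b b0 sec v k id (fun=> 1) 1 ler01.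
rewrite !mulr1; apply=> //.
by move=> t _; rewrite -/E E0 mulr0 mul0r; exact: is_derive_cst.
Qed.

(** [QQ] at time 1 is the Hessian of [rho^2 / 2] evaluated at [J]: the factor is 1 on the radial
    component of [J], whose squared norm is [<v, k>^2 / <v, v>], and at least [1 + DD] on the
    rest. *)
Lemma hessian i v k : chart_dom i (ex v) ->
  inner g P v k ^+ 2 / inner g P v v + (1 + DD b (Num.sqrt (inner g P v v))) *
   (NN complete P i v k 1 - inner g P v k ^+ 2 / inner g P v v) <= QQ complete P i v k 1.
Proof.
move=> iv; set E := inner g P v v; set a := inner g P v k; have := perp_hessian_DD v k; rewrite /perpN /perpQ -/E -/a (expr2 1) !mul1r.
have di := dep1 iv; have dc := dep_ca complete P v (@ler01 R).
rewrite /gNN /gQQ (NN_trans k di dc) (QQ_trans k di dc) lerBrDl.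
exact.
Qed.

Hypothesis sc : simply_connected R M.

Lemma sgK x : ex (sg x) = x.
Proof.
have [v vx] := exp_surjective complete P b0 sec sc.1 x.
by rewrite /sg; case: xgetP => [w -> //|/(_ v)].
Qed.

Lemma exK v : sg (ex v) = v.
Proof. by apply: (exp_injective b0 sec sc); exact: sgK. Qed.

(** By global injectivity, [sg] coincides near every point with a local inverse of the exponential
    map. *)
Lemma sg_c11 i y : cod i y -> exists A, c11v (fun z => sg (param i z)) A y.
Proof.
move=> iy; have [pd pc] := cod_param iy.
have iv : chart_dom i (ex (sg (param i y))) by rewrite sgK.
have [r [S [A [r0 _ _ nS]]]] := exp_local b0 sec iv.
rewrite sgK pc in nS; exists A.
have [_ _ _ cS] := nbhs_singleton nS.
move=> k; apply: c11_ext (cS k); apply: filterS nS => z [_ h2 h3 _]; split=> //.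
by rewrite -[in RHS]h3 coordK// exK.
Qed.

Lemma sg_c11e i y k : cod i y -> c11e (fun z => sg (param i z) 0 k) y.
Proof. by move=> /sg_c11[A h]; exists (fun q => col k (A q)); exact: h. Qed.

Lemma sg_curve i c (t : R) x' : {for t, continuous c} -> chart_dom i (c t) ->
  is_derive t 1 (coord i \o c) x' ->
  exists2 k, is_derive t 1 (sg \o c) k & Jx complete P i (sg (c t)) k 1 = x'.
Proof.
move=> cc it dx; have [A hA] := sg_c11 (cod_coord it).
have nc : \forall s \near t, chart_dom i (c s) := cc _ (near_chart it).
have d1 : is_derive t 1 (sg \o c) (x' *m A (coord i (c t))).
  apply: near_eq_is_derive (c11v_curve hA dx); apply: filterS nc => s is_.
  by rewrite /= coordK.
exists (x' *m A (coord i (c t))) => //.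
have iv : chart_dom i (ex (sg (c t))) by rewrite sgK.
rewrite JX_Jx; apply: is_derive_unique (c11v_curve (ex_c11 iv) d1) _.
by apply: near_eq_is_derive dx; apply: filterE => s; rewrite /= sgK.
Qed.

(** The Gauss lemma for [rho^2]: its gradient is twice the radial field, given at a point by the
    velocity at time 1 of the geodesic from [P] to that point. *)
Lemma en_curve i c (t : R) x' : {for t, continuous c} -> chart_dom i (c t) ->
  is_derive t 1 (coord i \o c) x' ->
  is_derive t 1 (en \o c) (2 * ip i (coord i (c t)) x' (yy complete P i (sg (c t)) 1)).
Proof.
move=> cc it dx; have [k dk Jk] := sg_curve cc it dx.
have iv : chart_dom i (ex (sg (c t))) by rewrite sgK.
have := @mm_eq _ _ _ g complete P i _ k 1 (@ler01 R) iv; rewrite mul1r /mm Jk /xx sgK => ->.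
exact: inner_derive dk.
Qed.

Lemma yy_norm i x : chart_dom i x -> let y := yy complete P i (sg x) 1 in ip i (coord i x) y y = en x.
Proof.
move=> ix y; have iv : chart_dom i (ex (sg x)) by rewrite sgK.
by have := @EE_inner _ _ _ g complete P i _ 1 (@ler01 R) iv; rewrite /EE /xx sgK.
Qed.

End with_curvature.

End inverse_exponential.

(** * Lengths of curves and the distance to the base point *)

Section distance.
Context {R : realType} {n : nat} {M : ptopologicalType}.
Variable g : riemannian R n M.
Implicit Types (i j : chart g).
Notation mu := (@lebesgue_measure R).

Definition speed (e : R -> M) (t : R) : R := tnorm g (e t) (velocity g e t).

Lemma speed_ge0 e t : 0 <= speed e t. Proof. exact: sqrtr_ge0. Qed.

Lemma C1_is_derive e i (t : R) : C1_curve g e -> chart_dom i (e t) ->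
  is_derive t 1 (coord i \o e) (derive1 (coord i \o e) t).
Proof. by move=> [_ h] it; have [d _] := h i t it; rewrite derive1E; exact: derivableP. Qed.

Lemma speed_chart e i t : C1_curve g e -> chart_dom i (e t) ->
  speed e t = Num.sqrt (ip i (coord i (e t)) (derive1 (coord i \o e) t) (derive1 (coord i \o e) t)).
Proof.
move=> ce it; rewrite /speed /tnorm inner_ip /velocity; congr Num.sqrt.
have jt := chart_atP g (e t); set j := chart_at g (e t) in jt *.
have d1 := curve_trans ce.1 it jt (C1_is_derive ce it).
rewrite (is_derive_unique (C1_is_derive ce jt) d1) -ip_trans//.
Qed.

Lemma continuous_sumf (T : topologicalType) m (F : 'I_m -> T -> R) (t : T) :
  (forall a, {for t, continuous (F a)}) -> {for t, continuous (fun s => \sum_a F a s)}.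
Proof.
move=> h; elim: (index_enum _) => [|a r IH].
  by apply: (@continuous_near_eq _ _ (fun=> 0)); [exact: cst_continuous|apply: filterE => s; rewrite big_nil].
apply: (@continuous_near_eq _ _ (fun s => F a s + \sum_(i <- r) F i s)).
  by apply: continuousD; [exact: h|exact: IH].
by apply: filterE => s; rewrite big_cons.
Qed.

Lemma speed_continuous e : C1_curve g e -> continuous (speed e).
Proof.
move=> ce t; have it := chart_atP g (e t); set i := chart_at g (e t) in it.
pose x := coord i \o e; pose d := derive1 x.
have ni : \forall s \near t, chart_dom i (e s) := ce.1 t _ (near_chart it).
have cx : {for t, continuous x} by exact: is_derive_continuous (C1_is_derive ce it).
have cd : {for t, continuous d} by have [_ h] := ce; have [] := h i t it.
apply: (@continuous_near_eq _ _ (fun s => Num.sqrt (ip i (x s) (d s) (d s)))); last first.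
  by apply: filterS ni => s is_; exact: speed_chart.
have cq : {for t, continuous (fun s => ip i (x s) (d s) (d s))}.
  apply: continuous_sumf => a; apply: continuous_sumf => c.
  have [A hA] := gcoef_c11 a c (cod_coord it).
  have c1 : {for t, continuous (fun s => gcoef i a c (x s))}.
    exact: continuous_comp cx (c11_continuous hA).
  have c2 l : {for t, continuous (fun s => d s 0 l)}.
    exact: continuous_comp cd (c11_continuous (c11_coord l (d t))).
  by apply: continuousM; [apply: continuousM|].
exact: continuous_comp cq (@sqrt_continuous R _).
Qed.

Lemma speed_integrable e a c : C1_curve g e -> mu.-integrable `[a, c] (EFin \o speed e).
Proof.
move=> ce; apply: continuous_compact_integrable; first exact: segment_compact.
by apply: continuous_subspaceT => t; exact: speed_continuous.
Qed.

Definition arc e a (t : R) : R := (\int[mu]_(s in `[a, t]) speed e s)%R.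

(** A two-sided derivative requires [a < t]; accordingly the arc length is measured below from a
    time before the interval of interest. *)
Lemma arc_derive e (a t : R) : C1_curve g e -> a < t -> is_derive t 1 (arc e a) (speed e t).
Proof.
move=> ce at_; have tt : t < t + 1 by rewrite ltrDl.
have [d1 d2] := continuous_FTC1_closed tt (speed_integrable a (t + 1) ce) at_ (@speed_continuous e ce t).
by rewrite -d2 derive1E; exact: derivableP.
Qed.

Lemma integral_speed e a u v : C1_curve g e -> a < u -> u <= v ->
  (\int[mu]_(t in `]u, v[) (speed e t)%:E = (arc e a v - arc e a u)%:E)%E.
Proof.
move=> ce au uv.
have h : arc e a v - arc e a u = (\int[mu]_(s in `]u, v]) speed e s)%R.
  by apply: Rintegral_itvB; [exact: speed_integrable|rewrite bnd_simp ltW|rewrite bnd_simp].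
have mf : measurable_fun `]u, v[ (EFin \o speed e).
  apply/measurable_EFinP; apply: measurable_funTS; apply: continuous_measurable_fun => t.
  exact: speed_continuous.
have int : mu.-integrable `]u, v] (EFin \o speed e).
  apply: integrableS (speed_integrable u v ce) => //.
  by move=> s /=; rewrite !in_itv /= => /andP[/ltW -> ->].
rewrite h /Rintegral fineK; last exact: integrable_fin_num.
exact: integral_itv_bndo_bndc.
Qed.

Hypothesis complete : geodesically_complete g.
Variable P : M.
Local Notation gd := (gd complete P).
Local Notation ex v := (gd v 1).
Local Notation sg := (sg complete P).
Local Notation en := (en complete P).
Local Notation rho := (rho complete P).
Variable b : R.
Hypothesis b0 : 0 <= b.
Hypothesis sec : sectional_curvature_le g (- b).
Hypothesis sc : simply_connected R M.

(** By [en_curve] and Cauchy-Schwarz the distance grows no faster than arc length. The shift [del]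
    makes the square root differentiable where the curve meets [P]. *)
Lemma energy_growth e u v del : 0 < del -> C1_curve g e -> u <= v ->
  ((Num.sqrt (del + en (e v)) - Num.sqrt (del + en (e u)))%:E <= \int[mu]_(t in `]u, v[) (speed e t)%:E)%E.
Proof.
move=> d0 ce uv; have u1 : u - 1 < u by rewrite ltrBlDr ltrDl.
rewrite (integral_speed ce u1 uv) lee_fin.
pose h t := Num.sqrt (del + en (e t)).
pose x' t := derive1 (coord (chart_at g (e t)) \o e) t.
pose dh t := (2 * h t)^-1 * (2 * ip (chart_at g (e t)) (coord (chart_at g (e t)) (e t)) (x' t) (yy complete P (chart_at g (e t)) (sg (e t)) 1)).
have W0 t : 0 < del + en (e t) by rewrite ltr_wpDr// en_ge0.
have hh (t : R) : is_derive t 1 h (dh t).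
  have it := chart_atP g (e t).
  have h1 := en_curve complete P b0 sec sc (ce.1 t) it (C1_is_derive ce it).
  have h2 : is_derive t 1 (fun s => del + en (e s)) (2 * ip (chart_at g (e t)) (coord (chart_at g (e t)) (e t)) (x' t) (yy complete P (chart_at g (e t)) (sg (e t)) 1)).
    by have := is_deriveD (is_derive_cst (del : R) (t : R) (1 : R)) h1; rewrite add0r.
  exact: (@is_derive1_comp R Num.sqrt (fun s => del + en (e s)) t _ _ (is_derive1_sqrt (W0 t)) h2).
have dle t : dh t <= speed e t.
  have it := chart_atP g (e t); have ct := cod_coord it.
  have w0 : 0 < h t by rewrite sqrtr_gt0.
  rewrite /dh invfM -mulrA mulrCA mulKf ?pnatr_eq0// ler_pdivrMl//.
  apply: le_trans (ler_norm _) _; rewrite -sqrtr_sqr.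
  apply: le_trans (ler_wsqrtr (ip_CS _ _ ct)) _.
  rewrite (yy_norm complete P b0 sec sc it) sqrtrM ?ip_ge0// mulrC (speed_chart ce it).
  by apply: ler_pM; rewrite ?sqrtr_ge0// ler_wsqrtr// lerDr ltW.
have := @nondecreasing_of_derive R (fun t => arc e (u - 1) t - h t) (fun t => speed e t - dh t) u v uv.
rewrite -/(h v) -/(h u); have H : forall p q p' q' : R, p - q <= p' - q' -> q' - q <= p' - p by move=> *; lra.
move=> N; apply: H; apply: N => t /andP[ut _]; last by rewrite subr_ge0.
by apply: is_deriveB; apply: arc_derive => //; exact: lt_le_trans u1 ut.
Qed.

Lemma velocity_near c e t : (\forall s \near t, c s = e s) -> velocity g c t = velocity g e t.
Proof.
move=> ce; rewrite /velocity (nbhs_singleton ce); apply: near_eq_derive1.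
by apply: filterS ce => s /= ->.
Qed.

Lemma en0 : en P = 0.
Proof.
rewrite enE; have -> : sg P = 0; last by rewrite inner_ip /ip bil0l.
by have := exK complete P b0 sec sc 0; rewrite ex0.
Qed.

Lemma rho_le_length c : piecewise_C1 g c -> c 0 = P -> rho (c 1) <= curve_length g c.
Proof.
move=> [m [s [s0 sm hs]]] cP.
have smono k : (k <= m)%N -> 0 <= s k.
  elim: k => [|k IH] km; first by rewrite s0.
  by apply: le_trans (IH (ltnW km)) _; have [/ltW] := hs k km.
(* [curve_length] is the finite part of an integral and would be 0 if the integral were infinite, so
   finiteness is proved along with the bound. Half-open intervals make consecutive pieces
   disjoint. *)
have key del k : 0 < del -> (k <= m)%N -> measurable_fun (`[0, s k[ : set R) (EFin \o speed c) /\
  ((Num.sqrt (del + en (c (s k))) - Num.sqrt del)%:E <= \int[mu]_(t in `[0%R, s k[) (speed c t)%:E < +oo)%E.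
  move=> d0; elim: k => [|k IH] km.
    rewrite s0 cP en0 addr0 subrr set_itvco0; split; first exact: measurable_fun_set0.
    by rewrite integral_set0 lexx ltry.
  have [mk /andP[lk fk]] := IH (ltnW km).
  have [sk [e ce cE]] := hs k km.
  have sp t : s k < t < s k.+1 -> speed c t = speed e t.
    move=> /andP[t1 t2]; have nt : \forall x \near t, c x = e x.
      near=> x; apply: cE; rewrite in_itv /= !ltW//; near: x.
        by apply: (@cvgr_lt _ _ (nbhs t) _ id t) => //; exact: cvg_id.
      by apply: (@cvgr_gt _ _ (nbhs t) _ id t) => //; exact: cvg_id.
    by rewrite /speed (nbhs_singleton nt) (velocity_near nt).
  have me : measurable_fun (`]s k, s k.+1[ : set R) (EFin \o speed c).
    apply: (eq_measurable_fun (EFin \o speed e)).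
      by move=> t; rewrite inE /= in_itv /= => /sp ->.
    apply/measurable_EFinP; apply: measurable_funTS; apply: continuous_measurable_fun => t.
    exact: speed_continuous.
  have mc : measurable_fun (`[s k, s k.+1[ : set R) (EFin \o speed c).
    rewrite -(@setU1itv _ _ (BLeft (s k.+1)) (s k) false) ?bnd_simp//; apply/measurable_funU => //; split=> //.
    exact: measurable_fun_set1.
  have int_e : (\int[mu]_(t in `[s k, s k.+1[) (speed c t)%:E = \int[mu]_(t in `]s k, s k.+1[) (speed e t)%:E)%E.
    rewrite -(integral_itv_obnd_cbnd me); apply: eq_integral => t.
    by rewrite inE /= in_itv /= => /sp /= ->.
  have U : `[0, s k.+1[%classic = `[0, s k[%classic `|` `[s k, s k.+1[%classic.
    by apply: itv_bndbnd_setU; rewrite bnd_simp; [exact: smono (ltnW km)|exact: ltW].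
  have mU : measurable_fun (`[0, s k.+1[ : set R) (EFin \o speed c).
    rewrite U; apply/(measurable_funU _ (measurable_itv _) (measurable_itv _)).
    by split; [exact: mk|exact: mc].
  split; first exact: mU.
  rewrite U ge0_integral_setU; [|exact: measurable_itv|exact: measurable_itv| | |].
  - rewrite int_e; have ce1 : c (s k) = e (s k) by apply: cE; rewrite in_itv /= lexx ltW.
    have ce2 : c (s k.+1) = e (s k.+1) by apply: cE; rewrite in_itv /= lexx ltW.
    have := energy_growth d0 ce (ltW sk); rewrite -ce1 -ce2 => gr.
    apply/andP; split.
      apply: le_trans (leeD lk gr); rewrite -EFinD lee_fin; lra.
    have k1 : s k - 1 < s k by rewrite ltrBlDr ltrDl.
    rewrite (integral_speed ce k1 (ltW sk)); apply: lte_add_pinfty; [exact: fk|exact: ltry].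
  - by rewrite -U; exact: mU.
  - by move=> x _; rewrite lee_fin speed_ge0.
  - apply/disj_setPS => y [/=]; rewrite 2!in_itv/= => /andP[_ yx] /andP[].
    by rewrite leNgt yx.
have [mc /andP[_ fin]] := key 1 m ltr01 (leqnn m).
rewrite sm in mc fin.
have LE : (curve_length g c)%:E = (\int[mu]_(t in `[0%R, 1%R[) (speed c t)%:E)%E.
  rewrite /curve_length /Rintegral (integral_itv_bndo_bndc mc) fineK//.
  rewrite ge0_fin_numE; last by apply: integral_ge0 => t _; rewrite lee_fin; exact: speed_ge0.
  by rewrite -(integral_itv_bndo_bndc mc); exact: fin.
apply/ler_addgt0Pl => eps eps0.
pose del := eps ^+ 2; have d0 : 0 < del by rewrite exprn_gt0.
have [_ /andP[+ _]] := key del m d0 (leqnn m); rewrite sm -LE lee_fin => h.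
have sq : Num.sqrt del = eps by rewrite sqrtr_sqr gtr0_norm.
apply: (@le_trans _ _ (Num.sqrt (del + en (c 1)))); first by rewrite ler_wsqrtr// lerDr ltW.
by move: h; rewrite sq; lra.
Unshelve. all: by end_near. Qed.

Lemma length_nonneg c : 0 <= curve_length g c.
Proof. by apply: Rintegral_ge0 => t _; exact: sqrtr_ge0. Qed.

Lemma radial_length x : exists c, [/\ piecewise_C1 g c, c 0 = P, c 1 = x & curve_length g c = rho x].
Proof.
exists (gd (sg x)); have gc := gd_geodesic complete P (sg x).
split; [|exact: gd0|exact: (sgK complete P b0 sec sc)|].
  exists 1%N, (fun k => k%:R); split=> // -[|//] _; split; first exact: ltr01.
  by exists (gd (sg x)); [case: gc|].
have E t : 0 <= t -> tnorm g (gd (sg x) t) (velocity g (gd (sg x)) t) = rho x.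
  move=> t0; rewrite /tnorm rhoE; congr Num.sqrt.
  by rewrite -[RHS](@gEE_inner _ _ _ g complete P (sg x) t t0) /gEE /EE /yy rsub_state inner_ip.
transitivity (\int[mu]_(t in `[0%R, 1%R]) rho x)%R.
  by apply: eq_Rintegral => t; rewrite inE /= in_itv /= => /andP[t0 _]; exact: E.
by rewrite Rintegral_cst//= lebesgue_measure_itv /= lte_fin ltr01 oppr0 addr0 /= mulr1.
Qed.

Lemma geodesic_dist_rho x : geodesic_dist g P x = rho x.
Proof.
have [c [pc c0 c1 lc]] := radial_length x.
apply/eqP; rewrite eq_le; apply/andP; split.
  rewrite -lc; apply: ge_inf; last by exists c.
  by exists 0 => _ [c' _ <-]; exact: length_nonneg.
apply: lb_le_inf; first by exists (curve_length g c), c.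
by move=> _ [c' [p0 p1 p2] <-]; rewrite -p2; exact: rho_le_length.
Qed.

End distance.

(** * Divergence of the radial field *)

Lemma row_entry (R : realType) (n : nat) (X W : 'M[R]_n) a :
  (row a X *m (row a W)^T) 0 0 = (X *m W^T) a a.
Proof.
rewrite [LHS]mxE [RHS]mxE; apply: eq_bigr => k _.
by rewrite [row a X 0 k]mxE [(row a W)^T _ _]mxE [row a W _ _]mxE [W^T _ _]mxE.
Qed.

Section orthonormal_frames.
Context {R : realType} {n : nat}.
Variable G : 'M[R]_n.
Hypothesis Gsym : G^T = G.
Hypothesis Gpos : forall u : 'rV[R]_n, u != 0 -> 0 < (u *m G *m u^T) 0 0.

(** Instead of orthogonalising a basis, a further vector is taken in the kernel of [G *m U^T], which
    is nonzero as long as fewer than [n] vectors are present. *)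
Lemma orthonormal_family m : (m <= n)%N -> exists U : 'M[R]_(m, n), U *m G *m U^T = 1%:M.
Proof.
elim: m => [|m IH] mn.
  by exists 0; apply/matrixP => -[].
have [U UU] := IH (ltnW mn).
have : kermx (G *m U^T) != 0.
  rewrite -mxrank_eq0 mxrank_ker subn_eq0 -ltnNge.
  exact: leq_ltn_trans (rank_leq_col _) mn.
rewrite -nz_row_eq0; have /sub_kermxP := nz_row_sub (kermx (G *m U^T)).
move: (nz_row _) => w wk w0; rewrite mulmxA in wk.
have q0 := Gpos w0; set q := (w *m G *m w^T) 0 0 in q0.
have s0 : Num.sqrt q != 0 by rewrite gt_eqF// sqrtr_gt0.
pose e := (Num.sqrt q)^-1 *: w.
have ee : e *m G *m e^T = 1%:M.
  rewrite /e -!scalemxAl linearZ /= -scalemxAr scalerA [w *m G *m w^T]mx11_scalar -/q.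
  apply/matrixP => a b; rewrite !ord1 !mxE !mulr1n.
  by rewrite -invfM -expr2 sqr_sqrtr ?(ltW q0)// mulVf// gt_eqF.
have eU : e *m G *m U^T = 0 by rewrite /e -!scalemxAl wk scaler0.
have Ue : U *m G *m e^T = 0.
  have -> : U *m G *m e^T = (e *m G *m U^T)^T by rewrite !trmx_mul trmxK Gsym mulmxA.
  by rewrite eU trmx0.
have : exists V : 'M[R]_(1 + m, n), V *m G *m V^T = 1%:M; last by case=> V; exists V.
exists (col_mx e U).
rewrite mul_col_mx tr_col_mx mul_mx_row !mul_col_mx ee eU Ue UU.
by rewrite -block_mxEh -scalar_mx_block.
Qed.

Lemma orthonormal_frame : exists U : 'M[R]_n, [/\ U *m G *m U^T = 1%:M, U \in unitmx & U^T *m U *m G = 1%:M].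
Proof.
have [U UU] := orthonormal_family (leqnn n).
have Uu : U \in unitmx by have := mulmx1_unit (etrans (mulmxA _ _ _) UU); case.
exists U; split=> //.
have h : G *m U^T *m U = 1%:M by apply: mulmx1C; rewrite mulmxA.
by have := congr1 trmx h; rewrite !trmx_mul trmxK Gsym trmx1 mulmxA.
Qed.

Lemma pos_det : 0 < \det G.
Proof.
have [U [UU Uu _]] := orthonormal_frame.
have : \det U ^+ 2 * \det G = 1.
  by rewrite -(det1 R n) -UU !det_mulmx det_tr expr2 mulrAC.
have d0 : \det U != 0 by rewrite -unitfE -unitmxE.
have d2 : 0 < \det U ^+ 2 by rewrite lt_neqAle eq_sym sqrf_eq0 d0 sqr_ge0.
move=> h; rewrite -(pmulr_rgt0 _ d2) h; exact: ltr01.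
Qed.

(* The trace is computed in an orthonormal frame, where Parseval's identity
   evaluates the two terms of the lower bound. *)
Lemma trace_lower_bound (B : 'M[R]_n) (Y : 'rV[R]_n) c : let E := (Y *m G *m Y^T) 0 0 in
  (forall w : 'rV[R]_n, let a := (w *m G *m Y^T) 0 0 in
    a ^+ 2 / E + c * ((w *m G *m w^T) 0 0 - a ^+ 2 / E) <= (w *m B *m G *m w^T) 0 0) ->
  c * n%:R + (1 - c) * (E / E) <= \tr B.
Proof.
move=> E h; have [U [UU Uu UtU]] := orthonormal_frame.
have trE : \tr B = \sum_a (row a U *m B *m G *m (row a U)^T) 0 0.
  have -> : \tr B = \tr (U *m B *m G *m U^T).
    rewrite -!mulmxA mxtrace_mulC -!mulmxA; congr (\tr _).
    have UG : U^T *m U *m G = 1%:M := UtU.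
    have : G *m U^T *m U = 1%:M by have := congr1 trmx UG; rewrite !trmx_mul trmxK Gsym trmx1 mulmxA.
    by rewrite -mulmxA => ->; rewrite mulmx1.
  by apply: eq_bigr => a _; rewrite -2!row_mul row_entry.
have par : \sum_a ((row a U *m G *m Y^T) 0 0) ^+ 2 = E.
  have GUU : G *m U^T *m U = 1%:M.
    by have := congr1 trmx UtU; rewrite !trmx_mul trmxK Gsym trmx1 mulmxA.
  have -> : E = ((Y *m G *m U^T) *m (U *m G *m Y^T)) 0 0.
    by rewrite !mulmxA -(mulmxA Y G) -(mulmxA Y) GUU mulmx1.
  rewrite [RHS]mxE; apply: eq_bigr => a _; rewrite -!row_mul [row a (U *m G *m Y^T) 0 0]mxE expr2; congr (_ * _).
  have -> : Y *m G *m U^T = (U *m G *m Y^T)^T by rewrite !trmx_mul trmxK Gsym mulmxA.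
  by rewrite [RHS]mxE.
have one a : (row a U *m G *m (row a U)^T) 0 0 = 1.
  by rewrite -row_mul row_entry UU mxE eqxx.
rewrite trE; apply: le_trans (ler_sum _ (fun a _ => h (row a U))).
rewrite (eq_bigr (fun a => c + (1 - c) * (((row a U *m G *m Y^T) 0 0) ^+ 2 / E))); last first.
  by move=> a _; rewrite one /=; ring.
by rewrite big_split /= sumr_const card_ord -[c *+ n]mulr_natr -mulr_sumr -mulr_suml par.
Qed.

End orthonormal_frames.

(** * Derivatives of determinants *)

Section jacobi_formula.
Context {R : realType}.

Lemma is_derive_prodf (I : eqType) (r : seq I) (f : I -> R -> R) (df : I -> R) (t : R) : uniq r ->
  (forall j, is_derive t 1 (f j) (df j)) ->
  is_derive t 1 (fun s => \prod_(j <- r) f j s) (\sum_(i <- r) \prod_(j <- r) (if j == i then df j else f j t)).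
Proof.
move=> + h; elim: r => [_|a r IH /= /andP[ar /IH {}IH]].
  rewrite big_nil; apply: near_eq_is_derive (is_derive_cst (1 : R) t 1).
  by apply: filterE => s; rewrite big_nil.
have := is_derive_mul (h a) IH.
rewrite [X in is_derive _ _ _ X -> _](_ : _ = \sum_(i <- a :: r) \prod_(j <- a :: r) (if j == i then df j else f j t)).
  by apply: near_eq_is_derive; apply: filterE => s; rewrite big_cons.
rewrite big_cons big_cons eqxx; congr (_ + _).
  congr (_ * _); rewrite big_seq [RHS]big_seq; apply: eq_bigr => j jr.
  by case: eqP => // ja; rewrite -ja jr in ar.
rewrite mulr_sumr [LHS]big_seq [RHS]big_seq; apply: eq_bigr => i ir; rewrite big_cons.
by case: eqP => // ai; rewrite ai ir in ar.
Qed.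

Lemma is_derive_sums (I : Type) (r : seq I) (f : I -> R -> R) (df : I -> R) (t : R) :
  (forall j, is_derive t 1 (f j) (df j)) ->
  is_derive t 1 (fun s => \sum_(j <- r) f j s) (\sum_(j <- r) df j).
Proof.
move=> h; elim: r => [|a r IH].
  rewrite big_nil; apply: near_eq_is_derive (is_derive_cst (0 : R) t 1).
  by apply: filterE => s; rewrite big_nil.
rewrite big_cons; apply: near_eq_is_derive (is_deriveD (h a) IH).
by apply: filterE => s; rewrite big_cons.
Qed.

(** Jacobi's formula. The product rule gives the sum over [i] of the determinants in which row [i]
    is differentiated, and each of them is expanded along that row. *)
Lemma det_derive n (A : R -> 'M[R]_n) (t : R) A' : is_derive t 1 A A' ->
  is_derive t 1 (fun s => \det (A s)) (\tr (A' *m \adj (A t))).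
Proof.
move=> /is_derive_mxP dA.
have h (s : {perm 'I_n}) : is_derive t 1 (fun z => (-1) ^+ s * \prod_i A z i (s i))
   ((-1) ^+ s * \sum_i \prod_j (if j == i then A' j (s j) else A t j (s j))).
  have := is_derive_mul (is_derive_cst ((-1) ^+ s : R) t 1)
    (@is_derive_prodf _ (index_enum 'I_n) (fun i z => A z i (s i)) (fun i => A' i (s i)) t (index_enum_uniq _) (fun j => dA j (s j))).
  by rewrite mul0r add0r.
have := is_derive_sums (index_enum _) h.
rewrite [X in is_derive _ _ _ X -> _](_ : _ = \tr (A' *m \adj (A t))); last first.
  under eq_bigr do rewrite mulr_sumr.
  rewrite exchange_big /=; apply: eq_bigr => i _.
  pose Bi := \matrix_(j, k) (if j == i then A' j k else A t j k).
  transitivity (\det Bi).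
    by apply: eq_bigr => s _; congr (_ * _); apply: eq_bigr => j _; rewrite mxE.
  rewrite (expand_det_row Bi i) mxE; apply: eq_bigr => k _; rewrite !mxE eqxx; congr (_ * _).
  rewrite /cofactor; congr (_ * \det _); apply/matrixP => a c; rewrite !mxE.
  by rewrite eq_sym (negbTE (neq_lift _ _)).
by [].
Qed.

Lemma sqrt_det_derive n (A : R -> 'M[R]_n) (t : R) A' : is_derive t 1 A A' -> 0 < \det (A t) ->
  is_derive t 1 (fun s => Num.sqrt (\det (A s))) (Num.sqrt (\det (A t)) * (2^-1 * \tr (invmx (A t) *m A'))).
Proof.
move=> dA d0; have dd := det_derive dA.
have := @is_derive1_comp R Num.sqrt (fun s => \det (A s)) t _ _ (is_derive1_sqrt d0) dd.
rewrite [X in is_derive _ _ _ X -> _](_ : _ = Num.sqrt (\det (A t)) * (2^-1 * \tr (invmx (A t) *m A')))//.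
have Au : A t \in unitmx by rewrite unitmxE unitfE gt_eqF.
rewrite /invmx Au -scalemxAl mxtraceZ [\tr (\adj _ *m _)]mxtrace_mulC.
have s0 : Num.sqrt (\det (A t)) != 0 by rewrite gt_eqF// sqrtr_gt0.
have s2 : Num.sqrt (\det (A t)) ^+ 2 = \det (A t) by rewrite sqr_sqrtr// ltW.
move: s0 s2; move: (Num.sqrt _) => w w0 <-; move: (\tr _) => q; field.
by rewrite w0.
Qed.

End jacobi_formula.

(** * The divergence in a chart and its value on the radial field *)

Section chart_divergence.
Context {R : realType} {n : nat} {M : ptopologicalType}.
Variable g : riemannian R n M.
Implicit Types (i j : chart g).

Lemma metric_det_gt0 i y : cod i y -> 0 < \det (metric i y).
Proof. by move=> iy; apply: pos_det; [exact: metric_sym|exact: metric_pos]. Qed.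

Definition dens i (y : 'rV[R]_n) : R := Num.sqrt (\det (metric i y)).

Lemma dens_gt0 i y : cod i y -> 0 < dens i y.
Proof. by move=> iy; rewrite sqrtr_gt0 metric_det_gt0. Qed.

Lemma dens_c11 i y : cod i y -> c11e (dens i) y.
Proof.
move=> iy; apply: c11_sqrt; last exact: metric_det_gt0.
by apply: c11e_det => a c; exact: metric_c11.
Qed.

(** The Christoffel part of the covariant derivative of a field with value [X], as a matrix acting
    on directions. *)
Definition gamma_mx i y (X : 'rV[R]_n) : 'M[R]_n := \matrix_(a, k) Gam i y (delta_mx 0 a) X 0 k.

Lemma gamma_mxE i y X w : w *m gamma_mx i y X = Gam i y w X.
Proof.
apply/rowP => k; rewrite [LHS]mxE [in RHS](row_sum_delta w).
have -> : Gam i y (\sum_j w 0 j *: delta_mx 0 j) X = \sum_j w 0 j *: Gam i y (delta_mx 0 j) X.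
  elim/big_ind2 : _ => [|u v u' v' <- <-|j _]; last by rewrite GamZl.
    by have := GamZl i y 0 (0 : 'rV[R]_n) X; rewrite !scale0r.
  by rewrite GamDl.
by rewrite summxE; apply: eq_bigr => j _; rewrite !mxE.
Qed.

Lemma metric_line_derive i y a : cod i y ->
  is_derive (0 : R) 1 (fun t => metric i (y + t *: delta_mx 0 a))
    (\matrix_(c, d) partial a (fun z => metric i z c d : R^o) y).
Proof.
move=> iy; apply/is_derive_mxP => c d; rewrite mxE.
have [A hA] := metric_c11 c d iy.
have z0 : y + (0 : R) *: delta_mx 0 a = y by rewrite scale0r addr0.
have := @c11_curve R n _ A (fun t => y + t *: delta_mx 0 a) 0 _ _ (line_is_derive_id y (delta_mx 0 a) 0).
rewrite z0 => /(_ _ hA); have [_ <-] := c11_derive (delta_mx 0 a) hA.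
exact.
Qed.

(** In the contracted Christoffel symbols two of the three derivatives of the metric cancel, being
    antisymmetric against the symmetric inverse metric. The remaining one is the logarithmic
    derivative of the volume density. *)
Lemma gamma_trace i y X : cod i y ->
  \tr (gamma_mx i y X) = \sum_a 2^-1 * \tr (invmx (metric i y) *m
     (\matrix_(c, d) partial a (fun z => metric i z c d : R^o) y)) * X 0 a.
Proof.
move=> iy; pose dG a c d := partial a (fun z => metric i z c d : R^o) y.
pose I := invmx (metric i y).
have Isym c d : I c d = I d c.
  have : I^T = I by rewrite /I trmx_inv (metric_sym iy).
  by move=> /(congr1 (fun X : 'M[R]_n => X d c)); rewrite mxE.
have dGsym a c d : dG a c d = dG a d c.
  rewrite /dG /partial; apply: near_eq_derive.
  by apply: filterS (gcoef_sym_near c d iy) => z.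
have chr k a c : christoffel i k a c y = 2^-1 * \sum_l I k l * (dG a c l + dG c a l - dG l a c) by [].
transitivity (\sum_k \sum_a christoffel i k k a y * X 0 a).
  apply: eq_bigr => k _; rewrite mxE GamE mxE (bigD1 k)//= [X in _ + X]big1 => [|c ck].
    by rewrite addr0; apply: eq_bigr => a _; rewrite mxE !eqxx mulr1.
  by rewrite big1// => a _; rewrite mxE eqxx /= (negbTE ck) mulr0 mul0r.
rewrite exchange_big /=; apply: eq_bigr => a _; rewrite -mulr_suml; congr (_ * _).
under eq_bigr do rewrite chr.
rewrite -mulr_sumr; congr (_ * _).
transitivity (\sum_k \sum_l I k l * dG a k l + \sum_k \sum_l I k l * (dG k a l - dG l k a)).
  rewrite -big_split; apply: eq_bigr => k _; rewrite -big_split; apply: eq_bigr => l _ /=; ring.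
have -> : \sum_k \sum_l I k l * (dG k a l - dG l k a) = 0.
  have : \sum_k \sum_l I k l * (dG k a l - dG l k a) = - \sum_k \sum_l I k l * (dG k a l - dG l k a).
    rewrite {1}exchange_big /= -sumrN; apply: eq_bigr => k _; rewrite -sumrN; apply: eq_bigr => l _.
    by rewrite (Isym l k) (dGsym l a k) (dGsym k l a); ring.
  by move/eqP; rewrite -addr_eq0 -mulr2n mulrn_eq0 /= => /eqP.
rewrite addr0; apply: eq_bigr => k _; rewrite mxE; apply: eq_bigr => l _.
by rewrite mxE dGsym.
Qed.

(* Rests on [d_a (sqrt (det G)) = sqrt (det G) Gamma^c_{ac}]. *)
Lemma divergence_coord i y (X : 'rV[R]_n -> 'rV[R]_n) A : cod i y -> c11v X A y ->
  exists D : 'I_n -> R,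
   (forall a, is_derive (0 : R) 1 (fun t => dens i (y + t *: delta_mx 0 a) * X (y + t *: delta_mx 0 a) 0 a) (D a)) /\
   \sum_a D a = dens i y * \tr (A y + gamma_mx i y (X y)).
Proof.
move=> iy hX.
have z0 a : y + (0 : R) *: delta_mx 0 a = y by rewrite scale0r addr0.
have dd a := sqrt_det_derive (metric_line_derive a iy).
have dX a : is_derive (0 : R) 1 (fun t => X (y + t *: delta_mx 0 a) 0 a) (A y a a).
  have := @c11v_curve R _ _ X A (fun t => y + t *: delta_mx 0 a) 0 _ _ (line_is_derive_id y (delta_mx 0 a) 0).
  rewrite z0 => /(_ hX)/is_derive_mxP /(_ 0 a).
  by rewrite -rowE [row a _ 0 a]mxE.
exists (fun a => dens i y * (2^-1 * \tr (invmx (metric i y) *m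
     (\matrix_(c, d) partial a (fun z => metric i z c d : R^o) y))) * X y 0 a + dens i y * A y a a); split.
  move=> a; have da := dd a; rewrite z0 in da.
  have := is_derive_mul (da (metric_det_gt0 iy)) (dX a); rewrite !z0; exact.
rewrite big_split /= addrC mxtraceD mulrDr gamma_trace// mulr_sumr; congr (_ + _).
  by rewrite mulr_sumr; apply: eq_bigr => a _; rewrite [RHS]mulrA.
Qed.

Hypothesis complete : geodesically_complete g.
Variable P : M.
Local Notation gd := (gd complete P).
Local Notation ex v := (gd v 1).
Local Notation sg := (sg complete P).
Local Notation en := (en complete P).
Local Notation rho := (rho complete P).
Variable b : R.
Hypothesis b0 : 0 <= b.
Hypothesis sec : sectional_curvature_le g (- b).
Hypothesis sc : simply_connected R M.

(* The coordinates in the chart i of the radial field [rho d/drho]. *)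
Definition Yc i (y : 'rV[R]_n) : 'rV[R]_n := yy complete P i (sg (param i y)) 1.

Lemma YcE i y : Yc i y = yy complete P i (sg (param i y)) 1. Proof. by []. Qed.

Lemma chart_sg i y : cod i y -> chart_dom i (ex (sg (param i y))).
Proof. by move=> iy; rewrite (sgK complete P b0 sec sc); have [] := cod_param iy. Qed.

Lemma Yc_c11e i y k : cod i y -> c11e (fun z => Yc i z 0 k) y.
Proof.
move=> iy; have iv := chart_sg iy; have [_ _ ds] := dep1 iv.
have := @c11e_compv R _ _ (fun w => state i (gd w) 1 0 (rshift n k)) (fun z => sg (param i z)) y
  (fun l => sg_c11e complete P b0 sec sc l iy) (ds (rshift n k)).
apply: c11e_ext; apply: filterE => z; by rewrite /Yc /yy [RHS]mxE.
Qed.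

Lemma Yc_c11 i y : cod i y -> c11v (Yc i) (jac (Yc i)) y.
Proof. by move=> iy; apply: c11v_jac => k; exact: Yc_c11e. Qed.

Lemma en_c11e i y : cod i y -> c11e (fun z => en (param i z)) y.
Proof.
move=> iy; have := @c11e_compv R _ _ (fun w => inner g P w w) (fun z => sg (param i z)) y
  (fun l => sg_c11e complete P b0 sec sc l iy) (inner_c11 g P _).
exact.
Qed.

(** The radial field is the final velocity of the geodesics from [P]. Varying the end point in the
    direction [w] therefore differentiates it to the covariant derivative, at time 1, of the Jacobi
    field that ends in [w]. *)
Lemma Yc_hessian i y w : cod i y -> exists k,
  [/\ Jx complete P i (sg (param i y)) k 1 = w &
      w *m (jac (Yc i) y + gamma_mx i y (Yc i y)) = DJ complete P i (sg (param i y)) k 1].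
Proof.
move=> iy; have iv := chart_sg iy; set v := sg (param i y) in iv *.
have z0 : y + (0 : R) *: w = y by rewrite scale0r addr0.
have [pd pc] := cod_param iy.
have dl := line_is_derive_id y w (0 : R); have cl := is_derive_continuous dl.
have cp := param_continuous iy; rewrite -z0 in cp.
have cc : {for (0 : R), continuous (fun t : R => param i (y + t *: w))} by exact: continuous_comp cl cp.
have it : chart_dom i (param i (y + (0 : R) *: w)) by rewrite z0.
have dx : is_derive (0 : R) 1 (coord i \o (fun t : R => param i (y + t *: w))) w.
  apply: near_eq_is_derive dl.
  have nc : \forall t \near (0 : R), cod i (y + t *: w) by apply: cl; rewrite z0; exact: near_cod.
  by apply: filterS nc => t ct; rewrite /=; have [_ ->] := cod_param ct.
have [k dk Jk] := sg_curve complete P b0 sec sc cc it dx.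
rewrite z0 -/v in Jk; exists k; split=> //.
have d1 : is_derive (0 : R) 1 (fun t => Yc i (y + t *: w)) (w *m jac (Yc i) y).
  have := @c11v_curve R _ _ (Yc i) (jac (Yc i)) (fun t => y + t *: w) 0 w; rewrite z0.
  by apply; exact: Yc_c11.
have d2 : is_derive (0 : R) 1 (fun t => Yc i (y + t *: w)) (Jy complete P i v k 1).
  have hs := state1_c11 iv.
  have := @c11v_curve R _ _ (fun u => state i (gd u) 1) (jac (fun u => state i (gd u) 1))
    (sg \o (fun t : R => param i (y + t *: w))) 0 k; rewrite /= z0 -/v.
  by move=> /(_ hs dk)/is_derive_rsub.
rewrite mulmxDr gamma_mxE (is_derive_unique d1 d2) /DJ /cov Jk /xx (sgK complete P b0 sec sc) pc Gam_sym//.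
Qed.

Lemma radial_trace i y : cod i y ->
  n%:R + (n%:R - 1) * DD b (rho (param i y)) <= \tr (jac (Yc i) y + gamma_mx i y (Yc i y)).
Proof.
move=> iy; have iv := chart_sg iy; set v := sg (param i y) in iv *.
have [pd pc] := cod_param iy.
have xE : xx complete P i v 1 = y by rewrite /xx (sgK complete P b0 sec sc).
have EE1 : (Yc i y *m metric i y *m (Yc i y)^T) 0 0 = en (param i y).
  by rewrite -ipE -{1}pc; exact: (yy_norm complete P b0 sec sc).
set c := 1 + DD b (rho (param i y)).
have tlb := @trace_lower_bound R n (metric i y) (metric_sym iy) (metric_pos iy)
   (jac (Yc i) y + gamma_mx i y (Yc i y)) (Yc i y) c.
rewrite /= EE1 in tlb; apply: le_trans (tlb _).
  (* At [P] the quotient [E / E] is 0 by convention instead of 1, but there [c = 1], so its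
     coefficient vanishes. *)
  have [E0|E0] := eqVneq (en (param i y)) 0.
    have r0 : rho (param i y) = 0 by rewrite rhoE E0 sqrtr0.
    by rewrite /c r0 /DD eqxx !addr0 subrr mul1r !(mulr0, mul0r) addr0.
  rewrite divff// mulr1 /c le_eqVlt; apply/orP; left; apply/eqP; ring.
move=> w; have [k [Jk Dk]] := Yc_hessian w iy.
have := hessian b0 sec k iv.
have := @mm_eq _ _ _ g complete P i v k 1 ler01 iv.
rewrite mul1r /mm /NN /QQ xE Jk -Dk => <-; rewrite -!ipE (_ : inner g P v v = en (param i y))//.
by rewrite -/(Yc i y) [X in _ -> _ <= X]ip_sym.
Qed.

End chart_divergence.

(** * Lebesgue measure on row vectors *)

Section borel_vectors.
Context {R : realType}.

Lemma borel_open (T : ptopologicalType) (O : set T) : open O -> measurable (O : set (borel T)).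
Proof. exact: sub_sigma_algebra. Qed.

Lemma borel_ball n k : measurable ([set y | `|y| <= k] : set (borel 'rV[R]_n)).
Proof.
rewrite -[X in measurable X]setCK; apply: measurableC; apply: borel_open.
apply: closed_openC; have -> : [set y : 'rV[R]_n | `|y| <= k] = closed_ball_ (fun x => `|x|) 0 k.
  by apply/seteqP; split=> z; rewrite /closed_ball_ /= sub0r normrN.
exact: closed_closed_ball_.
Qed.

Lemma continuous_borel (T : ptopologicalType) (f : T -> R) : continuous f ->
  measurable_fun setT (f : borel T -> measurableTypeR R).
Proof.
move=> cf; apply: (measurability _ (RGenOInfty.measurableE R)) => _ [_ [x ->] <-].
rewrite setTI; apply: borel_open; apply: open_comp; first by move=> y _; exact: cf.
by rewrite set_itvE; exact: open_gt.
Qed.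

Lemma integrable_compact_support n (mu : {measure set (borel 'rV[R]_n) -> \bar R}) (f : 'rV[R]_n -> R) K :
  (forall k : R, (mu [set y | (`|y| <= k)%R] < +oo)%E) -> continuous f -> (forall y, K < `|y| -> f y = 0) ->
  mu.-integrable setT (EFin \o f).
Proof.
move=> fin cf f0; pose B := [set y : 'rV[R]_n | `|y| <= K].
have -> : EFin \o f = (EFin \o f) \_ B.
  apply/funext => y; rewrite patchE; case: ifPn => //; rewrite notin_setE /= => /negP.
  by rewrite -ltNge => /f0 ->.
apply/(@integrable_mkcond _ _ R mu (B : set (borel _)) (EFin \o f)); first exact: borel_ball.
apply: measurable_bounded_integrable; [exact: borel_ball|exact: fin| |].
  exact: measurable_funTS (continuous_borel cf).
have [B0|/set0P[y0 yB]] := eqVneq B set0.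
  by exists 0; split=> // x x0 y /= By; exfalso; rewrite -/(B y) B0 in By.
have cB : compact B.
  have -> : B = [set z : 'rV[R]_n | `|z - 0| <= K] by apply/seteqP; split=> z; rewrite /B /= subr0.
  exact: closed_ball_compact.
have [||| c cB' hc] := @compact_EVT_max _ R (fun y => `|f y|) B.
- by exists y0.
- exact: cB.
- by apply: continuous_subspaceT => y; apply: (@cvg_comp _ _ _ f (@Num.norm _ _)); [exact: cf|exact: norm_continuous].
exists `|f c|; split; first exact: num_real.
by move=> x cx y /= By; apply: le_trans (ltW cx); apply: hc; rewrite inE.
Qed.

End borel_vectors.

Section lebesgue_step.
Context (R : realType) (n : nat) (m : {sigma_finite_measure set (borel 'rV[R]_n) -> \bar R}).
Local Notation TR := (measurableTypeR R).
Local Notation lam := (@lebesgue_measure R).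

(** The identification of [R * R^n] with [R^(n+1)] that is built into the recursion of
    [lebesgue_int]. *)
Definition rowpair (p : TR * borel 'rV[R]_n) : borel 'rV[R]_n.+1 := row_mx (p.1%:M : 'M[R]_1) p.2.

Lemma norm_row_mx p q (u : 'rV[R]_p) (v : 'rV[R]_q) c : `|u| <= c -> `|v| <= c -> `|row_mx u v| <= c.
Proof.
move=> uc vc; have c0 : 0 <= c := le_trans (normr_ge0 _) uc.
apply: mx_norm_le => // a k; rewrite -(splitK k); case: (fintype.split k) => l /=.
  by rewrite row_mxEl; exact: le_trans (mx_entry_le _ _ _) uc.
by rewrite row_mxEr; exact: le_trans (mx_entry_le _ _ _) vc.
Qed.

Lemma norm_scalar1 (x : R) : `|(x%:M : 'M[R]_1)| <= `|x|.
Proof. by apply: mx_norm_le => // a c; rewrite !ord1 mxE mulr1n. Qed.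

Lemma rsub_norm p q (z : 'rV[R]_(p + q)) : `|rsubmx z| <= `|z|.
Proof. by apply: mx_norm_le => // a k; rewrite mxE; exact: mx_entry_le. Qed.

Lemma norm_rowpair (x : R) (y : 'rV[R]_n) c : (`|rowpair (x, y) : 'rV[R]_n.+1| <= c) = (`|x| <= c) && (`|y| <= c).
Proof.
apply/idP/andP => [h|[hx hy]]; last first.
  by apply: (@norm_row_mx 1 n) hy; exact: le_trans (norm_scalar1 x) hx.
split; apply: le_trans h.
  have := mx_entry_le (row_mx (x%:M : 'M[R]_1) y) 0 (lshift n 0).
  by rewrite row_mxEl mxE mulr1n.
by have := @rsub_norm 1 n (row_mx (x%:M : 'M[R]_1) y); rewrite row_mxKr.
Qed.

Lemma rat_near (x e : R) : 0 < e -> exists q : rat, `|ratr q - x| < e.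
Proof.
move=> e0; have [|q] := @rat_in_itvoo R (x - e) (x + e); first by rewrite ltrD2l gtrN.
by rewrite in_itv /= => /andP[h1 h2]; exists q; rewrite ltr_norml; apply/andP; split; lra.
Qed.

Lemma rowpairB p q : (rowpair p : 'rV[R]_n.+1) - rowpair q = rowpair (p.1 - q.1, (p.2 : 'rV[R]_n) - q.2).
Proof.
rewrite /rowpair; have := @add_row_mx R 1 1 n (p.1%:M) p.2 (- q.1%:M) (- q.2).
by rewrite -opp_row_mx => ->; rewrite raddfB.
Qed.

(** An open set is a union of boxes with rational centres and radii [1 / (k + 1)]. There are
    countably many, so its preimage belongs to the product of the Borel structures. *)
Lemma rowpair_measurable : measurable_fun setT rowpair.
Proof.
apply: (@measurability _ _ (TR * borel 'rV[R]_n)%type (borel 'rV[R]_n.+1) setT rowpair (@open 'rV[R]_n.+1)) => // _ [U opU <-]; rewrite setTI.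
pose box (i : rat * 'rV[rat]_n * nat) : set (TR * borel 'rV[R]_n) :=
  [set x : R | `|ratr i.1.1 - x| < i.2.+1%:R^-1] `*` [set y : 'rV[R]_n | `|map_mx ratr i.1.2 - y| < i.2.+1%:R^-1].
have mbox i : measurable (box i).
  apply: measurableX.
    have -> : [set x : R | `|ratr i.1.1 - x| < i.2.+1%:R^-1] = ball (ratr i.1.1 : R) i.2.+1%:R^-1 by rewrite -ball_normE.
    exact: measurable_ball.
  apply: borel_open; have -> : [set y : 'rV[R]_n | `|map_mx ratr i.1.2 - y| < i.2.+1%:R^-1] = ball (map_mx ratr i.1.2 : 'rV[R]_n) i.2.+1%:R^-1 by rewrite -ball_normE.
  by apply: ball_open; rewrite invr_gt0.
pose F i := if pselect (box i `<=` rowpair @^-1` U) then box i else set0.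
have -> : rowpair @^-1` U = \bigcup_i F i.
  apply/seteqP; split=> [[x y] /= Uxy|p [i _]]; last by rewrite /F; case: pselect => // h; exact: h.
  have [d d0 hd] := near_all (open_near opU Uxy).
  have [eps [k [eE k0 kd]]] : exists eps k, [/\ eps = k.+1%:R^-1 :> R, 0 < eps & eps < d / 2].
    have dd : 0 < (d / 2)^-1 by rewrite invr_gt0 divr_gt0.
    exists (Num.trunc (d / 2)^-1).+1%:R^-1, (Num.trunc (d / 2)^-1); split=> //.
    by rewrite invf_plt ?posrE ?divr_gt0// truncnS_gt.
  have k2 : 0 < eps / 2 by rewrite divr_gt0.
  have [q qx] := rat_near x k0.
  pose c := \row_j sval (cid (rat_near (y 0 j) k2)).
  have hc : `|map_mx ratr c - y| < eps.
    apply: (@le_lt_trans _ _ (eps / 2)); last by lra.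
    apply: mx_norm_le => [|a j]; first exact: ltW.
    by rewrite ord1 !mxE; case: (cid _) => z /= /ltW.
  exists (q, c, k) => //; rewrite /F; case: pselect => [h|h]; first by split=> /=; rewrite -eE.
  exfalso; apply: h => -[x' y'] /=; rewrite /box /= -eE => -[/= hx' hy']; apply: hd.
  rewrite rowpairB /=; apply: (@le_lt_trans _ _ (2 * eps)); last by lra.
  rewrite norm_rowpair; apply/andP; split.
    rewrite -(subrKA (ratr q)); apply: le_trans (ler_normD _ _) _.
    by rewrite [X in X + _]distrC; lra.
  rewrite -(subrKA (map_mx ratr c)); apply: le_trans (ler_normD _ _) _.
  by rewrite [X in X + _]distrC; lra.
apply: countable_bigcupT_measurable; first exact: countableP.
by move=> i; rewrite /F; case: pselect => h; [exact: mbox|exact: measurable0].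
Qed.

(** The image under [rowpair] of the product measure. Tonelli's theorem for it reproduces one step
    of [lebesgue_int]. *)
Definition rvstep (A : set (borel 'rV[R]_n.+1)) : \bar R := (lam \x m)%E (rowpair @^-1` A).

Let mpre (A : set (borel 'rV[R]_n.+1)) : measurable A -> measurable (rowpair @^-1` A).
Proof. by move=> mA; rewrite -[X in measurable X]setTI; exact: rowpair_measurable. Qed.

Let rvstep0 : rvstep set0 = 0%E.
Proof. by rewrite /rvstep preimage_set0 measure0. Qed.

Let rvstep_ge0 A : (0 <= rvstep A)%E.
Proof. exact: measure_ge0. Qed.

Let rvstep_sigma_additive : semi_sigma_additive rvstep.
Proof.
move=> F mF tF mUF; rewrite /rvstep preimage_bigcup.
apply: measure_semi_sigma_additive.
- by move=> k; exact: mpre.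
- apply/trivIsetP => /= i j _ _ ij; rewrite -preimage_setI.
  by move/trivIsetP : tF => /(_ _ _ _ _ ij) ->//; rewrite preimage_set0.
- by rewrite -preimage_bigcup; exact: mpre.
Qed.

HB.instance Definition _ := isMeasure.Build _ _ _ rvstep rvstep0 rvstep_ge0 rvstep_sigma_additive.

Lemma rvstep_ball (mfin : forall k : R, (m [set y | (`|y| <= k)%R] < +oo)%E) (k : R) : (rvstep [set y | (`|y| <= k)%R] < +oo)%E.
Proof.
rewrite /rvstep.
have -> : rowpair @^-1` [set y | `|y| <= k] = ([set` `[- k, k]] : set TR) `*` ([set y : 'rV[R]_n | `|y| <= k] : set (borel _)).
  by apply/seteqP; split=> -[x y] /=; rewrite norm_rowpair in_itv /= ler_norml => /andP.
rewrite product_measure1E; [|exact: measurable_itv|exact: borel_ball].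
apply: lte_mul_pinfty; [exact: measure_ge0| |exact: mfin].
have E := lebesgue_measure_itv `[- k, k]; rewrite [X in X \is a fin_num]E /=; by case: ifP.
Qed.

Lemma rvstep_integral (F : borel 'rV[R]_n.+1 -> \bar R) : measurable_fun setT F -> (forall y, 0 <= F y)%E ->
  (\int[rvstep]_y F y = \int[lam]_x \int[m]_y F (rowpair (x, y)))%E.
Proof.
move=> mF F0; rewrite (@ge0_integral_pushforward _ _ _ _ R rowpair rowpair_measurable (lam \x m)%E setT F)//.
rewrite preimage_setT (@fubini_tonelli1 _ _ _ _ R lam m (F \o rowpair))//.
by apply: measurableT_comp => //; exact: rowpair_measurable.
by move=> p; exact: F0.
Qed.

Lemma rvstep_sigma_finite (mfin : forall k : R, (m [set y | (`|y| <= k)%R] < +oo)%E) : sigma_finite setT rvstep.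
Proof.
exists (fun k => [set y | `|y| <= k%:R]) => [|k]; last by split; [exact: borel_ball|exact: rvstep_ball mfin _].
apply/seteqP; split=> // y _; exists (Num.trunc `|y|).+1 => //=.
by rewrite ltW// truncnS_gt.
Qed.

End lebesgue_step.

Section sigma_finite.
Context d (T : measurableType d) (R : realType) (mu : {measure set T -> \bar R}).

(** An alias that turns a proof of sigma-finiteness into a structure on the measure; in the
    induction on the dimension this proof comes out of an existential statement. *)
Definition sigma_finite_of & sigma_finite setT mu : set T -> \bar R := mu.

Variable mu_sigma_finite : sigma_finite setT mu.

HB.instance Definition _ := Measure.copy (sigma_finite_of mu_sigma_finite) mu.
HB.instance Definition _ := @Measure_isSigmaFinite.Build _ _ _ (sigma_finite_of mu_sigma_finite) mu_sigma_finite.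

End sigma_finite.

Section lebesgue_vectors.
Context {R : realType}.
Local Notation lam := (@lebesgue_measure R).

(** Differentiability is asked in the direction [a] only, with continuous derivative [dh]. In this
    form the assumptions pass to slices, which the induction on [n] needs. *)
Definition parts_formula n (mu : {measure set (borel 'rV[R]_n) -> \bar R}) :=
  forall (a : 'I_n) (h dh : 'rV[R]_n -> R) K,
   (forall y, is_derive (0 : R) 1 (fun t : R => h (y + t *: delta_mx 0 a)) (dh y)) -> continuous dh ->
   (forall y, K < `|y| -> h y = 0 /\ dh y = 0) -> (\int[mu]_y (dh y)%:E = 0)%E.

Lemma parts_formula_line (h dh : R -> R) K : (forall x : R, is_derive x 1 h (dh x)) -> continuous dh ->
  (forall x, K < `|x| -> h x = 0 /\ dh x = 0) -> (\int[lam]_x (dh x)%:E = 0)%E.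
Proof.
move=> d cd h0; pose L := `|K| + 1.
have L0 : 0 < L by rewrite ltr_pwDr.
have KL : K < L by apply: le_lt_trans (ler_norm _) _; rewrite ltrDl.
have LL : - L < L by lra.
have -> : (\int[lam]_x (dh x)%:E = \int[lam]_(x in `[(- L)%R, L]) (dh x)%:E)%E.
  rewrite [RHS]integral_mkcond; apply: eq_integral => x _; rewrite patchE; case: ifPn => //.
  rewrite notin_setE /= in_itv /= -ler_norml => /negP; rewrite -ltNge => xL.
  by have [_ ->] := h0 x (lt_trans KL xL).
have nL : `|L| = L by rewrite gtr0_norm.
have [hL _] : h L = 0 /\ dh L = 0 by apply: h0; rewrite nL.
have [hNL _] : h (- L) = 0 /\ dh (- L) = 0 by apply: h0; rewrite normrN nL.
have ch (x : R) : {for x, continuous h} by exact: is_derive_continuous (d x).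
rewrite (@continuous_FTC2 _ dh h _ _ LL) ?hL ?hNL ?subee//.
- by apply: continuous_subspaceT.
- split; first by move=> x _; have [] := d x.
    by apply: cvg_at_right_filter; exact: ch.
  by apply: cvg_at_left_filter; exact: ch.
- by move=> x _; rewrite derive1E; exact: derive_val.
Qed.

Lemma is_derive_translate (V : normedModType R) (h : V -> R) (p e : V) d (x : R) :
  is_derive (0 : R) 1 (fun t : R => h (p + x *: e + t *: e)) d ->
  is_derive x 1 (fun t : R => h (p + t *: e)) d.
Proof.
move=> dh; have dx : is_diff (x - x) (fun t : R => h (p + x *: e + t *: e)) (fun t => t *: d).
  rewrite subrr; case: dh => h1 h2; split; first by apply/derivable1_diffP.
  by rewrite deriv1E// derive1E h2.
have ds : is_derive x 1 (fun t : R => t - x) 1.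
  by have := is_deriveB (is_derive_id x 1) (is_derive_cst x x 1); rewrite subr0.
have := @diff_curve R R R _ _ (fun t : R => t - x) x 1 dx ds; rewrite scale1r; apply: near_eq_is_derive; apply: filterE => t.
by rewrite -addrA -scalerDl (addrC x) subrK.
Qed.

(** The variable of differentiation is integrated first: the inner integral vanishes by the
    fundamental theorem of calculus if it is the new coordinate, and by the induction hypothesis on
    slices otherwise. *)
Lemma parts_formula_step n (m : {sigma_finite_measure set (borel 'rV[R]_n) -> \bar R})
  (mfin : forall k : R, (m [set y | (`|y| <= k)%R] < +oo)%E) :
  parts_formula m -> parts_formula (rvstep m).
Proof.
move=> IH a h dh K hd cd h0.
have intg := integrable_compact_support (rvstep_ball mfin) cd (fun y hy => (h0 y hy).2).
have mE : measurable_fun setT (EFin \o dh : borel 'rV[R]_n.+1 -> \bar R) by exact: measurable_int intg.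
have intp : (lam \x m)%E.-integrable setT ((EFin \o dh) \o @rowpair R n).
  apply/integrableP; split; first by apply: measurableT_comp mE _; exact: rowpair_measurable.
  move/integrableP: intg => [_]; rewrite (@ge0_integral_pushforward _ _ _ _ R (@rowpair R n) (@rowpair_measurable R n) (lam \x m)%E setT (abse \o (EFin \o dh)))//.
    by apply: measurableT_comp.
  by move=> y _; exact: abse_ge0.
rewrite (@integral_pushforward _ _ _ _ R (@rowpair R n) (@rowpair_measurable R n) (lam \x m)%E setT (EFin \o dh) mE intp)//.
rewrite preimage_setT.
have crow1 (y : 'rV[R]_n) : continuous (fun x : R => (rowpair (x, y) : 'rV[R]_n.+1)).
  move=> x; apply/cvgrPdist_le => e e0; near=> z; rewrite rowpairB /= subrr norm_rowpair normr0 (ltW e0) andbT.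
  by near: z; exact: cvgr_dist_le.
have crow2 (x : R) : continuous (fun y : 'rV[R]_n => (rowpair (x, y) : 'rV[R]_n.+1)).
  move=> y; apply/(@cvgrPdist_le _ _ _ _ (nbhs_filter y)) => e e0; near=> z; rewrite rowpairB /= subrr norm_rowpair normr0 (ltW e0) /=.
  by near: z; apply: (@cvgr_dist_le _ _ _ _ _ id y) => //; exact: cvg_id.
have rowpairD p q (t : R) : (rowpair p : 'rV[R]_n.+1) + t *: rowpair q = rowpair (p.1 + t * q.1, (p.2 : 'rV[R]_n) + t *: q.2).
  rewrite /rowpair; have -> : (p.1 + t * q.1)%:M = p.1%:M + t *: q.1%:M :> 'M[R]_1 by rewrite scale_scalar_mx raddfD.
  by rewrite -(@add_row_mx R 1 1 n) -(@scale_row_mx R 1 1 n).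
have [a0|[l al]] : (delta_mx 0 a = rowpair (1, 0) :> 'rV[R]_n.+1) \/ exists l, (delta_mx 0 a = rowpair (0, delta_mx 0 l) :> 'rV[R]_n.+1).
  have := @splitK 1 n a; case: (fintype.split _) => l /= <-; [left|right; exists l]; rewrite /rowpair /=.
    have E : delta_mx 0 l = 1%:M :> 'M[R]_1 by apply/matrixP => i j; rewrite !ord1 !mxE.
    by rewrite -E; exact: (@delta_mx_lshift R 1 1 n 0 l).
  by rewrite [LHS](@delta_mx_rshift R 1 1 n) raddf0.
- rewrite -(@integral21_prod_meas1 _ _ _ _ R lam m _ intp).
  rewrite (eq_integral (cst 0%E)) ?integral_cst ?mul0e// => y _.
  rewrite /fubini_G /=; apply: (@parts_formula_line (fun x => h (rowpair (x, y))) _ K).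
  + move=> x; have := hd (rowpair (x, y)); rewrite a0 => d.
    have E (t : R) : rowpair (0, y) + t *: rowpair (1, 0) = rowpair (t, y) :> 'rV[R]_n.+1.
      by rewrite rowpairD /= add0r mulr1 scaler0 addr0.
    have := @is_derive_translate _ h (rowpair (0, y)) (rowpair (1, 0)) (dh (rowpair (x, y))) x.
    rewrite E => /(_ d); apply: near_eq_is_derive; apply: filterE => t; exact: congr1 (E t).
  + move=> x; apply: continuous_comp; [exact: crow1|exact: cd].
  + move=> x Kx; apply: h0; rewrite ltNge norm_rowpair negb_and -ltNge Kx //.
- rewrite -(@integral12_prod_meas1 _ _ _ _ R lam m _ intp).
  rewrite (eq_integral (cst 0%E)) ?integral_cst ?mul0e// => x _.
  rewrite /fubini_F /=; apply: (IH l (fun y => h (rowpair (x, y))) _ K).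
  + move=> y; have := hd (rowpair (x, y)); rewrite al; apply: near_eq_is_derive; apply: filterE => t.
    by rewrite rowpairD /= mulr0 addr0.
  + move=> y; apply: continuous_comp; [exact: crow2|exact: cd].
  + by move=> y Ky; apply: h0; rewrite ltNge norm_rowpair negb_and -!ltNge Ky orbT.
Unshelve. all: by end_near. Qed.

(** [lebesgue_int] is only a functional on functions. Representing it by a measure on nonnegative
    measurable functions makes signed integrals, dominated integrability and Fubini's theorem
    available for it. *)
Lemma lebesgue_rV n : exists mu : {measure set (borel 'rV[R]_n) -> \bar R},
  [/\ sigma_finite setT mu, forall k : R, (mu [set y | (`|y| <= k)%R] < +oo)%E,
   forall F : borel 'rV[R]_n -> \bar R, measurable_fun setT F -> (forall y, 0 <= F y)%E -> lebesgue_int F = (\int[mu]_y F y)%E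
   & parts_formula mu].
Proof.
elim: n => [|n [mu [sf fin int pf]]].
  exists (@dirac _ (borel 'rV[R]_0) 0 R); split.
  - by have [F] := @sigma_finiteT _ _ _ (@dirac _ (borel 'rV[R]_0) 0 R); exists F.
  - by move=> k; rewrite [X in (X < _)%E]diracE; case: (_ \in _); rewrite ltry.
  - by move=> F mF F0; rewrite integral_dirac// diracT mul1e.
  - by case.
pose m : {sigma_finite_measure set (borel 'rV[R]_n) -> \bar R} := sigma_finite_of sf.
exists (rvstep m); split.
- by apply: rvstep_sigma_finite.
- by apply: rvstep_ball.
- move=> F mF F0; rewrite rvstep_integral//=; apply: eq_integral => x _; apply: int => //.
  have mx : measurable_fun setT (fun y : borel 'rV[R]_n => rowpair (x, y)).
    by apply: (@measurableT_comp _ _ _ _ _ _ (@rowpair R n)); [exact: rowpair_measurable|exact: pair1_measurable].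
  exact: (measurableT_comp mF mx).
- exact: parts_formula_step.
Qed.

End lebesgue_vectors.

(** * Continuously differentiable functions *)

Section c1_calculus.
Context {R : realType}.

(** Only continuity of the gradient at [y] is asked, which is simpler to check than [C^{1,1}] for
    the cut-offs and powers used from here on. *)
Definition c1 n (F : 'rV[R]_n -> R) (y : 'rV[R]_n) := exists D : 'rV[R]_n -> 'cV[R]_n,
  (\forall z \near y, is_diff z F (gradmap (D z))) /\ {for y, continuous D}.

(** For a displacement of length [|q - y|] along an axis, the expansions with gradients at [y] and
    at [q] differ by a quadratic quantity; division by the length bounds the difference of the
    gradients. *)
Lemma c11_grad_continuous n (F : 'rV[R]_n -> R) A y : c11 F A y -> {for y, continuous A}.
Proof.
move=> [C [d [d0 C0 H]]]; apply/(@cvgrPdist_le _ _ _ _ (nbhs_filter y)) => e e0; have k0 : 0 < e / (4 * C + 1) by rewrite divr_gt0// ltr_wpDl// mulr_ge0.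
near=> q.
have [->|qy] := eqVneq q y; first by rewrite subrr normr0 ltW.
have td : `|q - y| < d by near: q; exact: near_norm.
have te : `|q - y| < e / (4 * C + 1) by near: q; exact: near_norm k0.
set t := `|q - y| in td te *; have t0 : 0 < t by rewrite normr_gt0 subr_eq0.
have Ce : 4 * C * t <= e.
  apply: (@le_trans _ _ ((4 * C + 1) * t)); first by rewrite ler_wpM2r ?(ltW t0)// lerDl.
  by rewrite mulrC -ler_pdivlMr ?ltW// ltr_wpDl// mulr_ge0.
apply: mx_norm_le => [|a j]; first exact: ltW.
rewrite ord1 !mxE; pose p := y + t *: delta_mx 0 a.
have pE : p - y = t *: delta_mx 0 a by rewrite addrC addKr.
have ep : `|p - y| <= t.
  rewrite pE; apply: mx_norm_le => [|i k]; first exact: ltW.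
  rewrite mxE mxE; case: (_ && _); first by rewrite mulr1 gtr0_norm.
  by rewrite mulr0 normr0 ltW.
have yy : `|y - y| < d by rewrite subrr normr0.
have pd : `|p - y| < d := le_lt_trans ep td.
have [_ _ _ h1] := H p y y pd yy yy; have [_ _ _ h2] := H p y q pd yy td.
have gE B : ((p - y) *m B) 0 0 = t * B a 0 :> R.
  rewrite pE -scalemxAl mxE; congr (_ * _); rewrite mxE (bigD1 a)//= big1 ?addr0 => [|b ba].
    by rewrite mxE !eqxx mul1r.
  by rewrite mxE eqxx /= (negbTE ba) mul0r.
rewrite !gE subrr normr0 addr0 in h1; rewrite gE -[`|y - q|]distrC -/t in h2.
have hq : `|p - q| <= 2 * t.
  rewrite -(subrKA y); apply: le_trans (ler_normD _ _) _; rewrite [X in _ + X]distrC -/t; lra.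
have l1 : `|F p - F y - t * A y a 0| <= C * t * t.
  by apply: le_trans h1 _; rewrite ler_pM ?mulr_ge0// ler_wpM2l.
have l2 : `|F p - F y - t * A q a 0| <= C * t * (3 * t).
  apply: le_trans h2 _; rewrite ler_pM ?mulr_ge0 ?addr_ge0 ?(ltW t0) ?ler_wpM2l//; lra.
have : t * `|A y a 0 - A q a 0| <= t * (4 * C * t).
  rewrite -{1}(gtr0_norm t0) -normrM.
  have -> : t * (A y a 0 - A q a 0) = (F p - F y - t * A q a 0) - (F p - F y - t * A y a 0) by ring.
  apply: le_trans (ler_normB _ _) _; apply: le_trans (lerD l2 l1) _.
  by rewrite le_eqVlt; apply/orP; left; apply/eqP; ring.
by rewrite ler_pM2l// => /le_trans; exact.
Unshelve. all: by end_near. Qed.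

Lemma c11e_c1 n (F : 'rV[R]_n -> R) y : c11e F y -> c1 F y.
Proof.
move=> [A hA]; exists A; split; last exact: c11_grad_continuous hA.
by near=> z; apply: c11_is_diff; near: z; exact: c11_near.
Unshelve. all: by end_near. Qed.

Lemma is_diff_grad n (F : 'rV[R]_n -> R) y B : is_diff y F (gradmap B) -> grad F y = B.
Proof.
move=> [d1 d2]; apply/colP => a; rewrite mxE (deriveE _ d1) d2 /gradmap mxE (bigD1 a)//= big1 ?addr0 => [|b ba].
  by rewrite mxE !eqxx mul1r.
by rewrite mxE eqxx /= (negbTE ba) mul0r.
Qed.

Lemma c1_near n (F : 'rV[R]_n -> R) y : c1 F y -> \forall z \near y, is_diff z F (gradmap (grad F z)).
Proof.
by move=> [D [d _]]; apply: filterS d => z dz; rewrite (is_diff_grad dz).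
Qed.

Lemma c1_is_diff n (F : 'rV[R]_n -> R) y : c1 F y -> is_diff y F (gradmap (grad F y)).
Proof. by move=> /c1_near/nbhs_singleton. Qed.

Lemma c1_grad_continuous n (F : 'rV[R]_n -> R) y : c1 F y -> {for y, continuous (grad F)}.
Proof.
move=> [D [d cD]]; apply: (@continuous_near_eq _ _ D) cD _.
by apply: filterS d => z dz; rewrite (is_diff_grad dz).
Qed.

Lemma c1_continuous n (F : 'rV[R]_n -> R) y : c1 F y -> {for y, continuous F}.
Proof. by move=> /c1_is_diff[d _]; exact: differentiable_continuous. Qed.

Lemma continuousD_at (T : topologicalType) (V : normedModType R) (f h : T -> V) t :
  {for t, continuous f} -> {for t, continuous h} -> {for t, continuous (fun x => f x + h x)}.
Proof. exact: cvgD. Qed.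

Lemma continuousZ_at (T : topologicalType) (V : normedModType R) (k : T -> R) (f : T -> V) t :
  {for t, continuous k} -> {for t, continuous f} -> {for t, continuous (fun x => k x *: f x)}.
Proof. exact: cvgZ. Qed.

Lemma near_is_diff (V W : normedModType R) (f f' : V -> W) (df : V -> W) y :
  (\forall z \near y, f z = f' z) -> is_diff y f df -> is_diff y f' df.
Proof.
move=> e [d1 <-]; have [cd /eqaddoP E] := (diff_locallyP y f).1 d1.
have e0 : \forall h \near (0 : V), f (h + y) = f' (h + y).
  have c : {for (0 : V), continuous (fun h => h + y)} by apply: cvgD; [exact: cvg_id|exact: cvg_cst].
  by apply: (c [set z | f z = f' z]); rewrite /= add0r.
have E' : f' \o shift y = cst (f' y) + 'd f y +o_ 0 id.
  apply/eqaddoP => k k0; have := E k k0; apply: filter_app; apply: filterS e0 => h.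
  by rewrite /= !fctE /= => ->; rewrite (nbhs_singleton e).
have D : 'd f' y = 'd f y :> (V -> W) by exact: diff_unique.
split; last exact: D.
by apply/diff_locallyP; rewrite D; split; [exact: cd|exact: E'].
Qed.

Lemma c1_ext n (F F' : 'rV[R]_n -> R) y : (\forall z \near y, F z = F' z) -> c1 F y -> c1 F' y.
Proof.
move=> e [D [d cD]]; exists D; split=> //.
have e2 := near_join e; near=> z.
apply: (@near_is_diff _ _ F); by near: z.
Unshelve. all: by end_near. Qed.

Lemma c1M n (F G : 'rV[R]_n -> R) y : c1 F y -> c1 G y -> c1 (fun z => F z * G z) y.
Proof.
move=> hF hG; exists (fun z => F z *: grad G z + G z *: grad F z); split.
  near=> z; have dF : is_diff z F (gradmap (grad F z)) by near: z; exact: c1_near.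
  have dG : is_diff z G (gradmap (grad G z)) by near: z; exact: c1_near.
  apply: is_diff_eq (is_diffM dF dG) _; apply/funext => u.
  by rewrite /gradmap mulmxDr -!scalemxAr mxE [X in _ = X + _]mxE [X in _ = _ + X]mxE.
by apply: continuousD_at; apply: continuousZ_at; by [exact: c1_continuous|exact: c1_grad_continuous].
Unshelve. all: by end_near. Qed.

Lemma c1_scalar n (F : 'rV[R]_n -> R) y (phi phi1 : R -> R) : c1 F y ->
  (\forall t \near (F y : R), is_derive (t : R) 1 phi (phi1 t)) -> {for F y, continuous phi1} -> c1 (phi \o F) y.
Proof.
move=> hF d c; exists (fun z => phi1 (F z) *: grad F z); split.
  near=> z; have dF : is_diff z F (gradmap (grad F z)) by near: z; exact: c1_near.
  have [d1 d2] : is_derive (F z) 1 phi (phi1 (F z)).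
    by near: z; exact: (c1_continuous hF d).
  have dp : is_diff (F z) phi (fun t => t *: phi1 (F z)).
    by split; [exact/derivable1_diffP|rewrite deriv1E// derive1E d2].
  apply: is_diff_eq (is_diff_comp dF dp) _; apply/funext => u.
  by rewrite /gradmap /= -scalemxAr [RHS]mxE; exact: mulrC.
apply: (@continuousZ_at _ _ (fun z => phi1 (F z)) (grad F)); last exact: c1_grad_continuous.
by apply: continuous_comp => //; exact: c1_continuous.
Unshelve. all: by end_near. Qed.

End c1_calculus.

(** * The Riemannian volume in a chart *)

(** Monotonicity is read off the supremum over simple functions, so it applies to integrands whose
    measurability is not established, such as those of the norms in the theorem. *)
Lemma le_integral_ge0 d (T : measurableType d) (R : realType) (mu : {measure set T -> \bar R}) (D : set T) (f h : T -> \bar R) :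
  (forall x, D x -> 0 <= f x)%E -> (forall x, D x -> f x <= h x)%E ->
  (\int[mu]_(x in D) f x <= \int[mu]_(x in D) h x)%E.
Proof.
move=> f0 fh; rewrite !ge0_integralE//; last by move=> x Dx; apply: le_trans (f0 x Dx) (fh x Dx).
apply: ereal_sup_le => _ /= -[s sf <-]; exists s => // x; apply: le_trans (sf x) _.
by rewrite !patchE; case: ifPn => //; rewrite inE; exact: fh.
Qed.

Section density.
Context d d' (T : measurableType d) (U : measurableType d') (R : realType).
Variables (nu : {measure set T -> \bar R}) (mu : {measure set U -> \bar R}).
Variables (D : set T) (C : set U) (phi : U -> T) (w : U -> R).
Hypotheses (mD : measurable D) (mC : measurable C).
Hypotheses (mphi : measurable_fun C phi) (mw : measurable_fun C w).
Hypotheses (phiD : forall y, C y -> D (phi y)) (w0 : forall y, C y -> 0 <= w y).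
Hypothesis nuE : forall A, measurable A -> A `<=` D ->
  nu A = (\int[mu]_(y in C) (\1_A (phi y) * w y)%:E)%E.
Local Open Scope ereal_scope.

Import HBNNSimple.

(** On indicators this is [nuE]. It extends to simple functions by linearity and to nonnegative
    functions by monotone convergence. *)
Lemma density_integral (k : T -> \bar R) : measurable_fun setT k -> (forall x, 0 <= k x) ->
  \int[nu]_(x in D) k x = \int[mu]_(y in C) (k (phi y) * (w y)%:E).
Proof.
move=> mk k0; pose h := nnsfun_approx measurableT mk.
have mcomp (F : T -> R) : measurable_fun setT F -> measurable_fun C (F \o phi).
  by move=> mF; exact: measurableT_comp mF mphi.
have kE x : k x = lim ((EFin \o h n) x @[n --> \oo]).
  by apply/esym/cvg_lim => //; apply: cvg_nnsfun_approx.
have -> : \int[nu]_(x in D) k x = lim (\int[nu]_(x in D) (EFin \o h n) x @[n --> \oo]).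
  under eq_integral => x _ do rewrite kE.
  apply: monotone_convergence => //.
  - by move=> n; apply/measurable_EFinP; apply: measurable_funTS; exact: measurable_funP.
  - by move=> n x _ /=; rewrite lee_fin.
  - by move=> x _ a b ab; rewrite lee_fin; exact/lefP/nd_nnsfun_approx.
have -> : \int[mu]_(y in C) (k (phi y) * (w y)%:E) =
    lim (\int[mu]_(y in C) ((h n (phi y) * w y)%R%:E) @[n --> \oo]).
  have E y : C y -> k (phi y) * (w y)%:E = lim ((h n (phi y) * w y)%R%:E @[n --> \oo]).
    move=> Cy; apply/esym/cvg_lim => //; under eq_fun do rewrite EFinM.
    by apply: cvgeZr => //; apply: cvg_nnsfun_approx.
  under eq_integral => y /[!inE] /E -> //.
  apply: monotone_convergence => //.
  - move=> n; apply/measurable_EFinP; apply: measurable_funM => //; apply: mcomp; exact: measurable_funP.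
  - by move=> n y Cy /=; rewrite lee_fin mulr_ge0 ?w0.
  - by move=> y Cy a b ab; rewrite lee_fin ler_wpM2r ?w0//; exact/lefP/nd_nnsfun_approx.
suff S n : \int[nu]_(x in D) (EFin \o h n) x = \int[mu]_(y in C) ((h n (phi y) * w y)%R%:E).
  by under eq_fun do rewrite S.
have mi r : measurable (h n @^-1` [set r]) by [].
transitivity (\int[nu]_(x in D) (\sum_(r \in range (h n)) (r%:E * (\1_(h n @^-1` [set r]) x)%:E))).
  by apply: eq_integral => x _ /=; rewrite fimfunE -fsumEFin.
transitivity (\int[mu]_(y in C) (\sum_(r \in range (h n)) (r%:E * (\1_(h n @^-1` [set r]) (phi y) * w y)%:E))); last first.
  apply: eq_integral => y _ /=; rewrite (fimfunE (h n) (phi y)) EFinM -fsumEFin//.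
  rewrite ge0_mule_fsuml => [|r]; last by rewrite EFinM; exact: nnfun_muleindic_ge0.
  by apply: eq_fsbigr => r _; rewrite !EFinM muleA.
have m1 r : measurable_fun D (fun x => (\1_(h n @^-1` [set r]) x)%:E : \bar R).
  by apply/measurable_EFinP; apply: measurable_funTS; exact: measurable_indic.
have m2 r : measurable_fun C (fun y => (\1_(h n @^-1` [set r]) (phi y) * w y)%:E : \bar R).
  by apply/measurable_EFinP; apply: measurable_funM => //; apply: mcomp; exact: measurable_indic.
rewrite ge0_integral_fsum//; first last.
- by move=> r x _; exact: nnfun_muleindic_ge0.
- by move=> r; apply: measurable_funeM.
rewrite ge0_integral_fsum//; first last.
- by move=> r y Cy; rewrite EFinM muleA mule_ge0 ?lee_fin ?w0//; exact: nnfun_muleindic_ge0.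
- by move=> r; apply: measurable_funeM.
apply: eq_fsbigr => r; rewrite inE => -[x0 _ <-].
rewrite ge0_integralZl_EFin//.
rewrite ge0_integralZl_EFin//; last by move=> y Cy; rewrite lee_fin mulr_ge0 ?w0.
congr (_ * _); rewrite integral_indic//.
rewrite nuE; [|exact: measurableI|exact: subIsetr].
by apply: eq_integral => y /[!inE] Cy; rewrite indicI /= [X in (_ * X * _)%R]indicE mem_set ?mulr1//; exact: phiD.
Qed.

Lemma density_integral_EFin (k : T -> R) : measurable_fun setT k ->
  \int[nu]_(x in D) (k x)%:E = \int[mu]_(y in C) (k (phi y) * w y)%:E.
Proof.
move=> mk; have mE : measurable_fun setT (EFin \o k) by exact/measurable_EFinP.
rewrite [LHS]integralE [RHS]integralE density_integral//; last exact: measurable_funepos.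
rewrite density_integral//; last exact: measurable_funeneg.
congr (_ - _); apply: eq_integral => y /[!inE] Cy; rewrite ?funeposE ?funenegE -?EFinN -!EFin_max -EFinM maxr_pMl ?w0// mul0r//.
by rewrite mulNr.
Qed.

End density.

Section chart_measure.
Context {R : realType} {n : nat} {M : ptopologicalType}.
Variable g : riemannian R n M.
Variable dV : {measure set (borel M) -> \bar R}.
Hypothesis vol : riemannian_volume g dV.
Variable mu : {measure set (borel 'rV[R]_n) -> \bar R}.
Hypothesis mu_ball : forall k : R, (mu [set y | (`|y| <= k)%R] < +oo)%E.
Hypothesis mu_int : forall F : borel 'rV[R]_n -> \bar R, measurable_fun setT F -> (forall y, 0 <= F y)%E ->
  lebesgue_int F = (\int[mu]_y F y)%E.
Implicit Types (i : chart g).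

Lemma open_borel_fun (T U : ptopologicalType) (B : set T) (f : T -> U) : open B ->
  (forall x, B x -> {for x, continuous f}) -> measurable_fun (B : set (borel T)) (f : borel T -> borel U).
Proof.
move=> oB cf; apply: (@measurability _ _ (borel T) (borel U) B f (@open U)) => // _ [V oV <-].
apply: borel_open; rewrite openE => x [Bx fV]; apply: filterI; first exact: open_nbhs_nbhs.
by apply: cf => //; exact: open_nbhs_nbhs.
Qed.

Lemma open_borel_real (T : ptopologicalType) (B : set T) (f : T -> R) : open B ->
  (forall x, B x -> {for x, continuous f}) -> measurable_fun (B : set (borel T)) (f : borel T -> measurableTypeR R).
Proof.
move=> oB cf; apply: (measurability _ (RGenOInfty.measurableE R)) => _ [_ [z ->] <-].
apply: borel_open; rewrite openE => x [Bx fV]; apply: filterI; first exact: open_nbhs_nbhs.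
apply: cf => //; apply: open_nbhs_nbhs; split=> //.
Qed.

Let mC i : measurable (cod i : set (borel 'rV[R]_n)).
Proof. apply: borel_open; exact: cod_open. Qed.

Let mD i : measurable (chart_dom i : set (borel M)).
Proof. apply: borel_open; exact: chart_dom_open. Qed.

Let mparam i : measurable_fun (cod i : set (borel 'rV[R]_n)) (param i : borel 'rV[R]_n -> borel M).
Proof. by apply: open_borel_fun; [exact: cod_open|move=> y; exact: param_continuous]. Qed.

Let mdens i : measurable_fun (cod i : set (borel 'rV[R]_n)) (dens i : borel 'rV[R]_n -> measurableTypeR R).
Proof. by apply: open_borel_real; [exact: cod_open|move=> y /dens_c11[A]; exact: c11_continuous]. Qed.

(** The definition of the volume, with the image of [A] in coordinates rewritten as a preimage under
    [param i], so that it becomes an integral of a density and fits [density_integral]. *)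
Lemma chart_volume i (A : set (borel M)) : measurable A -> A `<=` chart_dom i ->
  dV A = (\int[mu]_(y in cod i) (\1_A (param i y) * dens i y)%:E)%E.
Proof.
move=> mA AD; rewrite (vol mA AD) [RHS]integral_mkcond.
have E : (fun y => (\1_(coord i @` A) y * Num.sqrt (\det (metric i y)))%:E) =
   (fun y => (\1_A (param i y) * dens i y)%:E) \_ (cod i) :> (_ -> \bar R).
  apply/funext => y; rewrite patchE; case: ifPn => [/set_mem iy|/negP ny].
    have [pd pc] := cod_param iy; rewrite !indicE; suff -> : (y \in coord i @` A) = (param i y \in A) by [].
    by apply/idP/idP => /set_mem; [move=> [x Ax <-]; rewrite coordK ?inE//; exact: AD|move=> Ay; rewrite inE; exists (param i y)].
  rewrite indicE memNset ?mul0r// => -[x Ax xy]; apply: ny; rewrite inE -xy.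
  by apply: cod_coord; exact: AD.
rewrite E mu_int//.
  apply/(measurable_restrictT _ (mC i)); apply/measurable_EFinP; apply: measurable_funM; last exact: mdens.
  by apply: (@measurableT_comp _ _ _ _ _ _ (\1_A : borel M -> R)); [exact: measurable_indic|exact: mparam].
by move=> y; rewrite patchE; case: ifPn => // _; rewrite lee_fin mulr_ge0 ?sqrtr_ge0.
Qed.

Definition pull i (k : M -> R) (y : 'rV[R]_n) : R := if `[< cod i y >] then k (param i y) * dens i y else 0.

Section compact_support.
Variables (i : chart g) (K : set 'rV[R]_n) (k : M -> R).
Hypotheses (cK : compact K) (KC : K `<=` cod i).
Hypothesis k0 : forall x, ~ (param i @` K) x -> k x = 0.
Hypothesis ck : forall y, cod i y -> {for y, continuous (k \o param i)}.

(** Outside the chart [k] vanishes near every point, because its support lies in the image of the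
    compact set [K], which is closed. *)
Lemma chart_cpt_continuous : continuous k.
Proof.
move=> x; have [ix|nix] := pselect (chart_dom i x).
  apply: (@continuous_near_eq _ _ ((k \o param i) \o coord i)).
    by apply: continuous_comp; [exact: coord_continuous|exact: ck (cod_coord ix)].
  by have := near_chart ix; apply: filterS => z iz; rewrite /= coordK.
apply: (@continuous_near_eq _ _ (fun=> 0)); first exact: cst_continuous.
have oc : open (~` (param i @` K)) by apply: closed_openC; exact: param_compact_closed.
have : \forall z \near x, (~` (param i @` K)) z.
  by apply: open_nbhs_nbhs; split=> // -[y Ky yx]; apply: nix; rewrite -yx; have [] := cod_param (KC Ky).
by apply: filterS => z; exact: k0.
Qed.

Lemma pull_out y : ~ K y -> pull i k y = 0.
Proof.
move=> nKy; rewrite /pull; case: asboolP => // iy; rewrite k0 ?mul0r// => -[z Kz zy]; apply: nKy.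
by have [_ <-] := cod_param iy; rewrite -zy; have [_ ->] := cod_param (KC Kz).
Qed.

Lemma pull_continuous : continuous (pull i k).
Proof.
move=> y; have [iy|niy] := pselect (cod i y).
  apply: (@continuous_near_eq _ _ (fun z => (k \o param i) z * dens i z)).
    by apply: (@continuousZ_at _ _ R^o); [exact: ck|have [A] := dens_c11 iy; exact: c11_continuous].
  by have := near_cod iy; apply: filterS => z iz; rewrite /pull asboolT.
apply: (@continuous_near_eq _ _ (fun=> 0)); first exact: cst_continuous.
have oc : open (~` K) by apply: closed_openC; apply: compact_closed => //; exact: norm_hausdorff.
have : \forall z \near y, (~` K) z by apply: open_nbhs_nbhs; split=> // Ky; apply: niy; exact: KC.
by apply: filterS => z; exact: pull_out.
Qed.

Lemma pull_bounded : exists B, forall y, B < `|y| -> pull i k y = 0.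
Proof.
have [B [_ hB]] := compact_bounded cK; exists (B + 1) => y hy; apply: pull_out => Ky.
by have := hB (B + 1); rewrite ltrDl ltr01 => /(_ isT y Ky) /=; rewrite leNgt hy.
Qed.

Lemma pull_integral : (\int[dV]_x (k x)%:E = \int[mu]_y (pull i k y)%:E)%E.
Proof.
have mk := continuous_borel chart_cpt_continuous.
have -> : (\int[dV]_x (k x)%:E = \int[dV]_(x in chart_dom i) (k x)%:E)%E.
  rewrite [RHS]integral_mkcond; apply: eq_integral => x _; rewrite patchE; case: ifPn => // /negP nix.
  by rewrite k0// => -[y Ky yx]; apply: nix; rewrite inE -yx; have [] := cod_param (KC Ky).
rewrite (@density_integral_EFin _ _ (borel M) (borel 'rV[R]_n) R dV mu (chart_dom i) (cod i) (param i) (dens i)); last exact: mk.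
- rewrite integral_mkcond; apply: eq_integral => y _; rewrite patchE /pull; case: ifPn => [/set_mem iy|/negP ny].
    by rewrite asboolT.
  by rewrite asboolF// => iy; apply: ny; rewrite inE.
- exact: mD.
- exact: mC.
- exact: mparam.
- exact: mdens.
- by move=> y iy; have [] := cod_param iy.
- by move=> y iy; exact/ltW/dens_gt0.
- by move=> A mA AD; exact: chart_volume.
Qed.

End compact_support.

Lemma pull_integrable i K k : compact K -> K `<=` cod i -> (forall x, ~ (param i @` K) x -> k x = 0) ->
  (forall y, cod i y -> {for y, continuous (k \o param i)}) -> dV.-integrable setT (EFin \o k).
Proof.
move=> cK KC k0 ck; have ck' := chart_cpt_continuous cK KC k0 ck.
apply/integrableP; split; first by apply/measurable_EFinP; exact: continuous_borel.
pose ak x := `|k x|.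
have ak0 x : ~ (param i @` K) x -> ak x = 0 by move=> h; rewrite /ak k0// normr0.
have cak y : cod i y -> {for y, continuous (ak \o param i)}.
  by move=> iy; apply: (@continuous_comp _ _ _ (k \o param i) (@Num.norm _ _)); [exact: ck|exact: norm_continuous].
have -> : (\int[dV]_x `|(EFin \o k) x| = \int[dV]_x (ak x)%:E)%E by [].
rewrite (pull_integral cK KC ak0 cak).
have [B hB] := @pull_bounded i K ak cK KC ak0.
have /integrableP[_] := integrable_compact_support mu_ball (pull_continuous cK KC ak0 cak) hB.
apply: le_lt_trans; apply: le_integral_ge0 => y _.
  by rewrite lee_fin /pull; case: asboolP => // iy; rewrite mulr_ge0 ?normr_ge0 ?sqrtr_ge0.
by rewrite lee_fin ler_norm.
Qed.

End chart_measure.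

(** * The radial derivation *)

Section smooth_step.
Context {R : realType}.

Definition possq (t : R) : R := Num.max t 0 ^+ 2.

Lemma possq_taylor (s t : R) : - (s - t) ^+ 2 <=
  Num.max s 0 ^+ 2 - Num.max t 0 ^+ 2 - 2 * Num.max t 0 * (s - t) <= (s - t) ^+ 2.
Proof.
have [s0|/ltW s0] := leP s 0; have [t0|/ltW t0] := leP t 0.
- have := sqr_ge0 (s - t); nra.
- have := mulr_ge0 t0 t0; have : 0 <= - s * t by rewrite mulr_ge0// oppr_ge0.
  have := sqr_ge0 s; have := sqr_ge0 (s - t); nra.
- have : 0 <= s * - t by rewrite mulr_ge0// oppr_ge0.
  have := sqr_ge0 s; have := sqr_ge0 t; have := sqr_ge0 (s - t); nra.
- have := sqr_ge0 (s - t); nra.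
Qed.

Lemma possq_derive (t : R) : is_derive t 1 possq (2 * Num.max t 0).
Proof.
have [||| d1 d2] := @diff_quad R R^o R^o possq ( *:%R (2 * Num.max t 0)) t 1 1.
- exact: scaler_continuous.
- exact: ltr01.
- move=> s _; rewrite mul1r -normrX [X in _ <= X]ger0_norm ?sqr_ge0// /possq.
  change (`|Num.max s 0 ^+ 2 - Num.max t 0 ^+ 2 - 2 * Num.max t 0 * (s - t)| <= (s - t) ^+ 2); rewrite ler_norml.
  exact: possq_taylor.
split; first exact/derivable1_diffP.
by rewrite (deriveE _ d1) d2; exact: mulr1.
Qed.

Lemma max0_continuous : continuous (fun t : R => Num.max t 0).
Proof. by move=> t; apply: continuous_max; [exact: cvg_id|exact: cvg_cst]. Qed.

(** A transition from 0 to 1 of class [C^1]: the inner [possq] flattens it at 0, the outer one at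
    1. *)
Definition step (v : R) : R := 1 - possq (1 - possq v).

Lemma step0 v : v <= 0 -> step v = 0.
Proof. by move=> v0; rewrite /step /possq (max_r v0) expr0n subr0 (max_l ler01) expr1n subrr. Qed.

Lemma step1 v : 1 <= v -> step v = 1.
Proof.
move=> v1; have v0 : 0 <= v := le_trans ler01 v1; rewrite /step /possq (max_l v0) max_r ?expr0n ?subr0//.
by rewrite subr_le0 -[1](expr1n _ 2) lerXn2r ?nnegrE.
Qed.

Lemma step01 v : 0 <= step v <= 1.
Proof.
rewrite /step /possq; set w := Num.max v 0 ^+ 2; have w0 : 0 <= w by exact: sqr_ge0.
by rewrite /Num.max; case: ltP => h; nra.
Qed.

Lemma c1_possq n (F : 'rV[R]_n -> R) y : c1 F y -> c1 (fun z => possq (F z)) y.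
Proof.
move=> hF; apply: (@c1_scalar _ _ F y possq (fun t => 2 * Num.max t 0)) => //.
  by apply: filterE => t; exact: possq_derive.
by apply: (@continuousZ_at _ _ R^o (cst 2)); [exact: cvg_cst|exact: max0_continuous].
Qed.

Lemma c1_compl n (F : 'rV[R]_n -> R) y : c1 F y -> c1 (fun z => 1 - F z) y.
Proof.
move=> hF; apply: (@c1_scalar _ _ F y (fun t => 1 - t) (fun _ => -1)) => //; last exact: cst_continuous.
apply: filterE => t; have := is_deriveB (is_derive_cst (1 : R) (t : R) (1 : R)) (is_derive_id (t : R) 1).
by rewrite sub0r.
Qed.

Lemma c1_step n (F : 'rV[R]_n -> R) y : c1 F y -> c1 (fun z => step (F z)) y.
Proof. by move=> hF; apply/c1_compl/c1_possq/c1_compl/c1_possq. Qed.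

Lemma c1_cst n (c : R) (y : 'rV[R]_n) : c1 (fun=> c) y.
Proof. by apply: c11e_c1; exact: c11eC. Qed.

End smooth_step.

(** * Bump functions and differentiation along the radial field *)

Section differentiable_functions.
Context {R : realType} {n : nat} {M : ptopologicalType}.
Variable g : riemannian R n M.
Implicit Types (i j : chart g).

Definition C1M (h : M -> R) := forall i y, cod i y -> c1 (h \o param i) y.

Lemma C1M_continuous h : C1M h -> continuous h.
Proof.
move=> hh x; have [i ix] := chart_cover g x.
apply: (@continuous_near_eq _ _ ((h \o param i) \o coord i)).
  by apply: continuous_comp; [exact: coord_continuous|exact: c1_continuous (hh i _ (cod_coord ix))].
by have := near_chart ix; apply: filterS => z iz; rewrite /= coordK.
Qed.

Lemma C1M_mul h k : C1M h -> C1M k -> C1M (fun x => h x * k x).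
Proof. by move=> hh hk i y iy; exact: c1M (hh i y iy) (hk i y iy). Qed.

Lemma C1M_compl h : C1M h -> C1M (fun x => 1 - h x).
Proof. by move=> hh i y iy; exact: c1_compl (hh i y iy). Qed.

Lemma bump (x : M) : exists phi : M -> R, [/\ C1M phi, forall z, 0 <= phi z <= 1,
  exists i (K : set 'rV[R]_n), [/\ compact K, K `<=` cod i & forall z, ~ (param i @` K) z -> phi z = 0]
  & \forall z \near x, phi z = 1].
Proof.
have [i ix] := chart_cover g x; set y0 := coord i x.
have [d d0 hd] := near_all (near_cod (cod_coord ix)).
set e := d / 2; have e0 : 0 < e by rewrite divr_gt0.
pose K := [set y : 'rV[R]_n | `|y - y0| <= e].
have cK : compact K by exact: closed_ball_compact.
have KC : K `<=` cod i by move=> y Ky; apply: hd; apply: le_lt_trans Ky _; rewrite /e; lra.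
(* Equal to 2 at the centre, hence above 1 nearby, and nonpositive off [K], where some coordinate
   differs by more than [e]. The Euclidean distance is used because the sup norm is not
   differentiable. *)
pose arg (y : 'rV[R]_n) := 2 - 2 / e ^+ 2 * \sum_a (y 0 a - y0 0 a) * (y 0 a - y0 0 a).
have carg y : c11e arg y.
  apply: c11eD; first exact: c11eC.
  apply: c11eN; apply: c11eM; first exact: c11eC.
  by apply: c11e_sum => a; apply: c11eM; apply: c11eD; (try exact: c11e_coord); exact: c11eC.
have arg0 : arg y0 = 2 by rewrite /arg big1 ?mulr0 ?subr0// => a _; rewrite subrr mulr0.
have argK y : ~ K y -> arg y <= 0.
  move=> nK; have [a ha] : exists a, e < `|y 0 a - y0 0 a|.
    apply: contrapT => H; apply: nK; apply: mx_norm_le => [|u a]; first exact: ltW.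
    by rewrite ord1 !mxE leNgt; apply/negP => ha; apply: H; exists a.
  rewrite /arg subr_le0 -mulrA ler_peMr// mulrC ler_pdivlMr ?exprn_gt0// mul1r.
  rewrite (bigD1 a)//= -[X in X <= _]addr0 lerD//; last by apply: sumr_ge0 => c _; rewrite -expr2 sqr_ge0.
  by rewrite -expr2 -[X in _ <= X]real_normK ?num_real// lerXn2r ?nnegrE ?(ltW e0) ?normr_ge0 ?(ltW ha).
pose phi z := if `[< chart_dom i z >] then step (arg (coord i z)) else 0.
have phi0 z : ~ (param i @` K) z -> phi z = 0.
  move=> nz; rewrite /phi; case: asboolP => // iz; apply: step0; apply: argK => Kz; apply: nz.
  by exists (coord i z) => //; exact: coordK.
exists phi; split.
- move=> j y jy; have [jx jc] := cod_param jy; have [iz|niz] := pselect (chart_dom i (param j y)).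
    apply: (@c1_ext _ _ (fun z => step (arg (trans j i z)))).
      have := near_param jy (near_chart iz); apply: filterS => z iz'; rewrite /phi /=.
      by rewrite asboolT.
    apply: c1_step; apply: c11e_c1; apply: c11e_compv => // k; apply: trans_c11e.
    by rewrite -jc; exact: overlap_coord.
  apply: (@c1_ext _ _ (fun _ => 0)); last exact: c1_cst.
  have oc : open (~` (param i @` K)) by apply: closed_openC; exact: param_compact_closed.
  have : \forall z \near param j y, (~` (param i @` K)) z.
    by apply: open_nbhs_nbhs; split=> // -[w Kw wx]; apply: niz; rewrite -wx; have [] := cod_param (KC w Kw).
  by move/(near_param jy); apply: filterS => z nz; rewrite /= phi0.
- by move=> z; rewrite /phi; case: asboolP => _; [exact: step01|rewrite lexx ler01].
- by exists i, K.
- have : \forall z \near y0, 1 < arg z.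
    have ca : {for y0, continuous arg} by have [A] := carg y0; exact: c11_continuous.
    by apply: (ca [set r | 1 < r]); rewrite arg0; apply: open_nbhs_nbhs; split; [exact: open_gt|rewrite /= ltrDl].
  move/(near_coord ix) => na; near=> z; rewrite /phi asboolT; last by near: z; exact: near_chart.
  by apply: step1; apply: ltW; near: z.
Unshelve. all: by end_near. Qed.

Section radial_derivation.
Hypothesis complete : geodesically_complete g.
Variable P : M.
Local Notation gd := (gd complete P).
Local Notation ex v := (gd v 1).
Local Notation sg := (sg complete P).
Variable b : R.
Hypothesis b0 : 0 <= b.
Hypothesis sec : sectional_curvature_le g (- b).
Hypothesis sc : simply_connected R M.

(* The derivative of [h] along [rho d/drho]. *)
Definition Yd (h : M -> R) (x : M) : R := derive1 (fun s : R => h (ex (s *: sg x)) : R^o) 1.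

Lemma Yd_derive h x : Yd h x = 'D_1 (fun s : R => h (ex (s *: sg x)) : R^o) 1.
Proof. by rewrite /Yd derive1E. Qed.

Let near1 : \forall s \near (1 : R), 0 <= s.
Proof.
apply/nbhs_ballP; exists 1 => //= s; rewrite /ball /= ltr_norml => /andP[h1 h2]; lra.
Qed.

Let ray_continuous v : {for (1 : R), continuous (fun s : R => ex (s *: v))}.
Proof.
apply: (@continuous_near_eq _ _ (gd v)).
  by have [[cc _] _] := gd_geodesic complete P v; exact: cc.
by apply: filterS near1 => s s0; rewrite gd_scale// mulr1.
Qed.

Lemma ray_is_derive h i y : cod i y -> c1 (h \o param i) y ->
  is_derive (1 : R) 1 (fun s : R => h (ex (s *: sg (param i y))) : R) (gradmap (grad (h \o param i) y) (Yc complete P i y)).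
Proof.
move=> iy hh; have [ip pc] := cod_param iy; have iv := chart_sg complete P b0 sec sc iy.
set v := sg (param i y) in iv *.
have dx := @xx_derive _ _ _ g complete P i v 1 iv.
have xE : xx complete P i v 1 = y by rewrite /xx (sgK complete P b0 sec sc).
have dh : is_diff (xx complete P i v 1) (h \o param i) (gradmap (grad (h \o param i) y)).
  by rewrite xE; exact: c1_is_diff.
have := diff_curve dh dx; apply: near_eq_is_derive.
have [[cc _] _] := gd_geodesic complete P v.
near=> s; rewrite /= /xx coordK; last by near: s; exact: curve_near_dom.
by congr h; rewrite gd_scale ?mulr1//; near: s.
Unshelve. all: by end_near. Qed.

Lemma YdE h i y : cod i y -> c1 (h \o param i) y ->
  Yd h (param i y) = gradmap (grad (h \o param i) y) (Yc complete P i y).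
Proof. by move=> iy hh; rewrite /Yd derive1E; have [_ ->] := ray_is_derive iy hh. Qed.

Lemma C1M_ray h x : C1M h -> is_derive (1 : R) 1 (fun s : R => h (ex (s *: sg x)) : R) (Yd h x).
Proof.
move=> hh; have [i ix] := chart_cover g x; have iy := cod_coord ix.
have := ray_is_derive iy (hh i _ iy); rewrite -YdE ?coordK//; exact: hh.
Qed.

Lemma YdD h k x : C1M h -> C1M k -> Yd (fun z => h z + k z) x = Yd h x + Yd k x.
Proof.
move=> hh hk; have := is_deriveD (C1M_ray x hh) (C1M_ray x hk).
by move=> [_ <-]; rewrite /Yd derive1E.
Qed.

Lemma Yd_mul h k x : C1M h -> C1M k -> Yd (fun z => h z * k z) x = h x * Yd k x + k x * Yd h x.
Proof.
move=> hh hk; have := is_derive_mul (C1M_ray x hh) (C1M_ray x hk).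
rewrite scale1r (sgK complete P b0 sec sc) => -[_ D]; rewrite {1}/Yd derive1E.
apply: etrans D _; ring.
Qed.

Lemma Yd_near0 h x : (\forall z \near x, h z = 0) -> Yd h x = 0.
Proof.
move=> h0; rewrite /Yd derive1E.
have : \forall s \near (1 : R), h (ex (s *: sg x)) = 0.
  by apply: (@ray_continuous (sg x) [set z | h z = 0]); rewrite /= scale1r (sgK complete P b0 sec sc).
move=> n0; have : is_derive (1 : R) 1 (fun s : R => h (ex (s *: sg x)) : R) 0.
  by apply: near_eq_is_derive (is_derive_cst (0 : R) (1 : R) (1 : R)); apply: filterS n0 => s ->.
by move=> [_ D].
Qed.

Lemma Yd_continuous h : C1M h -> continuous (Yd h).
Proof.
move=> hh x; have [i ix] := chart_cover g x; have iy := cod_coord ix.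
apply: (@continuous_near_eq _ _ ((fun y => \sum_k Yc complete P i y 0 k * grad (h \o param i) y k 0) \o coord i)).
  apply: continuous_comp; first exact: coord_continuous.
  apply: continuous_sumf => k; apply: (@continuousZ_at _ _ R^o).
    by have [A] := Yc_c11e complete P b0 sec sc k iy; exact: c11_continuous.
  by apply: (@continuous_comp _ _ _ (grad (h \o param i)) (fun D => D k 0)); [exact: c1_grad_continuous (hh i _ iy)|exact: matrix_normedtype.coord_continuous].
have := near_chart ix; apply: filterS => z iz; rewrite /= -{1}(coordK iz) (YdE (cod_coord iz) (hh i _ (cod_coord iz))).
by rewrite /gradmap mxE.
Qed.

End radial_derivation.
End differentiable_functions.

(** * The integrated divergence inequality *)

Section measurability.
Context {R : realType}.
Local Notation TR := (measurableTypeR R).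

(** Inversion is discontinuous at 0; written as [x] times a real power of [x ^+ 2] it is a product
    of measurable functions, with the right value at 0. *)
Lemma measurable_inv : measurable_fun setT (fun x : TR => x^-1 : TR).
Proof.
have -> : (fun x : R => x^-1) = (fun x => x * (x ^+ 2) `^ (-1)).
  apply/funext => x; rewrite powR_inv1 ?sqr_ge0//; have [->|x0] := eqVneq x 0; first by rewrite invr0 mul0r.
  by rewrite expr2 invfM mulrA divff// mul1r.
apply: measurable_funM; first exact: measurable_id.
by apply: (measurableT_comp (@measurable_powR R _)); exact: measurable_funX.
Qed.

Lemma DD_measurable b : measurable_fun setT (DD b : TR -> TR).
Proof.
apply: measurable_fun_ifT; [exact: measurable_fun_eqr|exact: measurable_cst|].
apply: measurable_funB; last exact: measurable_cst.
apply: measurable_funM; first exact: measurable_id.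
case E : (b == 0).
  by rewrite (_ : ct b = fun t => t^-1); [exact: measurable_inv|apply/funext => t; rewrite /ct E].
rewrite (_ : ct b = fun t => Num.sqrt b * coth (Num.sqrt b * t)); last by apply/funext => t; rewrite /ct E.
apply: measurable_funM; first exact: measurable_cst.
have me (F : TR -> TR) : measurable_fun setT F -> measurable_fun setT (fun t => expR (F t)).
  by move=> mF; exact: measurableT_comp.
have m1 : measurable_fun setT (fun t : TR => Num.sqrt b * t) by apply: measurable_funM => //.
rewrite /coth; apply: measurable_funM.
  by apply: measurable_funD; apply: me => //; exact: measurable_funN.
apply: (measurableT_comp measurable_inv).
by apply: measurable_funB; apply: me => //; exact: measurable_funN.
Qed.

Lemma measurable_fun_mul d (T : measurableType d) (f h : T -> TR) : measurable_fun setT f -> measurable_fun setT h ->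
  measurable_fun setT (fun x => f x * h x).
Proof. exact: measurable_funM. Qed.

End measurability.

Lemma coth_ge (R : realType) (x : R) : 0 < x -> 1 <= x * coth x.
Proof.
move=> x0; rewrite /coth; have d0 : 0 < expR x - expR (- x) by rewrite subr_gt0 ltr_expR; lra.
rewrite mulrA ler_pdivlMr// mul1r.
(* Cleared of its denominator, the claim is [0 <= q x]; [q] vanishes at 0 and has derivative
   [t * (expR t - expR (- t))]. *)
pose q (t : R) := t * (expR t + expR (- t)) - (expR t - expR (- t)).
have dN (t : R) : is_derive t 1 (fun s : R => expR (- s)) (- expR (- t)).
  have [h1 h2] := is_derive_expR (- t); have d : is_diff (- t) expR (fun h : R => h *: expR (- t)).
    by split; [exact/derivable1_diffP|rewrite deriv1E// derive1E h2].
  by have := diff_curve d (is_deriveN (is_derive_id t (1 : R))); rewrite scaleN1r.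
have dq (t : R) : is_derive t 1 q (t * (expR t - expR (- t))).
  have dS := is_deriveD (is_derive_expR t) (dN t).
  have := is_deriveB (is_derive_mul (is_derive_id t (1 : R)) dS) (is_deriveB (is_derive_expR t) (dN t)).
  rewrite [X in is_derive _ _ _ X -> _](_ : _ = t * (expR t - expR (- t)))// !fctE mul1r; ring.
have : q 0 <= q x.
  apply: (nondecreasing_of_derive (ltW x0) (fun t _ => dq t)) => t /andP[t0 _].
  by rewrite mulr_ge0// subr_ge0 ler_expR; lra.
by rewrite {1}/q mul0r oppr0 subrr subr0 subr_ge0.
Qed.

Lemma DD_ge0 (R : realType) (b t : R) : 0 <= b -> 0 <= t -> 0 <= DD b t.
Proof.
move=> b0; rewrite le_eqVlt => /predU1P[<-|t0]; first by rewrite /DD eqxx.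
rewrite /DD gt_eqF// /ct; case: eqP => [_|/eqP bn]; first by rewrite divff ?subrr// gt_eqF.
have s0 : 0 < Num.sqrt b by rewrite sqrtr_gt0 lt_def bn.
by rewrite subr_ge0 mulrA (mulrC t); apply: coth_ge; exact: mulr_gt0.
Qed.

Section divergence_inequality.
Context {R : realType} {n : nat} {M : ptopologicalType}.
Variable g : riemannian R n M.
Implicit Types (i : chart g).
Hypothesis complete : geodesically_complete g.
Variable P : M.
Local Notation gd := (gd complete P).
Local Notation ex v := (gd v 1).
Local Notation sg := (sg complete P).
Local Notation rho := (rho complete P).
Local Notation Yc := (Yc complete P).
Local Notation Yd := (Yd complete P).
Local Notation C1M := (@C1M R n M g).
Variable b : R.
Hypothesis b0 : 0 <= b.
Hypothesis sec : sectional_curvature_le g (- b).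
Hypothesis sc : simply_connected R M.
Variable dV : {measure set (borel M) -> \bar R}.
Hypothesis vol : riemannian_volume g dV.

Lemma rho_continuous : continuous rho.
Proof.
have ce : continuous (en complete P).
  move=> x; have [i ix] := chart_cover g x.
  apply: (@continuous_near_eq _ _ ((fun y => en complete P (param i y)) \o coord i)).
    apply: continuous_comp; first exact: coord_continuous.
    by have [A] := en_c11e complete P b0 sec sc (cod_coord ix); exact: c11_continuous.
  by have := near_chart ix; apply: filterS => z iz; rewrite /= coordK.
by move=> x; apply: (@continuous_comp _ _ _ (en complete P) Num.sqrt); [exact: ce|exact: sqrt_continuous].
Qed.

Definition flux i a (y : 'rV[R]_n) : R := dens i y * Yc i y 0 a.

Lemma flux_c11e i a y : cod i y -> c11e (flux i a) y.
Proof. by move=> iy; apply: (@c11eM _ _ (dens i) (fun z => Yc i z 0 a)); [exact: dens_c11|apply: Yc_c11e; eassumption]. Qed.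

(* The divergence of the radial field [rho d/drho]. *)
Definition Tc i (y : 'rV[R]_n) : R := (\sum_a grad (flux i a) y a 0) / dens i y.

Lemma c1_line_derive (F : 'rV[R]_n -> R) y a : c1 F y ->
  is_derive (0 : R) 1 (fun t : R => F (y + t *: delta_mx 0 a)) (grad F y a 0).
Proof.
move=> hF; have z0 : y + (0 : R) *: delta_mx 0 a = y by rewrite scale0r addr0.
have d : is_diff (y + (0 : R) *: delta_mx 0 a) F (gradmap (grad F y)) by rewrite z0; exact: c1_is_diff.
have := diff_curve d (line_is_derive_id y (delta_mx 0 a) (0 : R)).
rewrite [X in is_derive _ _ _ X -> _](_ : _ = grad F y a 0)//.
rewrite /gradmap mxE (bigD1 a)//= big1 ?addr0 => [|c ca]; first by rewrite mxE !eqxx mul1r.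
by rewrite mxE eqxx /= (negbTE ca) mul0r.
Qed.

Lemma Tc_ge i y : cod i y -> n%:R + (n%:R - 1) * DD b (rho (param i y)) <= Tc i y.
Proof.
move=> iy; apply: le_trans (radial_trace complete P b0 sec sc iy) _.
have [D [dD sD]] := divergence_coord iy (Yc_c11 complete P b0 sec sc iy).
have E : \sum_a grad (flux i a) y a 0 = \sum_a D a.
  apply: eq_bigr => a _; apply: is_derive_unique (dD a).
  by apply: c1_line_derive; apply: c11e_c1; exact: flux_c11e.
by rewrite /Tc E sD mulrC mulKf// gt_eqF// dens_gt0.
Qed.

Lemma grad_entry_continuous (F : 'rV[R]_n -> R) y a : c1 F y -> {for y, continuous (fun z => grad F z a 0)}.
Proof.
move=> hF; apply: (@continuous_comp _ _ _ (grad F) (fun D => D a 0)); first exact: c1_grad_continuous.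
exact: matrix_normedtype.coord_continuous.
Qed.

Lemma Tc_continuous i y : cod i y -> {for y, continuous (Tc i)}.
Proof.
move=> iy; apply: (@continuousZ_at _ _ R^o).
  by apply: continuous_sumf => a; apply: grad_entry_continuous; apply: c11e_c1; exact: flux_c11e.
have c : {for y, continuous (dens i)} by have [A] := dens_c11 iy; exact: c11_continuous.
by apply: (@cvgV R _ (nbhs y) (nbhs_filter y) (dens i)) => //; rewrite gt_eqF// dens_gt0.
Qed.

(* The integrated form of [div (rho d/drho) >= n + (n - 1) D_b(rho)], tested against [q]. *)
Definition div_ineq (q : M -> R) :=
  [/\ dV.-integrable setT (fun x => (q x * (n%:R + (n%:R - 1) * DD b (rho x)))%:E),
      dV.-integrable setT (EFin \o Yd q) &
      (\int[dV]_x (q x * (n%:R + (n%:R - 1) * DD b (rho x)) + Yd q x)%:E <= 0)%E].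

Lemma div_ineqD q1 q2 : C1M q1 -> C1M q2 -> div_ineq q1 -> div_ineq q2 -> div_ineq (fun x => q1 x + q2 x).
Proof.
move=> h1 h2 [a1 b1 c1'] [a2 b2 c2].
have E1 : (fun x => ((q1 x + q2 x) * (n%:R + (n%:R - 1) * DD b (rho x)))%:E) =
  (fun x => (q1 x * (n%:R + (n%:R - 1) * DD b (rho x)))%:E) \+ (fun x => (q2 x * (n%:R + (n%:R - 1) * DD b (rho x)))%:E).
  by apply/funext => x; rewrite /= -EFinD mulrDl.
have E2 : EFin \o Yd (fun x => q1 x + q2 x) = (EFin \o Yd q1) \+ (EFin \o Yd q2).
  by apply/funext => x; rewrite /= (YdD complete P b0 sec sc x h1 h2).
split; first by rewrite E1; exact: integrableD.
  by rewrite E2; exact: integrableD.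
have S q : dV.-integrable setT (fun x => (q x * (n%:R + (n%:R - 1) * DD b (rho x)))%:E) ->
  dV.-integrable setT (EFin \o Yd q) ->
  dV.-integrable setT (EFin \o (fun x => q x * (n%:R + (n%:R - 1) * DD b (rho x)) + Yd q x)).
  by move=> i1 i2; have := integrableD measurableT i1 i2.
have -> : (\int[dV]_x ((q1 x + q2 x) * (n%:R + (n%:R - 1) * DD b (rho x)) + Yd (fun x => (q1 x + q2 x)%R) x)%:E =
  \int[dV]_x (q1 x * (n%:R + (n%:R - 1) * DD b (rho x)) + Yd q1 x)%:E +
  \int[dV]_x (q2 x * (n%:R + (n%:R - 1) * DD b (rho x)) + Yd q2 x)%:E)%E.
  rewrite -(@integralD_EFin _ _ _ dV setT measurableT _ _ (S q1 a1 b1) (S q2 a2 b2)).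
  apply: eq_integral => x _; rewrite /= -EFinD; congr EFin.
  rewrite (YdD complete P b0 sec sc x h1 h2); ring.
by apply: le_trans (leeD c1' c2) _; rewrite adde0.
Qed.

Lemma DD_radial_ge0 x : 0 <= DD b (rho x).
Proof. exact: DD_ge0 (rho_ge0 _ _ _). Qed.

(** In coordinates, the density times [q Tc + Yd q] is the divergence of the compactly supported
    field with components [q * flux], so it integrates to 0. The bound [Tc_ge] can then be inserted
    because [q >= 0]. *)
Lemma div_ineq_chart q i (K : set 'rV[R]_n) : (0 < n)%N -> C1M q -> (forall x, 0 <= q x) -> compact K -> K `<=` cod i ->
  (forall x, ~ (param i @` K) x -> q x = 0) -> div_ineq q.
Proof.
move=> n0 hq q0 cK KC qK.
have [mu [_ mu_ball mu_int mu_parts]] := @lebesgue_rV R n.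
pose k1 x := q x * Tc i (coord i x).
have Y0 x : ~ (param i @` K) x -> Yd q x = 0.
  move=> nx; apply: (Yd_near0 complete P b0 sec sc).
  have oc : open (~` (param i @` K)) by apply: closed_openC; exact: param_compact_closed.
  have : \forall z \near x, (~` (param i @` K)) z by apply: open_nbhs_nbhs.
  by apply: filterS => z; exact: qK.
have k10 x : ~ (param i @` K) x -> k1 x = 0 by move=> nx; rewrite /k1 qK// mul0r.
have ck1 y : cod i y -> {for y, continuous (k1 \o param i)}.
  move=> iy; apply: (@continuous_near_eq _ _ (fun z => (q \o param i) z * Tc i z)).
    by apply: (@continuousZ_at _ _ R^o); [exact: c1_continuous (hq i y iy)|exact: Tc_continuous].
  by have := near_cod iy; apply: filterS => z iz; rewrite /k1 /=; have [_ ->] := cod_param iz.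
have cY : continuous (Yd q) by exact: (Yd_continuous b0 sec sc hq).
have cY' y : cod i y -> {for y, continuous (Yd q \o param i)}.
  by move=> iy; apply: continuous_comp; [exact: param_continuous|exact: cY].
have I1 := pull_integrable vol mu_ball mu_int cK KC k10 ck1.
have I2 := pull_integrable vol mu_ball mu_int cK KC Y0 cY'.
have I12 : dV.-integrable setT (EFin \o (fun x => k1 x + Yd q x)).
  by have := integrableD measurableT I1 I2.
have S0 : (\int[dV]_x (k1 x + Yd q x)%:E = 0)%E.
  have s0 x : ~ (param i @` K) x -> k1 x + Yd q x = 0 by move=> nx; rewrite k10// Y0// addr0.
  have cs y : cod i y -> {for y, continuous ((fun x => k1 x + Yd q x) \o param i)}.
    by move=> iy; apply: (@continuousD_at _ _ R^o); [exact: ck1|exact: cY'].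
  rewrite (pull_integral vol mu_int cK KC s0 cs).
  pose qe (y : 'rV[R]_n) := if `[< cod i y >] then q (param i y) else 0.
  have qe_out y : ~ K y -> qe y = 0.
    move=> nK; rewrite /qe; case: asboolP => // iy; apply: qK => -[z Kz zy]; apply: nK.
    by have [_ <-] := cod_param iy; rewrite -zy; have [_ ->] := cod_param (KC z Kz).
  have oK : open (~` K) by apply: closed_openC; apply: compact_closed => //; exact: norm_hausdorff.
  have nKn y : ~ K y -> \forall z \near y, ~ K z by move=> nK; apply: open_nbhs_nbhs.
  pose H a y := qe y * flux i a y.
  have H0 a y : ~ K y -> H a y = 0 by move=> nK; rewrite /H qe_out// mul0r.
  have cH a y : c1 (H a) y.
    have [iy|niy] := pselect (cod i y).
      apply: (@c1_ext _ _ (fun z => (q \o param i) z * flux i a z)).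
        by have := near_cod iy; apply: filterS => z iz; rewrite /H /qe asboolT.
      by apply: c1M; [exact: hq|apply: c11e_c1; exact: flux_c11e].
    apply: (@c1_ext _ _ (fun _ => 0)); last exact: c1_cst.
    have : \forall z \near y, ~ K z by apply: nKn => Ky; apply: niy; exact: KC.
    by apply: filterS => z nK; rewrite H0.
  have gH0 a y : ~ K y -> grad (H a) y a 0 = 0.
    move=> nK; apply: is_derive_unique (c1_line_derive a (cH a y)) _.
    have z0 : y + (0 : R) *: delta_mx 0 a = y by rewrite scale0r addr0.
    apply: near_eq_is_derive (is_derive_cst (0 : R) (0 : R) (1 : R)).
    have c := is_derive_continuous (line_is_derive_id y (delta_mx 0 a) (0 : R)).
    have : \forall t \near (0 : R), ~ K (y + t *: delta_mx 0 a) by apply: (c (~` K)); rewrite /= z0; exact: nKn.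
    by apply: filterS => t nt; rewrite H0.
  have [B0 [_ hB0]] := compact_bounded cK; pose B := B0 + 1.
  have Bout y : B < `|y| -> ~ K y.
    by move=> hy Ky; have := hB0 B; rewrite ltrDl ltr01 => /(_ isT y Ky) /=; rewrite leNgt hy.
  have gc a : continuous (fun y => grad (H a) y a 0) by move=> y; exact: grad_entry_continuous.
  have pullE y : pull i (fun x => k1 x + Yd q x) y = \sum_a grad (H a) y a 0.
    rewrite /pull; case: asboolP => [iy|niy]; last first.
      by rewrite big1// => a _; apply: gH0 => Ky; apply: niy; exact: KC.
    have hqi := hq i y iy.
    have gHE a : grad (H a) y a 0 = q (param i y) * grad (flux i a) y a 0 + flux i a y * grad (q \o param i) y a 0.
      have dF := c1_is_diff (c11e_c1 (flux_c11e a iy)); have dq := c1_is_diff hqi.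
      have d : is_diff y (H a) (gradmap ((q \o param i) y *: grad (flux i a) y + flux i a y *: grad (q \o param i) y)).
        apply: (@near_is_diff _ _ _ ((q \o param i) * flux i a)).
          by have := near_cod iy; apply: filterS => z iz; rewrite /H /qe asboolT.
        apply: is_diff_eq (is_diffM dq dF) _; apply/funext => u.
        by rewrite /gradmap mulmxDr -!scalemxAr mxE [X in _ = X + _]mxE [X in _ = _ + X]mxE.
      by rewrite (is_diff_grad d) mxE [X in X + _]mxE [X in _ + X]mxE.
    under eq_bigr do rewrite gHE.
    rewrite big_split /= -mulr_sumr mulrDl /k1; have [_ ->] := cod_param iy.
    rewrite -mulrA /Tc mulfVK ?gt_eqF ?dens_gt0//; congr (_ + _).
    rewrite (YdE complete P b0 sec sc iy hqi) /gradmap mxE mulr_suml; apply: eq_bigr => a _; rewrite /flux; ring.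
  have int0 a : (\int[mu]_y (grad (H a) y a 0)%:E = 0)%E.
    apply: (mu_parts a (H a) (fun y => grad (H a) y a 0) B) => //.
      by move=> y; exact: c1_line_derive.
    by move=> y /Bout nK; rewrite H0// gH0.
  have ii a : mu.-integrable setT (EFin \o (fun y => grad (H a) y a 0)).
    by apply: (integrable_compact_support mu_ball (gc a)) => y /Bout nK; exact: gH0.
  transitivity (\int[mu]_y \sum_a (grad (H a) y a 0)%:E)%E.
    by apply: eq_integral => y _; rewrite pullE sumEFin.
  rewrite (integral_sum measurableT (fun a : 'I_n => ii a)) big1// => a _; exact: int0.
pose k3 x := q x * (n%:R + (n%:R - 1) * DD b (rho x)).
have n1 : 0 <= n%:R - 1 :> R by rewrite subr_ge0 ler1n.
have k30 x : 0 <= k3 x by rewrite mulr_ge0// addr_ge0// mulr_ge0// DD_radial_ge0.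
have k31 x : k3 x <= k1 x.
  have [[y Ky <-]|nx] := pselect ((param i @` K) x); last by rewrite /k3 /k1 qK// !mul0r.
  have iy := KC y Ky; rewrite /k3 /k1 ler_wpM2l//; have [_ ->] := cod_param iy; exact: Tc_ge.
have mk3 : measurable_fun setT (k3 : borel M -> measurableTypeR R).
  apply: measurable_fun_mul; first exact: continuous_borel (C1M_continuous hq).
  apply: measurable_funD; first exact: measurable_cst.
  apply: measurable_fun_mul; first exact: measurable_cst.
  exact: measurableT_comp (DD_measurable b) (continuous_borel rho_continuous).
have I3 : dV.-integrable setT (EFin \o k3).
  apply: le_integrable I1 => //; first by apply/measurable_EFinP.
  by move=> x _; rewrite /= lee_fin !ger0_norm// (le_trans (k30 x)).
split=> //.
rewrite -S0; apply: le_integral => //; first by have := integrableD measurableT I3 I2.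
by move=> x _; rewrite lee_fin lerD2r; exact: k31.
Qed.

Lemma div_ineq0 q : (forall x, q x = 0) -> div_ineq q.
Proof.
move=> q0; have Y0 x : Yd q x = 0 by apply: (Yd_near0 complete P b0 sec sc); apply: filterE => z.
have E : (fun x => (q x * (n%:R + (n%:R - 1) * DD b (rho x)))%:E) = cst (0 : \bar R) by apply/funext => x; rewrite q0 mul0r.
split; first by rewrite E; exact: integrable0.
  by rewrite (_ : EFin \o _ = cst 0%E); [exact: integrable0|apply/funext => x; rewrite /= Y0].
by rewrite (eq_integral (cst 0%E)) ?integral0// => x _; rewrite q0 Y0 mul0r addr0.
Qed.

(** The support is covered by finitely many sets on which some bump function is 1. In place of a
    partition of unity, each bump function [phi] splits [q] into [phi q], supported in a chart, and
    [(1 - phi) q], passed on to the next one. *)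
Lemma divergence_inequality q (Kq : set M) : (0 < n)%N -> C1M q -> (forall x, 0 <= q x) -> compact Kq ->
  (forall x, ~ Kq x -> q x = 0) -> div_ineq q.
Proof.
move=> n0 hq q0 cK qK; have [phi hphi] := choice (@bump R n M g).
have cov : Kq `<=` cover setT (fun x => (fun z => phi x z = 1)^°).
  by move=> x Kx; exists x => //; have [_ _ _] := hphi x.
have : finite_subset_cover setT (fun x => (fun z => phi x z = 1)^°) Kq.
  by move: cK; rewrite compact_cover => /(_ M setT _ _ cov); apply => x _; exact: open_interior.
move=> [D _ covD].
(* The invariant of the induction: the remaining factors [1 - phi c] annihilate [q]. Once none is
   left, [q] is 0. *)
have : forall x, \prod_(c <- finmap.enum_fset D) (1 - phi c x) * q x = 0.
  move=> x; have [Kx|nx] := pselect (Kq x); last by rewrite qK// mulr0.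
  have [c cD /interior_subset cx] := covD x Kx.
  by rewrite (big_rem c)//= cx subrr !mul0r.
elim: (finmap.enum_fset D) q q0 hq {qK covD} => [|c r IH] q q0 hq.
  by move=> h; apply: div_ineq0 => x; have := h x; rewrite big_nil mul1r.
move=> h; have [h1 h2 [i [K [cK' KC pK]]] _] := hphi c.
have -> : q = (fun x => phi c x * q x + (1 - phi c x) * q x) by apply/funext => x; ring.
have p1 : C1M (fun x => phi c x * q x) by exact: C1M_mul.
have p2 : C1M (fun x => (1 - phi c x) * q x) by apply: C1M_mul => //; exact: C1M_compl.
apply: div_ineqD => //.
  apply: (@div_ineq_chart _ i K) => //.
    by move=> x; have /andP[x0 _] := h2 x; exact: mulr_ge0.
  by move=> x nx; rewrite pK// mul0r.
apply: IH => // x; first by have /andP[_ x1] := h2 x; rewrite mulr_ge0// subr_ge0.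
by have := h x; rewrite big_cons => <-; ring.
Qed.

End divergence_inequality.

(** * Regularised weights *)

Section regularised_powers.
Context {R : realType}.
Implicit Types (r s t x y a d : R).

Lemma le_powR_neg x y a : a <= 0 -> 0 < x -> x <= y -> y `^ a <= x `^ a.
Proof.
move=> a0 x0 xy; have y0 := lt_le_trans x0 xy.
rewrite -[a]opprK !(powRN _ (- a)) lef_pV2 ?posrE ?powR_gt0//.
by apply: ge0_ler_powR; rewrite ?nnegrE ?oppr_ge0// ltW.
Qed.

Lemma powR_continuous x a : 0 < x -> {for x, continuous (fun t => t `^ a)}.
Proof. by move=> x0; exact: is_derive_continuous (is_derive1_powR a x0). Qed.

Lemma powR_shift_derive (u : R -> R) t du a : is_derive t 1 u du -> 0 < u t ->
  is_derive t 1 (fun t => u t `^ a) (du * (a * u t `^ (a - 1))).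
Proof.
move=> hu u0; have [h1 h2] := is_derive1_powR a u0.
have d : is_diff (u t) (fun x => x `^ a) (fun h : R => h *: (a * u t `^ (a - 1))).
  by split; [exact/derivable1_diffP|rewrite deriv1E// derive1E h2].
exact: diff_curve d hu.
Qed.

Lemma sqr_powR t r : (t ^+ 2) `^ (r / 2) = `|t| `^ r.
Proof. by rewrite -real_normK ?num_real// -powR_mulrn// -powRrM mulrC divfK. Qed.

Lemma seq_eps_cvg : (fun k : nat => k.+1%:R^-1 : R) @ \oo --> 0.
Proof. exact: cvg_harmonic. Qed.

Lemma sqr_derive t : is_derive t 1 (fun t => t ^+ 2) (2 * t).
Proof.
have := is_derive_mul (is_derive_id t (1 : R)) (is_derive_id t (1 : R)).
rewrite [X in is_derive _ _ _ X -> _](_ : _ = 2 * t); last by ring.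
by apply: near_eq_is_derive; apply: filterE => x; rewrite expr2.
Qed.

Lemma is_derive_addc (u : R -> R) t du c : is_derive t 1 u du -> is_derive t 1 (fun x => u x + c) du.
Proof. by move=> hu; have := is_deriveD hu (is_derive_cst (c : R) t (1 : R)); rewrite addr0. Qed.

Lemma powR_seq_cvg0 a : 0 < a -> (fun k : nat => (k.+1%:R^-1 : R) `^ a) @ \oo --> (0 : R).
Proof.
move=> a0; apply/cvgrPdist_le => eta eta0; have pe : 0 < eta `^ a^-1 by exact: powR_gt0.
have nn : \forall k \near \oo, `|0 - (k.+1%:R^-1 : R)| <= eta `^ a^-1.
  by have /cvgrPdist_le := seq_eps_cvg; apply.
near=> k; rewrite sub0r normrN ger0_norm ?powR_ge0//.
have h : `|0 - k.+1%:R^-1| <= eta `^ a^-1.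
  by near: k; exact: nn.
rewrite sub0r normrN ger0_norm ?invr_ge0// in h.
rewrite -[leRHS](powRr1 (ltW eta0)) -[X in _ <= _ `^ X](mulVf (lt0r_neq0 a0)) powRrM.
by apply: ge0_ler_powR; rewrite ?nnegrE ?powR_ge0 ?invr_ge0 ?(ltW a0).
Unshelve. all: by end_near. Qed.

(* C^1 approximations of [|t|^r]; no regularisation is needed when [r > 2]. *)
Lemma regularised_norm_powR r : 0 < r -> exists G G1 : nat -> R -> R,
  [/\ forall k t, is_derive t 1 (G k) (G1 k t), forall k, continuous (G1 k), forall k t, 0 <= G k t,
    forall k, G k 0 = 0 /\ G1 k 0 = 0 & (forall k t, t != 0 -> `|G1 k t| <= r * `|t| `^ (r - 1)) /\
    forall t, (fun k => G k t) @ \oo --> `|t| `^ r].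
Proof.
move=> r0; have [r2|r2] := leP r 2.
  pose e (k : nat) : R := k.+1%:R^-1.
  have e0 k : 0 < e k by rewrite invr_gt0.
  have p0 k t : 0 < t ^+ 2 + e k by rewrite ltr_wpDl// sqr_ge0.
  (* Subtracting the value at [t = 0] keeps [G k (f x)] supported in the support of [f]. The
     derivative is below that of [|t|^r] because the exponent [r / 2 - 1] is nonpositive. *)
  exists (fun k t => (t ^+ 2 + e k) `^ (r / 2) - e k `^ (r / 2)), (fun k t => r * t * (t ^+ 2 + e k) `^ (r / 2 - 1)).
  split.
  - move=> k t; have := powR_shift_derive (r / 2) (is_derive_addc (e k) (sqr_derive t)) (p0 k t).
    move=> /(is_derive_addc (- e k `^ (r / 2))).
    by rewrite [X in is_derive _ _ _ X -> _](_ : _ = r * t * (t ^+ 2 + e k) `^ (r / 2 - 1))//; field.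
  - move=> k t; apply: (@continuousZ_at _ _ R^o (fun t => r * t)).
      by apply: (@continuousZ_at _ _ R^o (cst r)); [exact: cvg_cst|exact: cvg_id].
    have dt := powR_shift_derive (r / 2 - 1) (is_derive_addc (e k) (sqr_derive t)) (p0 k t).
    exact: is_derive_continuous dt.
  - move=> k t; rewrite subr_ge0; apply: ge0_ler_powR; rewrite ?nnegrE ?divr_ge0 ?(ltW r0) ?(ltW (e0 k)) ?(ltW (p0 k t))//.
    by rewrite lerDr sqr_ge0.
  - by move=> k; rewrite expr0n add0r subrr mulr0 mul0r.
  split.
    move=> k t t0; rewrite -mulrA normrM gtr0_norm// ler_pM2l// normrM [X in _ * X]ger0_norm ?powR_ge0//.
    have nt : 0 < `|t| by rewrite normr_gt0.
    apply: (@le_trans _ _ (`|t| * (t ^+ 2) `^ (r / 2 - 1))).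
      rewrite ler_wpM2l//; apply: le_powR_neg; [lra|by rewrite exprn_even_gt0|by rewrite lerDl ltW].
    have -> : r / 2 - 1 = (r - 2) / 2 by field.
    rewrite sqr_powR -{1}(powRr1 (ltW nt)) -powRD; last by rewrite normr_eq0 t0 implybT.
    by rewrite le_eqVlt; apply/orP; left; apply/eqP; congr (_ `^ _); ring.
  move=> t; have c1' : (fun k => e k `^ (r / 2)) @ \oo --> 0.
    by apply: powR_seq_cvg0; rewrite divr_gt0.
  have c2 : (fun k => (t ^+ 2 + e k) `^ (r / 2)) @ \oo --> `|t| `^ r.
    have [->|t0] := eqVneq t 0.
      rewrite normr0 powR0 ?gt_eqF//; have -> : (fun k => (0 ^+ 2 + e k) `^ (r / 2)) = (fun k => e k `^ (r / 2)).
        by apply/funext => k; rewrite expr0n add0r.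
      exact: c1'.
    rewrite -sqr_powR; apply: (@cvg_comp _ _ _ (fun k => t ^+ 2 + e k) (fun x => x `^ (r / 2)) \oo (nbhs (t ^+ 2))).
      have : (fun k => t ^+ 2 + e k) @ \oo --> t ^+ 2 + 0 by apply: cvgD; [exact: cvg_cst|exact: seq_eps_cvg].
      by rewrite addr0.
    by apply: powR_continuous; rewrite exprn_even_gt0.
  have : (fun k => (t ^+ 2 + e k) `^ (r / 2) - e k `^ (r / 2)) @ \oo --> `|t| `^ r - 0 by apply: cvgB.
  by rewrite subr0.
exists (fun _ t => `|t| `^ r), (fun _ t => r * (t * `|t| `^ (r - 2))).
have dpos (t : R) : t != 0 -> is_derive t 1 (fun t => `|t| `^ r) (r * (t * `|t| `^ (r - 2))).
  move=> t0; have q0 : 0 < t ^+ 2 by rewrite exprn_even_gt0.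
  have := powR_shift_derive (r / 2) (sqr_derive t) q0.
  have -> : r / 2 - 1 = (r - 2) / 2 by field.
  rewrite sqr_powR [X in is_derive _ _ _ X -> _](_ : _ = r * (t * `|t| `^ (r - 2))); last by field.
  by apply: near_eq_is_derive; apply: filterE => x; exact: sqr_powR.
have small (t : R) a : 0 < a -> `|t| < 1 -> `|t| `^ a <= 1.
  move=> a0 t1; have -> : 1 = 1 `^ a :> R by rewrite powR1.
  apply: ge0_ler_powR; rewrite ?nnegrE// ltW//.
split.
- move=> _ t; have [->|t0] := eqVneq t 0; last exact: dpos.
  rewrite mul0r mulr0.
  have [|||d1 d2] := @diff_quad R R^o R^o (fun t : R => `|t| `^ r) ( *:%R (0 : R)) 0 1 1.
  - exact: scaler_continuous.
  - exact: ltr01.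
  - move=> s; rewrite subr0 => s1; change (`| `|s| `^ r - `|0 : R| `^ r - 0 * s | <= 1 * `|s| ^+ 2).
    rewrite mul0r normr0 powR0 ?gt_eqF// !subr0 mul1r.
    rewrite ger0_norm ?powR_ge0//; have [->|s0] := eqVneq s 0.
      by rewrite normr0 powR0 ?gt_eqF// expr0n.
    have -> : r = 2 + (r - 2) by ring.
    rewrite powRD; last by rewrite normr_eq0 s0 implybT.
    rewrite (powR_mulrn 2)// -[X in _ <= X]mulr1 ler_wpM2l ?exprn_ge0//.
    by apply: small => //; lra.
  by split; [exact/derivable1_diffP|rewrite (deriveE _ d1) d2; exact: scale0r].
- move=> _ t; have [->|t0] := eqVneq t 0.
    apply/cvgrPdist_le => eps eps0; near=> s; rewrite mul0r mulr0 sub0r normrN normrM gtr0_norm// normrM.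
    rewrite [X in _ * (_ * X)]ger0_norm ?powR_ge0//.
    have s1 : `|0 - s| < 1 by near: s; apply: (@cvgr_dist_lt _ _ _ _ _ id 0) => //; exact: cvg_id.
    have s2 : `|0 - s| <= eps / r.
      by near: s; apply: (@cvgr_dist_le _ _ _ _ _ id 0); [exact: cvg_id|exact: divr_gt0].
    rewrite sub0r normrN in s1 s2; rewrite mulrC -ler_pdivlMr//; apply: le_trans s2.
    by rewrite -[leRHS]mulr1 ler_wpM2l//; apply: small => //; lra.
  apply: (@continuousZ_at R R R^o (cst r) (fun t => t * `|t| `^ (r - 2))); first exact: cvg_cst.
  apply: (@continuousZ_at R R R^o id (fun t => `|t| `^ (r - 2))); first exact: cvg_id.
  apply: (@continuous_comp R R R (fun x => `|x|) (fun x => x `^ (r - 2)) t); first exact: norm_continuous.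
  by apply: powR_continuous; rewrite normr_gt0.
- by move=> _ t; exact: powR_ge0.
- by move=> _; rewrite normr0 powR0 ?gt_eqF// mul0r mulr0.
split; last by move=> t; exact: cvg_cst.
move=> _ t t0; rewrite normrM gtr0_norm// ler_pM2l// normrM [X in _ * X]ger0_norm ?powR_ge0//.
have nt : 0 < `|t| by rewrite normr_gt0.
rewrite -{1}(powRr1 (ltW nt)) -powRD; last by rewrite normr_eq0 t0 implybT.
by rewrite le_eqVlt; apply/orP; left; apply/eqP; congr (_ `^ _); ring.
Unshelve. all: by end_near. Qed.

End regularised_powers.

Lemma Lnorm_le d (T : measurableType d) (R : realType) (mu : {measure set T -> \bar R}) (p : R) (f h : T -> \bar R) :
  0 < p -> (forall x, `|f x| <= `|h x|)%E -> ('N[mu]_(p%:E)[f] <= 'N[mu]_(p%:E)[h])%E.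
Proof.
move=> p0 fh; rewrite unlock; apply: gt0_ler_poweR.
- by rewrite invr_ge0 ltW.
- by rewrite in_itv /= leey andbT; apply: integral_ge0 => x _; exact: poweR_ge0.
- by rewrite in_itv /= leey andbT; apply: integral_ge0 => x _; exact: poweR_ge0.
apply: le_integral_ge0 => x _; first exact: poweR_ge0.
by apply: gt0_ler_poweR; rewrite ?in_itv /= ?leey ?andbT ?abse_ge0 ?(ltW p0).
Qed.

Section weights.
Context {R : realType}.
Implicit Types (m : nat) (a eps E : R).

(* With [a = s - m <= 0], a smooth approximation from below of [E ^ s]. *)
Definition psi m a eps E : R := E ^+ m * (E + eps) `^ a.

Lemma psi_ge0 m a eps E : 0 <= E -> 0 <= psi m a eps E.
Proof. by move=> E0; rewrite mulr_ge0 ?exprn_ge0 ?powR_ge0. Qed.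

Lemma psi_le m a eps E : a <= 0 -> 0 < eps -> 0 < E -> psi m a eps E <= E `^ (m%:R + a).
Proof.
move=> a0 e0 E0; rewrite /psi powRD ?(gt_eqF E0) ?implybT// powR_mulrn ?(ltW E0)// ler_wpM2l ?exprn_ge0 ?(ltW E0)//.
by apply: le_powR_neg => //; rewrite lerDl ltW.
Qed.

Lemma power_derive1 k : is_derive (1 : R) 1 (fun s : R => s ^+ k) k%:R.
Proof.
elim: k => [|k IH].
  by apply: near_eq_is_derive (is_derive_cst (1 : R) (1 : R) (1 : R)); apply: filterE => s; rewrite expr0.
have := is_derive_mul (is_derive_id (1 : R) (1 : R)) IH.
rewrite expr1n !mul1r addrC -natr1; apply: near_eq_is_derive; apply: filterE => s.
by rewrite exprS.
Qed.

Lemma psi_ray_derive m a eps E : 0 <= E -> 0 < eps ->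
  is_derive (1 : R) 1 (fun s : R => psi m a eps (s ^+ 2 * E)) (2 * psi m a eps E * (m%:R + a * (E / (E + eps)))).
Proof.
move=> E0 e0; have p0 : 0 < E + eps by rewrite ltr_wpDl.
have d2 : is_derive (1 : R) 1 (fun s : R => s ^+ 2 * E + eps) (2 * E).
  apply: is_derive_addc; have := is_derive_mul (power_derive1 2) (is_derive_cst (E : R) (1 : R) (1 : R)).
  by rewrite mulr0 addr0.
have d3 := powR_shift_derive a d2; rewrite expr1n mul1r in d3.
have d1 := is_derive_mul (power_derive1 (2 * m)) (is_derive_cst (E ^+ m : R) (1 : R) (1 : R)).
have := is_derive_mul d1 (d3 p0).
rewrite !expr1n !mul1r addr0 powRD ?(gt_eqF p0) ?implybT//.
rewrite powR_inv1 ?(ltW p0)// natrM /=.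
rewrite [X in is_derive _ _ _ X -> _](_ : _ = 2 * psi m a eps E * (m%:R + a * (E / (E + eps)))); last first.
  by rewrite /psi /=; field; rewrite gt_eqF.
by apply: near_eq_is_derive; apply: filterE => s; rewrite /psi exprMn -exprM.
Qed.

(** The delicate point is [rho = 0]. The limit there is 0 for [s > 0], as [m] is then positive, 1
    for [s = 0] and infinite for [s < 0], which are the values of [rpow]. *)
Lemma psi_cvg s m : (0 < s -> (0 < m)%N) -> (s <= 0 -> m = 0%N) -> s <= m%:R ->
  forall rho : R, 0 <= rho -> (fun k : nat => (psi m (s - m%:R) k.+1%:R^-1 (rho ^+ 2))%:E) @ \oo --> rpow rho (2 * s).
Proof.
move=> s1 s2 sm rho; rewrite le_eqVlt => /predU1P[<-|r0]; last first.
  have q0 : 0 < rho ^+ 2 by rewrite exprn_gt0.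
  have -> : rpow rho (2 * s) = ((rho ^+ 2) ^+ m * (rho ^+ 2) `^ (s - m%:R))%:E.
    rewrite /rpow gt_eqF//=; congr EFin.
    rewrite -powR_mulrn ?(ltW q0)// -powRD ?(gt_eqF q0) ?implybT// addrC subrK.
    by have := sqr_powR rho (2 * s); rewrite (gtr0_norm r0) => <-; congr (_ `^ _); field.
  apply: cvg_EFin; first by apply: nearW.
  apply: (@cvgM _ _ _ _ (cst ((rho ^+ 2) ^+ m)) (fun k => (rho ^+ 2 + k.+1%:R^-1) `^ (s - m%:R))); first exact: cvg_cst.
  apply: (@cvg_comp _ _ _ (fun k : nat => rho ^+ 2 + k.+1%:R^-1) (fun x => x `^ (s - m%:R)) \oo (nbhs (rho ^+ 2))).
    have : (fun k : nat => rho ^+ 2 + k.+1%:R^-1) @ \oo --> rho ^+ 2 + 0 by apply: cvgD; [exact: cvg_cst|exact: seq_eps_cvg].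
    by rewrite addr0.
  exact: powR_continuous.
rewrite expr0n /psi /rpow eqxx; have [s0|s0] := leP s 0; last first.
  have m0 := s1 s0; rewrite ltNge mulr_ge0 ?(ltW s0)//= powR0; last by rewrite gt_eqF// mulr_gt0.
  under eq_fun do rewrite expr0n (gtn_eqF m0) mul0r.
  exact: cvg_cst.
rewrite (s2 s0) subr0; under eq_fun do rewrite expr0 mul1r add0r.
move: s0; rewrite le_eqVlt => /predU1P[->|s0].
  rewrite mulr0 ltxx /= powRr0; under eq_fun do rewrite powRr0.
  exact: cvg_cst.
rewrite pmulr_rlt0// s0 /=; apply/cvgeyPge => A.
have a0 : 0 < - s by rewrite oppr_gt0.
have pe : 0 < (`|A| + 1)^-1 by rewrite invr_gt0 ltr_wpDl.
have /cvgrPdist_le/(_ _ pe) nn := powR_seq_cvg0 a0.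
near=> k; have h : `|0 - (k.+1%:R^-1 : R) `^ (- s)| <= (`|A| + 1)^-1 by near: k.
have k0 : 0 < (k.+1%:R^-1 : R) `^ s by rewrite powR_gt0 ?invr_gt0.
have h2 : ((k.+1%:R^-1 : R) `^ s)^-1 <= (`|A| + 1)^-1.
  by rewrite -powRN; apply: le_trans h; rewrite sub0r normrN; exact: ler_norm.
have h3 : `|A| + 1 <= (k.+1%:R^-1 : R) `^ s by rewrite -lef_pV2// posrE ltr_wpDl.
rewrite lee_fin; apply: le_trans h3; apply: le_trans (ler_norm _) _; by rewrite lerDl.
Unshelve. all: by end_near. Qed.

End weights.

(** * The weighted inequality for regularised data *)

Section weighted_inequality.
Context {R : realType} {n : nat} {M : ptopologicalType}.
Variable g : riemannian R n M.
Implicit Types (i : chart g).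
Hypothesis complete : geodesically_complete g.
Variable P : M.
Local Notation gd := (gd complete P).
Local Notation ex v := (gd v 1).
Local Notation sg := (sg complete P).
Local Notation en := (en complete P).
Local Notation rho := (rho complete P).
Local Notation Yc := (Yc complete P).
Local Notation Yd := (Yd complete P).
Local Notation C1M := (@C1M R n M g).
Variable b : R.
Hypothesis b0 : 0 <= b.
Hypothesis sec : sectional_curvature_le g (- b).
Hypothesis sc : simply_connected R M.
Variable dV : {measure set (borel M) -> \bar R}.
Hypothesis vol : riemannian_volume g dV.
Hypothesis n0 : (0 < n)%N.

Lemma inner_scale x c u : inner g x (c *: u) (c *: u) = c ^+ 2 * inner g x u u.
Proof. by rewrite /inner -!scalemxAl linearZ -scalemxAr !mxE mulrA -expr2. Qed.

Lemma en_ray x s : en (ex (s *: sg x)) = s ^+ 2 * en x.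
Proof. by rewrite !enE (exK complete P b0 sec sc) inner_scale. Qed.

Lemma C1M_scalar h (phi phi1 : R -> R) : C1M h ->
  (forall x, \forall t \near (h x : R), is_derive (t : R) 1 phi (phi1 t)) -> (forall x, {for h x, continuous phi1}) ->
  C1M (fun x => phi (h x)).
Proof. by move=> hh d c i y iy; apply: c1_scalar (hh i y iy) _ _; [exact: d|exact: c]. Qed.

Lemma en_C1M : C1M en.
Proof. by move=> i y iy; apply: c11e_c1; apply: en_c11e; eassumption. Qed.

Lemma psi_C1M m a eps : 0 < eps -> C1M (fun x => psi m a eps (en x)).
Proof.
move=> e0; apply: C1M_mul.
  elim: m => [|m IH]; first by move=> i y iy; exact: c1_cst.
  have -> : (fun x => en x ^+ m.+1) = (fun x => en x * en x ^+ m) by apply/funext => x; rewrite exprS.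
  by apply: C1M_mul => //; exact: en_C1M.
have p0 x : 0 < en x + eps by rewrite ltr_wpDl// en_ge0.
have d (t : R) : 0 < t + eps -> is_derive t 1 (fun t => (t + eps) `^ a) (1 * (a * (t + eps) `^ (a - 1))).
  by move=> t0; exact: powR_shift_derive (is_derive_addc eps (is_derive_id t (1 : R))) t0.
apply: (@C1M_scalar en (fun t => (t + eps) `^ a) (fun t => a * (t + eps) `^ (a - 1))); first exact: en_C1M.
- move=> x; have : \forall t \near (en x : R), - eps < t.
    by apply: open_nbhs_nbhs; split; [exact: open_gt|rewrite /= -subr_gt0 opprK].
  by apply: filterS => t et; have := d t; rewrite mul1r; apply; rewrite -ltrBlDr sub0r.
- move=> x; apply: (@continuousZ_at R R R^o (cst a) (fun t => (t + eps) `^ (a - 1))); first exact: cvg_cst.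
  have := powR_shift_derive (a - 1) (is_derive_addc eps (is_derive_id (en x) (1 : R))) (p0 x).
  exact: is_derive_continuous.
Qed.

(** The radial field multiplies the pure power [E^(m + a)] by [2 (m + a)]. The regularisation
    replaces [a] by [a E / (E + eps)], which is larger since [a <= 0]: the error has the favourable
    sign. *)
Lemma psi_Yd m a eps x : 0 < eps -> a <= 0 -> 2 * (m%:R + a) * psi m a eps (en x) <= Yd (fun x => psi m a eps (en x)) x.
Proof.
move=> e0 a0; have E0 : 0 <= en x by exact: en_ge0.
have p0 : 0 < en x + eps by rewrite ltr_wpDl.
rewrite Yd_derive.
have -> : (fun s : R => psi m a eps (en (ex (s *: sg x))) : R^o) = (fun s => psi m a eps (s ^+ 2 * en x)).
  by apply/funext => s; rewrite en_ray.
have [_ D] := psi_ray_derive m a E0 e0; rewrite [leRHS]D mulrAC; apply: ler_wpM2l; first by rewrite mulr_ge0// psi_ge0.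
rewrite lerD2l -[leLHS]mulr1 ler_wnM2l// ler_pdivrMr// mul1r lerDl ltW//.
Qed.

Lemma Yd_scalar f (G G1 : R -> R) x : C1M f -> (forall t : R, is_derive t 1 G (G1 t)) ->
  Yd (fun z => G (f z)) x = G1 (f x) * Yd f x.
Proof.
move=> hf dG; have df := C1M_ray complete P b0 sec sc x hf.
have e : f (ex ((1 : R) *: sg x)) = f x by rewrite scale1r (sgK complete P b0 sec sc).
have dg : is_diff (f (ex ((1 : R) *: sg x))) G (fun h : R => h *: G1 (f x)).
  by rewrite e; have [h1 h2] := dG (f x); split; [exact/derivable1_diffP|rewrite deriv1E// derive1E h2].
have [_ D] := diff_curve dg df; rewrite Yd_derive; apply: etrans D _.
by rewrite [LHS]mulrC.
Qed.

Lemma C1M_regular f : (forall i, smooth_on (coord i @` chart_dom i) (f \o param i : _ -> R^o)) -> C1M f.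
Proof. by move=> hf i y iy; apply: c11e_c1; exact: (smooth_c11e (@cod_open _ _ _ g i) (hf i) iy). Qed.

(** The divergence inequality for [q = psi * G(f)]. The derivative of the weight goes to the
    left-hand side by [psi_Yd], and that of [G(f)] is bounded by its absolute value. An infinite
    right-hand side is dealt with separately; otherwise all terms are integrable and can be
    separated. *)
Lemma weighted_inequality f (G G1 : R -> R) m a eps : C1M f -> compact (supp f) ->
  (forall t : R, is_derive t 1 G (G1 t)) -> continuous G1 -> (forall t, 0 <= G t) -> G 0 = 0 ->
  0 < eps -> a <= 0 -> 0 < n%:R + 2 * (m%:R + a) ->
  (\int[dV]_x (psi m a eps (en x) * G (f x) * (n%:R + 2 * (m%:R + a) + (n%:R - 1) * DD b (rho x)))%:E
   <= \int[dV]_x (psi m a eps (en x) * `|G1 (f x)| * `|Yd f x|)%:E)%E.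
Proof.
move=> hf cf dG cG1 G0 G00 e0 a0 c0; set s := m%:R + a in c0 *.
pose w x := psi m a eps (en x); pose q x := w x * G (f x).
have hw : C1M w by exact: psi_C1M.
have hG : C1M (fun x => G (f x)).
  by apply: C1M_scalar hf _ _ => x; [apply: filterE => t; exact: dG|exact: cG1].
have hq : C1M q by exact: C1M_mul.
have w0 x : 0 <= w x by apply: psi_ge0; exact: en_ge0.
have q0 x : 0 <= q x by exact: mulr_ge0.
have f0 x : ~ supp f x -> f x = 0.
  by move=> nx; apply: contrapT => fx; apply: nx; apply: subset_closure; exact/eqP.
have qK x : ~ supp f x -> q x = 0 by move=> /f0 fx; rewrite /q fx G00 mulr0.
have [I3 I2 S0] := divergence_inequality complete P b0 sec sc vol n0 hq q0 cf qK.
have n1 : 0 <= n%:R - 1 :> R by rewrite subr_ge0 ler1n.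
have D0 x : 0 <= DD b (rho x) by apply: DD_ge0 => //; exact: rho_ge0.
pose k3 x := q x * (n%:R + (n%:R - 1) * DD b (rho x)).
pose Lx x := psi m a eps (en x) * G (f x) * (n%:R + 2 * s + (n%:R - 1) * DD b (rho x)).
pose B x := psi m a eps (en x) * `|G1 (f x)| * `|Yd f x|.
have LE x : Lx x = k3 x + 2 * s * q x by rewrite /Lx /k3 /q /w; ring.
have B0 x : 0 <= B x by apply: mulr_ge0 => //; apply: mulr_ge0 => //; exact: w0.
have LB x : Lx x <= k3 x + Yd q x + B x.
  rewrite LE -addrA lerD2l /q (Yd_mul complete P b0 sec sc x hw hG) (Yd_scalar x hf dG).
  have h1 : 2 * s * (w x * G (f x)) <= G (f x) * Yd w x.
    have := ler_wpM2l (G0 (f x)) (psi_Yd m x e0 a0); rewrite -/(w x) -/s.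
    by apply: le_trans; rewrite le_eqVlt; apply/orP; left; apply/eqP; ring.
  have h2 : - B x <= w x * (G1 (f x) * Yd f x).
    by rewrite /B -mulrA -normrM -mulrN ler_wpM2l ?w0// lerNl -normrN ler_norm.
  lra.
have mB : measurable_fun setT (B : borel M -> measurableTypeR R).
  apply: measurable_fun_mul; last first.
    by apply: measurableT_comp => //; exact: continuous_borel (Yd_continuous b0 sec sc hf).
  apply: measurable_fun_mul; first exact: continuous_borel (C1M_continuous hw).
  apply: measurableT_comp => //; apply: continuous_borel => x.
  by apply: (@continuous_comp _ _ _ f G1); [exact: (C1M_continuous hf)|exact: cG1].
have mq : measurable_fun setT (q : borel M -> measurableTypeR R) by exact: continuous_borel (C1M_continuous hq).
have Iq : dV.-integrable setT (EFin \o q).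
  apply: le_integrable I3 => //; first by apply/measurable_EFinP.
  move=> x _; rewrite /= lee_fin (ger0_norm (q0 x)) ger0_norm; last by rewrite mulr_ge0// addr_ge0// mulr_ge0.
  by rewrite -[leLHS]mulr1 ler_wpM2l// ler_wpDr ?mulr_ge0// ler1n.
have IL : dV.-integrable setT (EFin \o Lx).
  have := integrableD measurableT I3 (integrableZl measurableT (2 * s) Iq).
  by apply: eq_integrable => // x _; rewrite /= LE.
have IA : dV.-integrable setT (EFin \o (fun x => k3 x + Yd q x)) by have := integrableD measurableT I3 I2.
have [Boo|Bfin] := eqVneq (\int[dV]_x (B x)%:E)%E +oo%E; first by rewrite Boo leey.
have IB : dV.-integrable setT (EFin \o B).
  apply/integrableP; split; first exact/measurable_EFinP.
  rewrite (_ : (fun x => `|(EFin \o B) x|%E) = EFin \o B); first by rewrite ltey.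
  by apply/funext => x; rewrite /= ger0_norm.
have IAB : dV.-integrable setT (EFin \o (fun x => k3 x + Yd q x + B x)) by have := integrableD measurableT IA IB.
apply: (@le_trans _ _ (\int[dV]_x (k3 x + Yd q x + B x)%:E)%E).
  by apply: le_integral => // x _; rewrite lee_fin; exact: LB.
have -> : (\int[dV]_x (k3 x + Yd q x + B x)%:E = \int[dV]_x (k3 x + Yd q x)%:E + \int[dV]_x (B x)%:E)%E.
  by rewrite -(@integralD_EFin _ _ _ dV setT measurableT _ _ IA IB).
by rewrite -[leRHS]add0e leeD2r.
Qed.

End weighted_inequality.

(** * The inequalities *)

Section radial_bounds.
Context {R : realType} {n : nat} {M : ptopologicalType}.
Variable g : riemannian R n M.
Hypothesis complete : geodesically_complete g.
Variable P : M.
Local Notation gd := (gd complete P).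
Local Notation ex v := (gd v 1).
Local Notation sg := (sg complete P).
Local Notation en := (en complete P).
Local Notation rho := (rho complete P).
Local Notation Yd := (Yd complete P).
Local Notation C1M := (@C1M R n M g).
Variable b : R.
Hypothesis b0 : 0 <= b.
Hypothesis sec : sectional_curvature_le g (- b).
Hypothesis sc : simply_connected R M.

(** Cauchy-Schwarz for the gradient and the radial field, whose norm at [x] is [rho x]. *)
Lemma Yd_gradient f x : C1M f -> `|Yd f x| <= rho x * tnorm g x (gradient g f x).
Proof.
move=> hf; have ix := chart_atP g x; set i := chart_at g x in ix; have iy := cod_coord ix.
set y := coord i x in iy; set D := grad (f \o param i) y.
have E : Yd f x = inner g x (Yc complete P i y) (gradient g f x).
  rewrite -{1}(coordK ix) (YdE complete P b0 sec sc iy (hf i y iy)) -/y -/D /gradmap /inner.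
  have -> : gradient g f x = D^T *m invmx (gram g x).
    by rewrite /gradient; congr (_ *m _); apply/rowP => a; rewrite !mxE.
  rewrite trmx_mul trmxK trmx_inv.
  have -> : (gram g x)^T = gram g x by exact: metric_sym iy.
  rewrite -mulmxA (mulmxA (gram g x)) mulmxV ?mul1mx//.
  exact: metric_unit iy.
have N : inner g x (Yc complete P i y) (Yc complete P i y) = en x.
  by rewrite inner_ip YcE coordK//; exact: (yy_norm complete P b0 sec sc ix).
rewrite E /tnorm rhoE -sqrtrM ?en_ge0// -sqrtr_sqr ler_wsqrtr// -N; exact: inner_CS.
Qed.

Lemma Yd_at_center f x : C1M f -> rho x = 0 -> Yd f x = 0.
Proof.
move=> hf r0; have := Yd_gradient x hf; rewrite r0 mul0r => h.
by apply/eqP; rewrite -normr_eq0 eq_le h normr_ge0.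
Qed.

(** Off [P], injectivity of the exponential map determines [t] and [u]. At [P] both sides are 0: no
    [t > 0] qualifies, so the default value is taken, and the quotient has denominator 0. *)
Lemma radial_derivativeE f x : C1M f -> radial_derivative g P f x = Yd f x / rho x.
Proof.
move=> hf; rewrite /radial_derivative; set S := [set l | _].
have key (t : R) u : 0 < t -> tnorm g P u = 1 -> x = Exp g P (t *: u) ->
   [/\ t = rho x, t *: u = sg x & derive1 (fun s : R => f (Exp g P (s *: u)) : R^o) t = Yd f x / rho x].
  move=> t0 u1 xE; have sE : t *: u = sg x by rewrite xE Exp_gd (exK complete P b0 sec sc).
  have tE : t = rho x.
    have uu : inner g P u u = 1 by have := sqr_sqrtr (inner_ge0 g P u); rewrite -/(tnorm g P u) u1 expr1n.
    by rewrite rhoE enE -sE inner_scale uu mulr1 sqrtr_sqr gtr0_norm.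
  split=> //; have dY := C1M_ray complete P b0 sec sc x hf.
  have dl : is_derive t 1 (fun s : R => s * t^-1) t^-1.
    have := is_derive_mul (is_derive_id t (1 : R)) (is_derive_cst (t^-1 : R) t (1 : R)).
    by rewrite mulr0 addr0 mul1r.
  have dd : is_diff (t * t^-1) (fun s : R => f (ex (s *: sg x)) : R) (fun h : R => h *: Yd f x).
    rewrite divff ?gt_eqF//; case: dY => h1 h2; split; first exact/derivable1_diffP.
    by rewrite deriv1E// derive1E h2.
  have [_ D] := @diff_curve R R R _ _ (fun s : R => s * t^-1) t t^-1 dd dl.
  rewrite -tE [RHS]mulrC derive1E; apply: etrans _ D; congr ('D_1 _ t).
  by apply/funext => s; rewrite -sE scalerA mulfVK ?gt_eqF// Exp_gd.
have [r0|r0] := eqVneq (rho x) 0.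
  rewrite r0 invr0 mulr0; case: xgetP => // l _ [t [u [t0 u1 xE _]]].
  by have [tE] := key t u t0 u1 xE; move: t0; rewrite tE r0 ltxx.
have rp : 0 < rho x by rewrite lt_def r0 rho_ge0.
case: xgetP => [l _ [t [u [t0 u1 xE ->]]]|]; first by have [_ _ ->] := key t u t0 u1 xE.
pose u := (rho x)^-1 *: sg x.
have u1 : tnorm g P u = 1.
  rewrite /tnorm /u inner_scale -/(en x) -(rho_sqr complete P x) exprVn mulVf ?sqrtr1//.
  by rewrite expf_neq0.
have xE : x = Exp g P (rho x *: u) by rewrite /u scalerA divff// scale1r Exp_gd (sgK complete P b0 sec sc).
by move=> /(_ (derive1 (fun s : R => f (Exp g P (s *: u)) : R^o) (rho x))) []; exists (rho x), u.
Qed.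

End radial_bounds.

Lemma rpow_ge_powR (R : realType) (x e : R) : ((x `^ e)%:E <= rpow x e)%E.
Proof. by rewrite /rpow; case: ifP => _; rewrite ?leey. Qed.

Lemma rpow_ge0 (R : realType) (x e : R) : (0 <= rpow x e)%E.
Proof. by apply: le_trans (rpow_ge_powR _ _); rewrite lee_fin powR_ge0. Qed.

Lemma fatou_bound d (T : measurableType d) (R : realType) (mu : {measure set T -> \bar R})
    (u : nat -> T -> \bar R) (l : T -> \bar R) (c : \bar R) :
  (forall k, measurable_fun setT (u k)) -> (forall k x, 0 <= u k x)%E ->
  (forall x, (fun k => u k x) @ \oo --> l x) -> (forall k, \int[mu]_x u k x <= c)%E ->
  (\int[mu]_x l x <= c)%E.
Proof.
move=> mu_ u0 ul uc.
have -> : (\int[mu]_x l x = \int[mu]_x limn_einf (u^~ x))%E.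
  by apply: eq_integral => x _; rewrite (cvg_limn_einf_sup (ul x)).1.
apply: le_trans (fatou mu measurableT mu_ (fun k x _ => u0 k x)) _.
rewrite limn_einf_lim; apply: lime_le; first exact: is_cvg_einfs.
apply: nearW => k; apply: le_trans (uc k); apply: ereal_inf_lbound.
by exists k => //=.
Qed.

Theorem corollary3p2 (R : realType) (n : nat) (p r alpha beta gamma b : R)
    (M : ptopologicalType) (g : riemannian R n M)
    (dV : {measure set (borel M) -> \bar R}) (P : M) (f : M -> R) :
  (2 <= n)%N -> 1 < p -> 0 < r ->
  0 < r^-1 - gamma / n%:R ->
  0 < p^-1 - alpha / n%:R ->
  0 < 1 - beta / n%:R ->
  gamma = (1 + alpha) / r + (p - 1) / (p * r) * beta ->
  cartan_hadamard g ->
  0 <= b ->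
  sectional_curvature_le g (- b) ->
  riemannian_volume g dV ->
  test_function g f ->
  let p' := p / (p - 1) in
  let d : M -> R := geodesic_dist g P in
  let C := r / (n%:R - gamma * r) in
  let lhs := (\int[dV]_(x in [set: borel M])
      ((`|f x| `^ r)%:E * rpow (d x) (- (gamma * r))%R
       * (1 + (n%:R - 1) / (n%:R - gamma * r) * DD b (d x))%:E))%E in
  let radial : borel M -> \bar R := fun x =>
    ((radial_derivative g P f x)%:E * rpow (d x) (- alpha)%R)%E in
  let grad : borel M -> \bar R := fun x =>
    ((tnorm g x (gradient g f x))%:E * rpow (d x) (- alpha)%R)%E in
  let weight : borel M -> \bar R := fun x =>
    (rpow `|f x|%R (r - 1)%R * rpow (d x) (- (beta / p'))%R)%E in
  (lhs <= C%:E * 'N[dV]_(p%:E)[radial] * 'N[dV]_(p'%:E)[weight \_ (supp f)])%E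
  /\
  (lhs <= C%:E * 'N[dV]_(p%:E)[grad] * 'N[dV]_(p'%:E)[weight \_ (supp f)])%E.
Proof.
move=> n2 p1 r0 hr _ _ gE [complete sc _] b0 sec vol [hf cf] p' d C lhs radial gradf weight.
have n0 : (0 < n)%N by exact: ltn_trans n2.
have nR : 0 < n%:R :> R by rewrite ltr0n.
have p0 : 0 < p by exact: lt_trans p1.
have pm0 : 0 < p - 1 by rewrite subr_gt0.
have p'0 : 0 < p' by exact: divr_gt0.
have dE x : d x = rho complete P x by exact: (geodesic_dist_rho complete P b0 sec sc x).
have Cf := C1M_regular hf.
have c0 : 0 < n%:R - gamma * r.
  have : 0 < (r^-1 - gamma / n%:R) * (r * n%:R) by rewrite mulr_gt0// mulr_gt0.
  by rewrite (_ : _ * _ = n%:R - gamma * r)//; field; rewrite !gt_eqF.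
(* The weight [rho^(- gamma r)] is written [en^s], since [en = rho^2] is differentiable at [P] as
   well. *)
pose s := - (gamma * r) / 2.
(* An integer with [s <= m], so that the regularised factor has a nonpositive exponent. It is
   positive exactly for [s > 0], when the weight has to vanish at [P]. *)
pose m := if s <= 0 then 0%N else (Num.trunc s).+1.
have s1 : 0 < s -> (0 < m)%N by rewrite /m ltNge => /negbTE ->.
have s2 : s <= 0 -> m = 0%N by rewrite /m => ->.
have sm : s <= m%:R by rewrite /m; have [//|_] := leP s 0; apply: ltW; exact: truncnS_gt.
have ss : m%:R + (s - m%:R) = s by rewrite addrC subrK.
have cE : n%:R + 2 * s = n%:R - gamma * r by rewrite /s; field.
have s2E : 2 * s = - (gamma * r) by rewrite /s; field.
(* The relation between the three exponents is used here: the weight splits into those of the two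
   norms, with an additional [-1] because the radial derivative of [f] is [Yf / rho]. *)
have expE : 2 * s = (-1 - alpha) + (- (beta / p')).
  rewrite s2E gE /p'; field; rewrite !gt_eqF//=.
pose Yf := Yd complete P f; pose rh := rho complete P.
have rh0 x : 0 <= rh x by exact: rho_ge0.
(* [F] and [W] are measurable minorants, in absolute value, of the integrands of the norms. They use
   the real-valued power, which is 0 where [rpow] is infinite, so that Hoelder's inequality applies
   to them. *)
pose F (x : borel M) : R := `|Yf x| * rh x `^ (-1 - alpha).
pose W (x : borel M) : R := (f x != 0)%:R * (`|f x| `^ (r - 1) * rh x `^ (- (beta / p'))).
have F0 x : 0 <= F x by rewrite mulr_ge0 ?powR_ge0.
have W0 x : 0 <= W x by rewrite mulr_ge0 ?mulr_ge0 ?powR_ge0.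
have mrh : measurable_fun setT (rh : borel M -> measurableTypeR R).
  by apply: continuous_borel; exact: (rho_continuous b0 sec sc).
have mf : measurable_fun setT (f : borel M -> measurableTypeR R) by exact: continuous_borel (C1M_continuous Cf).
have mY : measurable_fun setT (Yf : borel M -> measurableTypeR R).
  by apply: continuous_borel; exact: (Yd_continuous b0 sec sc Cf).
have mF : measurable_fun setT F.
  apply: measurable_fun_mul; first exact: measurableT_comp.
  exact: measurableT_comp (measurable_powR _) mrh.
have mW : measurable_fun setT W.
  apply: measurable_fun_mul.
    have -> : (fun x => (f x != 0)%:R : R) = \1_[set x | f x != 0].
      apply/funext => x; rewrite indicE; suff -> : (x \in [set x | f x != 0]) = (f x != 0) by [].
      by apply/idP/idP => h; [rewrite inE in h|rewrite inE].
    apply: measurable_indic; apply: borel_open.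
    apply: (@open_comp _ _ f [set y | y != 0]); last exact: open_neq.
    by move=> x _; exact: C1M_continuous Cf x.
  apply: measurable_fun_mul; last exact: measurableT_comp (measurable_powR _) mrh.
  by apply: measurableT_comp (measurable_powR _) _; exact: measurableT_comp.
have [G [G1 [dG cG G_ge0 G00 [G1_le G_cvg]]]] := regularised_norm_powR r0.
pose e (k : nat) : R := k.+1%:R^-1.
have e0 k : 0 < e k by rewrite invr_gt0.
have a0 : s - m%:R <= 0 by rewrite subr_le0.
pose ps k x := psi m (s - m%:R) (e k) (en complete P x).
have ps0 k x : 0 <= ps k x by apply: psi_ge0; exact: en_ge0.
have FW0 x : 0 <= r * (F x * W x) by apply: mulr_ge0; [exact: ltW|exact: mulr_ge0].
(* At zeros of [f] and at [P] the left-hand side vanishes, by [G1 k 0 = 0] and by [Yd_at_center]; so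
   the default values of powers at 0 do no harm. *)
have prod_bound k x : ps k x * `|G1 k (f x)| * `|Yf x| <= r * (F x * W x).
  have [f0|f0] := eqVneq (f x) 0.
    by rewrite f0 (G00 k).2 normr0 mulr0 mul0r; exact: FW0.
  have [r00|rn] := eqVneq (rh x) 0.
    by rewrite /Yf (Yd_at_center b0 sec sc Cf r00) normr0 mulr0; exact: FW0.
  have rp : 0 < rh x by rewrite lt_def rn rh0.
  have ep : 0 < en complete P x by rewrite -(rho_sqr complete P x) exprn_gt0.
  have h1 : ps k x <= rh x `^ (2 * s).
    apply: le_trans (psi_le _ a0 (e0 k) ep) _; rewrite ss -(rho_sqr complete P x) -/(rh x).
    have := sqr_powR (rh x) (2 * s); rewrite (gtr0_norm rp) => <-.
    by rewrite le_eqVlt; apply/orP; left; apply/eqP; congr (_ `^ _); field.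
  rewrite expE powRD in h1; last by rewrite rn implybT.
  rewrite /F /W f0 mul1r.
  rewrite (_ : r * _ = (rh x `^ (-1 - alpha) * rh x `^ (- (beta / p'))) * (r * `|f x| `^ (r - 1)) * `|Yf x|); last by ring.
  by rewrite ler_wpM2r// ler_pM//; exact: G1_le.
have int_bound k : (\int[dV]_x (ps k x * `|G1 k (f x)| * `|Yf x|)%:E <= r%:E * ('N[dV]_(p%:E)[EFin \o F] * 'N[dV]_(p'%:E)[EFin \o W]))%E.
  have h := hoelder dV mF mW p0 p'0; rewrite Lnorm1 in h.
  apply: (@le_trans _ _ (r%:E * \int[dV]_x (F x * W x)%:E)%E).
    rewrite -ge0_integralZl_EFin ?(ltW r0)//; last 2 first.
      by move=> x _; rewrite lee_fin mulr_ge0.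
      by apply/measurable_EFinP; exact: measurable_fun_mul.
    apply: le_integral_ge0 => x _; last by rewrite -EFinM lee_fin; exact: prod_bound.
    by rewrite lee_fin; apply: mulr_ge0 => //; apply: mulr_ge0.
  apply: lee_wpmul2l; first by rewrite lee_fin ltW.
  apply: le_trans (h _); last by rewrite /p' invf_div; field; rewrite gt_eqF.
  by apply: le_integral_ge0 => x _ /=; rewrite lee_fin; [exact: mulr_ge0|exact: ler_norm].
have dd0 x : 0 <= DD b (rh x) by apply: DD_ge0.
have n1 : 0 <= n%:R - 1 :> R by rewrite subr_ge0 ler1n.
pose q x := 1 + (n%:R - 1) / (n%:R - gamma * r) * DD b (rh x).
have q0 x : 0 <= q x by rewrite addr_ge0// mulr_ge0// divr_ge0// ltW.
have main : (lhs <= C%:E * ('N[dV]_(p%:E)[EFin \o F] * 'N[dV]_(p'%:E)[EFin \o W]))%E.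
  pose L k x := ps k x * G k (f x) * (n%:R + 2 * s + (n%:R - 1) * DD b (rh x)).
  have LE k x : G k (f x) * ps k x * q x = (n%:R - gamma * r)^-1 * L k x.
    by rewrite /L /q cE; field; rewrite gt_eqF.
  have L0 k x : 0 <= L k x.
    apply: mulr_ge0; first by apply: mulr_ge0 => //; exact: ps0.
    by apply: addr_ge0; [rewrite cE ltW|exact: mulr_ge0].
  have mL k : measurable_fun setT (L k : borel M -> measurableTypeR R).
    apply: measurable_fun_mul.
      apply: measurable_fun_mul.
        by apply: continuous_borel; apply: C1M_continuous; exact: (psi_C1M complete P b0 sec sc).
      apply: continuous_borel => x; apply: (@continuous_comp _ _ _ f (G k)); first exact: C1M_continuous Cf _.
      exact: is_derive_continuous (dG k (f x)).
    apply: measurable_funD; first exact: measurable_cst.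
    apply: measurable_fun_mul; first exact: measurable_cst.
    exact: measurableT_comp (DD_measurable b) mrh.
  (* The regularised integrands converge pointwise to that of [lhs], and all their integrals obey
     the same bound. *)
  apply: (@fatou_bound _ _ _ dV (fun k x => ((n%:R - gamma * r)^-1 * L k x)%:E)).
  - by move=> k; apply/measurable_EFinP; apply: measurable_fun_mul; [exact: measurable_cst|exact: mL].
  - by move=> k x; rewrite lee_fin mulr_ge0// invr_ge0 ltW.
  - move=> x; rewrite dE -/(rh x) -/(q x).
    under eq_fun do rewrite -LE 2!EFinM.
    apply: cvgeZr => //; have [f0|f0] := eqVneq (f x) 0.
      under eq_fun do rewrite f0 (G00 _).1 mul0e.
      by rewrite f0 normr0 powR0 ?gt_eqF// mul0e; exact: cvg_cst.
    apply: cvgeM.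
    (* At [P] the weight may tend to infinity; the product of the limits is still defined, since
       [|f x|^r] is positive in this case. *)
    + rewrite /rpow; case: ifP => _; last exact: mule_def_fin.
      by apply: mule_def_neq0_infty => //; rewrite eqe gt_eqF//; apply: powR_gt0; rewrite normr_gt0.
    + by apply: cvg_EFin; [exact: nearW|exact: G_cvg].
    + by rewrite -s2E; have := psi_cvg s1 s2 sm (rh0 x); rewrite /rh (rho_sqr complete P x).
  - move=> k; under eq_integral do rewrite EFinM.
    rewrite ge0_integralZl_EFin ?invr_ge0 ?(ltW c0)//; last 2 first.
      by move=> x _; rewrite lee_fin.
      by apply/measurable_EFinP; exact: mL.
    have c0' : 0 < n%:R + 2 * (m%:R + (s - m%:R)) by rewrite ss cE.
    have wi := weighted_inequality complete P b0 sec sc vol n0 Cf cf (dG k) (cG k) (G_ge0 k) (G00 k).1 (e0 k) a0 c0'.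
    rewrite ss in wi.
    apply: (@le_trans _ _ ((n%:R - gamma * r)^-1%:E * (r%:E * ('N[dV]_(p%:E)[EFin \o F] * 'N[dV]_(p'%:E)[EFin \o W])))%E).
      apply: lee_wpmul2l; first by rewrite lee_fin invr_ge0 ltW.
      by apply: le_trans (int_bound k); exact: wi.
    by rewrite muleA -EFinM (mulrC _ r).
have C0 : (0 <= C%:E)%E by rewrite lee_fin divr_ge0 ?ltW.
have NW : ('N[dV]_(p'%:E)[EFin \o W] <= 'N[dV]_(p'%:E)[weight \_ (supp f)])%E.
  apply: Lnorm_le => // x; rewrite [X in (X <= _)%E]gee0_abs ?lee_fin//.
  (* Where [f] vanishes [W] is 0, whatever the value of [weight], which may be infinite there when
     [r < 1]. *)
  have [f0|f0] := eqVneq (f x) 0; first by rewrite /= /W f0 eqxx mul0r abse_ge0.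
  rewrite patchE mem_set; last by apply: subset_closure.
  rewrite gee0_abs ?mule_ge0 ?rpow_ge0// [X in (X <= _)%E]/= /W f0 mul1r EFinM /weight dE.
  by apply: lee_pmul; rewrite ?lee_fin ?powR_ge0 ?rpow_ge_powR.
have fin N : ('N[dV]_(p%:E)[EFin \o F] <= N)%E -> (lhs <= C%:E * N * 'N[dV]_(p'%:E)[weight \_ (supp f)])%E.
  move=> hN; apply: le_trans main _; rewrite -muleA lee_wpmul2l//.
  by apply: lee_pmul => //; exact: Lnorm_ge0.
split; apply: fin; apply: Lnorm_le => // x; rewrite [X in (X <= _)%E]gee0_abs ?lee_fin//.
- have [r00|rn] := eqVneq (rh x) 0.
    by rewrite /= /F /Yf (Yd_at_center b0 sec sc Cf r00) normr0 mul0r abse_ge0.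
  have rp : 0 < rh x by rewrite lt_def rn rh0.
  rewrite /radial abseM (gee0_abs (rpow_ge0 _ _)) dE -/(rh x) (radial_derivativeE complete P b0 sec sc x Cf) -/Yf -/(rh x) /= normrM.
  rewrite normfV (gtr0_norm rp) /rpow (negbTE rn) /= -EFinM lee_fin /F powRD; last by rewrite rn implybT.
  by rewrite powR_inv1 ?(ltW rp)// mulrA.
- have [r00|rn] := eqVneq (rh x) 0.
    by rewrite /= /F /Yf (Yd_at_center b0 sec sc Cf r00) normr0 mul0r abse_ge0.
  have rp : 0 < rh x by rewrite lt_def rn rh0.
  rewrite /gradf abseM (gee0_abs (rpow_ge0 _ _)) dE -/(rh x) /rpow (negbTE rn) /= ger0_norm ?sqrtr_ge0//.
  rewrite -EFinM lee_fin /F powRD; last by rewrite rn implybT.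
  rewrite powR_inv1 ?(ltW rp)// mulrA ler_wpM2r ?powR_ge0// ler_pdivrMr// mulrC.
  exact: (Yd_gradient complete P b0 sec sc x Cf).
Qed.
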